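(* Let $\xi,\eta\in\mathbb{C}$ satisfy $$\Re((1-i)\xi+(1+i)\eta)>0\quad\text{and}\quad\Re((1+i)\xi+(1-i)\eta)>0 .$$ Let $\sigma\in\mathbb{C}$ be such that $|\Re\sigma|<\frac34$. Then $$\xi\eta\,K_1\left(\tfrac14(\xi^2+\eta^2)\right)=\frac{2^{1/2}(\xi^2+\eta^2)}{\pi i}\int_{\sigma-i\infty}^{\sigma+i\infty}\Gamma\left(\tfrac34-s\right)\Gamma\left(\tfrac34+s\right)D_{2s-\frac12}(\xi)\,D_{-2s-\frac12}(\eta)\,ds .$$
   Context: $\Gamma$ is Euler's gamma function. $U(a,b,z)$ is the confluent hypergeometric function of the second kind: the solution of $z w''+(b-z)w'-aw=0$ with $U(a,b,z)\sim z^{-a}$ as $z\to\infty$ in $|\arg z|\le\frac32\pi-\delta$ ($\delta>0$), analytic in $z$ on the Riemann surface of the logarithm. The modified Bessel function of the second kind (Macdonald function) is $K_\nu(z)=\sqrt\pi\,e^{-z}(2z)^\nu U\left(\frac12+\nu,1+2\nu,2z\right)$. The hypotheses imply $\xi^2+\eta^2\in\mathbb{C}\setminus(-\infty,0]$, and $K_1(z)$ is evaluated in the sector $-\pi<\arg z<\pi$. The parabolic cylinder function is $D_\nu(z)=2^{\nu/2}e^{-z^2/4}U\left(-\frac{\nu}{2},\frac12,\frac12z^2\right)$ (with $\arg(z^2)=2\arg z$, extended analytically); it is analytic for all $\nu,z\in\mathbb{C}$. The integral is along the vertical line through $\sigma$. *)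

(* Defs.v *)
From Stdlib Require Import Reals ZArith ClassicalEpsilon.
From Coquelicot Require Import Coquelicot.
Open Scope R_scope.
Open Scope C_scope.

Definition Cexp (z : C) : C :=
  (exp (Re z) * cos (Im z), exp (Re z) * sin (Im z))%R.

(** Principal argument, in (-PI, PI]; junk at [z = 0]. *)
Definition Carg (z : C) : R :=
  if Rle_dec 0 (Im z) then acos (Re z / Cmod z) else (- acos (Re z / Cmod z))%R.

Definition Clog (z : C) : C := (ln (Cmod z), Carg z).

(** Euler's integral of [t^(z-1) e^(-t)] over (0, +oo), convergent for [0 < Re z]. *)
Definition Gamma_integral (z : C) : C :=
  RInt_gen (V := C_R_CompleteNormedModule)
    (fun t : R => Cexp ((z - 1) * ln t - t))
    (at_right 0) (Rbar_locally p_infty).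

Fixpoint Cpochhammer (z : C) (n : nat) : C :=
  match n with
  | O => 1
  | S m => Cpochhammer z m * (z + INR m)
  end.

(** Analytic continuation of the integral by the functional equation.  The
    shift [n] is 0 when [0 < Re z] and satisfies [0 < Re z + n] in all cases.
    At the poles the value is junk. *)
Definition Gamma (z : C) : C :=
  let n := Z.to_nat (up (- Re z)%R) in
  Gamma_integral (z + INR n) / Cpochhammer z n.

(** Kummer's function of the second kind.
    The Riemann surface of the logarithm is identified with the complex plane
    through its global coordinate [w]: the point [w] lies above [z = Cexp w],
    with [|z| = exp (Re w)] and [arg z = Im w].  There [z^c] means
    [Cexp (c * w)], and [d/dz] is [d/dw] divided by [Cexp w]: below, [u1] and
    [u2] are the first and second derivatives of [u] with respect to [z].  The
    last clause is [u ~ z^(-a)], uniformly in each sector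
    [|arg z| <= 3 PI / 2 - delta].  *)
Definition is_KummerU (a b : C) (u : C -> C) : Prop :=
  (exists u1 u2 : C -> C,
     (forall w : C, @is_derive C_AbsRing C_NormedModule u w (Cexp w * u1 w)) /\
     (forall w : C, @is_derive C_AbsRing C_NormedModule u1 w (Cexp w * u2 w)) /\
     (forall w : C, Cexp w * u2 w + (b - Cexp w) * u1 w - a * u w = 0)) /\
  (forall delta : R, (0 < delta)%R ->
   forall eps : R, (0 < eps)%R ->
   exists M : R, forall w : C,
     (M < Re w)%R -> (Rabs (Im w) <= 3 / 2 * PI - delta)%R ->
     (Cmod (u w / Cexp (- a * w) - 1) < eps)%R).

(** [KummerU a b w] is [U(a, b, z)] at the point [w] of the surface; exactly
    one [u] satisfies [is_KummerU a b u]. *)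
Definition KummerU (a b : C) : C -> C :=
  epsilon (inhabits (fun _ : C => RtoC 0)) (is_KummerU a b).

(** The coordinate of [2 z] is [w + ln 2] when that of [z] is [w]. *)
Definition BesselK_log (nu w : C) : C :=
  sqrt PI * Cexp (- Cexp w) * Cexp (nu * (w + ln 2))
  * KummerU (RtoC (1 / 2) + nu) (1 + 2 * nu) (w + ln 2).

(** The branch in the sector [- PI < arg z < PI]. *)
Definition BesselK (nu z : C) : C := BesselK_log nu (Clog z).

(** The coordinate of [z^2 / 2] is [2 w - ln 2] when that of [z] is [w]. *)
Definition ParabolicD_log (nu w : C) : C :=
  Cexp (nu / 2 * ln 2) * Cexp (- (Cexp w * Cexp w) / 4)
  * KummerU (- nu / 2) (RtoC (1 / 2)) (2 * w - ln 2).

(** [ParabolicD_log nu] is invariant under [w |-> w + 2 PI i], so that any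
    choice of [arg z] gives the same value for [z <> 0]; the origin is a
    removable singularity. *)
Definition ParabolicD (nu z : C) : C :=
  if Ceq_dec z 0 then
    iota (T := C_CompleteNormedModule)
      (fun l : C =>
         filterlim (fun y : C => ParabolicD_log nu (Clog y))
           (locally' (0 : C)) (locally l))
  else ParabolicD_log nu (Clog z).

(** [I] is the (convergent) integral of [F(s) ds] from [sigma - i oo] to
    [sigma + i oo], with [s = sigma + i t] and [ds = i dt]; the two ends tend
    to infinity independently. *)
Definition is_vertical_integral (F : C -> C) (sigma I : C) : Prop :=
  is_RInt_gen (V := C_R_NormedModule)
    (fun t : R => F (sigma + Ci * t) * Ci)
    (Rbar_locally m_infty) (Rbar_locally p_infty) I.

(* Main.v *)
Require Import Defs.
From Stdlib Require Import Reals Lra Lia Psatz ZArith ClassicalEpsilon.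
From Coquelicot Require Import Coquelicot.
Open Scope R_scope.
Open Scope C_scope.

(** Put [s = A + i t]. By Kummer's transformation [U(a, 1/2, z) = z^(1/2) U(a + 1/2, 3/2, z)] and
    the Laplace integral of [U], the function [Gamma(3/4 - s) D_(2s - 1/2)(xi)] is an elementary
    factor times the integral over [t > 0] of
    [e^(- xi^2 t / 2) t^(-1/4 - s) (1 + t)^(s - 1/4)]
    ([GP_ray]), and similarly for [eta] with [- s]. In the variable [X = ln ((1 + t) / t)] both are
    Fourier integrals whose frequency is [Im s]. When [xi] and [eta] lie in the sector
    [|arg| < PI / 4], Parseval's relation ([parseval]) therefore turns the integral over [s] into
    the integral over [t > 0] of [e^(- (xi^2 + eta^2) t / 2) t^(1/2) (1 + t)^(1/2)], which is the
    Laplace integral of [U(3/2, 3, (xi^2 + eta^2) / 2)], that is, of [K_1((xi^2 + eta^2) / 4)]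
    ([integral_sector], [BesselK_one]).

    The other arguments are reached by continuation along the segment from [(1, 1)] to [(xi, eta)]
    ([integral_value]), on which the two hypotheses persist because they are convex. The integral
    is analytic along the segment because the integrand is entire in [xi] and [eta] and has a
    locally uniform majorant ([integrand_bound]). The majorant rests on the behaviour of
    [Gamma(3/4 - s) D_(2s - 1/2)(xi)] for large [|Im s|]: it is bounded by an exponential of
    [- sqrt |Im s| Re ((1 - i) xi)] at one end of the line and of [- sqrt |Im s| Re ((1 + i) xi)]
    at the other, up to an arbitrarily small loss. Where the rate is positive this comes from a
    saddle point estimate on a rotated ray ([J_ray_bound], [GP_ray_bound]); elsewhere it is
    transported from such a point by an energy estimate for Weber's equation ([GP_gronwall]). The
    two hypotheses say precisely that the rates of the two factors have positive sums at both ends.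
    Taylor expansions with geometric remainders carry analyticity through the integral
    ([taylor_CI]) and give the identity theorem ([identity_unit_interval]).

    Since [KummerU] is defined by its differential equation and its asymptotics on the whole
    logarithmic surface, it must be identified with these integrals. Two solutions asymptotic to
    [z^(-a)] on the positive axis coincide: their Wronskian is a multiple of [e^z z^(-b)], which
    grows too fast ([kummer_unique]). The Laplace integral [J], taken along rays that rotate with
    [z], has the required asymptotics for [|arg z| < 3 PI / 2] ([J_sector]). It extends to all
    sheets for [b = 1/2] because the parabolic cylinder functions are entire ([KummerU_half],
    [ParabolicD_DP]), and for [b = 3] because a turn around the origin adds a multiple of an
    entire solution ([monodromy], [KummerU_three_halves]).

    Throughout, integrals over a half-line or a ray are written over the line in the variable
    [v = ln |t|]. *)

(** * The complex exponential *)

(* [ring] on an equation of integrals, whose type is a normed module that unfolds to [C] *)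
Ltac Cring := match goal with |- @eq _ ?a ?b => change (@eq C a b) end; ring.

Lemma C_eq (x y : C) : Re x = Re y -> Im x = Im y -> x = y.
Proof. destruct x, y; simpl; intros; subst; reflexivity. Qed.

Lemma Cmod_sqr (z : C) : (Cmod z * Cmod z = Re z * Re z + Im z * Im z)%R.
Proof. generalize (Cmod2_alt z); simpl; intros; nra. Qed.

Lemma im_le_Cmod (c : C) : (Rabs (Im c) <= Cmod c)%R.
Proof. eapply Rle_trans; [apply Rmax_r | apply Rmax_Cmod]. Qed.

Lemma Cmod_le_sum (c : C) : (Cmod c <= Rabs (Re c) + Rabs (Im c))%R.
Proof.
  generalize (Cmod_sqr c) (Cmod_ge_0 c) (Rabs_pos (Re c)) (Rabs_pos (Im c)).
  generalize (Rsqr_abs (Re c)) (Rsqr_abs (Im c)); unfold Rsqr; intros.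
  nra.
Qed.

Lemma Cmod_sub_rev (x y : C) : Cmod (x - y) = Cmod (y - x).
Proof. rewrite <- Cmod_opp. f_equal. ring. Qed.

Lemma Cmod_triangle_inv (x y : C) : (Cmod x - Cmod y <= Cmod (x - y))%R.
Proof.
  generalize (Cmod_triangle (x - y) y). replace (x - y + y) with x by ring. lra.
Qed.

Lemma Cexp_plus (x y : C) : Cexp (x + y) = Cexp x * Cexp y.
Proof.
  unfold Cexp. apply C_eq; simpl; unfold Re, Im; rewrite exp_plus, ?cos_plus, ?sin_plus; ring.
Qed.

Lemma Cexp_0 : Cexp 0 = 1.
Proof. unfold Cexp. apply C_eq; simpl; rewrite exp_0, ?cos_0, ?sin_0; lra. Qed.

Lemma Cexp_RtoC (x : R) : Cexp x = RtoC (exp x).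
Proof. unfold Cexp; simpl. rewrite cos_0, sin_0. apply C_eq; simpl; lra. Qed.

Lemma Cmod_Cexp (z : C) : Cmod (Cexp z) = exp (Re z).
Proof.
  assert (H := exp_pos (Re z)).
  assert (H1 : (Cmod (Cexp z) * Cmod (Cexp z) = exp (Re z) * exp (Re z))%R).
  { rewrite Cmod_sqr. unfold Cexp; simpl.
    generalize (sin2_cos2 (Im z)); unfold Rsqr; intros E; nra. }
  generalize (Cmod_ge_0 (Cexp z)); intros; nra.
Qed.

Lemma Cexp_neq_0 (z : C) : Cexp z <> 0.
Proof. apply Cmod_gt_0. rewrite Cmod_Cexp. apply exp_pos. Qed.

Lemma Cexp_opp (z : C) : Cexp (- z) = / Cexp z.
Proof.
  assert (H : Cexp (- z) * Cexp z = 1).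
  { rewrite <- Cexp_plus, <- Cexp_0. f_equal. ring. }
  assert (N := Cexp_neq_0 z).
  replace (Cexp (- z)) with (Cexp (- z) * Cexp z / Cexp z) by (field; auto).
  rewrite H. field; auto.
Qed.

Lemma Cexp_minus (x y : C) : Cexp (x - y) = Cexp x / Cexp y.
Proof. unfold Cminus, Cdiv. rewrite Cexp_plus, Cexp_opp. reflexivity. Qed.

Lemma Cexp_cancel (z : C) : Cexp z * Cexp (- z) = 1.
Proof. rewrite <- Cexp_plus, <- Cexp_0. f_equal. ring. Qed.

(** * Continuity and derivatives of complex functions *)

(** Componentwise, so that real, complex and pair variables are handled by the same rules. *)
Definition ccts {U : UniformSpace} (f : U -> C) (x : U) : Prop :=
  continuous (fun u => Re (f u)) x /\ continuous (fun u => Im (f u)) x.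

Lemma continuous_R_eps {U : UniformSpace} (f : U -> R) (x : U) : continuous f x <->
  forall eps : R, (0 < eps)%R -> locally x (fun u => (Rabs (f u - f x) < eps)%R).
Proof.
  split.
  - intros H eps He. apply (H (fun y => (Rabs (y - f x) < eps)%R)).
    exists (mkposreal eps He). intros y Hy. exact Hy.
  - intros H P [eps HP]. specialize (H eps (cond_pos eps)).
    unfold filtermap. eapply filter_imp; [|exact H]. intros u Hu. apply HP. exact Hu.
Qed.

Lemma ccts_eps {U : UniformSpace} (f : U -> C) (x : U) : ccts f x <->
  forall eps : R, (0 < eps)%R -> locally x (fun u => (Cmod (f u - f x)%C < eps)%R).
Proof.
  split.
  - intros [H1 H2] eps He. rewrite continuous_R_eps in H1, H2.
    assert (He2 : (0 < eps / 2)%R) by lra.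
    generalize (filter_and _ _ (H1 _ He2) (H2 _ He2)). apply filter_imp.
    intros u [A B]. eapply Rle_lt_trans; [apply Cmod_le_sum|].
    unfold Re, Im in *; simpl in *. unfold Rminus in *. lra.
  - intros H. split; apply continuous_R_eps; intros eps He; generalize (H eps He);
    apply filter_imp; intros u Hu; (eapply Rle_lt_trans; [|exact Hu]).
    + eapply Rle_trans; [|apply re_le_Cmod]. right. f_equal.
    + eapply Rle_trans; [|apply im_le_Cmod]. right. f_equal.
Qed.

Lemma ccts_ext {U : UniformSpace} (f g : U -> C) (x : U) :
  (forall u, f u = g u) -> ccts f x -> ccts g x.
Proof.
  intros E [A B]. split.
  - apply continuous_ext with (2 := A). intros; rewrite E; auto.
  - apply continuous_ext with (2 := B). intros; rewrite E; auto.
Qed.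

Lemma ccts_const {U : UniformSpace} (c : C) (x : U) : ccts (fun _ => c) x.
Proof. split; apply continuous_const. Qed.

Lemma ccts_plus {U : UniformSpace} (f g : U -> C) (x : U) :
  ccts f x -> ccts g x -> ccts (fun u => f u + g u) x.
Proof.
  intros [A B] [A' B']. split; unfold Re, Im in *; simpl.
  - exact (continuous_plus (V := R_NormedModule) _ _ _ A A').
  - exact (continuous_plus (V := R_NormedModule) _ _ _ B B').
Qed.

Lemma ccts_opp {U : UniformSpace} (f : U -> C) (x : U) :
  ccts f x -> ccts (fun u => - f u) x.
Proof.
  intros [A B]. split; unfold Re, Im in *; simpl.
  - exact (continuous_opp (V := R_NormedModule) _ _ A).
  - exact (continuous_opp (V := R_NormedModule) _ _ B).
Qed.

Lemma ccts_minus {U : UniformSpace} (f g : U -> C) (x : U) :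
  ccts f x -> ccts g x -> ccts (fun u => f u - g u) x.
Proof. intros. apply ccts_plus; auto. apply ccts_opp; auto. Qed.

Lemma ccts_mult {U : UniformSpace} (f g : U -> C) (x : U) :
  ccts f x -> ccts g x -> ccts (fun u => f u * g u) x.
Proof.
  intros [A B] [A' B']. split; unfold Re, Im in *; simpl.
  - exact (continuous_minus (V := R_NormedModule) _ _ _
      (continuous_mult (K := R_AbsRing) _ _ _ A A') (continuous_mult (K := R_AbsRing) _ _ _ B B')).
  - exact (continuous_plus (V := R_NormedModule) _ _ _
      (continuous_mult (K := R_AbsRing) _ _ _ A B') (continuous_mult (K := R_AbsRing) _ _ _ B A')).
Qed.

Lemma ccts_RtoC {U : UniformSpace} (f : U -> R) (x : U) :
  continuous f x -> ccts (fun u => RtoC (f u)) x.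
Proof. intros A. split; simpl; auto. apply continuous_const. Qed.

Lemma locally_C_eps (z : C) (d : R) (P : C -> Prop) : (0 < d)%R ->
  (forall y, (Cmod (y - z) < d)%R -> P y) -> @locally C_UniformSpace z P.
Proof.
  intros Hd H. assert (Hd2 : (0 < d / 2)%R) by lra.
  exists (mkposreal _ Hd2). intros y [A B]. apply H.
  eapply Rle_lt_trans; [apply Cmod_le_sum|].
  change (Rabs (Re y - Re z) < d / 2)%R in A. change (Rabs (Im y - Im z) < d / 2)%R in B.
  unfold Re, Im in *; simpl. unfold Rminus in *. lra.
Qed.

Lemma locally_C_disc (z : C) (P : C -> Prop) : @locally C_UniformSpace z P ->
  exists r, (0 < r)%R /\ forall y, (Cmod (y - z) < r)%R -> P y.
Proof.
  intros [r H]. exists r. split; [apply cond_pos|]. intros y Hy. apply H.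
  split; (eapply Rle_lt_trans; [|exact Hy]); [apply (re_le_Cmod (y - z)) | apply (im_le_Cmod (y - z))].
Qed.


(** Derivatives in Caratheodory's form: the difference quotient extends continuously. The variable
    [y] enters through [iota y], which is [y] itself for complex derivatives and the embedding of
    the reals for derivatives along the line; the rules are proved once for both. *)
Section Caratheodory.
Context {U : UniformSpace} (iota : U -> C) (iota_ccts : forall x, ccts iota x)
  (iota_inj : forall x y, iota x = iota y -> x = y).

(** First-order expansion, with the increment measured through [iota]. *)
Definition increment (f : U -> C) (x : U) (l : C) : Prop := forall eps : R, (0 < eps)%R ->
  locally x (fun y => (Cmod (f y - f x - (iota y - iota x) * l)%C <= eps * Cmod (iota y - iota x)%C)%R).

Definition cara (f : U -> C) (x : U) (l : C) : Prop := exists q : U -> C,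
  ccts q x /\ q x = l /\ forall y, f y = f x + (iota y - iota x) * q y.

Lemma cara_increment f x l : cara f x l <-> increment f x l.
Proof using iota_inj.
  split.
  - intros [q [Cq [<- E]]] eps He.
    apply filter_imp with (2 := proj1 (ccts_eps _ _) Cq eps He). intros y Hy.
    rewrite E. replace (_ - _ - _) with ((q y - q x) * (iota y - iota x)) by ring.
    rewrite Cmod_mult. apply Rmult_le_compat_r; [apply Cmod_ge_0 | lra].
  - intros D. exists (fun y => if Ceq_dec (iota y - iota x) 0 then l else (f y - f x) / (iota y - iota x)).
    assert (Z : forall y, iota y - iota x = 0 -> y = x).
    { intros y H. apply iota_inj. replace (iota y) with (iota y - iota x + iota x) by ring. rewrite H. ring. }
    split; [|split].
    + apply ccts_eps. intros eps He.
      apply filter_imp with (2 := D (eps / 2)%R ltac:(lra)). intros y Hy.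
      destruct (Ceq_dec (iota x - iota x) 0) as [_|N]; [|exfalso; apply N; ring].
      destruct (Ceq_dec (iota y - iota x) 0) as [_|N].
      * replace (l - l) with (RtoC 0) by ring. rewrite Cmod_0. lra.
      * assert (P := proj1 (Cmod_gt_0 _) N). set (d := iota y - iota x) in *.
        replace ((f y - f x) / d - l) with ((f y - f x - d * l) / d) by (field; auto).
        rewrite Cmod_div by auto. apply Rmult_lt_reg_r with (Cmod d); auto.
        unfold Rdiv. rewrite Rmult_assoc, Rinv_l, Rmult_1_r by lra. nra.
    + destruct (Ceq_dec (iota x - iota x) 0) as [_|N]; [reflexivity | exfalso; apply N; ring].
    + intros y. destruct (Ceq_dec (iota y - iota x) 0) as [H|N]; [rewrite H, (Z y H); ring | field; auto].
Qed.

Lemma cara_ccts f x l : cara f x l -> ccts f x.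
Proof using iota_ccts.
  intros [q [Cq [_ E]]]. apply ccts_ext with (1 := fun y => eq_sym (E y)).
  apply ccts_plus; [apply ccts_const|]. apply ccts_mult; auto. apply ccts_minus; auto using ccts_const.
Qed.

Lemma cara_const c x : cara (fun _ => c) x 0.
Proof using. exists (fun _ => 0). split; [apply ccts_const|]. split; auto. intros; ring. Qed.

Lemma cara_iota x : cara iota x 1.
Proof using. exists (fun _ => 1). split; [apply ccts_const|]. split; auto. intros; ring. Qed.

Lemma cara_plus f g x l l' : cara f x l -> cara g x l' -> cara (fun y => f y + g y) x (l + l').
Proof using.
  intros [q [Cq [<- E]]] [r [Cr [<- F]]]. exists (fun y => q y + r y).
  split; [apply ccts_plus; auto|]. split; auto. intros y. rewrite (E y), (F y). ring.
Qed.

Lemma cara_mult f g x l l' : cara f x l -> cara g x l' -> cara (fun y => f y * g y) x (l * g x + f x * l').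
Proof using iota_ccts.
  intros [q [Cq [<- E]]] G. assert (Cg := cara_ccts _ _ _ G). destruct G as [r [Cr [<- F]]].
  exists (fun y => q y * g y + f x * r y). split; [|split; auto].
  - apply ccts_plus; apply ccts_mult; auto using ccts_const.
  - intros y. rewrite (E y). replace (f x * g x) with (f x * (g y - (iota y - iota x) * r y)) by (rewrite (F y); ring). ring.
Qed.
End Caratheodory.

(** Componentwise, so that the real mean value and integration theorems apply to each part. *)
Definition RD (g : R -> C) (t : R) (l : C) : Prop :=
  is_derive (fun u => Re (g u)) t (Re l) /\ is_derive (fun u => Im (g u)) t (Im l).

(** Stated with increments, the form in which remainder estimates produce derivatives; it agrees
    with [is_derive] by [is_derive_CD]. *)
Definition CD (f : C -> C) (z l : C) : Prop :=
  forall eps : R, (0 < eps)%R -> exists delta : R, (0 < delta)%R /\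
  forall h : C, (Cmod h < delta)%R -> (Cmod (f (z + h) - f z - h * l)%C <= eps * Cmod h)%R.

Lemma is_derive_eps (f : R -> R) (x l : R) : is_derive f x l <->
  forall eps : R, (0 < eps)%R -> exists delta : R, (0 < delta)%R /\
  forall h : R, (Rabs h < delta)%R -> (Rabs (f (x + h) - f x - h * l) <= eps * Rabs h)%R.
Proof.
  split.
  - intros H eps He. apply is_derive_Reals in H. destruct (H eps He) as [d Hd].
    exists d. split; [apply cond_pos|]. intros h Hh.
    destruct (Req_dec h 0) as [->|N].
    + rewrite Rplus_0_r, Rabs_R0.
      replace (f x - f x - 0 * l)%R with 0%R by ring. rewrite Rabs_R0; lra.
    + specialize (Hd h N Hh).
      replace (f (x + h) - f x - h * l)%R with (((f (x + h) - f x) / h - l) * h)%R by (field; auto).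
      rewrite Rabs_mult. apply Rmult_le_compat_r; [apply Rabs_pos | lra].
  - intros H. apply is_derive_Reals. intros eps He.
    destruct (H (eps / 2)%R) as [d [Hd H1]]; [lra|]. exists (mkposreal d Hd).
    simpl. intros h N Hh. specialize (H1 h Hh).
    replace ((f (x + h) - f x) / h - l)%R with ((f (x + h) - f x - h * l) / h)%R by (field; auto).
    unfold Rdiv. rewrite Rabs_mult, Rabs_inv.
    assert (P := Rabs_pos_lt h N).
    apply Rle_lt_trans with (eps / 2 * Rabs h * / Rabs h)%R.
    + apply Rmult_le_compat_r; auto. left; apply Rinv_0_lt_compat; auto.
    + rewrite Rmult_assoc, Rinv_r; lra.
Qed.

Lemma RD_eps (g : R -> C) (t : R) (l : C) : RD g t l <->
  forall eps : R, (0 < eps)%R -> exists delta : R, (0 < delta)%R /\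
  forall h : R, (Rabs h < delta)%R ->
    (Cmod (g (t + h)%R - g t - h * l)%C <= eps * Rabs h)%R.
Proof.
  split.
  - intros [H1 H2] eps He. rewrite is_derive_eps in H1, H2.
    destruct (H1 (eps / 2)%R) as [d1 [P1 D1]]; [lra|].
    destruct (H2 (eps / 2)%R) as [d2 [P2 D2]]; [lra|].
    exists (Rmin d1 d2). split; [apply Rmin_pos; auto|]. intros h Hh.
    specialize (D1 h (Rlt_le_trans _ _ _ Hh (Rmin_l _ _))).
    specialize (D2 h (Rlt_le_trans _ _ _ Hh (Rmin_r _ _))).
    eapply Rle_trans; [apply Cmod_le_sum|].
    match goal with |- (Rabs ?a + Rabs ?b <= _)%R =>
      replace a with (Re (g (t + h)%R) - Re (g t) - h * Re l)%R by (unfold Re, Im; simpl; ring);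
      replace b with (Im (g (t + h)%R) - Im (g t) - h * Im l)%R by (unfold Re, Im; simpl; ring) end.
    lra.
  - intros H. split; apply is_derive_eps; intros eps He;
    destruct (H eps He) as [d [P D]]; exists d; split; auto; intros h Hh;
    specialize (D h Hh); (eapply Rle_trans; [| exact D]).
    + eapply Rle_trans; [| apply re_le_Cmod]. right. f_equal. unfold Re, Im; simpl; ring.
    + eapply Rle_trans; [| apply im_le_Cmod]. right. f_equal. unfold Re, Im; simpl; ring.
Qed.

Lemma is_derive_CD (f : C -> C) (z l : C) :
  @is_derive C_AbsRing C_NormedModule f z l <-> CD f z l.
Proof.
  split.
  - intros [_ H] eps He.
    specialize (H z (fun P HP => HP) (mkposreal eps He)).
    destruct H as [d Hd]. exists d. split; [apply cond_pos|]. intros h Hh.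
    assert (B : @ball (AbsRing_UniformSpace C_AbsRing) z d (z + h)).
    { unfold ball; simpl. unfold AbsRing_ball. simpl.
      unfold minus, plus, opp, abs; simpl. replace (z + h + - z) with h by ring. exact Hh. }
    specialize (Hd (z + h) B). simpl in Hd.
    unfold norm, minus, plus, opp, scal in Hd; simpl in Hd. unfold mult, abs in Hd; simpl in Hd.
    replace (z + h + - z) with h in Hd by ring.
    replace (f (z + h) - f z - h * l) with (f (z + h) + - f z + - (h * l)) by ring.
    exact Hd.
  - intros H. split.
    + apply is_linear_scal_l.
    + intros x Hx eps.
      assert (E : z = x).
      { apply (@is_filter_lim_locally_unique C_AbsRing (AbsRing_NormedModule C_AbsRing) z x). exact Hx. }
      subst x. destruct (H eps (cond_pos eps)) as [d [P D]].
      exists (mkposreal d P). intros y By.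
      unfold ball in By; simpl in By. unfold AbsRing_ball in By. simpl in By.
      unfold minus, plus, opp, abs in By; simpl in By.
      specialize (D (y + - z) By).
      unfold norm, minus, plus, opp, scal; simpl. unfold mult, abs; simpl.
      assert (E : forall a b : C, a + (b + - a) = b) by (intros; ring).
      rewrite E in D. exact D.
Qed.


Lemma ccts_id z : @ccts C_UniformSpace (fun z => z) z.
Proof.
  apply ccts_eps. intros eps He. apply locally_C_eps with eps; auto.
Qed.

Lemma CD_cara f z l : CD f z l <-> @cara C_UniformSpace (fun z => z) f z l.
Proof.
  rewrite (cara_increment (fun z : C => z) (fun x y H => H)). split; intros D eps He.
  - destruct (D eps He) as [d [P H]]. apply locally_C_eps with d; auto. intros y Hy.
    specialize (H (y - z) Hy). replace (z + (y - z)) with y in H by ring. exact H.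
  - destruct (locally_C_disc _ _ (D eps He)) as [r [P H]]. exists r. split; auto. intros h Hh.
    replace h with (z + h - z) in Hh by ring. specialize (H (z + h) Hh).
    replace (z + h - z) with h in H by ring. exact H.
Qed.

Lemma RD_cara g t l : RD g t l <-> @cara R_UniformSpace RtoC g t l.
Proof.
  rewrite (cara_increment RtoC RtoC_inj), RD_eps. split; intros D eps He.
  - destruct (D eps He) as [d [P H]]. exists (mkposreal d P). refine (fun (y : R) Hy => _).
    specialize (H (y - t)%R Hy). replace (t + (y - t))%R with y in H by ring.
    rewrite <- RtoC_minus, Cmod_R. exact H.
  - destruct (D eps He) as [r H]. exists r. split; [apply cond_pos|]. intros h Hh.
    assert (B : @ball R_UniformSpace t r (t + h)%R).
    { change (Rabs (t + h - t) < r)%R. replace (t + h - t)%R with h by ring. exact Hh. }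
    specialize (H _ B). rewrite <- RtoC_minus, Cmod_R in H. replace (t + h - t)%R with h in H by ring. exact H.
Qed.

Lemma CD_eq f z l l' : CD f z l -> l = l' -> CD f z l'.
Proof. intros; subst; auto. Qed.

Lemma CD_ext f g z l : (forall x, f x = g x) -> CD f z l -> CD g z l.
Proof. intros E D eps He. destruct (D eps He) as [d [P D1]]. exists d; split; auto.
  intros h Hh. rewrite <- !E; auto. Qed.

Lemma CD_ext_loc f g z l (r : R) : (0 < r)%R ->
  (forall x, (Cmod (x - z) < r)%R -> f x = g x) -> CD f z l -> CD g z l.
Proof.
  intros Hr E D eps He. destruct (D eps He) as [d [P D1]].
  exists (Rmin d r); split; [apply Rmin_pos; auto|].
  intros h Hh. rewrite <- !E.
  - apply D1. eapply Rlt_le_trans; [exact Hh|apply Rmin_l].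
  - replace (z - z) with (RtoC 0) by ring. rewrite Cmod_0; auto.
  - replace (z + h - z) with h by ring. eapply Rlt_le_trans; [exact Hh|apply Rmin_r].
Qed.


Lemma CD_const c z : CD (fun _ => c) z 0.
Proof. apply CD_cara, cara_const. Qed.

Lemma CD_id z : CD (fun x => x) z 1.
Proof. apply CD_cara, (cara_iota (fun x : C => x)). Qed.

Lemma CD_plus f g z l l' : CD f z l -> CD g z l' -> CD (fun x => f x + g x) z (l + l').
Proof. rewrite !CD_cara. apply cara_plus. Qed.

Lemma CD_mult f g z l l' : CD f z l -> CD g z l' ->
  CD (fun x => f x * g x) z (l * g z + f z * l').
Proof. rewrite !CD_cara. apply cara_mult, ccts_id. Qed.

Lemma CD_scal c f z l : CD f z l -> CD (fun x => c * f x) z (c * l).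
Proof.
  intros F. eapply CD_eq; [apply CD_mult; [apply CD_const | exact F]|]. cbv beta; ring.
Qed.

Lemma CD_opp f z l : CD f z l -> CD (fun x => - f x) z (- l).
Proof.
  intros F. apply CD_ext with (fun x => - (1) * f x); [intros; ring|].
  eapply CD_eq; [apply CD_scal; exact F|]. ring.
Qed.

Lemma CD_minus f g z l l' : CD f z l -> CD g z l' -> CD (fun x => f x - g x) z (l - l').
Proof. intros F G. apply CD_plus; auto. apply CD_opp; auto. Qed.

Lemma CD_ccts (f : C -> C) (z l : C) : CD f z l -> @ccts C_UniformSpace f z.
Proof. rewrite CD_cara. apply cara_ccts, ccts_id. Qed.

Lemma ccts_comp_C {U : UniformSpace} (f : C -> C) (g : U -> C) (x : U) :
  @ccts C_UniformSpace f (g x) -> ccts g x -> ccts (fun u => f (g u)) x.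
Proof.
  intros F G. apply ccts_eps. intros eps He.
  destruct (locally_C_disc _ _ (proj1 (ccts_eps f (g x)) F eps He)) as [r [P H]].
  apply filter_imp with (2 := proj1 (ccts_eps g x) G r P). intros u Hu. apply H, Hu.
Qed.

Lemma ccts_comp {U : UniformSpace} (f : C -> C) (g : U -> C) (x : U) (l : C) :
  CD f (g x) l -> ccts g x -> ccts (fun u => f (g u)) x.
Proof. intros D. apply ccts_comp_C, (CD_ccts _ _ _ D). Qed.

Lemma cara_comp {U : UniformSpace} (iota : U -> C) (Ci : forall x, ccts iota x) (f : C -> C) (g : U -> C) x l l' :
  CD f (g x) l -> cara iota g x l' -> cara iota (fun y => f (g y)) x (l * l').
Proof.
  intros F G. assert (Cg := cara_ccts _ Ci _ _ _ G). apply CD_cara in F.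
  destruct F as [q [Cq [<- E]]]. destruct G as [r [Cr [<- H]]].
  exists (fun y => q (g y) * r y). split; [|split; auto].
  - apply ccts_mult; auto. apply (ccts_comp_C q g); auto.
  - intros y. rewrite (E (g y)). replace (g y - g x) with ((iota y - iota x) * r y) by (rewrite (H y); ring). ring.
Qed.

Lemma CD_comp f g z l l' : CD f (g z) l -> CD g z l' -> CD (fun x => f (g x)) z (l * l').
Proof. intros F. rewrite !CD_cara. apply (cara_comp _ ccts_id), F. Qed.

Lemma RtoC_ccts t : ccts RtoC t.
Proof. apply (ccts_RtoC (fun t => t)), continuous_id. Qed.

Lemma RD_eq f z l l' : RD f z l -> l = l' -> RD f z l'.
Proof. intros; subst; auto. Qed.

Lemma RD_ext f g z l : (forall x, f x = g x) -> RD f z l -> RD g z l.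
Proof.
  intros E [A B]. split; [revert A | revert B]; apply is_derive_ext; intros; rewrite E; auto.
Qed.

Lemma RD_ccts (g : R -> C) (t : R) (l : C) : RD g t l -> ccts g t.
Proof. rewrite RD_cara. apply cara_ccts, RtoC_ccts. Qed.

Lemma RD_comp f g t l l' : CD f (g t) l -> RD g t l' -> RD (fun x => f (g x)) t (l * l').
Proof. intros F. rewrite !RD_cara. apply (cara_comp _ RtoC_ccts), F. Qed.

Lemma RD_plus f g z l l' : RD f z l -> RD g z l' -> RD (fun x => f x + g x) z (l + l').
Proof. rewrite !RD_cara. apply cara_plus. Qed.

Lemma RD_mult f g z l l' : RD f z l -> RD g z l' ->
  RD (fun x => f x * g x) z (l * g z + f z * l').
Proof. rewrite !RD_cara. apply cara_mult, RtoC_ccts. Qed.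

Lemma RD_RtoC (f : R -> R) t l : is_derive f t l -> RD (fun x => RtoC (f x)) t (RtoC l).
Proof. intros D; split; simpl; auto. apply is_derive_Reals, derivable_pt_lim_const. Qed.

Lemma RD_const c t : RD (fun _ => c) t 0.
Proof. split; simpl; apply is_derive_Reals, derivable_pt_lim_const. Qed.

Lemma RD_scal c f z l : RD f z l -> RD (fun x => c * f x) z (c * l).
Proof.
  intros F. eapply RD_eq; [apply RD_mult; [apply RD_const | exact F]|]. cbv beta; ring.
Qed.

Lemma RD_opp f z l : RD f z l -> RD (fun x => - f x) z (- l).
Proof.
  intros F. apply RD_ext with (fun x => - (1) * f x); [intros; ring|].
  eapply RD_eq; [apply RD_scal; exact F|]. ring.
Qed.

Lemma RD_minus f g z l l' : RD f z l -> RD g z l' -> RD (fun x => f x - g x) z (l - l').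
Proof. intros F G. apply RD_plus; auto. apply RD_opp; auto. Qed.

Lemma RD_line (a b : C) (t : R) : RD (fun x : R => a + x * b) t b.
Proof.
  eapply RD_eq.
  - apply RD_plus; [apply RD_const|]. apply RD_mult; [|apply RD_const].
    apply RD_RtoC. apply is_derive_Reals, derivable_pt_lim_id.
  - cbv beta; ring.
Qed.

(** Mean value inequality; the constant is sharp because the real mean value theorem is
    applied to the projection of the path on the direction of its increment. *)
Lemma RD_mvt (g g' : R -> C) (a b K : R) : (a <= b)%R ->
  (forall t, (a <= t <= b)%R -> RD g t (g' t)) ->
  (forall t, (a <= t <= b)%R -> (Cmod (g' t) <= K)%R) ->
  (Cmod (g b - g a) <= K * (b - a))%R.
Proof.
  intros Hab D B. set (d := g b - g a).
  destruct (MVT_gen (fun t => Re d * Re (g t) + Im d * Im (g t))%R a b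
     (fun t => Re d * Re (g' t) + Im d * Im (g' t))%R) as [c [Hc E]].
  - rewrite Rmin_left, Rmax_right by auto. intros x Hx.
    destruct (D x) as [D1 D2]; [lra|].
    apply (is_derive_plus (fun t => Re d * Re (g t))%R (fun t => Im d * Im (g t))%R);
    apply is_derive_scal; auto.
  - rewrite Rmin_left, Rmax_right by auto. intros x Hx.
    destruct (D x Hx) as [D1 D2].
    apply continuity_pt_filterlim.
    apply (ex_derive_continuous (fun t => Re d * Re (g t) + Im d * Im (g t))%R).
    eexists. apply (is_derive_plus (fun t => Re d * Re (g t))%R (fun t => Im d * Im (g t))%R);
    apply is_derive_scal; eauto.
  - rewrite Rmin_left, Rmax_right in Hc by auto.
    assert (E2 : (Cmod d * Cmod d = (Re d * Re (g' c) + Im d * Im (g' c)) * (b - a))%R).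
    { rewrite <- E, Cmod_sqr. unfold d; unfold Re, Im; simpl. ring. }
    assert (E3 : (Re d * Re (g' c) + Im d * Im (g' c) <= Cmod d * Cmod (g' c))%R).
    { eapply Rle_trans; [|rewrite <- (Cmod_conj d), <- Cmod_mult; apply re_le_Cmod].
      eapply Rle_trans; [apply Rle_abs|]. right. f_equal.
      unfold Cconj, Re, Im; simpl; ring. }
    specialize (B c Hc).
    assert (P := Cmod_ge_0 d). assert (P2 := Cmod_ge_0 (g' c)).
    destruct (Req_dec (Cmod d) 0) as [Z|NZ].
    + rewrite Z. apply Rmult_le_pos; lra.
    + apply Rmult_le_reg_l with (Cmod d); [lra|]. rewrite E2.
      apply Rle_trans with (Cmod d * Cmod (g' c) * (b - a))%R.
      * apply Rmult_le_compat_r; lra.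
      * rewrite Rmult_assoc. apply Rmult_le_compat_l; auto.
        apply Rmult_le_compat_r; lra.
Qed.

Lemma Cexp_line (h : C) (t : R) : RD (fun x : R => Cexp (x * h)) t (h * Cexp (t * h)).
Proof.
  split; unfold Cexp, Re, Im; simpl; unfold Re, Im; simpl; auto_derive; auto; unfold Rminus; ring.
Qed.

Lemma exp_le (x y : R) : (x <= y)%R -> (exp x <= exp y)%R.
Proof. intros [H| ->]; [left; apply exp_increasing; auto | right; auto]. Qed.

Lemma Cmod_Cexp_le (z : C) : (Cmod (Cexp z) <= exp (Cmod z))%R.
Proof.
  rewrite Cmod_Cexp. apply exp_le. eapply Rle_trans; [apply Rle_abs | apply re_le_Cmod].
Qed.

Lemma Cexp_sub_1 (h : C) : (Cmod (Cexp h - 1) <= Cmod h * exp (Cmod h))%R.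
Proof.
  assert (M := RD_mvt (fun x : R => Cexp (x * h)) (fun t : R => h * Cexp (t * h)) 0 1
    (Cmod h * exp (Cmod h))).
  cbv beta in M. rewrite !Cmult_1_l, !Cmult_0_l, Cexp_0, Rminus_0_r, Rmult_1_r in M. apply M; [lra| |].
  - intros; apply Cexp_line.
  - intros t Ht. rewrite Cmod_mult. apply Rmult_le_compat_l; [apply Cmod_ge_0|].
    eapply Rle_trans; [apply Cmod_Cexp_le|]. apply exp_le.
    rewrite Cmod_mult, Cmod_R, Rabs_right by lra. generalize (Cmod_ge_0 h); nra.
Qed.

(** Second-order remainder, used twice: for the derivative of the exponential and for
    differentiation under the integral sign. *)
Lemma Cexp_sub_2 (h : C) :
  (Cmod (Cexp h - 1 - h) <= Cmod h * Cmod h * exp (Cmod h))%R.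
Proof.
  assert (M := RD_mvt (fun x : R => Cexp (x * h) + - (x * h))
    (fun t : R => h * Cexp (t * h) + - h) 0 1 (Cmod h * Cmod h * exp (Cmod h))).
  cbv beta in M. rewrite !Cmult_1_l, !Cmult_0_l, Cexp_0, Rminus_0_r, Rmult_1_r in M.
  replace (Cexp h - 1 - h) with (Cexp h + - h - (1 + - 0)) by ring. apply M; [lra| |].
  - intros. apply RD_plus; [apply Cexp_line|]. apply RD_opp.
    eapply RD_ext; [|eapply RD_eq; [apply (RD_line 0 h)|]]; [|reflexivity].
    intros; simpl; ring.
  - intros t Ht. replace (h * Cexp (t * h) + - h) with (h * (Cexp (t * h) - 1)) by ring.
    rewrite Cmod_mult, Rmult_assoc. apply Rmult_le_compat_l; [apply Cmod_ge_0|].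
    assert (P : (Cmod (t * h) <= Cmod h)%R).
    { rewrite Cmod_mult, Cmod_R, Rabs_right by lra. generalize (Cmod_ge_0 h); nra. }
    eapply Rle_trans; [apply Cexp_sub_1|].
    apply Rmult_le_compat; auto using Cmod_ge_0, exp_le. left; apply exp_pos.
Qed.

Lemma CD_Cexp (z : C) : CD Cexp z (Cexp z).
Proof.
  intros eps He.
  assert (P : (0 < exp (Re z) * exp 1)%R) by (apply Rmult_lt_0_compat; apply exp_pos).
  exists (Rmin 1 (eps / (exp (Re z) * exp 1))). split.
  { apply Rmin_pos; [lra|]. apply Rdiv_lt_0_compat; auto. }
  intros h Hh.
  replace (Cexp (z + h) - Cexp z - h * Cexp z) with (Cexp z * (Cexp h - 1 - h))
    by (rewrite Cexp_plus; ring).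
  rewrite Cmod_mult, Cmod_Cexp.
  assert (h1 : (Cmod h < 1)%R) by (eapply Rlt_le_trans; [exact Hh|apply Rmin_l]).
  assert (h2 : (Cmod h < eps / (exp (Re z) * exp 1))%R) by (eapply Rlt_le_trans; [exact Hh|apply Rmin_r]).
  apply Rmult_lt_compat_l with (r := (exp (Re z) * exp 1)%R) in h2; auto.
  replace (exp (Re z) * exp 1 * (eps / (exp (Re z) * exp 1)))%R with eps in h2 by (field; split; apply Rgt_not_eq, exp_pos).
  assert (Ph := Cmod_ge_0 h).
  apply Rle_trans with (exp (Re z) * (Cmod h * Cmod h * exp 1))%R.
  - apply Rmult_le_compat_l; [left; apply exp_pos|].
    eapply Rle_trans; [apply Cexp_sub_2|]. apply Rmult_le_compat_l; [nra|].
    apply exp_le; lra.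
  - replace (exp (Re z) * (Cmod h * Cmod h * exp 1))%R with (exp (Re z) * exp 1 * Cmod h * Cmod h)%R by ring.
    apply Rmult_le_compat_r; auto; lra.
Qed.

Lemma CD_exp f z l : CD f z l -> CD (fun x => Cexp (f x)) z (Cexp (f z) * l).
Proof. intros; apply (CD_comp Cexp); auto using CD_Cexp. Qed.

Lemma RD_exp f z l : RD f z l -> RD (fun x => Cexp (f x)) z (Cexp (f z) * l).
Proof. intros; apply (RD_comp Cexp); auto using CD_Cexp. Qed.

Lemma ccts_Cexp {U : UniformSpace} (g : U -> C) (x : U) :
  ccts g x -> ccts (fun u => Cexp (g u)) x.
Proof. apply ccts_comp with (1 := CD_Cexp (g x)). Qed.

Lemma ccts_exp {U : UniformSpace} (g : U -> R) (x : U) :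
  continuous g x -> continuous (fun u => exp (g u)) x.
Proof.
  intros H. apply (continuous_comp g exp); auto.
  apply continuity_pt_filterlim. apply derivable_continuous_pt, derivable_pt_exp.
Qed.

Lemma CD_RD_line f (a b : C) (t : R) l : CD f (a + t * b) l ->
  RD (fun x : R => f (a + x * b)) t (l * b).
Proof. intros. apply (RD_comp f (fun x : R => a + x * b)); auto using RD_line. Qed.

Lemma CD_inv (z : C) : z <> 0 -> CD (fun x => / x) z (- / (z * z)).
Proof.
  intros N eps He. assert (P : (0 < Cmod z)%R) by (exact (proj1 (Cmod_gt_0 z) N)).
  set (m := Cmod z) in *.
  exists (Rmin (m / 2) (eps * (m * m * m) / 2)). split.
  { apply Rmin_pos; [lra|]. assert (0 < m * m * m)%R by (repeat apply Rmult_lt_0_compat; lra). nra. }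
  intros h Hh.
  assert (h1 : (Cmod h < m / 2)%R) by (eapply Rlt_le_trans; [exact Hh|apply Rmin_l]).
  assert (h2 : (Cmod h < eps * (m * m * m) / 2)%R) by (eapply Rlt_le_trans; [exact Hh|apply Rmin_r]).
  assert (Q : (m / 2 <= Cmod (z + h))%R).
  { generalize (Cmod_triangle_inv z (- h)). replace (z - - h) with (z + h) by ring.
    rewrite Cmod_opp. fold m. lra. }
  assert (N2 : z + h <> 0) by (apply (proj2 (Cmod_gt_0 (z + h))); lra).
  replace (/ (z + h) - / z - h * - / (z * z)) with (h * (h * / (z * z * (z + h)))) by (field; auto).
  rewrite Cmod_mult, Rmult_comm. apply Rmult_le_compat_r; [apply Cmod_ge_0|].
  assert (N3 : z * z * (z + h) <> 0) by (apply Cmult_neq_0; [apply Cmult_neq_0|]; auto).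
  rewrite Cmod_mult, Cmod_inv by auto.
  rewrite !Cmod_mult. fold m.
  assert (Q2 : (m * m * (m / 2) <= m * m * Cmod (z + h))%R) by (apply Rmult_le_compat_l; [nra|auto]).
  assert (P3 : (0 < m * m * (m / 2))%R) by (repeat apply Rmult_lt_0_compat; lra).
  apply Rmult_le_reg_r with (m * m * Cmod (z + h))%R; [lra|].
  rewrite Rmult_assoc, Rinv_l, Rmult_1_r by lra.
  apply Rle_trans with (eps * (m * m * (m / 2)))%R; [|apply Rmult_le_compat_l; lra]. lra.
Qed.

(** * Integrals of complex functions of a real variable *)

Notation CInt f a b := (RInt (V := C_R_CompleteNormedModule) f a b).

Lemma ccts_continuous {U : UniformSpace} (f : U -> C) (x : U) :
  ccts f x -> continuous (f : U -> C_R_CompleteNormedModule) x.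
Proof.
  intros [A B] P [eps HP]. unfold filtermap.
  assert (A1 : locally x (fun u => ball (Re (f x)) eps (Re (f u))))
    by (apply A, locally_ball).
  assert (B1 : locally x (fun u => ball (Im (f x)) eps (Im (f u))))
    by (apply B, locally_ball).
  generalize (filter_and _ _ A1 B1). apply filter_imp. intros u [H1 H2]. apply HP. split; auto.
Qed.

Lemma ex_CInt (f : R -> C) (a b : R) : (forall t, ccts f t) ->
  ex_RInt (V := C_R_CompleteNormedModule) f a b.
Proof.
  intros H. apply ex_RInt_continuous. intros z _. apply ccts_continuous. apply H.
Qed.

Lemma CInt_correct (f : R -> C) (a b : R) : (forall t, ccts f t) ->
  is_RInt (V := C_R_CompleteNormedModule) f a b (CInt f a b).
Proof. intros H. apply (RInt_correct (V := C_R_CompleteNormedModule)), ex_CInt, H. Qed.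

Lemma CInt_unique (f : R -> C) (a b : R) (l : C) :
  is_RInt (V := C_R_NormedModule) (f : R -> C_R_NormedModule) a b l -> CInt f a b = l.
Proof. intros H. apply (is_RInt_unique (V := C_R_CompleteNormedModule)). exact H. Qed.

Lemma ex_RInt_Re (f : R -> C) (a b : R) : (forall t, ccts f t) -> ex_RInt (fun t => Re (f t)) a b.
Proof. intros F. apply (ex_RInt_continuous (V := R_CompleteNormedModule)). exact (fun z _ => proj1 (F z)). Qed.

Lemma ex_RInt_Im (f : R -> C) (a b : R) : (forall t, ccts f t) -> ex_RInt (fun t => Im (f t)) a b.
Proof. intros F. apply (ex_RInt_continuous (V := R_CompleteNormedModule)). exact (fun z _ => proj2 (F z)). Qed.

Lemma CInt_pair (f : R -> C) (a b : R) : (forall t, ccts f t) ->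
  CInt f a b = (RInt (fun t => Re (f t)) a b, RInt (fun t => Im (f t)) a b).
Proof.
  intros H. apply CInt_unique.
  apply (is_RInt_fct_extend_pair (U := R_NormedModule) (V := R_NormedModule));
  apply (RInt_correct (V := R_CompleteNormedModule)); [apply ex_RInt_Re, H | apply ex_RInt_Im, H].
Qed.

Lemma CInt_plus (f g : R -> C) (a b : R) : (forall t, ccts f t) -> (forall t, ccts g t) ->
  CInt (fun t => f t + g t) a b = CInt f a b + CInt g a b.
Proof.
  intros F G. apply (RInt_plus (V := C_R_CompleteNormedModule)); apply ex_CInt; auto.
Qed.

Lemma CInt_scal (c : C) (f : R -> C) (a b : R) : (forall t, ccts f t) ->
  CInt (fun t => c * f t) a b = c * CInt f a b.
Proof.
  intros F. rewrite !CInt_pair; auto.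
  2: intros; apply ccts_mult; auto using ccts_const.
  assert (E1 := ex_RInt_Re f a b F). assert (E2 := ex_RInt_Im f a b F).
  apply C_eq; unfold Re, Im in *; simpl.
  - apply is_RInt_unique. apply (is_RInt_minus (V := R_NormedModule));
    apply (is_RInt_scal (V := R_NormedModule)), (RInt_correct (V := R_CompleteNormedModule)); auto.
  - apply is_RInt_unique. apply (is_RInt_plus (V := R_NormedModule));
    apply (is_RInt_scal (V := R_NormedModule)), (RInt_correct (V := R_CompleteNormedModule)); auto.
Qed.

Lemma CInt_ext (f g : R -> C) (a b : R) : (forall t, f t = g t) -> CInt f a b = CInt g a b.
Proof. intros E. apply (RInt_ext (V := C_R_CompleteNormedModule)). intros; apply E. Qed.

Lemma CInt_Chasles (f : R -> C) (a b c : R) : (forall t, ccts f t) ->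
  CInt f a b + CInt f b c = CInt f a c.
Proof.
  intros F. apply (RInt_Chasles (V := C_R_CompleteNormedModule)); apply ex_CInt; auto.
Qed.

Lemma CInt_bound (f : R -> C) (g : R -> R) (a b : R) : (a <= b)%R ->
  (forall t, ccts f t) -> ex_RInt g a b ->
  (forall t, (a <= t <= b)%R -> (Cmod (f t) <= g t)%R) ->
  (Cmod (CInt f a b) <= RInt g a b)%R.
Proof.
  intros Hab F G H. rewrite Cmod_norm.
  apply (norm_RInt_le (V := C_R_NormedModule) f g a b); auto.
  - intros x Hx. specialize (H x Hx). rewrite Cmod_norm in H. exact H.
  - apply (RInt_correct (V := C_R_CompleteNormedModule)), ex_CInt, F.
  - apply (RInt_correct (V := R_CompleteNormedModule)), G.
Qed.

Lemma CInt_bound_const (f : R -> C) (K a b : R) : (a <= b)%R -> (forall t, ccts f t) ->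
  (forall t, (a <= t <= b)%R -> (Cmod (f t) <= K)%R) -> (Cmod (CInt f a b) <= (b - a) * K)%R.
Proof.
  intros Hab F H.
  apply Rle_trans with (RInt (fun _ => K) a b).
  - apply CInt_bound; auto. apply ex_RInt_const.
  - rewrite (RInt_const (V := R_CompleteNormedModule)). right. reflexivity.
Qed.

Lemma CInt_FTC (g g' : R -> C) (a b : R) :
  (forall t, (Rmin a b <= t <= Rmax a b)%R -> RD g t (g' t)) -> (forall t, ccts g' t) ->
  CInt g' a b = g b - g a.
Proof.
  intros D F. apply CInt_unique.
  apply (is_RInt_fct_extend_pair (U := R_NormedModule) (V := R_NormedModule)).
  - apply (is_RInt_derive (V := R_CompleteNormedModule) (fun t => Re (g t)) (fun t => Re (g' t))).
    + intros x Hx. apply D; auto.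
    + exact (fun x _ => proj1 (F x)).
  - apply (is_RInt_derive (V := R_CompleteNormedModule) (fun t => Im (g t)) (fun t => Im (g' t))).
    + intros x Hx. apply D; auto.
    + exact (fun x _ => proj2 (F x)).
Qed.

Lemma continuous_RInt_2d (f : R -> R -> R) (a b : R) (x : R) :
  (forall u v, continuity_2d_pt f u v) ->
  continuous (fun u => RInt (fun v => f u v) a b) x.
Proof.
  intros F.
  assert (W : forall c d, (c <= d)%R -> continuous (fun u => RInt (fun v => f u v) c d) x).
  { intros c d Hcd. apply continuous_R_eps. intros eps He.
    assert (He2 : (0 < eps / (d - c + 1))%R) by (apply Rdiv_lt_0_compat; lra).
    destruct (uniform_continuity_2d_1d' f c d x (fun y _ => F x y) (mkposreal _ He2)) as [dl H].
    exists dl. intros u Hu. change (Rabs (u - x) < dl)%R in Hu.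
    assert (ex : forall u, ex_RInt (fun v => f u v) c d).
    { intros u'. apply (ex_RInt_continuous (V := R_CompleteNormedModule)). intros z _.
      apply continuity_pt_filterlim. intros e Hee.
      destruct (F u' z (mkposreal e Hee)) as [d' H'].
      exists d'. split; [apply cond_pos|]. intros y [_ Hy]. apply H'; auto.
      rewrite Rminus_diag, Rabs_R0; apply cond_pos. }
    assert (L := abs_RInt_le_const (fun v => f u v - f x v)%R c d (eps / (d - c + 1)) Hcd).
    rewrite (RInt_minus (V := R_CompleteNormedModule) (fun v => f u v) (fun v => f x v)) in L; auto.
    change (minus (RInt (fun v => f u v) c d) (RInt (fun v => f x v) c d)) with
      (RInt (fun v => f u v) c d - RInt (fun v => f x v) c d)%R in L.
    eapply Rle_lt_trans; [apply L|].
    - apply (ex_RInt_minus (V := R_NormedModule)); auto.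
    - intros t Ht. left. apply (H t x t u); auto.
      + generalize (cond_pos dl). lra.
      + apply Rabs_def2 in Hu. lra.
      + rewrite Rminus_diag, Rabs_R0; apply cond_pos.
    - apply Rmult_lt_reg_r with (d - c + 1)%R; [lra|].
      replace ((d - c) * (eps / (d - c + 1)) * (d - c + 1))%R with ((d - c) * eps)%R by (field; lra).
      nra. }
  destruct (Rle_dec a b) as [H|H]; [auto|].
  eapply continuous_ext; [|apply (continuous_opp (V := R_NormedModule) _ _ (W b a ltac:(lra)))].
  intros u. simpl. apply (opp_RInt_swap (V := R_CompleteNormedModule)).
  apply (ex_RInt_continuous (V := R_CompleteNormedModule)). intros z _.
  apply continuity_pt_filterlim. intros e Hee.
  destruct (F u z (mkposreal e Hee)) as [d' H'].
  exists d'. split; [apply cond_pos|]. intros y [_ Hy]. apply H'; auto.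
  rewrite Rminus_diag, Rabs_R0; apply cond_pos.
Qed.

Lemma continuity_2d_slice (f : R -> R -> R) (u z : R) :
  continuity_2d_pt f u z -> continuous (fun v => f u v) z.
Proof.
  intros F. apply continuity_pt_filterlim. intros e Hee.
  destruct (F (mkposreal e Hee)) as [d' H'].
  exists d'. split; [apply cond_pos|]. intros y [_ Hy]. apply H'; auto.
  rewrite Rminus_diag, Rabs_R0; apply cond_pos.
Qed.

Lemma continuity_2d_slice' (f : R -> R -> R) (u z : R) :
  continuity_2d_pt f u z -> continuous (fun v => f v z) u.
Proof.
  intros F. apply continuity_pt_filterlim. intros e Hee.
  destruct (F (mkposreal e Hee)) as [d' H'].
  exists d'. split; [apply cond_pos|]. intros y [_ Hy]. apply H'; auto.
  rewrite Rminus_diag, Rabs_R0; apply cond_pos.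
Qed.

(** Fubini on a rectangle: both iterated integrals have the same derivative in the upper
    end of the outer one. *)
Lemma RInt_Fubini (f : R -> R -> R) (a b c d : R) :
  (forall u v, continuity_2d_pt f u v) ->
  RInt (fun u => RInt (fun v => f u v) c d) a b
  = RInt (fun v => RInt (fun u => f u v) a b) c d.
Proof.
  intros F.
  assert (ex1 : forall u p q, ex_RInt (fun v => f u v) p q).
  { intros u p q. apply (ex_RInt_continuous (V := R_CompleteNormedModule)). intros z _.
    apply continuity_2d_slice; auto. }
  assert (ex2 : forall v p q, ex_RInt (fun u => f u v) p q).
  { intros v p q. apply (ex_RInt_continuous (V := R_CompleteNormedModule)). intros z _.
    apply (continuity_2d_slice' f); auto. }
  assert (Fs : forall u v, continuity_2d_pt (fun v u => f u v) u v).
  { intros u v eps. destruct (F v u eps) as [dl H]. exists dl. intros; apply H; auto. }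
  assert (D2 : forall u v, is_derive (fun z => RInt (fun t => f t v) a z) u (f u v)).
  { intros u v. apply (is_derive_RInt (V := R_NormedModule) (fun t => f t v) _ a u).
    - exists (mkposreal 1 Rlt_0_1). intros y _. apply (RInt_correct (V := R_CompleteNormedModule)), ex2.
    - apply (continuity_2d_slice' f); auto. }
  set (G := fun x => (RInt (fun u => RInt (fun v => f u v) c d) a x
     - RInt (fun v => RInt (fun u => f u v) a x) c d)%R).
  assert (DG : forall x, is_derive G x 0%R).
  { intros x.
    replace 0%R with (RInt (fun v => f x v) c d - RInt (fun v => f x v) c d)%R by ring.
    apply (is_derive_minus (V := R_NormedModule)).
    - apply (is_derive_RInt (V := R_NormedModule) (fun u => RInt (fun v => f u v) c d) _ a x).
      + exists (mkposreal 1 Rlt_0_1). intros y _. apply (RInt_correct (V := R_CompleteNormedModule)).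
        apply (ex_RInt_continuous (V := R_CompleteNormedModule)). intros z _.
        apply continuous_RInt_2d; auto.
      + apply continuous_RInt_2d; auto.
    - assert (P := is_derive_RInt_param (fun x v => RInt (fun u => f u v) a x) c d x).
      replace (RInt (fun v => f x v) c d) with
        (RInt (fun t => Derive (fun u => RInt (fun u0 => f u0 t) a u) x) c d).
      2:{ apply RInt_ext. intros v _. apply is_derive_unique. apply D2. }
      apply P.
      + exists (mkposreal 1 Rlt_0_1). intros y _ t _. eexists. apply D2.
      + intros t _. eapply continuity_2d_pt_ext; [|apply F].
        intros u v. symmetry. apply is_derive_unique. apply D2.
      + exists (mkposreal 1 Rlt_0_1). intros y _.
        apply (ex_RInt_continuous (V := R_CompleteNormedModule)). intros z _.
        apply (continuous_RInt_2d (fun v u => f u v)); auto. }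
  assert (E : G b = G a).
  { destruct (MVT_gen G a b (fun _ => 0%R)) as [z [_ Hz]].
    - intros; apply DG.
    - intros x _. apply continuity_pt_filterlim.
      apply (ex_derive_continuous (V := R_NormedModule)). eexists; apply DG.
    - rewrite Rmult_0_l in Hz. lra. }
  unfold G in E. rewrite (RInt_point (V := R_CompleteNormedModule)) in E.
  assert (Z : RInt (fun v => RInt (fun u => f u v) a a) c d = 0%R).
  { rewrite (RInt_ext _ (fun _ => 0%R)).
    - rewrite (RInt_const (V := R_CompleteNormedModule)). unfold scal; simpl; unfold mult; simpl; ring.
    - intros; apply (RInt_point (V := R_CompleteNormedModule)). }
  rewrite Z in E. unfold zero in E; simpl in E. lra.
Qed.

Definition ccts2 (f : R -> R -> C) (x y : R) : Prop :=
  @ccts (prod_UniformSpace R_UniformSpace R_UniformSpace) (fun p => f (fst p) (snd p)) (x, y).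

Lemma ccts2_re f x y : ccts2 f x y -> continuity_2d_pt (fun u v => Re (f u v)) x y.
Proof. intros [A _]. apply continuity_2d_pt_filterlim. exact A. Qed.
Lemma ccts2_im f x y : ccts2 f x y -> continuity_2d_pt (fun u v => Im (f u v)) x y.
Proof. intros [_ A]. apply continuity_2d_pt_filterlim. exact A. Qed.

Lemma ccts2_slice f u z : ccts2 f u z -> ccts (fun v => f u v) z.
Proof.
  intros H. split.
  - apply (continuity_2d_slice (fun u v => Re (f u v))), ccts2_re; auto.
  - apply (continuity_2d_slice (fun u v => Im (f u v))), ccts2_im; auto.
Qed.

Lemma ccts2_slice' f u z : ccts2 f u z -> ccts (fun v => f v z) u.
Proof.
  intros H. split.
  - apply (continuity_2d_slice' (fun u v => Re (f u v))), ccts2_re; auto.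
  - apply (continuity_2d_slice' (fun u v => Im (f u v))), ccts2_im; auto.
Qed.

Lemma ccts2_fst (f : R -> C) x y : ccts f x -> ccts2 (fun u _ => f u) x y.
Proof.
  intros [A B]. split; simpl.
  - apply (continuous_comp (fst : R * R -> R) (fun u => Re (f u))); auto. apply continuous_fst.
  - apply (continuous_comp (fst : R * R -> R) (fun u => Im (f u))); auto. apply continuous_fst.
Qed.

Lemma ccts2_snd (f : R -> C) x y : ccts f y -> ccts2 (fun _ v => f v) x y.
Proof.
  intros [A B]. split; simpl.
  - apply (continuous_comp (snd : R * R -> R) (fun u => Re (f u))); auto. apply continuous_snd.
  - apply (continuous_comp (snd : R * R -> R) (fun u => Im (f u))); auto. apply continuous_snd.
Qed.

Lemma ccts_CInt_param (f : R -> R -> C) (a b x : R) : (forall u v, ccts2 f u v) ->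
  ccts (fun u => CInt (fun v => f u v) a b) x.
Proof.
  intros F. eapply ccts_ext.
  - intros u. symmetry. apply CInt_pair. intros t. apply (ccts2_slice f); auto.
  - split; simpl.
    + apply (continuous_RInt_2d (fun u v => Re (f u v))). intros; apply ccts2_re; auto.
    + apply (continuous_RInt_2d (fun u v => Im (f u v))). intros; apply ccts2_im; auto.
Qed.

Lemma CInt_Fubini (f : R -> R -> C) (a b c d : R) : (forall u v, ccts2 f u v) ->
  CInt (fun u => CInt (fun v => f u v) c d) a b = CInt (fun v => CInt (fun u => f u v) a b) c d.
Proof.
  intros F.
  assert (Fs : forall u v, ccts2 (fun v u => f u v) u v).
  { intros u v. destruct (F v u) as [A B].
    split; unfold ccts2, ccts in *; intros P HP; [specialize (A P HP) as [e H] | specialize (B P HP) as [e H]];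
    exists e; intros [y1 y2] [Y1 Y2]; apply (H (y2, y1)); split; auto. }
  rewrite (CInt_pair (fun u => CInt (fun v => f u v) c d)) by (intros; apply ccts_CInt_param; auto).
  rewrite (CInt_pair (fun v => CInt (fun u => f u v) a b))
    by (intros; apply (ccts_CInt_param (fun v u => f u v)); auto).
  f_equal.
  - transitivity (RInt (fun u => RInt (fun v => Re (f u v)) c d) a b);
    [|transitivity (RInt (fun v => RInt (fun u => Re (f u v)) a b) c d)].
    + apply RInt_ext. intros u _. rewrite CInt_pair; [reflexivity|].
      intros; apply (ccts2_slice f); auto.
    + apply (RInt_Fubini (fun u v => Re (f u v))). intros; apply ccts2_re; auto.
    + apply RInt_ext. intros v _. rewrite CInt_pair; [reflexivity|].
      intros; apply (ccts2_slice' f); auto.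
  - transitivity (RInt (fun u => RInt (fun v => Im (f u v)) c d) a b);
    [|transitivity (RInt (fun v => RInt (fun u => Im (f u v)) a b) c d)].
    + apply RInt_ext. intros u _. rewrite CInt_pair; [reflexivity|].
      intros; apply (ccts2_slice f); auto.
    + apply (RInt_Fubini (fun u v => Im (f u v))). intros; apply ccts2_im; auto.
    + apply RInt_ext. intros v _. rewrite CInt_pair; [reflexivity|].
      intros; apply (ccts2_slice' f); auto.
Qed.

(** * Improper integrals over the real line *)

(** All integrals over the line below are of continuous functions bounded by a multiple of
    [1 / (1 + v^2)], so that [atan] measures every tail. *)
Definition bdd (f : R -> C) (M : R) : Prop :=
  forall v : R, (Cmod (f v) <= M / (1 + v * v))%R.

Definition intg (f : R -> C) : Prop := (forall t, ccts f t) /\ exists M, bdd f M.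

Definition CI (f : R -> C) : C :=
  RInt_gen (V := C_R_CompleteNormedModule) f (Rbar_locally m_infty) (Rbar_locally p_infty).

(** The [atan] mass outside the segment, so that [M * tails a b] bounds the truncation error of an
    integrand bounded by [M / (1 + v^2)]. *)
Definition tails (a b : R) : R := ((atan a + PI / 2) + (PI / 2 - atan b))%R.

Lemma one_plus_sqr_pos (v : R) : (0 < 1 + v * v)%R.
Proof. nra. Qed.

Lemma bdd_pos f M : bdd f M -> (0 <= M)%R.
Proof.
  intros B. specialize (B 0%R). generalize (Cmod_ge_0 (f 0%R)). intros P.
  replace (M / (1 + 0 * 0))%R with M in B by field. lra.
Qed.

Lemma RInt_majorant (M a b : R) :
  is_RInt (fun v => M / (1 + v * v))%R a b (M * (atan b - atan a))%R.
Proof.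
  replace (M * (atan b - atan a))%R with (M * atan b - M * atan a)%R by ring.
  apply (is_RInt_derive (V := R_CompleteNormedModule) (fun x => M * atan x)%R).
  - intros x _. auto_derive; auto. simpl. field. generalize (one_plus_sqr_pos x); lra.
  - intros x _. apply (ex_derive_continuous (V := R_NormedModule)). auto_derive.
    generalize (one_plus_sqr_pos x); lra.
Qed.

Lemma bdd_CInt f M a b : (a <= b)%R -> (forall t, ccts f t) -> bdd f M ->
  (Cmod (CInt f a b) <= M * (atan b - atan a))%R.
Proof.
  intros Hab F B. rewrite <- (is_RInt_unique _ _ _ _ (RInt_majorant M a b)).
  apply CInt_bound; auto. eexists; apply RInt_majorant.
Qed.

Lemma atan_le (x y : R) : (x <= y)%R -> (atan x <= atan y)%R.
Proof. intros [H| ->]; [left; apply atan_increasing; auto | right; auto]. Qed.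

Lemma atan_small (y : R) : (0 <= y)%R -> (atan y <= y)%R.
Proof.
  intros Hy.
  assert (P := is_RInt_le (fun v => 1 / (1 + v * v))%R (fun _ => 1%R) 0 y _ _ Hy
    (RInt_majorant 1 0 y) (is_RInt_const 0%R y 1%R)).
  rewrite atan_0 in P. unfold scal in P; simpl in P; unfold mult in P; simpl in P.
  assert (atan y <= y)%R; [|lra].
  enough (1 * (atan y - 0) <= (y - 0) * 1)%R by lra. apply P.
  intros x _. generalize (one_plus_sqr_pos x); intros.
  apply Rmult_le_reg_r with (1 + x * x)%R; auto. unfold Rdiv. rewrite Rmult_assoc, Rinv_l; nra.
Qed.

Lemma tails_pos a b : (0 <= tails a b)%R.
Proof. unfold tails. generalize (atan_bound a) (atan_bound b); lra. Qed.

Lemma tails_small (x : R) : (0 < x)%R -> (tails (- x) x <= 2 / x)%R.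
Proof.
  intros Hx. unfold tails. rewrite atan_opp.
  assert (P := Rinv_0_lt_compat _ Hx).
  generalize (atan_small (/ x) ltac:(lra)). rewrite atan_inv by auto. unfold Rdiv. lra.
Qed.

Lemma tails_lim (M eps : R) : (0 < eps)%R -> exists X : R, (0 < X)%R /\
  forall a b, (a <= - X)%R -> (X <= b)%R -> (M * tails a b <= eps)%R.
Proof.
  intros He. exists (2 * (Rabs M + 1) / eps)%R. assert (P := Rabs_pos M).
  assert (PX : (0 < 2 * (Rabs M + 1) / eps)%R) by (apply Rdiv_lt_0_compat; lra).
  split; auto. intros a b Ha Hb. set (X := (2 * (Rabs M + 1) / eps)%R) in *.
  assert (T : (tails a b <= 2 / X)%R).
  { eapply Rle_trans; [|apply tails_small; auto]. unfold tails.
    generalize (atan_le _ _ Ha) (atan_le _ _ Hb); lra. }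
  assert (E : ((Rabs M + 1) * (2 / X) = eps)%R) by (unfold X; field; lra).
  generalize (tails_pos a b) (Rle_abs M). intros. nra.
Qed.

Lemma CI_ex (f : R -> C) (M : R) : (forall t, ccts f t) -> bdd f M ->
  exists l : C, forall a b, (a <= b)%R -> (Cmod (l - CInt f a b) <= M * tails a b)%R.
Proof.
  intros F B.
  assert (Mp := bdd_pos f M B).
  assert (K : forall a b a' b', (a' <= a)%R -> (a <= b)%R -> (b <= b')%R ->
     (Cmod (CInt f a' b' - CInt f a b) <= M * tails a b)%R).
  { intros a b a' b' H1 H2 H3.
    rewrite <- (CInt_Chasles f a' a b'), <- (CInt_Chasles f a b b') by auto.
    replace (CInt f a' a + (CInt f a b + CInt f b b') - CInt f a b) with
      (CInt f a' a + CInt f b b') by ring.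
    eapply Rle_trans; [apply Cmod_triangle|].
    generalize (bdd_CInt f M a' a H1 F B) (bdd_CInt f M b b' H3 F B). unfold tails.
    generalize (atan_bound a') (atan_bound b'). intros. nra. }
  set (u := fun n : nat => CInt f (- INR n) (INR n)).
  assert (Cau : forall eps : posreal, exists N, forall n m, (N <= n)%nat -> (N <= m)%nat ->
     (Cmod (u n - u m) < eps)%R).
  { intros eps. destruct (tails_lim M (eps / 2)) as [X [PX HX]]; [generalize (cond_pos eps); lra|].
    destruct (INR_unbounded X) as [N HN]. exists N.
    assert (W : forall n m, (N <= n)%nat -> (n <= m)%nat -> (Cmod (u m - u n) <= eps / 2)%R).
    { intros n m Hn Hm. apply le_INR in Hn. apply le_INR in Hm.
      eapply Rle_trans; [apply (K (- INR n)%R (INR n) (- INR m)%R (INR m)) | apply HX]; lra. }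
    intros n m Hn Hm. destruct (Nat.le_ge_cases n m) as [L|L].
    - rewrite Cmod_sub_rev. generalize (W n m Hn L) (cond_pos eps); lra.
    - generalize (W m n Hm L) (cond_pos eps); lra. }
  assert (L1 : ex_finite_lim_seq (fun n => Re (u n))).
  { apply ex_lim_seq_cauchy_corr. intros eps. destruct (Cau eps) as [N H]. exists N.
    intros n m Hn Hm. eapply Rle_lt_trans; [|apply (H n m Hn Hm)].
    apply (re_le_Cmod (u n - u m)). }
  assert (L2 : ex_finite_lim_seq (fun n => Im (u n))).
  { apply ex_lim_seq_cauchy_corr. intros eps. destruct (Cau eps) as [N H]. exists N.
    intros n m Hn Hm. eapply Rle_lt_trans; [|apply (H n m Hn Hm)].
    apply (im_le_Cmod (u n - u m)). }
  destruct L1 as [l1 L1]. destruct L2 as [l2 L2].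
  exists (l1, l2). intros a b Hab. apply le_epsilon. intros eps He.
  apply is_lim_seq_Reals in L1, L2.
  destruct (L1 (eps / 2)%R) as [N1 H1]; [lra|]. destruct (L2 (eps / 2)%R) as [N2 H2]; [lra|].
  destruct (INR_unbounded (Rmax (- a) b)) as [N3 H3].
  set (n := (N1 + N2 + N3)%nat).
  specialize (H1 n ltac:(lia)). specialize (H2 n ltac:(lia)).
  assert (N3n : (INR N3 <= INR n)%R) by (apply le_INR; lia).
  assert (Q := K a b (- INR n)%R (INR n)
     ltac:(generalize (Rmax_l (- a) b); lra) Hab ltac:(generalize (Rmax_r (- a) b); lra)).
  fold (u n) in Q.
  replace ((l1, l2) - CInt f a b) with (((l1, l2) - u n) + (u n - CInt f a b)) by ring.
  eapply Rle_trans; [apply Cmod_triangle|].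
  assert (Cmod ((l1, l2) - u n) <= eps)%R; [|lra].
  eapply Rle_trans; [apply Cmod_le_sum|].
  unfold Rdist in H1, H2. rewrite Rabs_minus_sym in H1, H2.
  unfold Re, Im in *; simpl in *. unfold Rminus in *. lra.
Qed.

Lemma is_RInt_gen_of_tail (f : R -> C) (M : R) (l : C) : (forall t, ccts f t) ->
  (forall a b, (a <= b)%R -> (Cmod (l - CInt f a b) <= M * tails a b)%R) ->
  is_RInt_gen (V := C_R_NormedModule) f (Rbar_locally m_infty) (Rbar_locally p_infty) l.
Proof.
  intros F H P [eps HP].
  destruct (tails_lim M (eps / 2)) as [X [PX HX]]; [generalize (cond_pos eps); lra|].
  apply Filter_prod with (fun a => (a < - X)%R) (fun b => (X < b)%R).
  - exists (- X)%R. auto.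
  - exists X. auto.
  - intros a b Ha Hb. exists (CInt f a b). split.
    + simpl. apply CInt_correct; auto.
    + apply HP.
      assert (Q : (Cmod (CInt f a b - l) < eps)%R).
      { rewrite Cmod_sub_rev. eapply Rle_lt_trans; [apply H; lra|].
        eapply Rle_lt_trans; [apply HX; lra|]. generalize (cond_pos eps); lra. }
      split.
      * apply Rle_lt_trans with (2 := Q). apply (re_le_Cmod (CInt f a b - l)).
      * apply Rle_lt_trans with (2 := Q). apply (im_le_Cmod (CInt f a b - l)).
Qed.

(** The integral does not depend on how its two ends go to infinity, and it is approximated on
    every segment with an explicit error. *)
Lemma CI_spec (f : R -> C) : intg f ->
  is_RInt_gen (V := C_R_NormedModule) f (Rbar_locally m_infty) (Rbar_locally p_infty) (CI f) /\
  forall M, bdd f M -> forall a b, (a <= b)%R -> (Cmod (CI f - CInt f a b) <= M * tails a b)%R.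
Proof.
  intros [F [M0 B0]].
  assert (E : forall l M, (forall a b, (a <= b)%R -> (Cmod (l - CInt f a b) <= M * tails a b)%R) ->
     CI f = l).
  { intros l M H.
    exact (@is_RInt_gen_unique C_R_CompleteNormedModule (Rbar_locally m_infty) (Rbar_locally p_infty)
      (Proper_StrongProper _ (Rbar_locally_filter m_infty)) (Proper_StrongProper _ (Rbar_locally_filter p_infty))
      f l (is_RInt_gen_of_tail f M l F H)). }
  split.
  - destruct (CI_ex f M0 F B0) as [l Hl]. rewrite (E _ _ Hl).
    apply (is_RInt_gen_of_tail f M0 l); auto.
  - intros M B. destruct (CI_ex f M F B) as [l Hl]. rewrite (E _ _ Hl). auto.
Qed.

Lemma CI_eq (f : R -> C) (l : C) : intg f ->
  (forall eps, (0 < eps)%R -> exists X, forall x, (X <= x)%R ->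
     (Cmod (l - CInt f (- x) x) <= eps)%R) -> CI f = l.
Proof.
  intros I H. destruct (CI_spec f I) as [_ T]. destruct I as [F [M B]]. specialize (T M B).
  assert (Z : (Cmod (CI f - l) <= 0)%R).
  { apply le_epsilon. intros eps He.
    destruct (H (eps / 2)%R) as [X HX]; [lra|].
    destruct (tails_lim M (eps / 2)) as [Y [PY HY]]; [lra|].
    set (x := Rmax X Y).
    specialize (HX x (Rmax_l _ _)).
    assert (Yx : (Y <= x)%R) by apply Rmax_r.
    specialize (T (- x)%R x ltac:(lra)). specialize (HY (- x)%R x ltac:(lra) Yx).
    replace (CI f - l) with ((CI f - CInt f (- x) x) + - (l - CInt f (- x) x)) by ring.
    eapply Rle_trans; [apply Cmod_triangle|]. rewrite Cmod_opp. lra. }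
  assert (Z2 : CI f - l = 0) by (apply Cmod_eq_0; generalize (Cmod_ge_0 (CI f - l)); lra).
  replace (CI f) with (CI f - l + l) by ring. rewrite Z2. ring.
Qed.

Lemma CI_lim (f : R -> C) : intg f -> forall eps, (0 < eps)%R ->
  exists X, (0 < X)%R /\ forall x, (X <= x)%R -> (Cmod (CI f - CInt f (- x) x) <= eps)%R.
Proof.
  intros I eps He. destruct (CI_spec f I) as [_ T]. destruct I as [F [M B]].
  destruct (tails_lim M eps He) as [Y [PY HY]]. exists Y. split; auto. intros x Hx.
  eapply Rle_trans; [apply (T M B); lra | apply HY; lra].
Qed.

Lemma bdd_plus f g M N : bdd f M -> bdd g N -> bdd (fun v => f v + g v) (M + N).
Proof.
  intros A B v. eapply Rle_trans; [apply Cmod_triangle|]. specialize (A v). specialize (B v).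
  unfold Rdiv in *. lra.
Qed.

Lemma intg_plus f g : intg f -> intg g -> intg (fun v => f v + g v).
Proof.
  intros [F [M A]] [G [N B]]. split.
  - intros; apply ccts_plus; auto.
  - exists (M + N)%R. apply bdd_plus; auto.
Qed.

Lemma intg_scal c f : intg f -> intg (fun v => c * f v).
Proof.
  intros [F [M A]]. split.
  - intros; apply ccts_mult; auto using ccts_const.
  - exists (Cmod c * M)%R. intros v. rewrite Cmod_mult. unfold Rdiv. rewrite Rmult_assoc.
    apply Rmult_le_compat_l; [apply Cmod_ge_0 | apply A].
Qed.

Lemma intg_ext f g : (forall v, f v = g v) -> intg f -> intg g.
Proof.
  intros E [F [M A]]. split.
  - intros; eapply ccts_ext; [|apply F]; auto.
  - exists M. intros v. rewrite <- E. apply A.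
Qed.

Lemma CI_ext f g : (forall v, f v = g v) -> CI f = CI g.
Proof.
  intros E. f_equal. apply FunctionalExtensionality.functional_extensionality; auto.
Qed.

Lemma CI_plus f g : intg f -> intg g -> CI (fun v => f v + g v) = CI f + CI g.
Proof.
  intros I J. apply CI_eq; [apply intg_plus; auto|]. intros eps He.
  destruct (CI_lim f I (eps / 2)) as [X [_ HX]]; [lra|].
  destruct (CI_lim g J (eps / 2)) as [Y [_ HY]]; [lra|].
  exists (Rmax X Y). intros x Hx.
  specialize (HX x (Rle_trans _ _ _ (Rmax_l _ _) Hx)).
  specialize (HY x (Rle_trans _ _ _ (Rmax_r _ _) Hx)).
  rewrite CInt_plus by (apply I || apply J).
  replace (CI f + CI g - (CInt f (- x) x + CInt g (- x) x)) with
    ((CI f - CInt f (- x) x) + (CI g - CInt g (- x) x)) by ring.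
  eapply Rle_trans; [apply Cmod_triangle|]. lra.
Qed.

Lemma CI_scal c f : intg f -> CI (fun v => c * f v) = c * CI f.
Proof.
  intros I. apply CI_eq; [apply intg_scal; auto|]. intros eps He.
  assert (P := Cmod_ge_0 c).
  destruct (CI_lim f I (eps / (Cmod c + 1))) as [X [_ HX]]; [apply Rdiv_lt_0_compat; lra|].
  exists X. intros x Hx. specialize (HX x Hx). rewrite CInt_scal by apply I.
  replace (c * CI f - c * CInt f (- x) x) with (c * (CI f - CInt f (- x) x)) by ring.
  rewrite Cmod_mult.
  apply Rle_trans with ((Cmod c + 1) * (eps / (Cmod c + 1)))%R; [|right; field; lra].
  apply Rmult_le_compat; auto using Cmod_ge_0. lra.
Qed.

Lemma intg_minus f g : intg f -> intg g -> intg (fun v => f v - g v).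
Proof.
  intros I J. apply intg_ext with (fun v => f v + - (1) * g v); [intros; ring|].
  apply intg_plus; auto. apply intg_scal; auto.
Qed.

Lemma CI_minus f g : intg f -> intg g -> CI (fun v => f v - g v) = CI f - CI g.
Proof.
  intros I J. rewrite (CI_ext _ (fun v => f v + - (1) * g v)) by (intros; ring).
  rewrite CI_plus, CI_scal; auto; [ring|]. apply intg_scal; auto.
Qed.

Lemma CI_bound f M : (forall t, ccts f t) -> bdd f M -> (Cmod (CI f) <= PI * M)%R.
Proof.
  intros F B. destruct (CI_spec f (conj F (ex_intro _ M B))) as [_ T].
  specialize (T M B 0%R 0%R (Rle_refl _)).
  unfold tails in T. rewrite atan_0 in T.
  assert (Z : CInt f 0 0 = RtoC 0) by (apply (RInt_point (V := C_R_CompleteNormedModule))).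
  rewrite Z in T. replace (CI f - 0) with (CI f) in T by ring. lra.
Qed.

Lemma CI_FTC (g g' : R -> C) (l1 l2 : C) : (forall t, RD g t (g' t)) -> intg g' ->
  (forall eps, (0 < eps)%R -> exists X, forall x, (X <= x)%R ->
     (Cmod (g x - l2) <= eps)%R /\ (Cmod (g (- x)%R - l1) <= eps)%R) ->
  CI g' = l2 - l1.
Proof.
  intros D I L. apply CI_eq; auto. intros eps He.
  destruct (L (eps / 2)%R) as [X HX]; [lra|]. exists X. intros x Hx.
  destruct (HX x Hx) as [A B].
  rewrite (CInt_FTC g g') by (auto; apply I).
  replace (l2 - l1 - (g x - g (- x)%R)) with (- (g x - l2) + (g (- x)%R - l1)) by ring.
  eapply Rle_trans; [apply Cmod_triangle|]. rewrite Cmod_opp. lra.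
Qed.

Lemma bdd_vanish (g : R -> C) (M : R) : bdd g M ->
  forall eps, (0 < eps)%R -> exists X, forall x, (X <= x)%R ->
     (Cmod (g x - 0) <= eps)%R /\ (Cmod (g (- x)%R - 0) <= eps)%R.
Proof.
  intros B eps He. assert (Mp := bdd_pos g M B).
  exists (M / eps + 1)%R. intros x Hx.
  assert (P : (0 <= M / eps)%R) by (apply Rmult_le_pos; [auto | left; apply Rinv_0_lt_compat; auto]).
  assert (Q : (M / (1 + x * x) <= eps)%R).
  { apply Rmult_le_reg_r with (1 + x * x)%R; [nra|].
    unfold Rdiv. rewrite Rmult_assoc, Rinv_l, Rmult_1_r by nra.
    apply Rmult_le_compat_l with (r := eps) in Hx; [|lra].
    replace (eps * (M / eps + 1))%R with (M + eps)%R in Hx by (field; lra). nra. }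
  split; (replace (g x - 0) with (g x) by ring); (replace (g (- x)%R - 0) with (g (- x)%R) by ring).
  - eapply Rle_trans; [apply B|]. exact Q.
  - eapply Rle_trans; [apply B|]. replace (- x * - x)%R with (x * x)%R by ring. exact Q.
Qed.

Lemma CI_FTC0 (g g' : R -> C) (M : R) : (forall t, RD g t (g' t)) -> intg g' -> bdd g M ->
  CI g' = 0.
Proof.
  intros D I B. rewrite (CI_FTC g g' 0 0 D I); [ring|]. apply bdd_vanish with M; auto.
Qed.

Lemma bdd_shift_factor (v c : R) : (/ (1 + (v + c) * (v + c)) <= 2 * (1 + c * c) / (1 + v * v))%R.
Proof.
  apply Rmult_le_reg_r with ((1 + v * v) * (1 + (v + c) * (v + c)))%R; [apply Rmult_lt_0_compat; apply one_plus_sqr_pos|].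
  replace (/ (1 + (v + c) * (v + c)) * ((1 + v * v) * (1 + (v + c) * (v + c))))%R with (1 + v * v)%R
    by (field; repeat split; apply Rgt_not_eq, one_plus_sqr_pos).
  replace (2 * (1 + c * c) / (1 + v * v) * ((1 + v * v) * (1 + (v + c) * (v + c))))%R
    with (2 * (1 + c * c) * (1 + (v + c) * (v + c)))%R by (field; repeat split; apply Rgt_not_eq, one_plus_sqr_pos).
  assert (0 <= (v + 2 * c) * (v + 2 * c))%R by apply Rle_0_sqr.
  assert (0 <= c * c * ((v + c) * (v + c)))%R by (apply Rmult_le_pos; apply Rle_0_sqr). nra.
Qed.

Lemma intg_shift f (c : R) : intg f -> intg (fun v => f (v + c)%R).
Proof.
  intros [F [M B]]. split.
  - intros t. destruct (F (t + c)%R) as [A A']. split.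
    + apply (continuous_comp (fun v => v + c)%R (fun v => Re (f v))); auto.
      apply (continuous_plus (V := R_NormedModule) (fun v => v) (fun _ => c));
      [apply continuous_id | apply continuous_const].
    + apply (continuous_comp (fun v => v + c)%R (fun v => Im (f v))); auto.
      apply (continuous_plus (V := R_NormedModule) (fun v => v) (fun _ => c));
      [apply continuous_id | apply continuous_const].
  - exists (M * (2 * (1 + c * c)))%R. intros v. eapply Rle_trans; [apply B|].
    unfold Rdiv. rewrite Rmult_assoc. apply Rmult_le_compat_l; [apply (bdd_pos f M B)|].
    apply bdd_shift_factor.
Qed.

Lemma CI_shift f (c : R) : intg f -> CI (fun v => f (v + c)%R) = CI f.
Proof.
  intros I. apply CI_eq; [apply intg_shift; auto|]. intros eps He.
  destruct (CI_spec f I) as [_ T]. destruct (I) as [F [M B]].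
  destruct (tails_lim M eps He) as [Y [PY HY]]. exists (Y + Rabs c)%R. intros x Hx.
  replace (CInt (fun v => f (v + c)%R) (- x) x) with (CInt f (- x + c) (x + c)).
  - apply Rle_trans with (M * tails (- x + c) (x + c))%R.
    + apply (T M B). generalize (Rabs_pos c). lra.
    + generalize (Rle_abs c) (Rle_abs (- c)). rewrite Rabs_Ropp. intros. apply HY; lra.
  - symmetry. apply CInt_unique.
    apply (is_RInt_ext (V := C_R_NormedModule) (fun y => scal 1 (f (1 * y + c)%R))).
    + intros y _. rewrite Rmult_1_l. apply (scal_one (V := C_R_NormedModule)).
    + apply (is_RInt_comp_lin (V := C_R_NormedModule) f 1 c (- x) x).
      rewrite !Rmult_1_l. apply CInt_correct; auto.
Qed.

(** Dominated convergence: the tails are uniformly small, and the integral over a large segment is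
    continuous in the parameter. *)
Lemma ccts_CI_param (f : R -> R -> C) (M x : R) (d : R) : (0 < d)%R -> (forall u v, ccts2 f u v) ->
  (forall u, (Rabs (u - x) < d)%R -> bdd (f u) M) -> ccts (fun u => CI (f u)) x.
Proof.
  intros Hd F B. apply ccts_eps. intros eps He.
  destruct (tails_lim M (eps / 4)) as [Y [PY HY]]; [lra|].
  assert (G := ccts_CInt_param f (- Y) Y x F). rewrite ccts_eps in G.
  assert (D : locally x (fun u => (Rabs (u - x) < d)%R)).
  { exists (mkposreal d Hd). intros y Hy. exact Hy. }
  generalize (filter_and _ _ D (G (eps / 4)%R ltac:(lra))). apply filter_imp.
  intros u [Hu Hg].
  assert (I : forall u, (Rabs (u - x) < d)%R -> (Cmod (CI (f u) - CInt (f u) (- Y) Y) <= eps / 4)%R).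
  { intros u' Hu'. destruct (CI_spec (f u')) as [_ T].
    - split; [intros t; apply (ccts2_slice f); auto | exists M; auto].
    - eapply Rle_trans; [apply (T M); auto; lra | apply HY; lra]. }
  assert (I1 := I u Hu). assert (I2 := I x ltac:(rewrite Rminus_diag, Rabs_R0; auto)).
  replace (CI (f u) - CI (f x)) with ((CI (f u) - CInt (f u) (- Y) Y) +
    ((CInt (f u) (- Y) Y - CInt (f x) (- Y) Y) + - (CI (f x) - CInt (f x) (- Y) Y))) by ring.
  eapply Rle_lt_trans; [apply Cmod_triangle|].
  eapply Rle_lt_trans; [apply Rplus_le_compat_l, Cmod_triangle|]. rewrite Cmod_opp.
  change (Cmod (CInt (f u) (- Y) Y - CInt (f x) (- Y) Y) < eps / 4)%R in Hg. lra.
Qed.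

Lemma CI_Fubini (f : R -> R -> C) (M : R) : (forall u v, ccts2 f u v) ->
  (forall u v, (Cmod (f u v) <= M / ((1 + u * u) * (1 + v * v)))%R) ->
  CI (fun u => CI (fun v => f u v)) = CI (fun v => CI (fun u => f u v)).
Proof.
  intros F B.
  assert (Fs : forall u v, ccts2 (fun v u => f u v) u v).
  { intros u v. destruct (F v u) as [A A'].
    split; intros P HP; [specialize (A P HP) as [e H] | specialize (A' P HP) as [e H]];
    exists e; intros [y1 y2] [Y1 Y2]; apply (H (y2, y1)); split; auto. }
  assert (Mp : (0 <= M)%R).
  { generalize (B 0%R 0%R) (Cmod_ge_0 (f 0%R 0%R)).
    replace (M / ((1 + 0 * 0) * (1 + 0 * 0)))%R with M by field. lra. }
  assert (B1 : forall u, bdd (f u) (M / (1 + u * u))).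
  { intros u v. eapply Rle_trans; [apply B|]. right. field.
    generalize (one_plus_sqr_pos u) (one_plus_sqr_pos v); lra. }
  assert (B2 : forall v, bdd (fun u => f u v) (M / (1 + v * v))).
  { intros v u. eapply Rle_trans; [apply B|]. right. field.
    generalize (one_plus_sqr_pos u) (one_plus_sqr_pos v); lra. }
  assert (Mb : forall u, (M / (1 + u * u) <= M)%R).
  { intros u. generalize (one_plus_sqr_pos u); intros.
    apply Rmult_le_reg_r with (1 + u * u)%R; auto. unfold Rdiv.
    rewrite Rmult_assoc, Rinv_l by lra. nra. }
  assert (C1 : forall x, ccts (fun u => CI (f u)) x).
  { intros x. apply ccts_CI_param with M 1%R; auto; [lra|].
    intros u _ v. eapply Rle_trans; [apply B1|].
    apply Rmult_le_compat_r; auto. left; apply Rinv_0_lt_compat, one_plus_sqr_pos. }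
  assert (C2 : forall x, ccts (fun v => CI (fun u => f u v)) x).
  { intros x. apply (ccts_CI_param (fun v u => f u v)) with M 1%R; auto; [lra|].
    intros u _ v. eapply Rle_trans; [apply (B2 u)|].
    apply Rmult_le_compat_r; auto. left; apply Rinv_0_lt_compat, one_plus_sqr_pos. }
  assert (I1 : intg (fun u => CI (f u))).
  { split; [exact C1|]. exists (PI * M)%R. intros u.
    eapply Rle_trans; [apply CI_bound; [|apply B1]|]; [intros; apply (ccts2_slice f); auto|].
    right; unfold Rdiv; ring. }
  assert (I2 : intg (fun v => CI (fun u => f u v))).
  { split; [exact C2|]. exists (PI * M)%R. intros v.
    eapply Rle_trans; [apply CI_bound; [|apply B2]|]; [intros; apply (ccts2_slice' f); auto|].
    right; unfold Rdiv; ring. }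
  (* both sides are within [eps] of the integral over a large square *)
  assert (W : forall g : R -> R -> C, (forall u v, ccts2 g u v) ->
      (forall u, bdd (g u) (M / (1 + u * u))) ->
      intg (fun u => CI (g u)) -> forall x, (0 < x)%R ->
      (Cmod (CInt (fun u => CI (g u)) (- x) x -
             CInt (fun u => CInt (fun v => g u v) (- x) x) (- x) x) <= M * PI * tails (- x) x)%R).
  { intros g G Bg Ig x Hx.
    assert (cg : forall t, ccts (fun u => CInt (fun v => g u v) (- x) x) t)
      by (intros; apply ccts_CInt_param; auto).
    assert (E : CInt (fun u => CI (g u)) (- x) x - CInt (fun u => CInt (fun v => g u v) (- x) x) (- x) x
       = CInt (fun u => CI (g u) + - (1) * CInt (fun v => g u v) (- x) x) (- x) x).
    { rewrite CInt_plus, CInt_scal; [ring | exact cg | apply Ig |].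
      intros; apply ccts_mult; [apply ccts_const | apply cg]. }
    rewrite E. assert (T0 := tails_pos (- x) x).
    apply Rle_trans with (M * tails (- x) x * (atan x - atan (- x)))%R.
    - apply bdd_CInt; [lra| |].
      + intros t. apply ccts_plus; [apply Ig|]. apply ccts_mult; auto using ccts_const.
      + intros u. replace (CI (g u) + - (1) * CInt (fun v => g u v) (- x) x) with
          (CI (g u) - CInt (fun v => g u v) (- x) x) by ring.
        destruct (CI_spec (g u)) as [_ T].
        * split; [intros; apply (ccts2_slice g); auto | eexists; apply Bg].
        * eapply Rle_trans; [apply (T _ (Bg u)); lra|]. right. unfold Rdiv; ring.
    - generalize (atan_bound x) (atan_bound (- x)); intros.
      replace (M * PI * tails (- x) x)%R with (M * tails (- x) x * PI)%R by ring.
      apply Rmult_le_compat_l; [apply Rmult_le_pos; auto | lra]. }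
  apply CI_eq; [exact I1|]. intros eps He.
  destruct (tails_lim (M * PI) (eps / 3)) as [X [PX HX]]; [lra|].
  destruct (CI_lim _ I2 (eps / 3)) as [Y [_ HY]]; [lra|].
  exists (Rmax X Y). intros x Hx.
  assert (xX := Rle_trans _ _ _ (Rmax_l _ _) Hx).
  specialize (HY x (Rle_trans _ _ _ (Rmax_r _ _) Hx)).
  specialize (HX (- x)%R x ltac:(lra) xX).
  assert (W1 := W f F B1 I1 x ltac:(lra)).
  assert (W2 := W (fun v u => f u v) Fs B2 I2 x ltac:(lra)).
  rewrite (CInt_Fubini f) in W1 by auto. simpl in W1, W2.
  set (S := CInt (fun v => CInt (fun u => f u v) (- x) x) (- x) x) in *.
  set (A := CInt (fun u => CI (fun v => f u v)) (- x) x) in *.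
  set (A2 := CInt (fun v => CI (fun u => f u v)) (- x) x) in *.
  change (CInt (fun u => CI (f u)) (- x) x) with A in W1.
  replace (CI (fun v => CI (fun u => f u v)) - A) with
    ((CI (fun v => CI (fun u => f u v)) - A2) + ((A2 - S) + - (A - S))) by ring.
  eapply Rle_trans; [apply Cmod_triangle|].
  eapply Rle_trans; [apply Rplus_le_compat_l, Cmod_triangle|]. rewrite Cmod_opp. lra.
Qed.

(** * Horizontal contours and exponential transforms *)

Lemma pair_C (v th : R) : (v, th) = RtoC v + th * Ci.
Proof. apply C_eq; simpl; ring. Qed.

Lemma RD_horizontal f (v th : R) l : CD f (v, th) l -> RD (fun x : R => f (x, th)) v l.
Proof.
  intros D. eapply RD_ext; [|eapply RD_eq; [apply (CD_RD_line f (th * Ci) 1 v l)|]].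
  - intros x; simpl. f_equal. rewrite pair_C. ring.
  - replace (th * Ci + v * 1) with ((v, th) : C); auto. rewrite pair_C; ring.
  - ring.
Qed.

Lemma RD_vertical f (v th : R) l : CD f (v, th) l -> RD (fun x : R => f (v, x)) th (Ci * l).
Proof.
  intros D. eapply RD_ext; [|eapply RD_eq; [apply (CD_RD_line f v Ci th l)|]].
  - intros x; simpl. f_equal. rewrite pair_C. ring.
  - rewrite <- pair_C. auto.
  - ring.
Qed.

Definition clamp (a b x : R) : R := Rmax a (Rmin b x).

Lemma clamp_in a b x : (a <= b)%R -> (a <= clamp a b x <= b)%R.
Proof. intros. unfold clamp. split; [apply Rmax_l|]. apply Rmax_lub; auto. apply Rmin_l. Qed.

Lemma clamp_id a b x : (a <= x <= b)%R -> clamp a b x = x.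
Proof. intros. unfold clamp. rewrite Rmin_right, Rmax_right; lra. Qed.

Lemma continuous_clamp a b x : continuous (clamp a b) x.
Proof.
  apply continuous_R_eps. intros eps He. exists (mkposreal eps He). intros y Hy.
  change (Rabs (y - x) < eps)%R in Hy. eapply Rle_lt_trans; [|exact Hy].
  unfold clamp, Rmax, Rmin. repeat destruct Rle_dec; apply Rabs_le_between';
  generalize (Rle_abs (y - x)) (Rle_abs (- (y - x))); rewrite ?Rabs_Ropp; intros; try lra.
Qed.

(** Cauchy's theorem for a horizontal strip: the difference of the integrals over the two lines
    is, on a long rectangle, the double integral of a derivative, and the vertical sides
    contribute [O(1 / x^2)]. *)
Lemma CI_contour_le (f f' : C -> C) (a b M : R) : (a <= b)%R ->
  (forall v th : R, (a <= th <= b)%R -> CD f (v, th) (f' (v, th))) ->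
  (forall v th : R, (a <= th <= b)%R -> @ccts C_UniformSpace f' (v, th)) ->
  (forall th, (a <= th <= b)%R -> bdd (fun v => f (v, th)) M) ->
  CI (fun v => f (v, a)) = CI (fun v => f (v, b)).
Proof.
  intros Hab D F' B.
  assert (cf : forall th, (a <= th <= b)%R -> forall t, ccts (fun v => f (v, th)) t).
  { intros th Hth t. eapply RD_ccts. apply RD_horizontal, D; auto. }
  assert (I : forall th, (a <= th <= b)%R -> intg (fun v => f (v, th))).
  { intros th Hth. split; auto. exists M; auto. }
  assert (Mp := bdd_pos _ _ (B a ltac:(lra))).
  (* [clamp] extends the derivative continuously outside the strip *)
  set (F := fun v th : R => Ci * f' (v, clamp a b th)).
  assert (F2 : forall v th, ccts2 F v th).
  { intros v th. unfold ccts2, F. simpl. apply ccts_mult; [apply ccts_const|].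
    apply (ccts_comp_C f' (fun p : R * R => ((fst p, clamp a b (snd p)) : C))).
    - simpl. apply F', clamp_in; auto.
    - split; simpl; [apply continuous_fst|].
      apply (continuous_comp (snd : R * R -> R) (clamp a b)); [apply continuous_snd|].
      apply continuous_clamp. }
  apply CI_eq; [apply I; lra|]. intros eps He.
  destruct (CI_lim _ (I b ltac:(lra)) (eps / 2)) as [X [PX HX]]; [lra|].
  exists (Rmax X (2 * (b - a) * M * 2 / eps + 1)). intros x Hx.
  specialize (HX x (Rle_trans _ _ _ (Rmax_l _ _) Hx)).
  assert (Hx2 := Rle_trans _ _ _ (Rmax_r _ _) Hx).
  assert (Hx1 : (1 <= x)%R).
  { assert (0 <= 2 * (b - a) * M * 2 / eps)%R; [|lra].
    apply Rmult_le_pos; [nra | left; apply Rinv_0_lt_compat; auto]. }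
  assert (E1 : CInt (fun v => CInt (fun th => F v th) a b) (- x) x =
     CInt (fun v => f (v, b)) (- x) x - CInt (fun v => f (v, a)) (- x) x).
  { transitivity (CInt (fun v => f (v, b) + - (1) * f (v, a)) (- x) x).
    - apply CInt_ext. intros v.
      rewrite (CInt_FTC (fun th => f (v, th)) (fun th => F v th)).
      + Cring.
      + rewrite Rmin_left, Rmax_right by auto. intros t Ht. unfold F. rewrite clamp_id by auto.
        apply RD_vertical, D; auto.
      + intros t. apply (ccts2_slice F); auto.
    - assert (ca : forall v, ccts (fun v => f (v, a)) v) by (intros; apply cf; lra).
      rewrite CInt_plus; [rewrite CInt_scal; [Cring | exact ca] | intros; apply cf; lra|].
      intros; apply ccts_mult; [apply ccts_const | apply ca]. }
  assert (E2 : (Cmod (CInt (fun v => CInt (fun th => F v th) a b) (- x) x) <=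
     (b - a) * (2 * M / (1 + x * x)))%R).
  { rewrite (CInt_Fubini F) by auto.
    apply CInt_bound_const; auto.
    - intros t. apply (ccts_CInt_param (fun th v => F v th)).
      intros u v. destruct (F2 v u) as [A A'].
      split; intros P HP; [specialize (A P HP) as [e H] | specialize (A' P HP) as [e H]];
      exists e; intros [y1 y2] [Y1 Y2]; apply (H (y2, y1)); split; auto.
    - intros th Hth.
      rewrite (CInt_FTC (fun v => Ci * f (v, th)) (fun v => F v th)).
      + replace (Ci * f (x, th) - Ci * f ((- x)%R, th)) with
          (Ci * (f (x, th) + - f ((- x)%R, th))) by ring.
        rewrite Cmod_mult, Cmod_Ci, Rmult_1_l.
        eapply Rle_trans; [apply Cmod_triangle|]. rewrite Cmod_opp.
        assert (b1 := B th Hth x). assert (b2 := B th Hth (- x)%R). simpl in b1, b2.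
        replace (- x * - x)%R with (x * x)%R in b2 by ring. unfold Rdiv in *. lra.
      + intros t _. unfold F. rewrite clamp_id by auto. apply RD_scal.
        apply RD_horizontal, D; auto.
      + intros t. apply (ccts2_slice' F); auto. }
  rewrite E1 in E2.
  assert (E3 : ((b - a) * (2 * M / (1 + x * x)) <= eps / 2)%R).
  { apply Rmult_le_reg_r with (1 + x * x)%R; [nra|].
    replace ((b - a) * (2 * M / (1 + x * x)) * (1 + x * x))%R with ((b - a) * (2 * M))%R by (field; apply Rgt_not_eq, one_plus_sqr_pos).
    apply Rmult_le_compat_l with (r := eps) in Hx2; [|lra].
    replace (eps * (2 * (b - a) * M * 2 / eps + 1))%R with (2 * (b - a) * M * 2 + eps)%R in Hx2 by (field; lra).
    assert (eps * x <= eps * (x * x))%R by (apply Rmult_le_compat_l; nra). lra. }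
  set (Ia := CInt (fun v => f (v, a)) (- x) x) in *.
  set (Ib := CInt (fun v => f (v, b)) (- x) x) in *.
  replace (CI (fun v => f (v, b)) - Ia) with ((CI (fun v => f (v, b)) - Ib) + (Ib - Ia)) by ring.
  eapply Rle_trans; [apply Cmod_triangle|]. lra.
Qed.

Lemma CI_contour (f f' : C -> C) (a b M : R) :
  (forall v th : R, (Rmin a b <= th <= Rmax a b)%R -> CD f (v, th) (f' (v, th))) ->
  (forall v th : R, (Rmin a b <= th <= Rmax a b)%R -> @ccts C_UniformSpace f' (v, th)) ->
  (forall th, (Rmin a b <= th <= Rmax a b)%R -> bdd (fun v => f (v, th)) M) ->
  CI (fun v => f (v, a)) = CI (fun v => f (v, b)).
Proof.
  intros D F B. destruct (Rle_dec a b) as [H|H].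
  - rewrite Rmin_left, Rmax_right in * by auto. apply CI_contour_le with f' M; auto.
  - rewrite Rmin_right, Rmax_left in * by lra. symmetry. apply CI_contour_le with f' M; auto. lra.
Qed.

(** Gamma functions and all the confluent integrals below are values of one exponential
    transform, which is therefore differentiated once and for all. *)
Definition ET (k : R -> R) (h : R -> C) (z : C) : C :=
  CI (fun v => Cexp (- (z * k v)) * h v).

(** Convergence of the transform and of its derivative for [|Re z - x| <= r]; the factor [1 + k^2]
    pays for the quadratic remainder of the exponential. *)
Definition ET_dom (k : R -> R) (h : R -> C) (x r M : R) : Prop :=
  (forall v, continuous k v) /\ (forall v, ccts h v) /\
  forall v, ((1 + k v * k v) * exp (r * Rabs (k v) - x * k v) * Cmod (h v) <= M / (1 + v * v))%R.

Lemma ET_ccts (k : R -> R) (h : R -> C) (z : C) :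
  (forall v, continuous k v) -> (forall v, ccts h v) ->
  forall v, ccts (fun v : R => Cexp (- (z * k v)) * h v) v.
Proof.
  intros K H v. apply ccts_mult; auto. apply ccts_Cexp, ccts_opp, ccts_mult; [apply ccts_const|].
  apply ccts_RtoC; auto.
Qed.

Lemma Cmod_ET (k : R -> R) (z : C) (v : R) : Cmod (Cexp (- (z * RtoC (k v)))) = exp (- (Re z * k v)).
Proof. rewrite Cmod_Cexp. f_equal. unfold Re; simpl. ring. Qed.

Lemma ET_dom_le k h x r M : (0 <= r)%R -> ET_dom k h x r M ->
  forall y v, (Rabs (y - x) <= r)%R ->
  ((1 + k v * k v) * exp (- (y * k v)) * Cmod (h v) <= M / (1 + v * v))%R.
Proof.
  intros Hr [_ [_ B]] y v Hy. eapply Rle_trans; [|apply (B v)].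
  apply Rmult_le_compat_r; [apply Cmod_ge_0|]. apply Rmult_le_compat_l; [nra|].
  apply exp_le.
  assert (P := Rle_abs ((x - y) * k v)). rewrite Rabs_mult, Rabs_minus_sym in P.
  assert (Rabs (y - x) * Rabs (k v) <= r * Rabs (k v))%R by (apply Rmult_le_compat_r; auto using Rabs_pos).
  lra.
Qed.

Lemma ET_intg k h x r M z : (0 <= r)%R -> ET_dom k h x r M -> (Rabs (Re z - x) <= r)%R ->
  intg (fun v => Cexp (- (z * k v)) * h v) /\
  intg (fun v => Cexp (- (z * k v)) * (k v * h v)).
Proof.
  intros Hr Dm Hz. destruct (Dm) as [K [H B]].
  assert (N : forall v, (0 <= exp (- (Re z * k v)) * Cmod (h v))%R).
  { intros v. apply Rmult_le_pos; [left; apply exp_pos | apply Cmod_ge_0]. }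
  split; split.
  - apply ET_ccts; auto.
  - exists M. intros v. eapply Rle_trans; [|apply (ET_dom_le k h x r M Hr Dm (Re z) v Hz)].
    rewrite Cmod_mult, Cmod_ET. specialize (N v). assert (0 <= k v * k v)%R by apply Rle_0_sqr. nra.
  - apply ET_ccts; auto. intros; apply ccts_mult; auto. apply ccts_RtoC; auto.
  - exists M. intros v. eapply Rle_trans; [|apply (ET_dom_le k h x r M Hr Dm (Re z) v Hz)].
    rewrite !Cmod_mult, Cmod_ET, Cmod_R. specialize (N v).
    assert (Rabs (k v) <= 1 + k v * k v)%R.
    { assert (0 <= (k v - 1) * (k v - 1))%R by apply Rle_0_sqr.
      assert (0 <= (k v + 1) * (k v + 1))%R by apply Rle_0_sqr.
      apply Rabs_le. nra. }
    nra.
Qed.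

(** Differentiation under the integral sign, by the quadratic remainder of the exponential. *)
Lemma ET_CD k h x r M z : (0 < r)%R -> ET_dom k h x r M -> Re z = x ->
  CD (ET k h) z (- ET k (fun v => k v * h v) z).
Proof.
  intros Hr Dm Hz eps He. destruct (Dm) as [K [H B]].
  assert (Mp : (0 <= M)%R).
  { specialize (B 0%R). assert (0 <= M / (1 + 0 * 0))%R.
    - eapply Rle_trans; [|apply B]. apply Rmult_le_pos; [|apply Cmod_ge_0].
      apply Rmult_le_pos; [nra | left; apply exp_pos].
    - replace (M / (1 + 0 * 0))%R with M in H0 by field. auto. }
  assert (Pp := PI_RGT_0).
  exists (Rmin r (eps / (PI * M + 1))). split.
  { apply Rmin_pos; auto. apply Rdiv_lt_0_compat; auto. nra. }
  intros d Hd.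
  assert (d1 : (Cmod d < r)%R) by (eapply Rlt_le_trans; [exact Hd|apply Rmin_l]).
  assert (d2 : (Cmod d < eps / (PI * M + 1))%R) by (eapply Rlt_le_trans; [exact Hd|apply Rmin_r]).
  assert (Pd := Cmod_ge_0 d).
  assert (Pr : (0 <= r)%R) by lra.
  destruct (ET_intg k h x r M z Pr Dm) as [I1 I2].
  { rewrite Hz, Rminus_diag, Rabs_R0; auto. }
  destruct (ET_intg k h x r M (z + d) Pr Dm) as [I3 _].
  { rewrite <- Hz. replace (Re (z + d) - Re z)%R with (Re d) by (unfold Re; simpl; ring).
    eapply Rle_trans; [apply re_le_Cmod | lra]. }
  unfold ET.
  replace (CI (fun v => Cexp (- ((z + d) * k v)) * h v) - CI (fun v => Cexp (- (z * k v)) * h v) -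
      d * - CI (fun v => Cexp (- (z * k v)) * (k v * h v)))
    with (CI (fun v => Cexp (- ((z + d) * k v)) * h v - Cexp (- (z * k v)) * h v
       + d * (Cexp (- (z * k v)) * (k v * h v)))).
  2:{ rewrite CI_plus; [rewrite CI_minus, CI_scal; auto; ring | apply intg_minus; auto | apply intg_scal; auto]. }
  apply Rle_trans with (PI * (Cmod d * Cmod d * M))%R.
  - apply CI_bound.
    + intros t. apply ccts_plus; [apply ccts_minus; [apply I3 | apply I1] |].
      apply ccts_mult; [apply ccts_const | apply I2].
    + intros v.
      replace (Cexp (- ((z + d) * k v)) * h v - Cexp (- (z * k v)) * h v + d * (Cexp (- (z * k v)) * (k v * h v)))
        with (Cexp (- (z * k v)) * h v * (Cexp (- (d * k v)) - 1 - - (d * k v))).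
      2:{ replace (- ((z + d) * k v)) with (- (z * k v) + - (d * k v)) by ring. rewrite Cexp_plus. ring. }
      assert (Ec : Cmod (- (d * k v)) = (Cmod d * Rabs (k v))%R)
        by (rewrite Cmod_opp, Cmod_mult, Cmod_R; auto).
      rewrite !Cmod_mult, Cmod_ET.
      assert (S2 := Cexp_sub_2 (- (d * k v))). rewrite Ec in S2.
      replace (Cmod d * Cmod d * M / (1 + v * v))%R with (Cmod d * Cmod d * (M / (1 + v * v)))%R
        by (unfold Rdiv; ring).
      apply Rle_trans with (exp (- (Re z * k v)) * Cmod (h v) *
         (Cmod d * Cmod d * (k v * k v) * exp (r * Rabs (k v))))%R.
      * apply Rmult_le_compat_l; [apply Rmult_le_pos; [left; apply exp_pos | apply Cmod_ge_0]|].
        eapply Rle_trans; [apply S2|].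
        replace (Cmod d * Rabs (k v) * (Cmod d * Rabs (k v)))%R with (Cmod d * Cmod d * (k v * k v))%R.
        2:{ assert (E : (Rabs (k v) * Rabs (k v) = k v * k v)%R).
            { rewrite <- Rabs_mult. apply Rabs_pos_eq. apply Rle_0_sqr. }
            rewrite <- E. ring. }
        apply Rmult_le_compat_l.
        -- apply Rmult_le_pos; [nra | apply Rle_0_sqr].
        -- apply exp_le. apply Rmult_le_compat_r; [apply Rabs_pos | lra].
      * specialize (B v). rewrite <- Hz in B.
        replace (exp (r * Rabs (k v) - Re z * k v)) with (exp (- (Re z * k v)) * exp (r * Rabs (k v)))%R in B
          by (rewrite <- exp_plus; f_equal; ring).
        assert (Q : (0 <= exp (- (Re z * k v)) * exp (r * Rabs (k v)) * Cmod (h v))%R).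
        { apply Rmult_le_pos; [|apply Cmod_ge_0]. left; apply Rmult_lt_0_compat; apply exp_pos. }
        apply Rle_trans with (Cmod d * Cmod d * ((1 + k v * k v) * (exp (- (Re z * k v)) * exp (r * Rabs (k v))) * Cmod (h v)))%R;
        [|apply Rmult_le_compat_l; nra].
        assert (0 <= Cmod d * Cmod d)%R by nra. nra.
  - apply Rmult_lt_compat_l with (r := (PI * M + 1)%R) in d2; [|nra].
    replace ((PI * M + 1) * (eps / (PI * M + 1)))%R with eps in d2 by (field; nra). nra.
Qed.

(** * The principal logarithm *)

(** The plane cut along the negative real axis and the origin. *)
Definition slit (z : C) : Prop := (0 < Re z)%R \/ Im z <> 0%R.

Lemma slit_neq_0 z : slit z -> z <> 0.
Proof. intros [H|H] E; subst; simpl in H; [lra|]. apply H; reflexivity. Qed.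

Lemma Re_div_Cmod (z : C) : z <> 0 -> (-1 <= Re z / Cmod z <= 1)%R.
Proof.
  intros N. assert (P := proj1 (Cmod_gt_0 z) N). assert (Q := re_le_Cmod z).
  apply Rabs_le_between in Q.
  split; apply Rmult_le_reg_r with (Cmod z); auto; unfold Rdiv; rewrite Rmult_assoc, Rinv_l; lra.
Qed.

Lemma Carg_bound (z : C) : (- PI <= Carg z <= PI)%R.
Proof.
  unfold Carg. destruct (acos_bound (Re z / Cmod z)). destruct Rle_dec; lra.
Qed.

(** This covers the cut, where [Carg] is [PI]. *)
Lemma Cexp_Clog (z : C) : z <> 0 -> Cexp (Clog z) = z.
Proof.
  intros N. assert (P := proj1 (Cmod_gt_0 z) N). assert (B := Re_div_Cmod z N).
  assert (E : (1 - (Re z / Cmod z)² = (Rabs (Im z) / Cmod z)²)%R).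
  { unfold Rsqr. generalize (Cmod_sqr z). intros H.
    assert (Rabs (Im z) * Rabs (Im z) = Im z * Im z)%R
      by (rewrite <- Rabs_mult; apply Rabs_pos_eq, Rle_0_sqr).
    replace (Rabs (Im z) / Cmod z * (Rabs (Im z) / Cmod z))%R with
      (Rabs (Im z) * Rabs (Im z) / (Cmod z * Cmod z))%R by (field; lra).
    rewrite H0. replace (Im z * Im z)%R with (Cmod z * Cmod z - Re z * Re z)%R by lra. field; lra. }
  assert (S : sin (acos (Re z / Cmod z)) = (Rabs (Im z) / Cmod z)%R).
  { rewrite sin_acos by auto. rewrite E. apply sqrt_Rsqr.
    apply Rmult_le_pos; [apply Rabs_pos | left; apply Rinv_0_lt_compat; auto]. }
  assert (K : cos (acos (Re z / Cmod z)) = (Re z / Cmod z)%R) by (apply cos_acos; auto).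
  unfold Clog, Cexp. change (Re (ln (Cmod z), Carg z)) with (ln (Cmod z)).
  change (Im (ln (Cmod z), Carg z)) with (Carg z). rewrite exp_ln by auto.
  unfold Carg. apply C_eq; destruct Rle_dec as [H|H];
    rewrite ?cos_neg, ?sin_neg, ?K, ?S; unfold Re, Im; simpl; unfold Re, Im in *.
  - field; lra.
  - field; lra.
  - rewrite Rabs_pos_eq by auto. field; lra.
  - rewrite Rabs_left by lra. field; lra.
Qed.

Lemma slit_pos (z : C) : slit z -> (0 < Cmod z + Re z)%R.
Proof.
  intros S. assert (N := slit_neq_0 z S). assert (P := proj1 (Cmod_gt_0 z) N).
  destruct S as [H|H]; [lra|].
  assert (E := Cmod_sqr z). assert (0 < Im z * Im z)%R by nra.
  assert (Q := re_le_Cmod z). apply Rabs_le_between in Q. nra.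
Qed.

(** The half-angle formula is a single continuous expression on the whole slit plane. *)
Lemma Carg_atan (z : C) : slit z -> Carg z = (2 * atan (Im z / (Cmod z + Re z)))%R.
Proof.
  intros S. assert (N := slit_neq_0 z S). assert (P := proj1 (Cmod_gt_0 z) N).
  assert (Q := slit_pos z S). set (u := (Im z / (Cmod z + Re z))%R).
  assert (U : (1 + u * u = 2 * Cmod z / (Cmod z + Re z))%R).
  { unfold u. assert (E := Cmod_sqr z).
    replace (1 + Im z / (Cmod z + Re z) * (Im z / (Cmod z + Re z)))%R with
      (((Cmod z + Re z) * (Cmod z + Re z) + Im z * Im z) / ((Cmod z + Re z) * (Cmod z + Re z)))%R
      by (field; lra).
    replace (Im z * Im z)%R with (Cmod z * Cmod z - Re z * Re z)%R by lra. field; lra. }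
  assert (C2 : cos (2 * atan u) = (Re z / Cmod z)%R).
  { rewrite cos_2a_cos, cos_atan.
    replace (2 * (1 / sqrt (1 + u²)) * (1 / sqrt (1 + u²)) - 1)%R with
      (2 / (sqrt (1 + u²) * sqrt (1 + u²)) - 1)%R.
    - rewrite sqrt_sqrt by (unfold Rsqr; nra). unfold Rsqr. rewrite U. field. lra.
    - field. apply Rgt_not_eq, sqrt_lt_R0. unfold Rsqr; nra. }
  assert (B := atan_bound u).
  unfold Carg. rewrite <- C2. destruct Rle_dec as [H|H].
  - apply acos_cos. assert (0 <= atan u)%R; [|lra].
    rewrite <- atan_0. apply atan_le. unfold u. apply Rmult_le_pos; auto. left; apply Rinv_0_lt_compat; auto.
  - rewrite <- (Ropp_involutive (2 * atan u)), cos_neg. rewrite acos_cos; auto.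
    assert (atan u <= 0)%R; [|lra].
    rewrite <- atan_0. apply atan_le. unfold u, Rdiv.
    assert (0 < / (Cmod z + Re z))%R by (apply Rinv_0_lt_compat; auto). nra.
Qed.

Lemma Carg_slit (z : C) : slit z -> (- PI < Carg z < PI)%R.
Proof.
  intros S. rewrite Carg_atan by auto. generalize (atan_bound (Im z / (Cmod z + Re z))). lra.
Qed.

Lemma ccts_Cmod {U : UniformSpace} (g : U -> C) (x : U) :
  ccts g x -> continuous (fun u => Cmod (g u)) x.
Proof.
  intros H. apply continuous_R_eps. intros eps He. rewrite ccts_eps in H.
  generalize (H eps He). apply filter_imp. intros u Hu. eapply Rle_lt_trans; [|exact Hu].
  apply Rabs_le. split; [|apply Cmod_triangle_inv].
  generalize (Cmod_triangle_inv (g x) (g u)). rewrite Cmod_sub_rev. lra.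
Qed.

Lemma continuous_of_derive {U : UniformSpace} (f : R -> R) (g : U -> R) (x : U) :
  ex_derive f (g x) -> continuous g x -> continuous (fun u => f (g u)) x.
Proof.
  intros D G. apply (continuous_comp g f); auto.
  apply (ex_derive_continuous (V := R_NormedModule)); auto.
Qed.

Lemma slit_open (z : C) : slit z -> @locally C_UniformSpace z slit.
Proof.
  intros [H|H].
  - apply locally_C_eps with (Re z); auto. intros y Hy. left.
    assert (P := re_le_Cmod (y - z)). apply Rabs_le_between in P.
    replace (Re (y - z)) with (Re y - Re z)%R in P by (unfold Re; simpl; ring). lra.
  - apply locally_C_eps with (Rabs (Im z)); [apply Rabs_pos_lt; auto|]. intros y Hy. right. intros E.
    assert (P := im_le_Cmod (y - z)).
    replace (Im (y - z)) with (- Im z)%R in P by (unfold Im in *; simpl; rewrite E; ring).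
    rewrite Rabs_Ropp in P. lra.
Qed.

Lemma ccts_Clog_id (z : C) : slit z -> @ccts C_UniformSpace Clog z.
Proof.
  intros S. assert (N := slit_neq_0 z S). assert (P := proj1 (Cmod_gt_0 z) N).
  assert (I : @ccts C_UniformSpace (fun y => y) z) by (apply CD_ccts with (RtoC 1), CD_id).
  split.
  - apply (continuous_of_derive ln (fun y : C_UniformSpace => Cmod y)); [|apply ccts_Cmod; auto].
    eexists. apply is_derive_Reals, derivable_pt_lim_ln; auto.
  - apply (continuous_ext_loc (T := C_UniformSpace) (U := R_UniformSpace) (fun y => Im (Clog y)) (fun y : C => (2 * atan (Im y / (Cmod y + Re y)))%R) z).
    + generalize (slit_open z S). apply filter_imp. intros y Hy.
      change (Im (Clog y)) with (Carg y). rewrite Carg_atan; auto.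
    + apply (continuous_of_derive (fun t => 2 * atan t)%R
        (fun y : C_UniformSpace => (Im y / (Cmod y + Re y))%R)); [auto_derive; auto|].
      apply (continuous_mult (K := R_AbsRing)); [apply I|].
      apply (continuous_of_derive Rinv (fun y : C_UniformSpace => (Cmod y + Re y)%R)).
      * auto_derive. generalize (slit_pos z S); lra.
      * apply (continuous_plus (V := R_NormedModule)); [apply ccts_Cmod; auto | apply I].
Qed.

(** Inverse function argument: [h = z (e^d - 1)] when [d] is the increment of the logarithm. *)
Lemma CD_Clog (z : C) : slit z -> CD Clog z (/ z).
Proof.
  intros S eps He. assert (N := slit_neq_0 z S). assert (P := proj1 (Cmod_gt_0 z) N).
  assert (K := ccts_Clog_id z S). rewrite ccts_eps in K.
  set (m := Rmin (/ 8) (eps * Cmod z / 8)).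
  assert (Pm : (0 < m)%R). { apply Rmin_pos; [lra|]. apply Rdiv_lt_0_compat; [nra|lra]. }
  destruct (K m Pm) as [d1 H1]. destruct (slit_open z S) as [d2 H2].
  exists (Rmin d1 d2). split; [apply Rmin_pos; apply cond_pos|]. intros h Hh.
  assert (B : forall d : posreal, (Rmin d1 d2 <= d)%R -> @ball C_UniformSpace z d (z + h)).
  { intros d Hd. apply C_NormedModule_mixin_compat1.
    unfold minus, plus, opp; simpl. replace (z + h + - z) with h by ring. lra. }
  specialize (H1 (z + h) (B d1 (Rmin_l _ _))). specialize (H2 (z + h) (B d2 (Rmin_r _ _))).
  set (d := Clog (z + h) - Clog z) in *.
  assert (E : h / z = Cexp d - 1).
  { unfold d. rewrite Cexp_minus, !Cexp_Clog by (auto; apply slit_neq_0; auto). field; auto. }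
  replace (d - h * / z) with (- (Cexp d - 1 - d)) by (unfold Cdiv in E; rewrite E; ring).
  rewrite Cmod_opp.
  assert (Eh : (Cmod h = Cmod z * Cmod (Cexp d - 1))%R).
  { rewrite <- E, <- Cmod_mult. f_equal. field; auto. }
  assert (m8 : (m <= / 8)%R) by apply Rmin_l.
  assert (S2 := Cexp_sub_2 d).
  assert (Pd := Cmod_ge_0 d).
  assert (X : (exp (Cmod d) <= 4)%R).
  { apply Rle_trans with (exp 1); [apply exp_le; lra|]. generalize exp_le_3; lra. }
  assert (S3 : (Cmod (Cexp d - 1 - d) <= 4 * (Cmod d * Cmod d))%R).
  { eapply Rle_trans; [apply S2|]. rewrite Rmult_comm. apply Rmult_le_compat_r; auto; nra. }
  assert (T := Cmod_triangle_inv d (- (Cexp d - 1 - d))). rewrite Cmod_opp in T.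
  replace (d - - (Cexp d - 1 - d)) with (Cexp d - 1) in T by ring.
  assert (L : (Cmod d / 2 <= Cmod (Cexp d - 1))%R) by nra.
  rewrite Eh. apply Rle_trans with (4 * (Cmod d * Cmod d))%R; auto.
  assert (mz : (m <= eps * Cmod z / 8)%R) by apply Rmin_r.
  apply Rle_trans with (4 * (eps * Cmod z / 8 * Cmod d))%R; [nra|].
  assert (0 <= eps * Cmod z)%R by nra. nra.
Qed.

Lemma Clog_Cexp (w : C) : (- PI < Im w < PI)%R -> Clog (Cexp w) = w.
Proof.
  intros B. unfold Clog, Carg. rewrite Cmod_Cexp, ln_exp.
  assert (P := exp_pos (Re w)).
  apply C_eq; [reflexivity|].
  change (Im (Re w, if Rle_dec 0 (Im (Cexp w)) then acos (Re (Cexp w) / exp (Re w))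
     else (- acos (Re (Cexp w) / exp (Re w)))%R)) with
    (if Rle_dec 0 (Im (Cexp w)) then acos (Re (Cexp w) / exp (Re w))
     else (- acos (Re (Cexp w) / exp (Re w)))%R).
  replace (Re (Cexp w) / exp (Re w))%R with (cos (Im w)) by (unfold Cexp; simpl; field; lra).
  replace (Im (Cexp w)) with (exp (Re w) * sin (Im w))%R by reflexivity.
  destruct Rle_dec as [H|H].
  - apply acos_cos. split; [|lra]. apply Rnot_lt_le. intros L.
    assert (sin (Im w) < 0)%R by (apply sin_lt_0_var; lra). nra.
  - rewrite <- (Ropp_involutive (Im w)), cos_neg, acos_cos; auto. split; [|lra].
    assert (Im w < 0)%R; [|lra]. apply Rnot_le_lt. intros L. apply H.
    apply Rmult_le_pos; [lra|]. apply sin_ge_0; lra.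
Qed.

(** * The Laplace integral for Kummer's function *)

(** [ln (1 + t)] at [t = e^v]. In the variable [v], integrals over the half-line become integrals
    over the line, and all powers become exponentials. *)
Definition lg (v : R) : R := ln (1 + exp v).

Lemma one_plus_exp_pos v : (0 < 1 + exp v)%R.
Proof. generalize (exp_pos v); lra. Qed.

Lemma lg_pos v : (0 <= lg v)%R.
Proof.
  unfold lg. rewrite <- ln_1. generalize (exp_pos v); intros. left; apply ln_increasing; lra.
Qed.

Lemma exp_lg v : exp (lg v) = (1 + exp v)%R.
Proof. apply exp_ln, one_plus_exp_pos. Qed.

Lemma lg_ge v : (v <= lg v)%R.
Proof.
  apply Rnot_lt_le. intros H. apply exp_increasing in H. rewrite exp_lg in H. lra.
Qed.

Lemma lg_opp v : lg (- v) = (lg v - v)%R.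
Proof.
  unfold lg. rewrite <- (ln_exp v) at 3. rewrite <- ln_div by (apply one_plus_exp_pos || apply exp_pos).
  f_equal. rewrite exp_Ropp. field. apply Rgt_not_eq, exp_pos.
Qed.

(** [m ln (1 + t) <= x t + C]: the logarithm is beaten by any multiple of its argument. *)
Lemma ln_le_lin (x m : R) : (0 < x)%R -> exists K : R, forall t, (0 <= t)%R ->
  (m * ln (1 + t) <= x * t + K)%R.
Proof.
  intros Hx. set (n := (Rabs m + 1)%R). assert (Pn : (0 < n)%R) by (unfold n; generalize (Rabs_pos m); lra).
  exists (x + n * (- 1 - ln (x / n)))%R. intros t Ht.
  assert (Pa : (0 < x / n)%R) by (apply Rdiv_lt_0_compat; auto).
  assert (L : (ln (1 + t) <= (1 + t) * (x / n) - 1 - ln (x / n))%R).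
  { assert (E : ln (1 + t) = (ln ((1 + t) * (x / n)) - ln (x / n))%R) by (rewrite ln_mult by lra; ring).
    rewrite E.
    assert (Q : (0 < (1 + t) * (x / n))%R) by (apply Rmult_lt_0_compat; lra).
    generalize (exp_ineq1_le (ln ((1 + t) * (x / n)))). rewrite exp_ln by auto. lra. }
  assert (L0 : (0 <= ln (1 + t))%R).
  { rewrite <- ln_1. destruct Ht as [Ht| <-]; [left; apply ln_increasing; lra | rewrite Rplus_0_r; right; auto]. }
  apply Rle_trans with (n * ln (1 + t))%R.
  - apply Rmult_le_compat_r; auto. unfold n. generalize (Rle_abs m); lra.
  - apply Rle_trans with (n * ((1 + t) * (x / n) - 1 - ln (x / n)))%R.
    + apply Rmult_le_compat_l; lra.
    + right. field. lra.
Qed.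

Lemma ln_sqr_le (u : R) : (0 <= u)%R -> (ln (1 + u * u) <= 2 * ln (1 + u))%R.
Proof.
  intros Hu. replace (2 * ln (1 + u))%R with (ln ((1 + u) * (1 + u))) by (rewrite ln_mult by lra; ring).
  destruct Hu as [Hu| <-].
  - left. apply ln_increasing; nra.
  - right. f_equal. ring.
Qed.

Lemma bdd_of_exp (f : R -> R) (K : R) : (forall v, (f v + ln (1 + v * v) <= K)%R) ->
  forall v, (exp (f v) <= exp K / (1 + v * v))%R.
Proof.
  intros H v. apply Rmult_le_reg_r with (1 + v * v)%R; [apply one_plus_sqr_pos|].
  unfold Rdiv. rewrite Rmult_assoc, Rinv_l, Rmult_1_r by (apply Rgt_not_eq, one_plus_sqr_pos).
  rewrite <- (exp_ln (1 + v * v)) by apply one_plus_sqr_pos. rewrite <- exp_plus. apply exp_le, H.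
Qed.

(** The term [- x e^v] dominates at plus infinity, where [lg v] is about [v], and [d v] at minus
    infinity, where [lg v] is about [0]. *)
Lemma double_exp_bound (x d m : R) : (0 < x)%R -> (0 < d)%R ->
  exists M, forall v, (exp (- (x * exp v) + d * v + m * lg v) <= M / (1 + v * v))%R.
Proof.
  intros Hx Hd.
  destruct (ln_le_lin x (d + Rabs m + 2) Hx) as [K1 H1].
  destruct (ln_le_lin d 2 Hd) as [K2 H2].
  exists (exp (Rmax K1 (K2 + Rabs m))). apply bdd_of_exp. intros v.
  assert (ml : (m * lg v <= Rabs m * lg v)%R) by (apply Rmult_le_compat_r; [apply lg_pos | apply Rle_abs]).
  assert (P := exp_pos v). assert (Pm := Rabs_pos m).
  destruct (Rle_dec 0 v) as [Hv|Hv].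
  - eapply Rle_trans; [|apply Rmax_l]. specialize (H1 (exp v) ltac:(lra)). fold (lg v) in H1.
    assert (L := lg_ge v).
    assert (E : (ln (1 + v * v) <= 2 * lg v)%R).
    { eapply Rle_trans; [apply ln_sqr_le; auto|]. apply Rmult_le_compat_l; [lra|].
      unfold lg. generalize (exp_ineq1_le v); intros.
      destruct (Req_dec v (exp v)); [rewrite <- H0; lra|]. left. apply ln_increasing; lra. }
    nra.
  - eapply Rle_trans; [|apply Rmax_r]. specialize (H2 (- v)%R ltac:(lra)).
    assert (E := ln_sqr_le (- v) ltac:(lra)). replace (- v * - v)%R with (v * v)%R in E by ring.
    assert (L1 : (lg v <= 1)%R).
    { unfold lg. assert (exp v <= 1)%R by (rewrite <- exp_0; apply exp_le; lra).
      generalize (exp_ineq1_le (ln (1 + exp v))). rewrite exp_ln by apply one_plus_exp_pos. lra. }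
    assert (Rabs m * lg v <= Rabs m * 1)%R by (apply Rmult_le_compat_l; auto).
    assert (0 < x * exp v)%R by (apply Rmult_lt_0_compat; auto). lra.
Qed.

(** [(1 + t) / t] at [t = Cexp y], and its logarithm. *)
Definition lam (y : C) : C := Clog (1 + Cexp (- y)).

Lemma slit_lam (y : C) : (- PI < Im y < PI)%R -> slit (1 + Cexp (- y)).
Proof.
  intros B. destruct (Req_dec (Im y) 0) as [Z|N].
  - left. unfold Cexp, Re, Im in *; simpl. rewrite Z, Ropp_0, cos_0.
    generalize (exp_pos (- fst y)); lra.
  - right. unfold Cexp, Re, Im in *; simpl. rewrite sin_neg.
    assert (P := exp_pos (- fst y)).
    assert (S : sin (snd y) <> 0%R).
    { destruct (Rlt_dec 0 (snd y)).
      - apply Rgt_not_eq, sin_gt_0; lra.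
      - apply Rlt_not_eq, sin_lt_0_var; lra. }
    intros E. apply S. nra.
Qed.

Lemma Cexp_lam (y : C) : (- PI < Im y < PI)%R -> Cexp (lam y) = 1 + Cexp (- y).
Proof. intros B. apply Cexp_Clog, slit_neq_0, slit_lam; auto. Qed.

Lemma CD_lam (y : C) : (- PI < Im y < PI)%R ->
  CD lam y (- (Cexp (- y) / (1 + Cexp (- y)))).
Proof.
  intros B. unfold lam. eapply CD_eq.
  - apply (CD_comp Clog (fun y => 1 + Cexp (- y))).
    + apply CD_Clog, slit_lam; auto.
    + apply CD_plus; [apply CD_const|]. apply CD_exp, CD_opp, CD_id.
  - field. apply slit_neq_0, slit_lam; auto.
Qed.

Lemma Im_lam (y : C) : (Rabs (Im (lam y)) <= PI)%R.
Proof. apply Rabs_le. apply Carg_bound. Qed.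

Lemma Cmod_one_plus_polar (r th : R) : (0 <= r)%R ->
  ((1 + r) * cos (th / 2) <= Cmod (1 + (r * cos th, r * sin th)%R) <= 1 + r)%R.
Proof.
  intros Hr. set (z := 1 + ((r * cos th)%R, (r * sin th)%R)).
  assert (E : (Cmod z * Cmod z = 1 + 2 * r * cos th + r * r)%R).
  { rewrite Cmod_sqr. unfold z, Re, Im; simpl. generalize (sin2_cos2 th). unfold Rsqr. intros; nra. }
  assert (C := COS_bound th). assert (P := Cmod_ge_0 z).
  split.
  - assert (H : (cos th = 2 * (cos (th / 2) * cos (th / 2)) - 1)%R).
    { rewrite <- (Rmult_1_r th) at 1. replace (th * 1)%R with (2 * (th / 2))%R by field.
      rewrite cos_2a_cos. ring. }
    apply Rsqr_incr_0_var; auto. unfold Rsqr. rewrite E.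
    set (c := cos (th / 2)) in *. rewrite H in *.
    assert (0 <= (1 - r) * (1 - r))%R by apply Rle_0_sqr.
    assert (0 <= 1 - c * c)%R by nra. nra.
  - apply Rsqr_incr_0_var; [|lra]. unfold Rsqr. rewrite E. nra.
Qed.

Lemma Cmod_lam_bound (v th : R) : (- PI < th < PI)%R ->
  (lg (- v) + ln (cos (th / 2)) <= Re (lam (v, th)) <= lg (- v))%R.
Proof.
  intros B. unfold lam, Clog, Re; simpl.
  assert (E : 1 + Cexp (- (v, th)) = 1 + ((exp (- v) * cos (- th))%R, (exp (- v) * sin (- th))%R)).
  { unfold Cexp, Re, Im; simpl. reflexivity. }
  rewrite E.
  assert (P := exp_pos (- v)).
  destruct (Cmod_one_plus_polar (exp (- v)) (- th)) as [L U]; [lra|].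
  replace (- th / 2)%R with (- (th / 2))%R in L by field. rewrite cos_neg in L.
  assert (C : (0 < cos (th / 2))%R) by (apply cos_gt_0; lra).
  unfold lg. split.
  - rewrite <- ln_mult by lra. destruct L as [L|L].
    + left. apply ln_increasing; auto. apply Rmult_lt_0_compat; lra.
    + right. f_equal. exact L.
  - destruct U as [U|U].
    + left. apply ln_increasing; auto. eapply Rlt_le_trans; [|exact L]. apply Rmult_lt_0_compat; lra.
    + right. f_equal. exact U.
Qed.

(** [t^(al-1) (1+t)^(be-1) dt] at [t = Cexp y], as a form in [y]. *)
Definition hJ (al be y : C) : C := Cexp ((al + be - 1) * y + (be - 1) * lam y).

Lemma CD_hJ (al be y : C) : (- PI < Im y < PI)%R ->
  CD (hJ al be) y (hJ al be y * ((al + be - 1) + (be - 1) * - (Cexp (- y) / (1 + Cexp (- y))))).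
Proof.
  intros B. unfold hJ. apply (CD_exp (fun y => (al + be - 1) * y + (be - 1) * lam y)). eapply CD_eq.
  - apply CD_plus; [apply CD_scal, CD_id | apply CD_scal, CD_lam; auto].
  - ring.
Qed.

(** In a closed sector away from the negative axis, [|1 + t|] is comparable with [1 + |t|]. *)
Lemma hJ_bound (al be : C) (th0 : R) : (0 <= th0 < PI)%R -> exists K, (0 < K)%R /\
  forall v th, (Rabs th <= th0)%R ->
  (Cmod (hJ al be (v, th)) <= K * exp (Re al * v + (Re be - 1) * lg v))%R.
Proof.
  intros H0.
  set (c := (- ln (cos (th0 / 2)))%R).
  exists (exp (Rabs (Im (al + be - 1)) * PI + Rabs (Im (be - 1)) * PI + Rabs (Re be - 1) * c)).
  split; [apply exp_pos|]. intros v th Hth.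
  assert (B := proj1 (Rabs_le_between _ _) Hth).
  unfold hJ. rewrite Cmod_Cexp, <- exp_plus. apply exp_le.
  replace (Re ((al + be - 1) * (v, th) + (be - 1) * lam (v, th))) with
    ((Re al + Re be - 1) * v - Im (al + be - 1) * th + ((Re be - 1) * Re (lam (v, th))
       - Im (be - 1) * Im (lam (v, th))))%R by (unfold Re, Im; simpl; ring).
  assert (E1 : (- (Im (al + be - 1) * th) <= Rabs (Im (al + be - 1)) * PI)%R).
  { eapply Rle_trans; [apply Rle_abs|]. rewrite Rabs_Ropp, Rabs_mult.
    apply Rmult_le_compat_l; [apply Rabs_pos | lra]. }
  assert (E2 : (- (Im (be - 1) * Im (lam (v, th))) <= Rabs (Im (be - 1)) * PI)%R).
  { eapply Rle_trans; [apply Rle_abs|]. rewrite Rabs_Ropp, Rabs_mult.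
    apply Rmult_le_compat_l; [apply Rabs_pos | apply Im_lam]. }
  assert (E3 : ((Re be - 1) * Re (lam (v, th)) <= (Re be - 1) * (lg v - v) + Rabs (Re be - 1) * c)%R).
  { destruct (Cmod_lam_bound v th) as [L U]; [lra|]. rewrite lg_opp in L, U.
    assert (C : (cos (th0 / 2) <= cos (th / 2))%R).
    { rewrite <- (cos_neg (th / 2)). destruct (Rle_dec 0 th).
      - rewrite cos_neg. apply cos_decr_1; lra.
      - apply cos_decr_1; lra. }
    assert (C0 : (0 < cos (th0 / 2))%R) by (apply cos_gt_0; lra).
    assert (Lc : (- c <= ln (cos (th / 2)))%R).
    { unfold c. rewrite Ropp_involutive. destruct C as [C|C]; [left; apply ln_increasing; auto | right; f_equal; auto]. }
    assert (X : (Rabs (Re (lam (v, th)) - (lg v - v)) <= c)%R) by (apply Rabs_le; lra).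
    assert (Y := Rle_abs ((Re be - 1) * (Re (lam (v, th)) - (lg v - v)))).
    rewrite Rabs_mult in Y.
    assert (Rabs (Re be - 1) * Rabs (Re (lam (v, th)) - (lg v - v)) <= Rabs (Re be - 1) * c)%R
      by (apply Rmult_le_compat_l; auto using Rabs_pos). lra. }
  lra.
Qed.

Lemma continuous_exp v : continuous exp v.
Proof. apply continuity_pt_filterlim, derivable_continuous_pt, derivable_pt_exp. Qed.

Lemma hJ_ccts al be th : (- PI < th < PI)%R -> forall v, ccts (fun v => hJ al be (v, th)) v.
Proof.
  intros B v. eapply RD_ccts. apply RD_horizontal. apply CD_hJ. exact B.
Qed.

Lemma one_plus_exp_sqr v : (1 + exp v * exp v <= exp (2 * lg v))%R.
Proof.
  replace (2 * lg v)%R with (lg v + lg v)%R by ring. rewrite exp_plus, exp_lg.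
  generalize (exp_pos v); nra.
Qed.

Lemma hJ_dom (al be : C) (th x : R) : (0 < Re al)%R -> (- PI < th < PI)%R -> (0 < x)%R ->
  exists M, ET_dom exp (fun v => hJ al be (v, th)) x (x / 2) M.
Proof.
  intros Ha B Hx.
  destruct (hJ_bound al be (Rabs th)) as [K [PK HK]].
  { split; [apply Rabs_pos | apply Rabs_def1; lra]. }
  destruct (double_exp_bound (x / 2) (Re al) (Re be - 1 + 2)) as [M HM]; [lra | auto|].
  exists (K * M)%R. split; [apply continuous_exp|]. split; [apply hJ_ccts; auto|].
  intros v. rewrite Rabs_pos_eq by (left; apply exp_pos).
  replace (x / 2 * exp v - x * exp v)%R with (- (x / 2 * exp v))%R by field.
  specialize (HM v). specialize (HK v th (Rle_refl _)).
  unfold Rdiv in *. rewrite Rmult_assoc.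
  apply Rle_trans with (exp (2 * lg v) * (exp (- (x * / 2 * exp v)) *
     (K * exp (Re al * v + (Re be - 1) * lg v))))%R.
  - rewrite Rmult_assoc. apply Rmult_le_compat.
    + generalize (exp_pos v); nra.
    + apply Rmult_le_pos; [left; apply exp_pos | apply Cmod_ge_0].
    + apply one_plus_exp_sqr.
    + apply Rmult_le_compat_l; auto. left; apply exp_pos.
  - apply Rle_trans with (K * exp (- (x * / 2 * exp v) + Re al * v + (Re be - 1 + 2) * lg v))%R.
    + right. replace (- (x * / 2 * exp v) + Re al * v + (Re be - 1 + 2) * lg v)%R with
        (2 * lg v + (- (x * / 2 * exp v)) + (Re al * v + (Re be - 1) * lg v))%R by ring.
      rewrite !exp_plus. ring.
    + rewrite (Rmult_assoc K M). apply Rmult_le_compat_l; lra.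
Qed.

(** The integral along the ray [arg t = th], where [z = Cexp w]. *)
Definition Jray (al be : C) (th : R) (w : C) : C :=
  ET exp (fun v => hJ al be (v, th)) (Cexp (w + (0, th))).

(** The ray avoids the cut of [(1 + t)^(be - 1)], and [e^(- z t)] decays along it. *)
Definition adm (w : C) (th : R) : Prop :=
  (Rabs th < PI)%R /\ (Rabs (Im w + th) < PI / 2)%R.

(** The Laplace integral for [Gamma(al) U(al, al + be, z)], [z = Cexp w]. The ray [arg t = - 2/3
    arg z] is admissible for every [|arg z| < 3 PI / 2]. *)
Definition J (al be w : C) : C := Jray al be (- (2 / 3 * Im w)) w.

Lemma adm_default (w : C) : (Rabs (Im w) < 3 / 2 * PI)%R -> adm w (- (2 / 3 * Im w)).
Proof.
  intros H. apply Rabs_def2 in H. split; apply Rabs_def1; lra.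
Qed.

Lemma Re_ray (w : C) (th : R) : Re (Cexp (w + (0, th))) = (exp (Re w) * cos (Im w + th))%R.
Proof. unfold Cexp, Re, Im; simpl. rewrite Rplus_0_r. reflexivity. Qed.

Lemma adm_pos (w : C) (th : R) : adm w th -> (0 < Re (Cexp (w + (0, th))))%R.
Proof.
  intros [_ H]. rewrite Re_ray. apply Rabs_def2 in H.
  apply Rmult_lt_0_compat; [apply exp_pos | apply cos_gt_0; lra].
Qed.

Lemma hJ_shift al be y : Cexp y * hJ al be y = hJ (al + 1) be y.
Proof. unfold hJ. rewrite <- Cexp_plus. f_equal. ring. Qed.

Lemma Jray_CD (al be : C) (th : R) (w : C) : (0 < Re al)%R -> adm w th ->
  CD (Jray al be th) w (- (Cexp w * Jray (al + 1) be th w)).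
Proof.
  intros Ha A. assert (P := adm_pos w th A). destruct (A) as [A1 A2]. apply Rabs_def2 in A1.
  destruct (hJ_dom al be th _ Ha ltac:(lra) P) as [M D].
  set (z := Cexp (w + (0, th))) in *.
  assert (D1 := ET_CD exp (fun v => hJ al be (v, th)) (Re z) (Re z / 2) M z ltac:(lra) D eq_refl).
  unfold Jray. eapply CD_eq.
  - apply (CD_comp (ET exp (fun v => hJ al be (v, th))) (fun w => Cexp (w + (0, th)))).
    + exact D1.
    + apply CD_exp. apply CD_plus; [apply CD_id | apply CD_const].
  - fold z. destruct (ET_intg exp (fun v => hJ al be (v, th)) (Re z) (Re z / 2) M z) as [_ I]; auto; try lra.
    { rewrite Rminus_diag, Rabs_R0; lra. }
    unfold ET. fold z.
    rewrite (CI_ext (fun v => Cexp (- (z * exp v)) * hJ (al + 1) be (v, th))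
      (fun v => Cexp (0, th) * (Cexp (- (z * exp v)) * (exp v * hJ al be (v, th))))).
    + rewrite CI_scal by auto. unfold z. rewrite Cexp_plus. ring.
    + intros v. rewrite <- hJ_shift. replace (Cexp (v, th)) with (exp v * Cexp (0, th)); [ring|].
      rewrite <- Cexp_RtoC, <- Cexp_plus. f_equal. apply C_eq; simpl; ring.
Qed.

Lemma adm_between (w : C) (a b th : R) : adm w a -> adm w b ->
  (Rmin a b <= th <= Rmax a b)%R -> adm w th.
Proof.
  intros [A1 A2] [B1 B2] H. apply Rabs_def2 in A1, A2, B1, B2.
  unfold Rmin, Rmax in H. destruct Rle_dec; split; apply Rabs_def1; lra.
Qed.

Lemma cos_ge_of_abs (u m : R) : (Rabs u <= m)%R -> (m < PI / 2)%R -> (cos m <= cos u)%R.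
Proof.
  intros H Hm. assert (P := PI_RGT_0). apply Rabs_le_between in H.
  destruct (Rle_dec 0 u).
  - apply cos_decr_1; lra.
  - rewrite <- (cos_neg u). apply cos_decr_1; lra.
Qed.

(** Rotation of the ray, by [CI_contour]: between two admissible rays the integrands have a common
    majorant. *)
Lemma Jray_indep (al be : C) (a b : R) (w : C) : (0 < Re al)%R -> adm w a -> adm w b ->
  Jray al be a w = Jray al be b w.
Proof.
  intros Ha A B.
  set (f := fun y => Cexp (- Cexp (w + y)) * hJ al be y).
  set (f' := fun y => f y * (- Cexp (w + y) + ((al + be - 1) +
      (be - 1) * - (Cexp (- y) * / (1 + Cexp (- y)))))).
  assert (E : forall th, Jray al be th w = CI (fun v => f (v, th))).
  { intros th. unfold Jray, ET. apply CI_ext. intros v. unfold f. f_equal. f_equal. f_equal.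
    rewrite <- Cexp_RtoC, <- Cexp_plus. f_equal. apply C_eq; simpl; ring. }
  rewrite !E.
  assert (S : forall th, (Rmin a b <= th <= Rmax a b)%R -> (- PI < th < PI)%R).
  { intros th Hth. destruct (adm_between w a b th A B Hth) as [H _]. apply Rabs_def2 in H. lra. }
  set (m := Rmax (Rabs (Im w + a)) (Rabs (Im w + b))).
  assert (Hm : (m < PI / 2)%R) by (apply Rmax_lub_lt; [apply A | apply B]).
  assert (Pm : (0 <= m)%R) by (eapply Rle_trans; [apply Rabs_pos | apply Rmax_l]).
  set (t0 := Rmax (Rabs a) (Rabs b)).
  assert (Ht0 : (t0 < PI)%R) by (apply Rmax_lub_lt; [apply A | apply B]).
  assert (Pt0 : (0 <= t0)%R) by (eapply Rle_trans; [apply Rabs_pos | apply Rmax_l]).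
  set (x := (exp (Re w) * cos m)%R).
  assert (Px : (0 < x)%R) by (apply Rmult_lt_0_compat; [apply exp_pos | apply cos_gt_0; lra]).
  destruct (hJ_bound al be t0 (conj Pt0 Ht0)) as [K [PK HK]].
  destruct (double_exp_bound x (Re al) (Re be - 1) Px Ha) as [M HM].
  apply CI_contour with f' (K * M)%R.
  - intros v th Hth. unfold f'. unfold f at 1. eapply CD_eq.
    + apply CD_mult; [|apply CD_hJ; apply S; auto].
      apply CD_exp, CD_opp, CD_exp, CD_plus; [apply CD_const | apply CD_id].
    + unfold f, Cdiv. ring.
  - intros v th Hth.
    assert (I : @ccts C_UniformSpace (fun y => y) (v, th)) by (apply CD_ccts with (RtoC 1), CD_id).
    unfold f', f.
    apply ccts_mult; [apply ccts_mult|].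
    + apply ccts_Cexp, ccts_opp, ccts_Cexp, ccts_plus; auto using ccts_const.
    + eapply CD_ccts. apply CD_hJ. apply S; auto.
    + apply ccts_plus; [apply ccts_opp, ccts_Cexp, ccts_plus; auto using ccts_const|].
      apply ccts_plus; [apply ccts_const|]. apply ccts_mult; [apply ccts_const|]. apply ccts_opp.
      apply ccts_mult; [apply ccts_Cexp, ccts_opp; auto|].
      apply (ccts_comp (fun x => / x) (fun y : C => 1 + Cexp (- y))) with (- / ((1 + Cexp (- (v, th))) * (1 + Cexp (- (v, th))))).
      * apply CD_inv. apply slit_neq_0, slit_lam, S; auto.
      * apply ccts_plus; [apply ccts_const | apply ccts_Cexp, ccts_opp; auto].
  - intros th Hth v.
    assert (Hs : (Rabs (Im w + th) <= m)%R).
    { unfold m. unfold Rmin, Rmax in Hth. apply Rabs_le.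
      generalize (Rmax_l (Rabs (Im w + a)) (Rabs (Im w + b))) (Rmax_r (Rabs (Im w + a)) (Rabs (Im w + b))).
      generalize (Rle_abs (Im w + a)) (Rle_abs (Im w + b)) (Rle_abs (- (Im w + a))) (Rle_abs (- (Im w + b))).
      rewrite !Rabs_Ropp. destruct Rle_dec; intros; lra. }
    assert (Ht : (Rabs th <= t0)%R).
    { unfold t0. unfold Rmin, Rmax in Hth. apply Rabs_le.
      generalize (Rmax_l (Rabs a) (Rabs b)) (Rmax_r (Rabs a) (Rabs b)).
      generalize (Rle_abs a) (Rle_abs b) (Rle_abs (- a)) (Rle_abs (- b)).
      rewrite !Rabs_Ropp. destruct Rle_dec; intros; lra. }
    unfold f. rewrite Cmod_mult, Cmod_Cexp.
    replace (Re (- Cexp (w + (v, th)))) with (- (exp (Re w) * exp v * cos (Im w + th)))%R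
      by (unfold Cexp, Re, Im; simpl; rewrite exp_plus; ring).
    assert (Cm := cos_ge_of_abs _ _ Hs Hm).
    apply Rle_trans with (exp (- (x * exp v)) * (K * exp (Re al * v + (Re be - 1) * lg v)))%R.
    + apply Rmult_le_compat; [left; apply exp_pos | apply Cmod_ge_0 | | apply HK; auto].
      apply exp_le. unfold x. generalize (exp_pos (Re w)) (exp_pos v); intros.
      assert (exp (Re w) * exp v * cos m <= exp (Re w) * exp v * cos (Im w + th))%R; [|nra].
      apply Rmult_le_compat_l; auto. nra.
    + apply Rle_trans with (K * exp (- (x * exp v) + Re al * v + (Re be - 1) * lg v))%R.
      * right. rewrite !exp_plus. ring.
      * unfold Rdiv. rewrite Rmult_assoc. apply Rmult_le_compat_l; [lra | apply HM].
Qed.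

Lemma J_adm (al be : C) (th : R) (w : C) : (0 < Re al)%R -> adm w th -> (Rabs (Im w) < 3 / 2 * PI)%R ->
  J al be w = Jray al be th w.
Proof.
  intros Ha A Hw. unfold J. apply Jray_indep; [exact Ha | apply adm_default; exact Hw | exact A].
Qed.

Lemma adm_open (w : C) (th : R) : adm w th -> exists r, (0 < r)%R /\
  forall y, (Cmod (y - w) < r)%R -> adm y th.
Proof.
  intros [A B]. apply Rabs_def2 in B.
  exists (Rmin (PI / 2 - (Im w + th)) (PI / 2 + (Im w + th))). split; [apply Rmin_pos; lra|].
  intros y Hy. split; auto.
  assert (P := im_le_Cmod (y - w)). apply Rabs_le_between in P.
  replace (Im (y - w)) with (Im y - Im w)%R in P by (unfold Im; simpl; ring).
  assert (Q1 := Rmin_l (PI / 2 - (Im w + th)) (PI / 2 + (Im w + th))).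
  assert (Q2 := Rmin_r (PI / 2 - (Im w + th)) (PI / 2 + (Im w + th))).
  apply Rabs_def1; lra.
Qed.

Lemma J_CD (al be w : C) : (0 < Re al)%R -> (Rabs (Im w) < 3 / 2 * PI)%R ->
  CD (J al be) w (- (Cexp w * J (al + 1) be w)).
Proof.
  intros Ha Hw. assert (A := adm_default w Hw).
  destruct (adm_open _ _ A) as [r [Pr Hr]].
  apply (CD_ext_loc (Jray al be (- (2 / 3 * Im w)))) with (Rmin r (3 / 2 * PI - Rabs (Im w))).
  - apply Rmin_pos; lra.
  - intros y Hy. symmetry. apply J_adm; auto.
    + apply Hr. eapply Rlt_le_trans; [exact Hy | apply Rmin_l].
    + assert (P := im_le_Cmod (y - w)).
      replace (Im (y - w)) with (Im y - Im w)%R in P by (unfold Im; simpl; ring).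
      assert (Q := Rmin_r r (3 / 2 * PI - Rabs (Im w))).
      generalize (Rabs_triang_inv (Im y) (Im w)). lra.
  - apply Jray_CD; auto.
Qed.

(** Kummer's equation: the left-hand side is the integral of the derivative of
    [t^al (1+t)^be e^(-z t)]. *)
Lemma J_ODE (al be w : C) : (0 < Re al)%R -> (Rabs (Im w) < 3 / 2 * PI)%R ->
  Cexp w * J (al + 2) be w - (al + be - Cexp w) * J (al + 1) be w - al * J al be w = 0.
Proof.
  intros Ha Hw. assert (A := adm_default w Hw). set (th := (- (2 / 3 * Im w))%R) in *.
  unfold J. fold th. assert (P := adm_pos _ _ A).
  destruct (A) as [A1 A2]. apply Rabs_def2 in A1.
  set (z := Cexp (w + (0, th))) in *.
  assert (I : forall al' be' : C, (0 < Re al')%R -> intg (fun v => Cexp (- (z * exp v)) * hJ al' be' (v, th))).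
  { intros al' be' Ha'. destruct (hJ_dom al' be' th _ Ha' ltac:(lra) P) as [M D].
    apply (ET_intg exp (fun v => hJ al' be' (v, th)) (Re z) (Re z / 2) M z); auto; try lra.
    rewrite Rminus_diag, Rabs_R0; lra. }
  assert (R1 : (0 < Re (al + 1))%R) by (unfold Re in *; simpl; lra).
  assert (R2 : (0 < Re (al + 2))%R) by (unfold Re in *; simpl; lra).
  set (g := fun v : R => Cexp (- (z * exp v)) * hJ (al + 0) (be + 1) (v, th)).
  set (G := fun v : R => - Cexp w * (Cexp (- (z * exp v)) * hJ (al + 2) be (v, th)) +
     ((al + be - Cexp w) * (Cexp (- (z * exp v)) * hJ (al + 1) be (v, th)) +
       al * (Cexp (- (z * exp v)) * hJ al be (v, th)))).
  assert (Ez : forall v : R, z * exp v = Cexp w * Cexp (v, th)).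
  { intros v. unfold z. rewrite <- Cexp_RtoC, <- !Cexp_plus. f_equal. apply C_eq; simpl; ring. }
  assert (D : forall t, RD g t (G t)).
  { intros v. unfold g, G. eapply RD_eq.
    - apply RD_mult.
      + apply RD_exp, RD_opp, RD_scal, RD_RtoC. apply is_derive_Reals, derivable_pt_lim_exp.
      + apply RD_horizontal, CD_hJ. simpl; lra.
    - rewrite <- !hJ_shift.
      replace (al + 2) with (al + 1 + 1) by ring. rewrite <- !hJ_shift.
      assert (B : (- PI < Im (v, th) < PI)%R) by (simpl; lra).
      assert (Eh : hJ (al + 0) (be + 1) (v, th) = hJ al be (v, th) * (1 + Cexp (v, th))).
      { unfold hJ. rewrite <- (Cmult_1_l (1 + Cexp (v, th))).
        replace (1 + Cexp (v, th)) with (Cexp (v, th) * (1 + Cexp (- (v, th)))).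
        - rewrite <- Cexp_lam by auto. rewrite Cmult_1_l, <- !Cexp_plus. f_equal. ring.
        - generalize (Cexp_cancel (v, th)). intros Q.
          rewrite Cmult_plus_distr_l, Q. ring. }
      rewrite Eh.
      assert (N : 1 + Cexp (- (v, th)) <> 0) by (apply slit_neq_0, slit_lam; auto).
      assert (Q : Cexp (- (v, th)) / (1 + Cexp (- (v, th))) = / (1 + Cexp (v, th))).
      { rewrite Cexp_opp in *. assert (N2 := Cexp_neq_0 (v, th)).
        field. split; auto. intros Z. apply N.
        replace (1 + / Cexp (v, th)) with ((1 + Cexp (v, th)) / Cexp (v, th)) by (field; auto).
        rewrite Z. field; auto. }
      assert (N3 : 1 + Cexp (v, th) <> 0).
      { intros Z. apply N. rewrite Cexp_opp.
        replace (1 + / Cexp (v, th)) with ((1 + Cexp (v, th)) / Cexp (v, th)) by (field; apply Cexp_neq_0).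
        rewrite Z. field. apply Cexp_neq_0. }
      rewrite Q, (Ez v). field. auto. }
  assert (IG : intg G).
  { unfold G. apply intg_plus; [apply intg_scal, I; auto|].
    apply intg_plus; apply intg_scal, I; auto. }
  assert (Ig : intg g) by (apply I; unfold Re in *; simpl; lra).
  destruct Ig as [_ [M BM]].
  assert (Z := CI_FTC0 g G M D IG BM).
  assert (I2 := I (al + 2) be R2). assert (I1 := I (al + 1) be R1). assert (I0 := I al be Ha).
  unfold G in Z. rewrite (CI_plus _ _ (intg_scal _ _ I2) (intg_plus _ _ (intg_scal _ _ I1) (intg_scal _ _ I0))),
    (CI_plus _ _ (intg_scal _ _ I1) (intg_scal _ _ I0)), (CI_scal _ _ I2), (CI_scal _ _ I1), (CI_scal _ _ I0) in Z.
  unfold Jray, ET. fold z. match type of Z with ?L = _ => transitivity (- L); [ring | rewrite Z; ring] end.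
Qed.

(** * Uniqueness for Kummer's equation *)

Lemma gronwall (E E' : R -> R) (K : R) :
  (forall t, (0 <= t <= 1)%R -> is_derive E t (E' t)) ->
  (forall t, (0 <= t <= 1)%R -> (E' t <= K * E t)%R) -> (E 1 <= E 0 * exp K)%R.
Proof.
  intros D B.
  assert (D2 : forall t, (0 <= t <= 1)%R ->
    is_derive (fun t => E t * exp (- (K * t)))%R t ((E' t - K * E t) * exp (- (K * t)))%R).
  { intros t Ht.
    replace ((E' t - K * E t) * exp (- (K * t)))%R with
      (E' t * exp (- (K * t)) + E t * (- K * exp (- (K * t))))%R by ring.
    apply (is_derive_mult (K := R_AbsRing) E (fun t => exp (- (K * t)))).
    - apply D; auto.
    - auto_derive; auto. ring.
    - intros; apply Rmult_comm. }
  destruct (MVT_gen (fun t => E t * exp (- (K * t)))%R 0 1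
    (fun t => (E' t - K * E t) * exp (- (K * t)))%R) as [c [Hc Q]].
  - intros x Hx. rewrite Rmin_left, Rmax_right in Hx by lra. apply D2; lra.
  - intros x Hx. rewrite Rmin_left, Rmax_right in Hx by lra.
    apply continuity_pt_filterlim.
    apply (ex_derive_continuous (V := R_NormedModule) (fun t => E t * exp (- (K * t)))%R).
    eexists; apply D2; lra.
  - rewrite Rmin_left, Rmax_right in Hc by lra.
    assert (P := exp_pos (- (K * c))). specialize (B c Hc).
    assert (L : (E 1 * exp (- (K * 1)) <= E 0 * exp (- (K * 0)))%R) by nra.
    replace (- (K * 0))%R with 0%R in L by ring. rewrite exp_0 in L.
    apply Rmult_le_reg_r with (exp (- (K * 1))); [apply exp_pos|].
    rewrite Rmult_assoc, <- exp_plus. replace (K + - (K * 1))%R with 0%R by ring.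
    rewrite exp_0. lra.
Qed.

Definition sq (z : C) : R := (Re z * Re z + Im z * Im z)%R.

Lemma sq_Cmod z : sq z = (Cmod z * Cmod z)%R.
Proof. unfold sq. rewrite Cmod_sqr. reflexivity. Qed.

Definition dot (x y : C) : R := (Re x * Re y + Im x * Im y)%R.

Lemma dot_le x y : (dot x y <= Cmod x * Cmod y)%R.
Proof.
  unfold dot. rewrite <- (Cmod_conj x), <- Cmod_mult. eapply Rle_trans; [|apply re_le_Cmod].
  eapply Rle_trans; [apply Rle_abs|]. right. f_equal. unfold Cconj, Re, Im; simpl; ring.
Qed.

Lemma RD_sq g t l : RD g t l -> is_derive (fun t => sq (g t)) t (2 * dot (g t) l)%R.
Proof.
  intros [A B]. unfold sq, dot.
  replace (2 * (Re (g t) * Re l + Im (g t) * Im l))%R with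
    ((Re l * Re (g t) + Re (g t) * Re l) + (Im l * Im (g t) + Im (g t) * Im l))%R by ring.
  apply (is_derive_plus (K := R_AbsRing) (V := R_NormedModule)).
  - apply (is_derive_mult (K := R_AbsRing)); auto. intros; apply Rmult_comm.
  - apply (is_derive_mult (K := R_AbsRing)); auto. intros; apply Rmult_comm.
Qed.

Definition convex (S : C -> Prop) : Prop :=
  forall x y, S x -> S y -> forall t : R, (0 <= t <= 1)%R -> S (x + t * (y - x)).

Lemma CD_zero_const (S : C -> Prop) (f : C -> C) : convex S ->
  (forall w, S w -> CD f w 0) -> forall x y, S x -> S y -> f x = f y.
Proof.
  intros Cv D x y Hx Hy.
  assert (M := RD_mvt (fun t : R => f (x + t * (y - x))) (fun t => 0 * (y - x)) 0 1 0 ltac:(lra)).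
  assert (Z : (Cmod (f y - f x) <= 0)%R).
  { rewrite Rmult_0_l in M. replace (x + 1 * (y - x)) with y in M by ring.
    replace (x + 0 * (y - x)) with x in M by ring. apply M.
    - intros t Ht. apply CD_RD_line. apply D, Cv; auto.
    - intros t _. rewrite Cmult_0_l, Cmod_0. lra. }
  assert (Z2 : f y - f x = 0) by (apply Cmod_eq_0; generalize (Cmod_ge_0 (f y - f x)); lra).
  replace (f y) with (f y - f x + f x) by ring. rewrite Z2. ring.
Qed.

(** A solution of Kummer's equation together with its derivative in [z]. *)
Definition Ksol (a b : C) (S : C -> Prop) (u u1 : C -> C) : Prop :=
  forall w, S w -> CD u w (Cexp w * u1 w) /\ CD u1 w (a * u w - (b - Cexp w) * u1 w).

Lemma Ksol_lin a b S u u1 v v1 c d : Ksol a b S u u1 -> Ksol a b S v v1 ->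
  Ksol a b S (fun w => c * u w + d * v w) (fun w => c * u1 w + d * v1 w).
Proof.
  intros U V w Hw. destruct (U w Hw) as [U1 U2]. destruct (V w Hw) as [V1 V2]. split.
  - eapply CD_eq; [apply CD_plus; apply CD_scal; eassumption|]. ring.
  - eapply CD_eq; [apply CD_plus; apply CD_scal; eassumption|]. ring.
Qed.

Lemma Ksol_sub a b (S T : C -> Prop) u u1 : (forall w, T w -> S w) -> Ksol a b S u u1 -> Ksol a b T u u1.
Proof. intros H U w Hw. apply U, H, Hw. Qed.

(** Gronwall for [|u|^2 + |u1|^2] along the segment from [w0]. *)
Lemma Ksol_zero a b S u u1 : convex S -> Ksol a b S u u1 ->
  forall w0, S w0 -> u w0 = 0 -> u1 w0 = 0 -> forall w, S w -> u w = 0 /\ u1 w = 0.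
Proof.
  intros Cv U w0 H0 Z Z1 w Hw. set (d := w - w0).
  set (Q := exp (Rmax (Re w0) (Re w))).
  set (K := (2 * Cmod d * (Cmod a + Cmod b + 2 * Q))%R).
  set (p := fun t : R => w0 + t * d).
  assert (Sp : forall t, (0 <= t <= 1)%R -> S (p t)) by (intros; apply Cv; auto).
  assert (G := gronwall (fun t => sq (u (p t)) + sq (u1 (p t)))%R
    (fun t => 2 * dot (u (p t)) (Cexp (p t) * u1 (p t) * d) +
       2 * dot (u1 (p t)) ((a * u (p t) - (b - Cexp (p t)) * u1 (p t)) * d))%R K).
  assert (L : (sq (u (p 1)) + sq (u1 (p 1)) <= (sq (u (p 0)) + sq (u1 (p 0))) * exp K)%R).
  { apply G.
    - intros t Ht. destruct (U (p t) (Sp t Ht)) as [D1 D2].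
      apply (is_derive_plus (K := R_AbsRing) (V := R_NormedModule)).
      + apply (RD_sq (fun t => u (p t))). apply CD_RD_line; auto.
      + apply (RD_sq (fun t => u1 (p t))). apply CD_RD_line; auto.
    - intros t Ht.
      assert (E : (Cmod (Cexp (p t)) <= Q)%R).
      { rewrite Cmod_Cexp. apply exp_le. unfold p, d.
        replace (Re (w0 + t * (w - w0))) with ((1 - t) * Re w0 + t * Re w)%R by (unfold Re; simpl; ring).
        generalize (Rmax_l (Re w0) (Re w)) (Rmax_r (Re w0) (Re w)). intros. nra. }
      assert (PQ := exp_pos (Rmax (Re w0) (Re w))). fold Q in PQ.
      set (x := u (p t)) in *. set (y := u1 (p t)) in *. set (z := Cexp (p t)) in *.
      assert (B1 : (dot x (z * y * d) <= Cmod x * (Q * Cmod y * Cmod d))%R).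
      { eapply Rle_trans; [apply dot_le|]. rewrite !Cmod_mult.
        apply Rmult_le_compat_l; [apply Cmod_ge_0|].
        apply Rmult_le_compat_r; [apply Cmod_ge_0|]. apply Rmult_le_compat_r; [apply Cmod_ge_0|]. auto. }
      assert (B2 : (dot y ((a * x - (b - z) * y) * d) <=
         Cmod y * ((Cmod a * Cmod x + (Cmod b + Q) * Cmod y) * Cmod d))%R).
      { eapply Rle_trans; [apply dot_le|]. rewrite Cmod_mult.
        apply Rmult_le_compat_l; [apply Cmod_ge_0|]. apply Rmult_le_compat_r; [apply Cmod_ge_0|].
        unfold Cminus. eapply Rle_trans; [apply Cmod_triangle|].
        rewrite Cmod_opp, !Cmod_mult. apply Rplus_le_compat_l.
        apply Rmult_le_compat_r; [apply Cmod_ge_0|].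
        eapply Rle_trans; [apply Cmod_triangle|]. rewrite Cmod_opp. lra. }
      rewrite !sq_Cmod. unfold K.
      assert (Px := Cmod_ge_0 x). assert (Py := Cmod_ge_0 y). assert (Pd := Cmod_ge_0 d).
      assert (Pa := Cmod_ge_0 a). assert (Pb := Cmod_ge_0 b).
      set (X := Cmod x) in *. set (Y := Cmod y) in *. set (A := Cmod a) in *. set (B := Cmod b) in *.
      set (dd := Cmod d) in *.
      assert (XY : (2 * (X * Y) <= X * X + Y * Y)%R) by (generalize (Rle_0_sqr (X - Y)); unfold Rsqr; lra).
      assert (T : (2 * (X * (Q * Y) + Y * (A * X + (B + Q) * Y)) <=
         2 * (A + B + 2 * Q) * (X * X + Y * Y))%R).
      { assert (Q * (2 * (X * Y)) <= Q * (X * X + Y * Y))%R by (apply Rmult_le_compat_l; lra).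
        assert (A * (2 * (X * Y)) <= A * (X * X + Y * Y))%R by (apply Rmult_le_compat_l; lra).
        assert (0 <= X * X)%R by nra. assert (0 <= Y * Y)%R by nra.
        assert (0 <= A * (X * X))%R by nra. assert (0 <= A * (Y * Y))%R by nra.
        assert (0 <= B * (X * X))%R by nra. assert (0 <= B * (Y * Y))%R by nra.
        assert (0 <= Q * (X * X))%R by nra. assert (0 <= Q * (Y * Y))%R by nra. nra. }
      apply Rmult_le_compat_l with (r := dd) in T; auto. nra. }
  assert (E0 : p 0%R = w0) by (unfold p; ring).
  assert (E1 : p 1%R = w) by (unfold p, d; ring).
  rewrite E0, E1, Z, Z1 in L. rewrite !sq_Cmod, Cmod_0 in L.
  generalize (Cmod_ge_0 (u w)) (Cmod_ge_0 (u1 w)); intros. split; apply Cmod_eq_0; nra.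
Qed.

Definition wronskian (u u1 v v1 : C -> C) (w : C) : C := u w * v1 w - u1 w * v w.

(** Abel's identity for the Wronskian. *)
Lemma wronskian_CD a b S u u1 v v1 : Ksol a b S u u1 -> Ksol a b S v v1 -> forall w, S w ->
  CD (fun w => wronskian u u1 v v1 w * Cexp (b * w - Cexp w)) w 0.
Proof.
  intros U V w Hw. destruct (U w Hw) as [U1 U2]. destruct (V w Hw) as [V1 V2].
  unfold wronskian. eapply CD_eq.
  - apply CD_mult.
    + apply CD_minus; apply CD_mult; eassumption.
    + apply CD_exp, CD_minus; [apply CD_scal, CD_id | apply CD_Cexp].
  - cbv beta. ring.
Qed.

(** The asymptotic condition of [is_KummerU] on the positive axis only: it already determines the
    solution ([kummer_unique]). *)
Definition asym (a : C) (u : C -> C) : Prop :=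
  forall eps, (0 < eps)%R -> exists M : R, forall x : R, (M < x)%R ->
  (Cmod (u x / Cexp (- a * x) - 1) < eps)%R.

Lemma asym_bound a u : asym a u -> exists M : R, forall x : R, (M < x)%R ->
  u x <> 0 /\ (Cmod (u x) <= 2 * exp (- Re a * x))%R.
Proof.
  intros A. destruct (A 1%R Rlt_0_1) as [M H]. exists M. intros x Hx. specialize (H x Hx).
  assert (N := Cexp_neq_0 (- a * x)).
  split.
  - intros Z. rewrite Z in H. replace (0 / Cexp (- a * x) - 1) with (- (1)) in H by (field; auto).
    rewrite Cmod_opp, Cmod_1 in H. lra.
  - assert (T := Cmod_triangle (u x / Cexp (- a * x) - 1) 1).
    replace (u x / Cexp (- a * x) - 1 + 1) with (u x / Cexp (- a * x)) in T by ring.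
    rewrite Cmod_1, Cmod_div, Cmod_Cexp in T by auto.
    replace (Re (- a * x)) with (- Re a * x)%R in T by (unfold Re; simpl; ring).
    assert (P := exp_pos (- Re a * x)).
    apply Rmult_le_reg_r with (/ exp (- Re a * x))%R; [apply Rinv_0_lt_compat; auto|].
    rewrite Rmult_assoc, Rinv_r by lra. unfold Rdiv in T. lra.
Qed.

Lemma superexp_decay (m : R) : exists K, (0 < K)%R /\ forall x : R, (0 <= x)%R ->
  (exp (m * x - exp x) <= K * exp (- x))%R.
Proof.
  destruct (ln_le_lin 1 (Rabs m + 1) Rlt_0_1) as [K HK]. exists (exp K). split; [apply exp_pos|].
  intros x Hx. rewrite <- exp_plus. apply exp_le.
  assert (P := exp_pos x). specialize (HK (exp x) ltac:(lra)). fold (lg x) in HK.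
  assert (L := lg_ge x). assert (Q := Rle_abs m). assert (Pm := Rabs_pos m).
  assert (m * x <= Rabs m * x)%R by (apply Rmult_le_compat_r; auto).
  assert ((Rabs m + 1) * x <= (Rabs m + 1) * lg x)%R by (apply Rmult_le_compat_l; lra). lra.
Qed.

(** A solution with algebraic decay is recessive along the positive axis: the Wronskian of two
    such solutions is [c e^z z^(-b)], which is incompatible with algebraic growth unless [c = 0].
    The derivative of one solution only is controlled; the other is removed by integrating
    by parts, that is, by comparing [c] with the increments of [e^(-z) z^(b-1) u v]. *)
Lemma kummer_unique (a b : C) (S : C -> Prop) (u u1 v v1 : C -> C) (Cu : R) :
  convex S -> (forall x : R, S x) -> Ksol a b S u u1 -> Ksol a b S v v1 ->
  asym a u -> asym a v -> (forall x : R, (0 <= x)%R -> (Cmod (u1 x) <= Cu)%R) ->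
  forall w, S w -> u w = v w.
Proof.
  intros Cv SR U V AU AV BU.
  assert (PC : (0 <= Cu)%R) by (eapply Rle_trans; [apply Cmod_ge_0 | apply (BU 0%R); lra]).
  destruct (asym_bound a u AU) as [Mu Hu]. destruct (asym_bound a v AV) as [Mv Hv].
  set (c := wronskian u u1 v v1 0%R * Cexp (b * 0%R - Cexp 0%R)).
  assert (WC : forall w, S w -> wronskian u u1 v v1 w * Cexp (b * w - Cexp w) = c).
  { intros w Hw. apply (CD_zero_const S (fun w => wronskian u u1 v v1 w * Cexp (b * w - Cexp w))); auto.
    intros; eapply wronskian_CD; eauto. }
  assert (c0 : c = 0).
  (* [c = H' - Er] with [H] and [Er] superexponentially small; integrate over the segment from [x]
     to [x + 1] *)
  { set (H := fun x : R => Cexp ((b - 1) * x - Cexp x) * (u x * v x)).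
    set (Er := fun x : R => Cexp ((b - 1) * x - Cexp x) *
       ((b - 1 - Cexp x) * (u x * v x) + 2 * Cexp x * (u1 x * v x))).
    assert (DH : forall x, RD H x (c + Er x)).
    { intros x. destruct (U x (SR x)) as [U1 _]. destruct (V x (SR x)) as [V1 _].
      assert (L : forall f l, CD f (RtoC x) l -> RD (fun x : R => f x) x l).
      { intros f l D. eapply RD_eq; [apply (RD_comp f (fun x : R => RtoC x) x l 1); auto|ring].
        apply RD_RtoC. apply is_derive_Reals, derivable_pt_lim_id. }
      unfold H. eapply RD_eq.
      - apply RD_mult.
        + apply RD_exp, RD_minus; [apply RD_scal, (L (fun x => x) 1), CD_id | apply (L Cexp), CD_Cexp].
        + apply RD_mult; [apply (L u) | apply (L v)]; eassumption.
      - rewrite <- (WC x (SR x)). unfold Er, wronskian.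
        replace (b * x - Cexp x) with ((b - 1) * x - Cexp x + x) by ring.
        rewrite (Cexp_plus ((b - 1) * x - Cexp x) x). ring. }
    set (m1 := (Re b - 1 - 2 * Re a)%R). set (m2 := (Re b - 2 * Re a)%R). set (m3 := (Re b - Re a)%R).
    destruct (superexp_decay m1) as [K1 [P1 D1]]. destruct (superexp_decay m2) as [K2 [P2 D2]].
    destruct (superexp_decay m3) as [K3 [P3 D3]].
    set (K := (4 * K1 + (4 * Cmod (b - 1) * K1 + 4 * K2 + 4 * Cu * K3))%R).
    assert (Pb := Cmod_ge_0 (b - 1)).
    set (X := Rmax 0 (Rmax (Mu + 1) (Mv + 1))).
    assert (HX : forall x, (X <= x)%R -> (0 <= x)%R /\ (Mu < x)%R /\ (Mv < x)%R).
    { intros x Hx. unfold X in Hx.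
      generalize (Rmax_l 0 (Rmax (Mu + 1) (Mv + 1))) (Rmax_r 0 (Rmax (Mu + 1) (Mv + 1)))
        (Rmax_l (Mu + 1) (Mv + 1)) (Rmax_r (Mu + 1) (Mv + 1)). lra. }
    assert (Ex : forall (p : R), Cmod (Cexp ((b - 1) * p - Cexp p)) = exp ((Re b - 1) * p - exp p)).
    { intros p. rewrite Cmod_Cexp, Cexp_RtoC. f_equal. unfold Re; simpl; ring. }
    assert (BHE : forall x, (X <= x)%R -> (Cmod (H x) <= K * exp (- x))%R /\ (Cmod (Er x) <= K * exp (- x))%R).
    { intros x Hx. destruct (HX x Hx) as [x0 [x1 x2]].
      destruct (Hu x x1) as [_ bu]. destruct (Hv x x2) as [_ bv]. specialize (BU x x0).
      assert (Pe := exp_pos (- x)).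
      assert (UV : (Cmod (u x * v x) <= 4 * exp (- (2 * Re a) * x))%R).
      { rewrite Cmod_mult.
        replace (4 * exp (- (2 * Re a) * x))%R with (2 * exp (- Re a * x) * (2 * exp (- Re a * x)))%R.
        - apply Rmult_le_compat; auto using Cmod_ge_0.
        - replace (- (2 * Re a) * x)%R with (- Re a * x + - Re a * x)%R by ring. rewrite exp_plus. ring. }
      assert (b1 : (exp ((Re b - 1) * x - exp x) * (4 * exp (- (2 * Re a) * x)) <= 4 * (K1 * exp (- x)))%R).
      { eapply Rle_trans; [|apply Rmult_le_compat_l; [lra | apply (D1 x x0)]]. right.
        unfold m1. replace ((Re b - 1 - 2 * Re a) * x - exp x)%R with
          (((Re b - 1) * x - exp x) + - (2 * Re a) * x)%R by ring. rewrite (exp_plus _ (- (2 * Re a) * x)). ring. }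
      assert (b2 : (exp ((Re b - 1) * x - exp x) * exp x * (4 * exp (- (2 * Re a) * x)) <= 4 * (K2 * exp (- x)))%R).
      { eapply Rle_trans; [|apply Rmult_le_compat_l; [lra | apply (D2 x x0)]]. right.
        unfold m2. replace ((Re b - 2 * Re a) * x - exp x)%R with
          (((Re b - 1) * x - exp x) + x + - (2 * Re a) * x)%R by ring.
        rewrite (exp_plus _ (- (2 * Re a) * x)), (exp_plus _ x). ring. }
      assert (b3 : (exp ((Re b - 1) * x - exp x) * exp x * (2 * exp (- Re a * x)) <= 2 * (K3 * exp (- x)))%R).
      { eapply Rle_trans; [|apply Rmult_le_compat_l; [lra | apply (D3 x x0)]]. right.
        unfold m3. replace ((Re b - Re a) * x - exp x)%R with
          (((Re b - 1) * x - exp x) + x + - Re a * x)%R by ring.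
        rewrite (exp_plus _ (- Re a * x)), (exp_plus _ x). ring. }
      assert (Pq := exp_pos ((Re b - 1) * x - exp x)).
      assert (PK1 : (0 <= K1 * exp (- x))%R) by nra. assert (PK2 : (0 <= K2 * exp (- x))%R) by nra.
      assert (PK3 : (0 <= K3 * exp (- x))%R) by nra.
      assert (c3 := Rmult_le_pos _ _ PC PK3). assert (c1 := Rmult_le_pos _ _ Pb PK1).
      split.
      - unfold H. rewrite Cmod_mult, Ex.
        apply Rle_trans with (4 * (K1 * exp (- x)))%R.
        + eapply Rle_trans; [|apply b1]. apply Rmult_le_compat_l; lra.
        + unfold K. nra.
      - unfold Er. rewrite Cmod_mult, Ex.
        apply Rle_trans with (exp ((Re b - 1) * x - exp x) *
          ((Cmod (b - 1) + exp x) * (4 * exp (- (2 * Re a) * x)) + 2 * exp x * (Cu * (2 * exp (- Re a * x)))))%R.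
        + apply Rmult_le_compat_l; [lra|]. eapply Rle_trans; [apply Cmod_triangle|].
          apply Rplus_le_compat.
          * rewrite Cmod_mult. apply Rmult_le_compat; auto using Cmod_ge_0.
            unfold Cminus at 1. eapply Rle_trans; [apply Cmod_triangle|].
            rewrite Cmod_opp, Cmod_Cexp. simpl. lra.
          * rewrite !Cmod_mult, Cmod_Cexp, Cmod_R, Rabs_pos_eq by lra. simpl.
            apply Rmult_le_compat_l; [generalize (exp_pos x); lra|].
            apply Rmult_le_compat; auto using Cmod_ge_0.
        + unfold K.
          assert (c1' : (Cmod (b - 1) * (exp ((Re b - 1) * x - exp x) * (4 * exp (- (2 * Re a) * x))) <=
             Cmod (b - 1) * (4 * (K1 * exp (- x))))%R) by (apply Rmult_le_compat_l; auto).
          assert (c3' : (2 * Cu * (exp ((Re b - 1) * x - exp x) * exp x * (2 * exp (- Re a * x))) <=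
             2 * Cu * (2 * (K3 * exp (- x))))%R) by (apply Rmult_le_compat_l; lra).
          nra. }
    assert (PK : (0 < K)%R).
    { unfold K. assert (0 <= Cmod (b - 1) * K1)%R by nra. assert (0 <= Cu * K3)%R by nra. lra. }
    assert (Bc : forall x, (X <= x)%R -> (Cmod c <= 3 * K * exp (- x))%R).
    { intros x Hx.
      assert (M := RD_mvt (fun t : R => H t - t * c) (fun t => c + Er t - c) x (x + 1) (K * exp (- x)) ltac:(lra)).
      assert (T : (Cmod (H (x + 1)%R - (x + 1)%R * c - (H x - x * c)) <= K * exp (- x) * (x + 1 - x))%R).
      { apply M.
        - intros t _. apply RD_minus; auto. eapply RD_ext; [|apply (RD_line 0 c t)]. intros; simpl; ring.
        - intros t Ht. replace (c + Er t - c) with (Er t) by ring.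
          eapply Rle_trans; [apply BHE; lra|]. apply Rmult_le_compat_l; [lra | apply exp_le; lra]. }
      destruct (BHE x Hx) as [B0 _]. destruct (BHE (x + 1)%R ltac:(lra)) as [B1 _].
      assert (exp (- (x + 1)) <= exp (- x))%R by (apply exp_le; lra).
      assert (K * exp (- (x + 1)) <= K * exp (- x))%R by (apply Rmult_le_compat_l; lra).
      replace c with (- (H (x + 1)%R - (x + 1)%R * c - (H x - x * c)) + (H (x + 1)%R + - H x)).
      2:{ rewrite RtoC_plus. ring. }
      eapply Rle_trans; [apply Cmod_triangle|].
      eapply Rle_trans; [apply Rplus_le_compat_l, Cmod_triangle|]. rewrite !Cmod_opp. lra. }
    apply Cmod_eq_0. apply Rle_antisym; [|apply Cmod_ge_0].
    apply le_epsilon. intros eps He. rewrite Rplus_0_l.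
    set (x := Rmax X (3 * K / eps)).
    eapply Rle_trans; [apply (Bc x), Rmax_l|].
    assert (Hx : (3 * K / eps <= x)%R) by apply Rmax_r.
    assert (0 < 3 * K / eps)%R by (apply Rdiv_lt_0_compat; lra).
    apply Rmult_le_reg_r with (exp x); [apply exp_pos|].
    rewrite Rmult_assoc, <- exp_plus. replace (- x + x)%R with 0%R by ring. rewrite exp_0.
    assert (E := exp_ineq1_le x).
    apply Rle_trans with (eps * (3 * K / eps))%R; [right; field; lra|].
    apply Rmult_le_compat_l; lra. }
  (* the Wronskian vanishes, so [v] is a multiple of [u]; the asymptotics force the factor to be
     one *)
  set (x0 := (Rmax Mu Mv + 1)%R).
  assert (x1 : (Mu < x0)%R) by (unfold x0; generalize (Rmax_l Mu Mv); lra).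
  destruct (Hu x0 x1) as [N _].
  set (k := v x0 / u x0).
  assert (KV : forall w, S w -> v w - k * u w = 0).
  { intros w Hw.
    assert (Z := Ksol_zero a b S (fun w => 1 * v w + - k * u w) (fun w => 1 * v1 w + - k * u1 w) Cv
      (Ksol_lin a b S v v1 u u1 1 (- k) V U) x0 (SR x0)).
    replace (v w - k * u w) with (1 * v w + - k * u w) by ring. apply Z; auto.
    - unfold k. field; auto.
    - assert (Wz : wronskian u u1 v v1 x0 = 0).
      { assert (Q := WC x0 (SR x0)). rewrite c0 in Q.
        destruct (Ceq_dec (wronskian u u1 v v1 x0) 0) as [E|E]; auto.
        exfalso. apply (Cmult_neq_0 _ _ E (Cexp_neq_0 (b * x0 - Cexp x0))). auto. }
      unfold wronskian in Wz. unfold k.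
      replace (1 * v1 x0 + - (v x0 / u x0) * u1 x0) with ((u x0 * v1 x0 - u1 x0 * v x0) / u x0) by (field; auto).
      rewrite Wz. field; auto. }
  assert (K1 : k = 1).
  { assert (Z : k - 1 = 0).
    { apply Cmod_eq_0. apply Rle_antisym; [|apply Cmod_ge_0]. apply le_epsilon. intros eps He.
      rewrite Rplus_0_l. assert (Pk := Cmod_ge_0 k).
      assert (He2 : (0 < eps / (Cmod k + 1))%R) by (apply Rdiv_lt_0_compat; lra).
      destruct (AU _ He2) as [M1 H1]. destruct (AV _ He2) as [M2 H2].
      set (x := (Rmax M1 M2 + 1)%R).
      specialize (H1 x ltac:(unfold x; generalize (Rmax_l M1 M2); lra)).
      specialize (H2 x ltac:(unfold x; generalize (Rmax_r M1 M2); lra)).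
      assert (E : v x = k * u x) by (generalize (KV x (SR x)); intros Q;
        replace (v x) with (v x - k * u x + k * u x) by ring; rewrite Q; ring).
      rewrite E in H2.
      replace (k - 1) with (- (k * (u x / Cexp (- a * x) - 1)) + (k * u x / Cexp (- a * x) - 1))
        by (unfold Cdiv; ring).
      eapply Rle_trans; [apply Cmod_triangle|]. rewrite Cmod_opp, Cmod_mult.
      apply Rle_trans with ((Cmod k + 1) * (eps / (Cmod k + 1)))%R; [|right; field; lra].
      rewrite Rmult_plus_distr_r, Rmult_1_l.
      apply Rplus_le_compat; [apply Rmult_le_compat_l; lra | lra]. }
    replace k with (k - 1 + 1) by ring. rewrite Z. ring. }
  intros w Hw. generalize (KV w Hw). rewrite K1. intros Q.
  replace (v w) with (v w - 1 * u w + u w) by ring. rewrite Q. ring.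
Qed.

(** * The Gamma function *)

Lemma ccts_real (g : R -> R) (x : R) : continuous g x -> ccts (fun v : R => RtoC (g v)) x.
Proof. apply ccts_RtoC. Qed.

Lemma Re_CInt (g : R -> R) (a b : R) : (forall v, continuous g v) ->
  Re (CInt (fun v => RtoC (g v)) a b) = RInt g a b.
Proof. intros G. rewrite CInt_pair; [reflexivity|]. intros; apply ccts_real; auto. Qed.

Lemma CI_le (f : R -> C) (g : R -> R) : intg f -> (forall v, continuous g v) ->
  intg (fun v => RtoC (g v)) -> (forall v, (Cmod (f v) <= g v)%R) ->
  (Cmod (CI f) <= Re (CI (fun v => RtoC (g v))))%R.
Proof.
  intros F Gc G H. apply le_epsilon. intros eps He.
  destruct (CI_lim f F (eps / 2)) as [X [PX HX]]; [lra|].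
  destruct (CI_lim _ G (eps / 2)) as [Y [PY HY]]; [lra|].
  set (x := Rmax X Y). specialize (HX x (Rmax_l _ _)). specialize (HY x (Rmax_r _ _)).
  assert (Px : (0 < x)%R) by (unfold x; generalize (Rmax_l X Y); lra).
  assert (B : (Cmod (CInt f (- x) x) <= RInt g (- x) x)%R).
  { apply CInt_bound; [lra | apply F | | intros; apply H].
    apply (ex_RInt_continuous (V := R_CompleteNormedModule)); auto. }
  rewrite <- Re_CInt in B by auto.
  set (a := CInt f (- x) x) in *. set (b := CInt (fun v => RtoC (g v)) (- x) x) in *.
  assert (T1 := Cmod_triangle_inv (CI f) a).
  assert (T2 := re_le_Cmod (CI (fun v => RtoC (g v)) - b)).
  replace (Re (CI (fun v => RtoC (g v)) - b)) with (Re (CI (fun v => RtoC (g v))) - Re b)%R in T2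
    by (unfold Re; simpl; ring).
  apply Rabs_le_between in T2. lra.
Qed.

Lemma CI_pos (g : R -> R) : (forall v, continuous g v) ->
  intg (fun v => RtoC (g v)) -> (forall v, (0 < g v)%R) -> (0 < Re (CI (fun v => RtoC (g v))))%R.
Proof.
  intros Gc G P.
  assert (ex : forall a b, ex_RInt g a b)
    by (intros; apply (ex_RInt_continuous (V := R_CompleteNormedModule)); auto).
  assert (c0 : (0 < RInt g 0 1)%R).
  { apply RInt_gt_0; auto; lra. }
  destruct (CI_lim _ G (RInt g 0 1 / 2)) as [Y [PY HY]]; [lra|].
  set (x := Rmax 1 Y). specialize (HY x (Rmax_r _ _)). assert (Px : (1 <= x)%R) by apply Rmax_l.
  assert (E : (RInt g (- x) x = RInt g (- x) 0 + (RInt g 0 1 + RInt g 1 x))%R).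
  { rewrite <- (RInt_Chasles g (- x) 0 x), <- (RInt_Chasles g 0 1 x) by auto. reflexivity. }
  assert (N : forall a b, (a <= b)%R -> (0 <= RInt g a b)%R).
  { intros a b Hab. apply RInt_ge_0; auto. intros; left; auto. }
  assert (T2 := re_le_Cmod (CI (fun v => RtoC (g v)) - CInt (fun v => RtoC (g v)) (- x) x)).
  replace (Re (CI (fun v => RtoC (g v)) - CInt (fun v => RtoC (g v)) (- x) x)) with
    (Re (CI (fun v => RtoC (g v))) - Re (CInt (fun v => RtoC (g v)) (- x) x))%R in T2
    by (unfold Re; simpl; ring).
  rewrite Re_CInt, E in T2 by auto.
  generalize (N (- x) 0 ltac:(lra))%R (N 1 x Px)%R. intros.
  apply Rabs_le_between in T2. lra.
Qed.

(** Mellin transforms of rapidly decreasing functions, in the variable [v = ln t]. *)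
Definition mel (h : R -> C) (z : C) : C := CI (fun v => Cexp (z * v) * h v).

Lemma mel_ET h z : mel h z = ET (fun v => (- v)%R) h z.
Proof.
  apply CI_ext. intros v. f_equal. f_equal. rewrite RtoC_opp. ring.
Qed.

Lemma abs_le_lg (v : R) : (Rabs v <= - v + 2 * lg v)%R.
Proof.
  unfold Rabs. destruct (Rcase_abs v).
  - generalize (lg_pos v); lra.
  - generalize (lg_ge v); lra.
Qed.

Lemma mel_dom (h : R -> C) (K x : R) : (0 < x)%R -> (forall v, ccts h v) ->
  (forall v, (Cmod (h v) <= K * exp (- exp v))%R) ->
  exists M, ET_dom (fun v => (- v)%R) h x (x / 4) M.
Proof.
  intros Hx H B.
  assert (PK : (0 <= K)%R).
  { generalize (B 0%R) (Cmod_ge_0 (h 0%R)) (exp_pos (- exp 0)); intros. nra. }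
  destruct (ln_le_lin (x / 4) 2 ltac:(lra)) as [K2 H2].
  destruct (double_exp_bound 1 (x / 2) x Rlt_0_1 ltac:(lra)) as [M HM].
  exists (K * exp K2 * M)%R. split; [|split; auto].
  - intros v. apply (continuous_opp (V := R_NormedModule)), continuous_id.
  - intros v. rewrite Rabs_Ropp. replace (- v * - v)%R with (v * v)%R by ring.
    assert (E : (1 + v * v <= exp (x / 4 * Rabs v + K2))%R).
    { rewrite <- (exp_ln (1 + v * v)) by apply one_plus_sqr_pos. apply exp_le.
      eapply Rle_trans; [|apply H2, Rabs_pos].
      rewrite <- (Rabs_pos_eq (v * v)) by apply Rle_0_sqr. rewrite Rabs_mult.
      apply ln_sqr_le, Rabs_pos. }
    apply Rle_trans with (exp (x / 4 * Rabs v + K2) * exp (x / 4 * Rabs v - x * - v) * (K * exp (- exp v)))%R.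
    + apply Rmult_le_compat; auto using Cmod_ge_0.
      * apply Rmult_le_pos; [nra | left; apply exp_pos].
      * apply Rmult_le_compat_r; auto. left; apply exp_pos.
    + apply Rle_trans with (K * exp K2 * exp (- (1 * exp v) + x / 2 * v + x * lg v))%R.
      * assert (A := abs_le_lg v).
        replace (exp (x / 4 * Rabs v + K2) * exp (x / 4 * Rabs v - x * - v) * (K * exp (- exp v)))%R
          with (K * exp K2 * exp (x / 4 * Rabs v + (x / 4 * Rabs v - x * - v) + - exp v))%R
          by (rewrite !exp_plus; ring).
        apply Rmult_le_compat_l; [apply Rmult_le_pos; auto; left; apply exp_pos|].
        apply exp_le. nra.
      * unfold Rdiv in *. rewrite (Rmult_assoc _ M). apply Rmult_le_compat_l; [|apply HM].
        apply Rmult_le_pos; auto. left; apply exp_pos.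
Qed.

Lemma mel_intg (h : R -> C) (K : R) (z : C) : (0 < Re z)%R -> (forall v, ccts h v) ->
  (forall v, (Cmod (h v) <= K * exp (- exp v))%R) -> intg (fun v => Cexp (z * v) * h v).
Proof.
  intros Hz H B. destruct (mel_dom h K (Re z) Hz H B) as [M D].
  destruct (ET_intg _ h (Re z) (Re z / 4) M z ltac:(lra) D) as [I _].
  - rewrite Rminus_diag, Rabs_R0; lra.
  - revert I. apply intg_ext. intros v. simpl. f_equal. f_equal. rewrite RtoC_opp. ring.
Qed.

Lemma mel_CD (h : R -> C) (K : R) (z : C) : (0 < Re z)%R -> (forall v, ccts h v) ->
  (forall v, (Cmod (h v) <= K * exp (- exp v))%R) -> exists l, CD (mel h) z l.
Proof.
  intros Hz H B. destruct (mel_dom h K (Re z) Hz H B) as [M D].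
  eexists. apply CD_ext with (ET (fun v => (- v)%R) h).
  - intros; symmetry; apply mel_ET.
  - apply (ET_CD _ h (Re z) (Re z / 4) M z ltac:(lra) D eq_refl).
Qed.

Lemma scal_C (r : R) (c : C) : @scal R_Ring C_R_NormedModule r c = RtoC r * c.
Proof.
  destruct c as [x y]. apply C_eq; unfold scal, Re, Im; simpl; unfold scal; simpl; unfold mult; simpl;
  match goal with |- @eq _ ?a ?b => change (@eq R a b) end; ring.
Qed.

Definition hG (v : R) : C := RtoC (exp (- exp v)).

Lemma hG_ccts v : ccts hG v.
Proof.
  apply ccts_RtoC. apply ccts_exp, (continuous_opp (V := R_NormedModule)), continuous_exp.
Qed.

Lemma hG_bound v : (Cmod (hG v) <= 1 * exp (- exp v))%R.
Proof. unfold hG. rewrite Cmod_R, Rabs_pos_eq; [lra | left; apply exp_pos]. Qed.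

Lemma hG_intg z : (0 < Re z)%R -> intg (fun v => Cexp (z * v) * hG v).
Proof. intros; apply mel_intg with 1%R; auto using hG_ccts, hG_bound. Qed.

(** The substitution [t = e^v]. *)
Lemma is_RInt_gen_halfline (z : C) : (0 < Re z)%R ->
  is_RInt_gen (V := C_R_NormedModule) (fun t : R => Cexp ((z - 1) * ln t - t))
    (at_right 0) (Rbar_locally p_infty) (mel hG z).
Proof.
  intros Hz. assert (I := hG_intg z Hz). destruct (CI_spec _ I) as [_ T].
  destruct (I) as [F [M B]]. specialize (T M B). fold (mel hG z) in T.
  intros P [eps HP].
  destruct (tails_lim M (eps / 2)) as [X [PX HX]]; [generalize (cond_pos eps); lra|].
  apply Filter_prod with (fun a => (0 < a < exp (- X))%R) (fun b => (exp X < b)%R).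
  - exists (mkposreal _ (exp_pos (- X))). intros y Hy Hy0. split; auto.
    change (Rabs (y - 0) < exp (- X))%R in Hy. apply Rabs_def2 in Hy. lra.
  - exists (exp X). auto.
  - intros a b [Ha Ha'] Hb.
    assert (Hb0 : (0 < b)%R) by (generalize (exp_pos X); lra).
    assert (la : (ln a < - X)%R) by (rewrite <- (ln_exp (- X)); apply ln_increasing; auto).
    assert (lb : (X < ln b)%R) by (rewrite <- (ln_exp X); apply ln_increasing; auto using exp_pos).
    exists (CInt (fun v : R => Cexp (z * v) * hG v) (ln a) (ln b)). split.
    + simpl.
      set (f := fun t : R => Cexp ((z - 1) * ln t - t)).
      assert (cf : forall x, continuous (f : R -> C_R_CompleteNormedModule) (exp x)).
      { intros x. apply ccts_continuous. unfold f. apply ccts_Cexp, ccts_minus.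
        - apply ccts_mult; [apply ccts_const|]. apply ccts_RtoC.
          apply (ex_derive_continuous (V := R_NormedModule) ln). eexists.
          apply is_derive_Reals, derivable_pt_lim_ln, exp_pos.
        - apply ccts_RtoC, continuous_id. }
      assert (Q := is_RInt_comp (V := C_R_CompleteNormedModule) f exp exp (ln a) (ln b)).
      rewrite !exp_ln in Q by auto.
      assert (exf : ex_RInt (V := C_R_CompleteNormedModule) f a b).
      { apply (ex_RInt_continuous (V := C_R_CompleteNormedModule)). intros x Hx.
        assert (0 < x)%R.
        { eapply Rlt_le_trans; [|apply Hx]. apply Rmin_pos; auto. }
        rewrite <- (exp_ln x) by auto. apply cf. }
      assert (E : CInt (fun v : R => Cexp (z * v) * hG v) (ln a) (ln b) = CInt f a b).
      { apply CInt_unique.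
        apply (is_RInt_ext (V := C_R_NormedModule) (fun y : R => scal (exp y) (f (exp y)))).
        - intros x _. unfold f, hG. rewrite ln_exp.
          transitivity (RtoC (exp x) * Cexp ((z - 1) * x - exp x)).
          + apply scal_C.
          + rewrite <- !Cexp_RtoC, <- !Cexp_plus. f_equal. rewrite RtoC_opp. rewrite Cexp_RtoC. ring.
        - apply Q; [intros; apply cf|]. intros x _. split.
          + apply is_derive_Reals, derivable_pt_lim_exp.
          + apply continuous_exp. }
      rewrite E. apply (RInt_correct (V := C_R_CompleteNormedModule)). exact exf.
    + apply HP. set (g := fun v : R => Cexp (z * v) * hG v) in *.
      assert (Q : (Cmod (CInt g (ln a) (ln b) - mel hG z)%C < eps)%R).
      { rewrite Cmod_sub_rev. eapply Rle_lt_trans; [apply T; lra|].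
        eapply Rle_lt_trans; [apply HX; lra|]. generalize (cond_pos eps); lra. }
      split.
      * apply Rle_lt_trans with (2 := Q). apply (re_le_Cmod (CInt g (ln a) (ln b) - mel hG z)).
      * apply Rle_lt_trans with (2 := Q). apply (im_le_Cmod (CInt g (ln a) (ln b) - mel hG z)).
Qed.

Lemma Gamma_mel (z : C) : (0 < Re z)%R -> Gamma z = mel hG z.
Proof.
  intros Hz. unfold Gamma.
  assert (N : Z.to_nat (up (- Re z)) = 0%nat).
  { destruct (archimed (- Re z)) as [A B].
    assert (L : (IZR (up (- Re z)) < 1)%R) by lra. apply lt_IZR in L. lia. }
  rewrite N. simpl. replace (z + 0) with z by ring. unfold Cdiv.
  replace (/ 1) with (RtoC 1) by (field). rewrite Cmult_1_r.
  unfold Gamma_integral.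
  exact (@is_RInt_gen_unique C_R_CompleteNormedModule (at_right 0) (Rbar_locally p_infty)
      (Proper_StrongProper _ (at_right_proper_filter 0)) (Proper_StrongProper _ (Rbar_locally_filter p_infty))
      _ _ (is_RInt_gen_halfline z Hz)).
Qed.

Lemma mel_hG_succ (z : C) : (0 < Re z)%R -> mel hG (z + 1) = z * mel hG z.
Proof.
  intros Hz. assert (I := hG_intg z Hz).
  assert (I1 : intg (fun v => Cexp ((z + 1) * v) * hG v)) by (apply hG_intg; unfold Re in *; simpl; lra).
  set (g' := fun v : R => z * (Cexp (z * v) * hG v) - Cexp ((z + 1) * v) * hG v).
  assert (Ig : intg g') by (apply intg_minus; auto; apply intg_scal; auto).
  destruct I as [F [M B]] eqn:EI.
  assert (Z := CI_FTC0 (fun v : R => Cexp (z * v) * hG v) g' M).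
  assert (Z1 : CI g' = 0).
  { apply Z; auto. intros t. unfold g', hG. eapply RD_eq.
    - apply RD_mult.
      + apply RD_exp, RD_scal, RD_RtoC, is_derive_Reals, derivable_pt_lim_id.
      + apply RD_RtoC. apply (is_derive_comp (V := R_NormedModule) exp (fun t => - exp t)%R).
        * apply is_derive_Reals, derivable_pt_lim_exp.
        * apply (is_derive_opp (V := R_NormedModule)). apply is_derive_Reals, derivable_pt_lim_exp.
    - unfold scal, opp; simpl; unfold mult; simpl. rewrite RtoC_mult, RtoC_opp.
      replace ((z + 1) * t) with (z * t + t) by ring. rewrite Cexp_plus, Cexp_RtoC. ring. }
  unfold g' in Z1. rewrite CI_minus, CI_scal in Z1; auto.
  - fold (mel hG z) in Z1. fold (mel hG (z + 1)) in Z1.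
    replace (mel hG (z + 1)) with (z * mel hG z - (z * mel hG z - mel hG (z + 1))) by ring.
    rewrite Z1. ring.
  - apply intg_scal; auto.
Qed.

Lemma mel_hG_real (a : R) : mel hG a = CI (fun v => RtoC (exp (a * v + - exp v))).
Proof.
  apply CI_ext. intros v. unfold hG. rewrite <- RtoC_mult, Cexp_RtoC, <- RtoC_mult, <- exp_plus. auto.
Qed.

Lemma continuous_hGr (a v : R) : continuous (fun v => exp (a * v + - exp v)) v.
Proof.
  apply (ex_derive_continuous (V := R_NormedModule)). auto_derive. auto.
Qed.

Lemma intg_hGr (a : R) : (0 < a)%R -> intg (fun v => RtoC (exp (a * v + - exp v))).
Proof.
  intros Ha. apply intg_ext with (fun v : R => Cexp (a * v) * hG v); [|apply hG_intg; auto].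
  intros v. unfold hG. rewrite <- RtoC_mult, Cexp_RtoC, <- RtoC_mult, <- exp_plus. auto.
Qed.

Lemma mel_hG_pos (a : R) : (0 < a)%R -> (0 < Re (mel hG a))%R.
Proof.
  intros Ha. rewrite mel_hG_real. apply CI_pos.
  - apply continuous_hGr.
  - apply intg_hGr; auto.
  - intros; apply exp_pos.
Qed.

Lemma CI_real_Im (g : R -> R) : (forall v, continuous g v) -> intg (fun v => RtoC (g v)) ->
  Im (CI (fun v => RtoC (g v))) = 0%R.
Proof.
  intros Gc G.
  assert (E : (Rabs (Im (CI (fun v => RtoC (g v)))) <= 0)%R).
  { apply le_epsilon. intros eps He. rewrite Rplus_0_l.
    destruct (CI_lim _ G eps He) as [X [PX HX]]. specialize (HX X (Rle_refl _)).
    eapply Rle_trans; [|apply HX]. eapply Rle_trans; [|apply im_le_Cmod].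
    right. f_equal. rewrite CInt_pair by (intros; apply ccts_real; auto).
    unfold Im; simpl.
    rewrite (RInt_const (V := R_CompleteNormedModule)). unfold scal; simpl; unfold mult; simpl. ring. }
  assert (P := Rabs_pos (Im (CI (fun v => RtoC (g v))))).
  apply Rabs_eq_0. lra.
Qed.

Lemma cosh_ge (y : R) : (y * y <= exp y + exp (- y) - 2)%R.
Proof.
  assert (W : forall y, (0 <= y)%R -> (y * y <= exp y + exp (- y) - 2)%R).
  { intros x Hx.
    destruct (MVT_gen (fun y => exp y + exp (- y) - 2 - y * y)%R 0 x
      (fun y => exp y - exp (- y) - 2 * y)%R) as [c [Hc E]].
    - intros t _. auto_derive; auto. ring.
    - intros t _. apply continuity_pt_filterlim, (ex_derive_continuous (V := R_NormedModule)
        (fun y => exp y + exp (- y) - 2 - y * y)%R). auto_derive; auto.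
    - rewrite Rmin_left, Rmax_right in Hc by auto.
      destruct (MVT_gen (fun y => exp y - exp (- y) - 2 * y)%R 0 c
        (fun y => exp y + exp (- y) - 2)%R) as [d [Hd E2]].
      + intros t _. auto_derive; auto. ring.
      + intros t _. apply continuity_pt_filterlim, (ex_derive_continuous (V := R_NormedModule)
          (fun y => exp y - exp (- y) - 2 * y)%R). auto_derive; auto.
      + rewrite !Ropp_0, exp_0 in *.
        assert (0 <= exp d + exp (- d) - 2)%R.
        { rewrite exp_Ropp. assert (P := exp_pos d).
          replace (exp d + / exp d - 2)%R with ((exp d - 1) * (exp d - 1) * / exp d)%R by (field; lra).
          apply Rmult_le_pos; [apply Rle_0_sqr | left; apply Rinv_0_lt_compat; auto]. }
        assert (0 <= exp c - exp (- c) - 2 * c)%R by nra. nra. }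
  destruct (Rle_dec 0 y); auto.
  generalize (W (- y)%R ltac:(lra)). rewrite Ropp_involutive. lra.
Qed.

Lemma CI_lin3 (f0 f1 f2 : R -> C) (c c0 c1 c2 c3 : C) : intg f0 -> intg f1 -> intg f2 ->
  CI (fun v => c * (c0 * f0 v + c1 * (c2 * f1 v + c3 * f2 v))) =
  c * (c0 * CI f0 + c1 * (c2 * CI f1 + c3 * CI f2)).
Proof.
  intros I0 I1 I2.
  assert (J0 := intg_scal c0 f0 I0). assert (J1 := intg_scal c2 f1 I1).
  assert (J2 := intg_scal c3 f2 I2). assert (J12 := intg_plus _ _ J1 J2).
  assert (J3 := intg_scal c1 _ J12). assert (J4 := intg_plus _ _ J0 J3).
  rewrite (CI_scal c _ J4), (CI_plus _ _ J0 J3), (CI_scal c1 _ J12), (CI_plus _ _ J1 J2).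
  rewrite (CI_scal c0 f0 I0), (CI_scal c2 f1 I1), (CI_scal c3 f2 I2). reflexivity.
Qed.

(** For large [a] the measure [e^(a v - e^v) dv] concentrates near [v = ln (a - 1)], so its
    oscillating integral cannot vanish; [cosh_ge] turns the variance into values of Gamma. The
    functional equation extends the result to [0 < Re z]. *)
Lemma mel_hG_neq_0_large (a tau : R) : (2 * (Rabs tau + 1) * (Rabs tau + 1) + 2 < a)%R ->
  mel hG (a, tau) <> 0.
Proof.
  intros Ha. set (T := (Rabs tau + 1)%R) in *. assert (PT := Rabs_pos tau).
  assert (T1 : (1 <= T)%R) by (unfold T; lra).
  set (m := (a - 1)%R). assert (Hm : (2 * T * T + 1 < m)%R) by (unfold m; lra).
  assert (m0 : (0 < m)%R) by nra.
  set (A := Re (mel hG a)).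
  assert (A0 : (0 < A)%R) by (apply mel_hG_pos; unfold m in *; lra).
  assert (EA : mel hG a = A).
  { unfold A. rewrite mel_hG_real. apply C_eq; [reflexivity|].
    rewrite CI_real_Im; auto using continuous_hGr. apply intg_hGr. unfold m in *; lra. }
  (* [|y| <= e / 2 + y^2 / (2 e)] and [cosh_ge] bound the relative oscillation by [g], whose
     integral is explicit; [e] balances the two terms *)
  set (e := (/ T)%R).
  set (g := fun v : R => (Rabs tau * ((e / 2 - / e) * exp (a * v + - exp v) +
     / (2 * e) * (/ m * exp ((a + 1) * v + - exp v) + m * exp ((a - 1) * v + - exp v))))%R).
  assert (e0 : (0 < e)%R) by (apply Rinv_0_lt_compat; lra).
  assert (gc : forall v, continuous g v).
  { intros v. apply (ex_derive_continuous (V := R_NormedModule)). unfold g. auto_derive. auto. }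
  assert (gE : forall v, RtoC (g v) = Rabs tau * (((e / 2 - / e)%R * RtoC (exp (a * v + - exp v))) +
     ((/ (2 * e))%R * ((/ m)%R * RtoC (exp ((a + 1) * v + - exp v)) + m * RtoC (exp ((a - 1) * v + - exp v)))))).
  { intros v. unfold g. rewrite !RtoC_mult, !RtoC_plus, !RtoC_mult, !RtoC_plus, !RtoC_mult. reflexivity. }
  assert (I0 : intg (fun v => RtoC (exp (a * v + - exp v)))) by (apply intg_hGr; unfold m in *; lra).
  assert (I1 : intg (fun v => RtoC (exp ((a + 1) * v + - exp v)))) by (apply intg_hGr; unfold m in *; lra).
  assert (I2 : intg (fun v => RtoC (exp ((a - 1) * v + - exp v)))) by (apply intg_hGr; unfold m in *; lra).
  assert (gI : intg (fun v => RtoC (g v))).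
  { eapply intg_ext; [intros v; symmetry; apply gE|].
    apply intg_scal, intg_plus; [apply intg_scal; auto|].
    apply intg_scal, intg_plus; apply intg_scal; auto. }
  assert (Eg : CI (fun v => RtoC (g v)) = RtoC (Rabs tau * (e / 2 + / (2 * e * m)) * A)%R).
  { rewrite (CI_ext _ _ gE).
    rewrite (CI_lin3 _ _ _ _ _ _ _ _ I0 I1 I2).
    rewrite <- !mel_hG_real.
    assert (R0 : (0 < Re (RtoC a))%R) by (simpl; unfold m in *; lra).
    assert (R1 : (0 < Re (RtoC (a - 1)))%R) by (simpl; unfold m in *; lra).
    assert (S1 := mel_hG_succ (RtoC a) R0). assert (S2 := mel_hG_succ (RtoC (a - 1)) R1).
    rewrite <- RtoC_plus in S1, S2. replace (a - 1 + 1)%R with a in S2 by ring.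
    fold m in S2. rewrite EA in S1, S2.
    assert (S3 : mel hG m = RtoC (A / m)).
    { assert (Nm : RtoC m <> 0) by (intros Q; apply RtoC_inj in Q; lra).
      rewrite RtoC_div, S2 by lra. field; auto. }
    rewrite S1, EA. fold m. rewrite S3. rewrite <- !RtoC_mult, <- !RtoC_plus, <- !RtoC_mult, <- RtoC_plus, <- RtoC_mult.
    f_equal. unfold m in *. field. split; lra. }
  set (c := Cexp (RtoC (ln m) * (0, tau))).
  assert (Iz : intg (fun v => Cexp ((a, tau) * v) * hG v)) by (apply hG_intg; simpl; unfold m in *; lra).
  assert (Ia : intg (fun v : R => Cexp (a * v) * hG v)) by (apply hG_intg; simpl; unfold m in *; lra).
  assert (D : (Cmod (mel hG (a, tau) - c * A) <= Rabs tau * (e / 2 + / (2 * e * m)) * A)%R).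
  { rewrite <- EA. unfold mel. rewrite <- CI_scal, <- CI_minus; auto; [|apply intg_scal; auto].
    assert (Q := CI_le (fun v : R => Cexp ((a, tau) * v) * hG v - c * (Cexp (a * v) * hG v)) g).
    rewrite Eg in Q. apply Q; auto.
    - apply intg_minus; auto. apply intg_scal; auto.
    - intros v.
      assert (E : Cexp ((a, tau) * v) * hG v - c * (Cexp (a * v) * hG v) =
         c * (Cexp (a * v) * hG v) * (Cexp (RtoC (v - ln m) * (0, tau)) - 1)).
      { unfold c. replace ((a, tau) * v) with (RtoC (ln m) * (0, tau) + a * v + RtoC (v - ln m) * (0, tau)).
        - rewrite !Cexp_plus. ring.
        - rewrite RtoC_minus. apply C_eq; unfold Re, Im; simpl; ring. }
      rewrite E, !Cmod_mult. unfold c. rewrite Cmod_Cexp.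
      replace (Re (RtoC (ln m) * (0, tau))) with 0%R by (unfold Re; simpl; ring). rewrite exp_0, Rmult_1_l.
      assert (Em : (Cmod (Cexp (a * v)) * Cmod (hG v) = exp (a * v + - exp v))%R).
      { rewrite Cmod_Cexp, exp_plus. f_equal.
        - f_equal. unfold Re; simpl; ring.
        - unfold hG. rewrite Cmod_R, Rabs_pos_eq; auto. left; apply exp_pos. }
      rewrite Em.
      assert (Eu : (Cmod (Cexp (RtoC (v - ln m) * (0, tau)) - 1) <= Rabs tau * Rabs (v - ln m))%R).
      { assert (M := RD_mvt (fun x : R => Cexp (x * (RtoC (v - ln m) * (0, tau))))
          (fun t : R => (RtoC (v - ln m) * (0, tau)) * Cexp (t * (RtoC (v - ln m) * (0, tau)))) 0 1
          (Rabs tau * Rabs (v - ln m))).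
        cbv beta in M. rewrite Cmult_1_l, Cmult_0_l, Cexp_0, Rminus_0_r, Rmult_1_r in M.
        apply M; [lra | intros; apply Cexp_line|].
        intros t _. rewrite Cmod_mult, Cmod_Cexp.
        replace (Re (t * (RtoC (v - ln m) * (0, tau)))) with 0%R by (unfold Re; simpl; ring).
        rewrite exp_0, Rmult_1_r, Cmod_mult, Cmod_R, Rmult_comm. apply Rmult_le_compat_r; [apply Rabs_pos|].
        eapply Rle_trans; [apply Cmod_le_sum|]. simpl. rewrite Rabs_R0. lra. }
      set (y := (v - ln m)%R) in *.
      assert (Ey : (Rabs y <= e / 2 + / (2 * e) * (exp y + exp (- y) - 2))%R).
      { assert (H := cosh_ge y).
        assert (Hs : (0 <= (Rabs y - e) * (Rabs y - e))%R) by apply Rle_0_sqr.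
        assert (Hy : (Rabs y * Rabs y = y * y)%R) by (rewrite <- Rabs_mult; apply Rabs_pos_eq, Rle_0_sqr).
        apply Rmult_le_reg_l with (2 * e)%R; [lra|].
        replace (2 * e * (e / 2 + / (2 * e) * (exp y + exp (- y) - 2)))%R with
          (e * e + (exp y + exp (- y) - 2))%R by (field; lra). nra. }
      assert (X1 : exp y = (exp v * / m)%R) by (unfold y, Rminus; rewrite exp_plus, exp_Ropp, exp_ln by auto; auto).
      assert (X2 : exp (- y) = (exp (- v) * m)%R).
      { unfold y. replace (- (v - ln m))%R with (- v + ln m)%R by ring. rewrite exp_plus, exp_ln by auto; auto. }
      assert (Pe := exp_pos (a * v + - exp v)).
      unfold g.
      replace ((a + 1) * v + - exp v)%R with (a * v + - exp v + v)%R by ring.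
      replace ((a - 1) * v + - exp v)%R with (a * v + - exp v + - v)%R by ring.
      rewrite (exp_plus _ v), (exp_plus _ (- v)). set (W := exp (a * v + - exp v)) in *.
      rewrite X1, X2 in Ey.
      apply Rle_trans with (W * (Rabs tau * (e / 2 + / (2 * e) * (exp v * / m + exp (- v) * m - 2))))%R.
      + apply Rmult_le_compat_l; [lra|]. eapply Rle_trans; [apply Eu|]. apply Rmult_le_compat_l; auto.
      + right. field. split; lra. }
  intros Z. rewrite Z in D. replace (0 - c * A) with (- (c * A)) in D by ring.
  rewrite Cmod_opp, Cmod_mult in D. unfold c in D. rewrite Cmod_Cexp in D.
  replace (Re (RtoC (ln m) * (0, tau))) with 0%R in D by (unfold Re; simpl; ring).
  rewrite exp_0, Rmult_1_l, Cmod_R, Rabs_pos_eq in D by lra.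
  assert (L : (Rabs tau * (e / 2 + / (2 * e * m)) < 1)%R).
  { unfold e. replace (/ (2 * / T * m))%R with (T / (2 * m))%R by (field; lra).
    assert (Q1 : (Rabs tau * (/ T / 2) <= / 2)%R).
    { apply Rmult_le_reg_r with (2 * T)%R; [lra|].
      replace (Rabs tau * (/ T / 2) * (2 * T))%R with (Rabs tau) by (field; lra).
      replace (/ 2 * (2 * T))%R with T by field. unfold T; lra. }
    assert (Q2 : (Rabs tau * (T / (2 * m)) < / 2)%R).
    { apply Rmult_lt_reg_r with (2 * m)%R; [lra|].
      replace (Rabs tau * (T / (2 * m)) * (2 * m))%R with (Rabs tau * T)%R by (field; lra).
      replace (/ 2 * (2 * m))%R with m by field. unfold T in *. nra. }
    lra. }
  nra.
Qed.

Lemma mel_hG_neq_0 (z : C) : (0 < Re z)%R -> mel hG z <> 0.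
Proof.
  intros Hz.
  destruct (INR_unbounded (2 * (Rabs (Im z) + 1) * (Rabs (Im z) + 1) + 2)) as [n Hn].
  assert (W : forall n : nat, mel hG (z + INR n) <> 0 -> mel hG z <> 0).
  { clear n Hn. induction n as [|n IH].
    - simpl. replace (z + 0) with z by ring. auto.
    - intros H. apply IH. intros E. apply H. rewrite S_INR, RtoC_plus.
      replace (z + (INR n + 1)) with (z + INR n + 1) by ring.
      rewrite mel_hG_succ, E; [ring|]. unfold Re in *; simpl. generalize (pos_INR n); lra. }
  apply (W n). replace (z + INR n) with ((Re z + INR n)%R, Im z).
  - apply mel_hG_neq_0_large. lra.
  - apply C_eq; unfold Re, Im; simpl; ring.
Qed.

(** The Gaussian integral, for the value of Gamma at [3/2]. *)
Definition erf0 (x : R) : R := RInt (fun t => exp (- (t * t))) 0 x.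

Lemma ex_RInt_gauss a b : ex_RInt (fun t => exp (- (t * t))%R) a b.
Proof.
  apply (ex_RInt_continuous (V := R_CompleteNormedModule)). intros z _.
  apply (ex_derive_continuous (V := R_NormedModule) (fun t => exp (- (t * t)))%R). auto_derive. auto.
Qed.

Lemma erf0_derive x : is_derive erf0 x (exp (- (x * x))).
Proof.
  apply (is_derive_RInt (V := R_NormedModule) (fun t => exp (- (t * t))%R) erf0 0 x).
  - exists (mkposreal 1 Rlt_0_1). intros y _. apply (RInt_correct (V := R_CompleteNormedModule)), ex_RInt_gauss.
  - apply (ex_derive_continuous (V := R_NormedModule) (fun t => exp (- (t * t)))%R). auto_derive. auto.
Qed.

Lemma cont2_exp (g : R -> R -> R) x y : continuity_2d_pt g x y ->
  continuity_2d_pt (fun u v => exp (g u v)) x y.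
Proof.
  intros H. apply (continuity_1d_2d_pt_comp exp g); auto.
  apply derivable_continuous_pt, derivable_pt_exp.
Qed.

(** The two terms have opposite derivatives in [x], and at [x = 0] the second one is [atan 1]. *)
Lemma erf0_sqr (x : R) :
  (erf0 x * erf0 x + RInt (fun t => exp (- (x * x * (1 + t * t))) / (1 + t * t)) 0 1 = PI / 4)%R.
Proof.
  set (f := fun x t : R => (exp (- (x * x * (1 + t * t))) / (1 + t * t))%R).
  set (f' := fun x t : R => (- (2 * x * exp (- (x * x * (1 + t * t)))))%R).
  assert (D : forall u v, is_derive (fun z => f z v) u (f' u v)).
  { intros u v. unfold f, f'. auto_derive; auto. field. generalize (one_plus_sqr_pos v); lra. }
  assert (C : forall u v, continuity_2d_pt f' u v).
  { intros u v. unfold f'. apply continuity_2d_pt_opp, continuity_2d_pt_mult.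
    - apply continuity_2d_pt_mult; [apply continuity_2d_pt_const | apply continuity_2d_pt_id1].
    - apply cont2_exp, continuity_2d_pt_opp, continuity_2d_pt_mult;
      [apply continuity_2d_pt_mult; apply continuity_2d_pt_id1|].
      apply continuity_2d_pt_plus; [apply continuity_2d_pt_const|].
      apply continuity_2d_pt_mult; apply continuity_2d_pt_id2. }
  assert (exf : forall y, ex_RInt (fun t => f y t) 0 1).
  { intros y. apply (ex_RInt_continuous (V := R_CompleteNormedModule)). intros z _. unfold f.
    apply (ex_derive_continuous (V := R_NormedModule) (fun t => exp (- (y * y * (1 + t * t))) / (1 + t * t))%R).
    auto_derive. generalize (one_plus_sqr_pos z); lra. }
  set (F := fun x => (erf0 x * erf0 x + RInt (fun t => f x t) 0 1)%R).
  assert (DF : forall x : R, is_derive F x 0%R).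
  { intros y.
    assert (E : RInt (fun t => f' y t) 0 1 = (- (exp (- (y * y)) * erf0 y + erf0 y * exp (- (y * y))))%R).
    { replace (- (exp (- (y * y)) * erf0 y + erf0 y * exp (- (y * y))))%R with
        (scal (- 2 * exp (- (y * y)))%R (erf0 y)) by (unfold scal; simpl; unfold mult; simpl; ring).
      apply is_RInt_unique.
      apply (is_RInt_ext (V := R_NormedModule)
        (fun t => scal (- 2 * exp (- (y * y)))%R (scal y (exp (- ((y * t + 0) * (y * t + 0))))%R))).
      - intros t _. unfold f', scal; simpl; unfold mult; simpl.
        replace (- (y * y * (1 + t * t)))%R with (- (y * y) + - ((y * t + 0) * (y * t + 0)))%R by ring.
        rewrite exp_plus. ring.
      - apply (is_RInt_scal (V := R_NormedModule)).
        apply (is_RInt_comp_lin (V := R_NormedModule) (fun t => exp (- (t * t))%R) y 0 0 1).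
        replace (y * 0 + 0)%R with 0%R by ring. replace (y * 1 + 0)%R with y by ring.
        apply (RInt_correct (V := R_CompleteNormedModule)), ex_RInt_gauss. }
    assert (Z : ((exp (- (y * y)) * erf0 y + erf0 y * exp (- (y * y))) + RInt (fun t => f' y t) 0 1 = 0)%R)
      by (rewrite E; ring).
    refine (eq_ind _ (fun l : R => is_derive F y l) _ _ Z).
    apply (is_derive_plus (K := R_AbsRing) (V := R_NormedModule)).
    - apply (is_derive_mult (K := R_AbsRing) erf0 erf0); auto using erf0_derive. intros; apply Rmult_comm.
    - rewrite (RInt_ext _ (fun t => Derive (fun u => f u t) y)).
      + apply is_derive_RInt_param.
        * exists (mkposreal 1 Rlt_0_1). intros z _ t _. eexists; apply D.
        * intros t _. eapply continuity_2d_pt_ext; [|apply C]. intros u v. symmetry. apply is_derive_unique, D.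
        * exists (mkposreal 1 Rlt_0_1). intros z _. apply exf.
      + intros t _. symmetry. apply is_derive_unique, D. }
  assert (E : F x = F 0%R).
  { destruct (MVT_gen F 0 x (fun _ => 0%R)) as [z [_ Hz]].
    - intros; apply DF.
    - intros y _. apply continuity_pt_filterlim.
      apply (ex_derive_continuous (V := R_NormedModule)). eexists; apply DF.
    - rewrite Rmult_0_l in Hz. lra. }
  change (F x = PI / 4)%R. rewrite E. unfold F.
  replace (erf0 0) with 0%R by (symmetry; apply (RInt_point (V := R_CompleteNormedModule))).
  rewrite (RInt_ext _ (fun t => 1 / (1 + t * t))%R).
  - rewrite (is_RInt_unique _ _ _ _ (RInt_majorant 1 0 1)), atan_0, atan_1. field.
  - intros t _. unfold f. f_equal. replace (- (0 * 0 * (1 + t * t)))%R with 0%R by ring. apply exp_0.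
Qed.

Lemma erf0_pos x : (0 <= x)%R -> (0 <= erf0 x <= x)%R.
Proof.
  intros Hx. split.
  - apply RInt_ge_0; auto using ex_RInt_gauss. intros; left; apply exp_pos.
  - replace x with (RInt (fun _ => 1%R) 0 x) at 2
      by (rewrite (RInt_const (V := R_CompleteNormedModule)); unfold scal; simpl; unfold mult; simpl; ring).
    apply RInt_le; auto using ex_RInt_gauss, ex_RInt_const.
    intros t _. rewrite <- exp_0. apply exp_le. generalize (Rle_0_sqr t); unfold Rsqr; lra.
Qed.

Lemma erf0_lim x : (0 <= x)%R -> (Rabs (2 * erf0 x - sqrt PI) <= 4 / sqrt PI * exp (- (x * x)))%R.
Proof.
  intros Hx. assert (P := PI_RGT_0). assert (S := sqrt_lt_R0 PI P). assert (SS := sqrt_sqrt PI ltac:(lra)).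
  assert (E := erf0_sqr x). destruct (erf0_pos x Hx) as [E0 _].
  set (r := RInt (fun t => exp (- (x * x * (1 + t * t))) / (1 + t * t))%R 0 1) in *.
  assert (exr : ex_RInt (fun t => exp (- (x * x * (1 + t * t))) / (1 + t * t))%R 0 1).
  { apply (ex_RInt_continuous (V := R_CompleteNormedModule)). intros z _.
    apply (ex_derive_continuous (V := R_NormedModule) (fun t => exp (- (x * x * (1 + t * t))) / (1 + t * t))%R).
    auto_derive. generalize (one_plus_sqr_pos z); lra. }
  assert (r0 : (0 <= r <= exp (- (x * x)))%R).
  { split.
    - apply RInt_ge_0; auto; [lra|]. intros t _. apply Rmult_le_pos; [left; apply exp_pos|].
      left; apply Rinv_0_lt_compat, one_plus_sqr_pos.
    - replace (exp (- (x * x))) with (RInt (fun _ => exp (- (x * x))) 0 1)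
        by (rewrite (RInt_const (V := R_CompleteNormedModule)); unfold scal; simpl; unfold mult; simpl; ring).
      apply RInt_le; auto using ex_RInt_const; [lra|].
      intros t _. apply Rmult_le_reg_r with (1 + t * t)%R; [apply one_plus_sqr_pos|].
      unfold Rdiv. rewrite Rmult_assoc, Rinv_l, Rmult_1_r by (apply Rgt_not_eq, one_plus_sqr_pos).
      assert (L : (exp (- (x * x * (1 + t * t))) <= exp (- (x * x)))%R).
      { apply exp_le. assert (0 <= x * x * (t * t))%R by (apply Rmult_le_pos; apply Rle_0_sqr). lra. }
      assert (Q := exp_pos (- (x * x))). assert (0 <= t * t)%R by apply Rle_0_sqr. nra. }
  set (d := (2 * erf0 x - sqrt PI)%R). set (s := sqrt PI) in *.
  assert (Ed : (d * (2 * erf0 x + s) = - (4 * r))%R) by (unfold d; nra).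
  assert (dn : (d <= 0)%R). { destruct (Rle_dec d 0); auto. assert (0 < d * (2 * erf0 x + s))%R by nra. lra. }
  rewrite Rabs_left1 by auto.
  apply Rmult_le_reg_r with s; auto.
  replace (4 / s * exp (- (x * x)) * s)%R with (4 * exp (- (x * x)))%R by (field; lra). nra.
Qed.

Lemma mel_hG_half : mel hG (RtoC (1 / 2)) = RtoC (sqrt PI).
Proof.
  rewrite mel_hG_real.
  assert (P := PI_RGT_0). assert (S := sqrt_lt_R0 PI P).
  rewrite (CI_FTC (fun v => RtoC (2 * erf0 (exp (1 / 2 * v)))) _ 0 (RtoC (sqrt PI))).
  - ring.
  - intros t. apply RD_RtoC.
    replace (exp (1 / 2 * t + - exp t)) with
      (2 * (scal (1 / 2 * exp (1 / 2 * t)) (exp (- (exp (1 / 2 * t) * exp (1 / 2 * t))))))%R.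
    + apply is_derive_scal. apply (is_derive_comp (V := R_NormedModule) erf0 (fun v => exp (1 / 2 * v))).
      * apply erf0_derive.
      * auto_derive; auto. ring.
    + unfold scal; simpl; unfold mult; simpl. rewrite <- (exp_plus (1 / 2 * t) (1 / 2 * t)).
      replace (1 / 2 * t + 1 / 2 * t)%R with t by field. rewrite exp_plus. field.
  - apply intg_hGr. lra.
  - intros eps He.
    set (A := (4 / sqrt PI)%R). assert (PA : (0 < A)%R) by (apply Rdiv_lt_0_compat; lra).
    exists (Rmax (A / eps) (4 / eps)). intros x Hx.
    assert (Hx1 := Rle_trans _ _ _ (Rmax_l _ _) Hx). assert (Hx2 := Rle_trans _ _ _ (Rmax_r _ _) Hx).
    assert (x0 : (0 < x)%R) by (eapply Rlt_le_trans; [|exact Hx1]; apply Rdiv_lt_0_compat; auto).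
    split.
    + rewrite <- RtoC_minus, Cmod_R. eapply Rle_trans; [apply erf0_lim; left; apply exp_pos|]. fold A.
      rewrite <- exp_plus. replace (1 / 2 * x + 1 / 2 * x)%R with x by field.
      apply Rmult_le_reg_r with (exp (exp x)); [apply exp_pos|].
      rewrite Rmult_assoc, <- exp_plus. replace (- exp x + exp x)%R with 0%R by ring. rewrite exp_0, Rmult_1_r.
      assert (e1 := exp_ineq1_le x). assert (e2 := exp_ineq1_le (exp x)).
      apply Rle_trans with (eps * x)%R; [|apply Rmult_le_compat_l; lra].
      apply Rmult_le_reg_r with (/ eps)%R; [apply Rinv_0_lt_compat; auto|].
      replace (eps * x * / eps)%R with x by (field; lra). exact Hx1.
    + replace (RtoC (2 * erf0 (exp (1 / 2 * - x))) - 0) with (RtoC (2 * erf0 (exp (1 / 2 * - x)))) by ring.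
      assert (B := erf0_pos (exp (1 / 2 * - x)) ltac:(left; apply exp_pos)).
      rewrite Cmod_R, Rabs_pos_eq by lra.
      replace (1 / 2 * - x)%R with (- (x / 2))%R in * by field.
      apply Rle_trans with (2 * exp (- (x / 2)))%R; [lra|].
      apply Rmult_le_reg_r with (exp (x / 2)); [apply exp_pos|].
      rewrite Rmult_assoc, <- exp_plus. replace (- (x / 2) + x / 2)%R with 0%R by ring. rewrite exp_0, Rmult_1_r.
      assert (e1 := exp_ineq1_le (x / 2)).
      apply Rle_trans with (eps * (x / 2))%R; [|apply Rmult_le_compat_l; lra].
      apply Rmult_le_reg_r with (2 / eps)%R; [apply Rdiv_lt_0_compat; lra|].
      replace (eps * (x / 2) * (2 / eps))%R with x by (field; lra).
      replace (2 * (2 / eps))%R with (4 / eps)%R by (field; lra). exact Hx2.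
Qed.

Lemma mel_hG_three_halves : mel hG (RtoC (3 / 2)) = RtoC (sqrt PI / 2).
Proof.
  replace (RtoC (3 / 2)) with (RtoC (1 / 2) + 1).
  - rewrite mel_hG_succ, mel_hG_half; [|simpl; lra]. rewrite <- RtoC_mult. f_equal. field.
  - rewrite <- RtoC_plus. f_equal. field.
Qed.

(** * Asymptotics of the Laplace integral *)

Lemma convex_gt (m a b t : R) : (m < a)%R -> (m < b)%R -> (0 <= t <= 1)%R -> (m < (1 - t) * a + t * b)%R.
Proof. intros. destruct (Rle_dec a b); nra. Qed.

Lemma convex_lt (m a b t : R) : (a < m)%R -> (b < m)%R -> (0 <= t <= 1)%R -> ((1 - t) * a + t * b < m)%R.
Proof. intros. destruct (Rle_dec a b); nra. Qed.

Lemma slit_one_plus_exp (y : C) (k : R) : (- PI < Im y < PI)%R -> (0 <= k)%R -> slit (1 + k * Cexp y).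
Proof.
  intros B Hk. destruct (Req_dec (k * sin (Im y)) 0) as [Z|N].
  - left. destruct (Rmult_integral _ _ Z) as [E|E].
    + rewrite E. unfold Re; simpl. lra.
    + assert (Z2 : Im y = 0%R).
      { destruct (Rtotal_order (Im y) 0) as [L|[L|L]]; auto.
        - assert (sin (Im y) < 0)%R by (apply sin_lt_0_var; lra). lra.
        - assert (0 < sin (Im y))%R by (apply sin_gt_0; lra). lra. }
      unfold Cexp. rewrite Z2, cos_0, sin_0. unfold Re; simpl. generalize (exp_pos (Re y)). unfold Re. nra.
  - right. intros E. apply N. unfold Cexp, Im in *; simpl in *.
    assert (P := exp_pos (Re y)).
    assert (Q : (exp (Re y) * (k * sin (snd y)) = 0)%R) by lra.
    destruct (Rmult_integral _ _ Q); lra.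
Qed.

Lemma lam_log (y : C) : (- PI < Im y < PI)%R -> y + lam y = Clog (1 + Cexp y).
Proof.
  intros B.
  set (S := fun y : C => (- PI < Im y < PI)%R).
  assert (Cv : convex S).
  { intros a b [A1 A2] [B1 B2] t Ht. unfold S.
    replace (Im (a + t * (b - a))) with ((1 - t) * Im a + t * Im b)%R by (unfold Im; simpl; ring).
    split; [apply convex_gt | apply convex_lt]; auto. }
  assert (E := CD_zero_const S (fun y => Clog (1 + Cexp y) - (y + lam y)) Cv).
  assert (P := PI_RGT_0).
  assert (Z : Clog (1 + Cexp y) - (y + lam y) = Clog (1 + Cexp 0) - (0 + lam 0)).
  { apply E; auto; [|unfold S; simpl; lra].
    intros w Hw.
    assert (N1 : slit (1 + Cexp w)).
    { replace (1 + Cexp w) with (1 + 1%R * Cexp w) by ring. apply slit_one_plus_exp; auto; lra. }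
    assert (N2 := slit_neq_0 _ (slit_lam w Hw)). rewrite Cexp_opp in N2.
    assert (N3 := Cexp_neq_0 w). assert (N4 := slit_neq_0 _ N1).
    eapply CD_eq.
    - apply CD_minus.
      + apply (CD_comp Clog (fun w => 1 + Cexp w)); [apply CD_Clog; auto|].
        apply CD_plus; [apply CD_const | apply CD_Cexp].
      + apply CD_plus; [apply CD_id | apply CD_lam; auto].
    - rewrite Cexp_opp. field. repeat split; auto. intros Q. apply N4. rewrite <- Q. ring. }
  unfold lam at 2 in Z. replace (- RtoC 0) with (RtoC 0) in Z by ring.
  replace (y + lam y) with (Clog (1 + Cexp y) - (Clog (1 + Cexp y) - (y + lam y))) by ring.
  rewrite Z. ring.
Qed.

(** Mean value inequality for [(1 + k t)^g], [0 <= k <= 1]: the increment [(1 + t)^g - 1] is [O(t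
    (1 + t)^N)], uniformly in closed sectors away from the negative axis. *)
Lemma pow_sub_one (g : C) (th0 : R) : (0 <= th0 < PI)%R -> exists K, (0 < K)%R /\
  forall v th, (Rabs th <= th0)%R ->
  (Cmod (Cexp (g * ((v, th) + lam (v, th))) - 1)%C <= K * exp (v + Rabs (Re g) * lg v))%R.
Proof.
  intros H0. set (c := cos (th0 / 2)).
  assert (Pc : (0 < c)%R) by (apply cos_gt_0; lra).
  assert (c1 : (c <= 1)%R) by apply COS_bound.
  assert (lc : (ln c <= 0)%R).
  { rewrite <- ln_1. destruct c1 as [c1|c1]; [left; apply ln_increasing; auto | rewrite c1; right; auto]. }
  exists ((Cmod g + 1) / c * exp (Rabs (Im g) * PI + Rabs (Re g) * - ln c))%R.
  split.
  { apply Rmult_lt_0_compat; [|apply exp_pos]. apply Rdiv_lt_0_compat; auto. generalize (Cmod_ge_0 g); lra. }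
  intros v th Hth. assert (B := proj1 (Rabs_le_between _ _) Hth).
  assert (Bi : (- PI < Im (v, th) < PI)%R) by (simpl; lra).
  rewrite lam_log by auto.
  set (T := Cexp (v, th)).
  assert (ET : T = ((exp v * cos th)%R, (exp v * sin th)%R)) by reflexivity.
  assert (P := exp_pos v).
  assert (Sl : forall k : R, (0 <= k)%R -> slit (1 + k * T)) by (intros; apply slit_one_plus_exp; auto).
  assert (Bd : forall k : R, (0 <= k <= 1)%R -> (c * (1 + k * exp v) <= Cmod (1 + k * T) <= 1 + k * exp v)%R).
  { intros k Hk.
    assert (E : 1 + k * T = 1 + ((k * exp v * cos th)%R, (k * exp v * sin th)%R)).
    { rewrite ET. f_equal. apply C_eq; unfold Re, Im; simpl; ring. }
    rewrite E. destruct (Cmod_one_plus_polar (k * exp v) th) as [L U]; [nra|]. split; auto.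
    eapply Rle_trans; [|exact L]. rewrite Rmult_comm. apply Rmult_le_compat_l; [nra|].
    unfold c. rewrite <- (cos_neg (th / 2)). destruct (Rle_dec 0 th).
    - rewrite cos_neg. apply cos_decr_1; lra.
    - apply cos_decr_1; lra. }
  assert (M := RD_mvt (fun k : R => Cexp (g * Clog (1 + k * T)))
    (fun k : R => Cexp (g * Clog (1 + k * T)) * (g * (/ (1 + k * T) * T))) 0 1
    ((Cmod g + 1) / c * exp (Rabs (Im g) * PI + Rabs (Re g) * - ln c) * exp (v + Rabs (Re g) * lg v)) ltac:(lra)).
  cbv beta in M.
  rewrite Rminus_0_r, Rmult_1_r, Cmult_0_l, Cmult_1_l, Cplus_0_r in M.
  assert (L1 : Clog 1 = 0).
  { rewrite <- Cexp_0. apply Clog_Cexp. simpl. generalize PI_RGT_0; lra. }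
  rewrite L1, Cmult_0_r, Cexp_0 in M. apply M.
  - intros k Hk. apply (RD_exp (fun k : R => g * Clog (1 + k * T))). apply RD_scal.
    apply (RD_comp Clog (fun k : R => 1 + k * T)); [apply CD_Clog, Sl; lra | apply RD_line].
  - intros k Hk. destruct (Bd k Hk) as [L U].
    assert (N := slit_neq_0 _ (Sl k (proj1 Hk))).
    assert (N0 := proj1 (Cmod_gt_0 _) N).
    assert (ke : (0 <= k * exp v)%R) by (apply Rmult_le_pos; lra).
    assert (cL : (c <= Cmod (1 + k * T))%R) by (eapply Rle_trans; [|exact L]; nra).
    assert (cU : (Cmod (1 + k * T) <= 1 + exp v)%R) by (eapply Rle_trans; [exact U|]; nra).
    rewrite !Cmod_mult, Cmod_inv, Cmod_Cexp by auto.
    replace (Cmod T) with (exp v) by (unfold T; rewrite Cmod_Cexp; reflexivity).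
    assert (E1 : (Re (g * Clog (1 + k * T)) <= Rabs (Im g) * PI + Rabs (Re g) * - ln c + Rabs (Re g) * lg v)%R).
    { replace (Re (g * Clog (1 + k * T))) with (Re g * ln (Cmod (1 + k * T)) - Im g * Carg (1 + k * T))%R
        by (unfold Clog, Re, Im; simpl; ring).
      assert (A1 : (- (Im g * Carg (1 + k * T)) <= Rabs (Im g) * PI)%R).
      { eapply Rle_trans; [apply Rle_abs|]. rewrite Rabs_Ropp, Rabs_mult.
        apply Rmult_le_compat_l; [apply Rabs_pos|]. apply Rabs_le, Carg_bound. }
      assert (A2 : (Re g * ln (Cmod (1 + k * T)) <= Rabs (Re g) * (lg v - ln c))%R).
      { eapply Rle_trans; [apply Rle_abs|]. rewrite Rabs_mult. apply Rmult_le_compat_l; [apply Rabs_pos|].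
        apply Rabs_le. split.
        - assert (ln c <= ln (Cmod (1 + k * T)))%R; [|generalize (lg_pos v); lra].
          destruct cL as [H|H]; [left; apply ln_increasing; auto | right; f_equal; auto].
        - assert (ln (Cmod (1 + k * T)) <= lg v)%R; [|lra]. unfold lg.
          destruct cU as [H|H]; [left; apply ln_increasing; auto | right; f_equal; auto]. }
      lra. }
    apply Rle_trans with (exp (Rabs (Im g) * PI + Rabs (Re g) * - ln c + Rabs (Re g) * lg v) *
       ((Cmod g + 1) * (/ c * exp v)))%R.
    + apply Rmult_le_compat; [left; apply exp_pos | | apply exp_le; auto |].
      * apply Rmult_le_pos; [apply Cmod_ge_0|]. apply Rmult_le_pos; [|lra]. left; apply Rinv_0_lt_compat; auto.
      * apply Rmult_le_compat; [apply Cmod_ge_0 | | lra |].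
        -- apply Rmult_le_pos; [|lra]. left; apply Rinv_0_lt_compat; auto.
        -- apply Rmult_le_compat_r; [lra|]. apply Rinv_le_contravar; auto.
    + right. rewrite !exp_plus. field. lra.
Qed.

Lemma hJ_split (al be y : C) : hJ al be y = Cexp (al * y) * Cexp ((be - 1) * (y + lam y)).
Proof. unfold hJ. rewrite <- Cexp_plus. f_equal. ring. Qed.

Lemma hJ_one (al y : C) : hJ al 1 y = Cexp (al * y).
Proof. unfold hJ. f_equal. ring. Qed.

Lemma Jray_intg (al be : C) (th : R) (w : C) : (0 < Re al)%R -> adm w th ->
  intg (fun v : R => Cexp (- (Cexp (w + (0, th)) * exp v)) * hJ al be (v, th)).
Proof.
  intros Ha A. assert (P := adm_pos w th A). destruct (A) as [A1 A2]. apply Rabs_def2 in A1.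
  destruct (hJ_dom al be th _ Ha ltac:(lra) P) as [M D].
  set (z := Cexp (w + (0, th))) in *.
  destruct (ET_intg exp (fun v => hJ al be (v, th)) (Re z) (Re z / 2) M z ltac:(lra) D) as [I _]; auto.
  rewrite Rminus_diag, Rabs_R0; lra.
Qed.

(** For [be = 1] the Laplace integral at [z = 1] is Euler's, up to a rotation. *)
Lemma Gamma_ray (al : C) (ph : R) : (0 < Re al)%R -> (Rabs ph < PI / 2)%R ->
  Jray al 1 ph 0 = mel hG al.
Proof.
  intros Ha Hp. assert (P := PI_RGT_0).
  rewrite (Jray_indep al 1 ph 0 0 Ha).
  - unfold Jray, ET, mel. apply CI_ext. intros v. rewrite hJ_one. unfold hG.
    replace (0 + (0, 0)%R) with (RtoC 0) by (apply C_eq; simpl; ring).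
    rewrite Cexp_0, <- (Cexp_RtoC (- exp v)), RtoC_opp.
    change ((v, 0%R) : C) with (RtoC v).
    replace (- (1 * exp v)) with (- RtoC (exp v)) by ring. ring.
  - split; [lra|]. simpl. rewrite Rplus_0_l. auto.
  - split; [rewrite Rabs_R0; lra|]. simpl. rewrite Rplus_0_l, Rabs_R0. lra.
Qed.

(** After the shift [t -> t / z] the integrand differs from Euler's only by the factor [(1 + t /
    z)^(be - 1)], whose difference from one gains a power of [1 / z]. *)
Lemma J_asym_bound (al be : C) (delta : R) : (0 < Re al)%R -> (0 < delta)%R ->
  exists K, forall w : C, (0 <= Re w)%R -> (Rabs (Im w) <= 3 / 2 * PI - delta)%R ->
  (Cmod (Cexp (al * w) * J al be w - mel hG al)%C <= K * exp (- Re w))%R.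
Proof.
  intros Ha Hd. assert (P := PI_RGT_0).
  set (d := Rmin delta PI). assert (Pd : (0 < d)%R) by (apply Rmin_pos; auto).
  assert (d1 : (d <= delta)%R) by apply Rmin_l. assert (d2 : (d <= PI)%R) by apply Rmin_r.
  set (x0 := cos (PI / 2 - d / 3)). assert (Px : (0 < x0)%R) by (apply cos_gt_0; lra).
  destruct (pow_sub_one (be - 1) (PI - 2 * d / 3)) as [K [PK HK]]; [lra|].
  destruct (double_exp_bound x0 (Re al + 1) (Rabs (Re (be - 1)))) as [M HM]; [auto | lra |].
  set (K1 := exp (Rabs (Im al) * (PI / 2))).
  exists (PI * (K1 * K * M))%R. intros w Hw Hi.
  assert (Hi' := proj1 (Rabs_le_between _ _) Hi).
  assert (Hi3 : (Rabs (Im w) < 3 / 2 * PI)%R) by lra.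
  (* the shift [t -> t / z] turns the ray [th] of [J] into the ray [ph = arg z + th] of the gamma
     integral *)
  set (th := (- (2 / 3 * Im w))%R). set (ph := (Im w / 3)%R).
  assert (A : adm w th) by (apply adm_default; auto).
  assert (Bph : (Rabs ph <= PI / 2 - d / 3)%R) by (apply Rabs_le; unfold ph; lra).
  assert (Bth : (Rabs th <= PI - 2 * d / 3)%R) by (apply Rabs_le; unfold th; lra).
  assert (A0 : adm 0 ph).
  { split; [lra|]. simpl. rewrite Rplus_0_l. lra. }
  assert (I1 := Jray_intg al be th w Ha A).
  assert (I2 := intg_shift _ (- Re w) I1). assert (I0 := Jray_intg al 1 ph 0 Ha A0).
  assert (Ew : forall v : R, w + ((v + - Re w)%R, th) = (v, ph)).
  { intros v. apply C_eq; unfold ph, th; unfold Re, Im; simpl; field. }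
  rewrite <- (Gamma_ray al ph Ha ltac:(lra)). unfold J. fold th. unfold Jray, ET.
  rewrite <- (CI_shift _ (- Re w) I1). cbv beta.
  rewrite <- CI_scal, <- CI_minus; auto; [|apply intg_scal; auto].
  assert (ID := intg_minus _ _ (intg_scal (Cexp (al * w)) _ I2) I0).
  replace (PI * (K1 * K * M) * exp (- Re w))%R with (PI * (K1 * K * M * exp (- Re w)))%R by ring.
  apply CI_bound; [apply ID|]. intros v.
  set (y := (((v + - Re w)%R, th) : C)).
  assert (Ey : (v, ph) = w + y) by (unfold y; rewrite Ew; auto).
  assert (E1 : Cexp (w + (0, th)) * exp (v + - Re w) = Cexp (v, ph)).
  { rewrite <- Cexp_RtoC, <- Cexp_plus. f_equal. rewrite Ey. unfold y. apply C_eq; unfold Re, Im; simpl; ring. }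
  assert (E2 : Cexp (0 + (0, ph)) * exp v = Cexp (v, ph)).
  { rewrite <- Cexp_RtoC, <- Cexp_plus. f_equal. apply C_eq; unfold Re, Im; simpl; ring. }
  rewrite E1, E2, hJ_one, hJ_split.
  replace (Cexp (al * w) * (Cexp (- Cexp (v, ph)) * (Cexp (al * y) * Cexp ((be - 1) * (y + lam y)))) -
     Cexp (- Cexp (v, ph)) * Cexp (al * (v, ph))) with
    (Cexp (- Cexp (v, ph)) * Cexp (al * (v, ph)) * (Cexp ((be - 1) * (y + lam y)) - 1)).
  2:{ rewrite Ey. replace (al * (w + y)) with (al * w + al * y) by ring. rewrite (Cexp_plus (al * w)). ring. }
  rewrite !Cmod_mult, !Cmod_Cexp.
  assert (L1 : (Re (- Cexp (v, ph)) <= - (x0 * exp v))%R).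
  { replace (Re (- Cexp (v, ph))) with (- (exp v * cos ph))%R by reflexivity.
    assert (C := cos_ge_of_abs _ _ Bph ltac:(lra)). fold x0 in C. generalize (exp_pos v). nra. }
  assert (L2 : (Re (al * (v, ph)) <= Rabs (Im al) * (PI / 2) + Re al * v)%R).
  { replace (Re (al * (v, ph))) with (Re al * v - Im al * ph)%R by reflexivity.
    assert (- (Im al * ph) <= Rabs (Im al) * (PI / 2))%R; [|lra].
    eapply Rle_trans; [apply Rle_abs|]. rewrite Rabs_Ropp, Rabs_mult.
    apply Rmult_le_compat_l; [apply Rabs_pos | lra]. }
  assert (L3 := HK (v + - Re w)%R th Bth). fold y in L3.
  assert (L4 : (lg (v + - Re w) <= lg v)%R).
  { unfold lg. assert (H : (exp (v + - Re w) <= exp v)%R) by (apply exp_le; lra).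
    destruct H as [H|H]; [left; apply ln_increasing; generalize (exp_pos (v + - Re w)); lra | right; rewrite H; auto]. }
  assert (Pg := Rabs_pos (Re (be - 1))).
  apply Rle_trans with (exp (- (x0 * exp v)) * (K1 * exp (Re al * v)) *
     (K * (exp (- Re w) * exp (v + Rabs (Re (be - 1)) * lg v))))%R.
  - apply Rmult_le_compat; [| apply Cmod_ge_0 | |].
    + left; apply Rmult_lt_0_compat; apply exp_pos.
    + apply Rmult_le_compat; try (left; apply exp_pos); [apply exp_le; auto|].
      unfold K1. rewrite <- exp_plus. apply exp_le; auto.
    + eapply Rle_trans; [apply L3|]. apply Rmult_le_compat_l; [lra|]. rewrite <- exp_plus. apply exp_le. nra.
  - apply Rle_trans with (K1 * K * exp (- Re w) * exp (- (x0 * exp v) + (Re al + 1) * v + Rabs (Re (be - 1)) * lg v))%R.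
    + right. replace (- (x0 * exp v) + (Re al + 1) * v + Rabs (Re (be - 1)) * lg v)%R with
        (- (x0 * exp v) + Re al * v + (v + Rabs (Re (be - 1)) * lg v))%R by ring.
      rewrite (exp_plus (- (x0 * exp v) + Re al * v)), (exp_plus (- (x0 * exp v))). ring.
    + apply Rle_trans with (K1 * K * exp (- Re w) * (M / (1 + v * v)))%R; [|right; unfold Rdiv; ring].
      apply Rmult_le_compat_l; [|apply HM].
      apply Rmult_le_pos; [|left; apply exp_pos]. apply Rmult_le_pos; [left; apply exp_pos | lra].
Qed.

Lemma exp_small (K eps : R) : (0 < eps)%R -> exists X, (0 < X)%R /\ forall x, (X < x)%R -> (K * exp (- x) < eps)%R.
Proof.
  intros He. exists ((Rabs K + 1) / eps)%R. assert (P := Rabs_pos K).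
  assert (PX : (0 < (Rabs K + 1) / eps)%R) by (apply Rdiv_lt_0_compat; lra).
  split; auto. intros x Hx. assert (Q := exp_pos (- x)).
  apply Rle_lt_trans with ((Rabs K + 1) * exp (- x))%R.
  - apply Rmult_le_compat_r; [lra|]. generalize (Rle_abs K); lra.
  - apply Rmult_lt_reg_r with (exp x); [apply exp_pos|].
    rewrite Rmult_assoc, <- exp_plus. replace (- x + x)%R with 0%R by ring. rewrite exp_0, Rmult_1_r.
    apply Rle_lt_trans with (eps * ((Rabs K + 1) / eps))%R; [right; field; lra|].
    apply Rmult_lt_compat_l; auto. generalize (exp_ineq1_le x); lra.
Qed.

Definition sector_asym (a : C) (u : C -> C) : Prop :=
  forall delta : R, (0 < delta)%R -> forall eps : R, (0 < eps)%R ->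
  exists M : R, forall w : C, (M < Re w)%R -> (Rabs (Im w) <= 3 / 2 * PI - delta)%R ->
  (Cmod (u w / Cexp (- a * w) - 1) < eps)%R.

Lemma J_sector (al be : C) : (0 < Re al)%R ->
  sector_asym al (fun w => / mel hG al * J al be w).
Proof.
  intros Ha delta Hd eps He. destruct (J_asym_bound al be delta Ha Hd) as [K HK].
  assert (N := mel_hG_neq_0 al Ha). assert (PN := proj1 (Cmod_gt_0 _) N).
  destruct (exp_small K (eps * Cmod (mel hG al))) as [X [PX HX]]; [nra|].
  exists X. intros w Hw Hi. specialize (HK w ltac:(lra) Hi).
  assert (N2 := Cexp_neq_0 (- al * w)).
  replace (/ mel hG al * J al be w / Cexp (- al * w) - 1) with
    (/ mel hG al * (Cexp (al * w) * J al be w - mel hG al)).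
  - rewrite Cmod_mult, Cmod_inv by auto.
    apply Rmult_lt_reg_l with (Cmod (mel hG al)); auto.
    rewrite <- Rmult_assoc, Rinv_r, Rmult_1_l by lra.
    specialize (HX (Re w) Hw). lra.
  - replace (Cexp (al * w)) with (/ Cexp (- al * w)).
    + field. auto.
    + rewrite <- Cexp_opp. f_equal. ring.
Qed.

Lemma sector_asym_asym a u : sector_asym a u -> asym a u.
Proof.
  intros S eps He. assert (P := PI_RGT_0).
  destruct (S (PI / 2)%R ltac:(lra) eps He) as [M H]. exists M. intros x Hx.
  apply (H (RtoC x)); simpl; auto. rewrite Rabs_R0. lra.
Qed.

Lemma J_real_bound (al be : C) : (0 < Re al)%R ->
  exists K, forall x : R, (0 <= x)%R -> (Cmod (J al be x) <= K)%R.
Proof.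
  intros Ha. assert (P := PI_RGT_0).
  destruct (hJ_bound al be 0) as [K [PK HK]]; [lra|].
  destruct (double_exp_bound 1 (Re al) (Re be - 1) Rlt_0_1 Ha) as [M HM].
  exists (PI * (K * M))%R. intros x Hx.
  assert (A : adm (RtoC x) 0) by (split; simpl; rewrite ?Rplus_0_r, Rabs_R0; lra).
  rewrite (J_adm al be 0 x Ha A) by (simpl; rewrite Rabs_R0; lra).
  unfold Jray, ET. apply CI_bound; [apply (Jray_intg al be 0 x Ha A)|].
  intros v. rewrite Cmod_mult, Cmod_Cexp.
  replace (Re (- (Cexp (x + (0, 0)%R) * exp v))) with (- (exp x * exp v))%R.
  2:{ unfold Cexp, Re, Im; simpl. rewrite !Rplus_0_r, cos_0. ring. }
  apply Rle_trans with (exp (- (1 * exp v)) * (K * exp (Re al * v + (Re be - 1) * lg v)))%R.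
  - apply Rmult_le_compat; [left; apply exp_pos | apply Cmod_ge_0 | | apply HK; rewrite Rabs_R0; lra].
    apply exp_le. assert (1 <= exp x)%R by (rewrite <- exp_0; apply exp_le; auto).
    generalize (exp_pos v). nra.
  - apply Rle_trans with (K * exp (- (1 * exp v) + Re al * v + (Re be - 1) * lg v))%R.
    + right. rewrite !exp_plus. ring.
    + unfold Rdiv. rewrite Rmult_assoc. apply Rmult_le_compat_l; [lra | apply HM].
Qed.

(** The sheet on which the Laplace integral is defined; the sector of the asymptotic condition of
    [is_KummerU] lies in it. *)
Definition strip (w : C) : Prop := (Rabs (Im w) < 3 / 2 * PI)%R.

Lemma strip_convex : convex strip.
Proof.
  intros a b A B t Ht. unfold strip in *. apply Rabs_def2 in A, B.
  replace (Im (a + t * (b - a))) with ((1 - t) * Im a + t * Im b)%R by (unfold Im; simpl; ring).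
  apply Rabs_def1; [apply convex_lt | apply convex_gt]; lra.
Qed.

Lemma strip_real (x : R) : strip x.
Proof. unfold strip. simpl. rewrite Rabs_R0. generalize PI_RGT_0; lra. Qed.

Lemma J_Ksol (al be c : C) : (0 < Re al)%R ->
  Ksol al (al + be) strip (fun w => c * J al be w) (fun w => - c * J (al + 1) be w).
Proof.
  intros Ha w Hw. assert (R1 : (0 < Re (al + 1))%R) by (unfold Re in *; simpl; lra). split.
  - eapply CD_eq; [apply CD_scal, J_CD; auto|]. ring.
  - eapply CD_eq; [apply CD_scal, J_CD; auto|].
    replace (al + 1 + 1) with (al + 2) by ring.
    assert (O := J_ODE al be w Ha Hw).
    replace (- c * - (Cexp w * J (al + 2) be w)) with
      (c * (Cexp w * J (al + 2) be w - (al + be - Cexp w) * J (al + 1) be w - al * J al be w) +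
       c * ((al + be - Cexp w) * J (al + 1) be w + al * J al be w)) by ring.
    rewrite O. ring.
Qed.

Lemma is_KummerU_intro (a b : C) (u u1 : C -> C) : Ksol a b (fun _ => True) u u1 -> sector_asym a u ->
  is_KummerU a b u.
Proof.
  intros U S. split; auto.
  exists u1, (fun w => (a * u w - (b - Cexp w) * u1 w) / Cexp w).
  assert (N := Cexp_neq_0). split; [|split].
  - intros w. apply is_derive_CD. apply U; auto.
  - intros w. apply is_derive_CD. eapply CD_eq; [apply U; auto|]. field. auto.
  - intros w. field. auto.
Qed.

Lemma is_KummerU_elim (a b : C) (u : C -> C) : is_KummerU a b u ->
  exists u1, Ksol a b (fun _ => True) u u1 /\ sector_asym a u.
Proof.
  intros [[u1 [u2 [H1 [H2 H3]]]] S]. exists u1. split; auto.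
  intros w _. split; [apply is_derive_CD; auto|].
  eapply CD_eq; [apply is_derive_CD, H2|]. specialize (H3 w).
  replace (Cexp w * u2 w) with (Cexp w * u2 w + (b - Cexp w) * u1 w - a * u w + (a * u w - (b - Cexp w) * u1 w)) by ring.
  rewrite H3. ring.
Qed.

(** [KummerU] is chosen among the solutions, so existence is needed first. Uniqueness then
    identifies it with the normalized Laplace integral. *)
Lemma KummerU_eq_J (al be : C) : (0 < Re al)%R -> (exists u, is_KummerU al (al + be) u) ->
  is_KummerU al (al + be) (KummerU al (al + be)) /\
  forall w, strip w -> KummerU al (al + be) w = / mel hG al * J al be w.
Proof.
  intros Ha ex.
  assert (K : is_KummerU al (al + be) (KummerU al (al + be))) by (exact (epsilon_spec _ _ ex)).
  split; auto. intros w Hw. symmetry.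
  destruct (is_KummerU_elim _ _ _ K) as [v1 [V S]].
  assert (R1 : (0 < Re (al + 1))%R) by (unfold Re in *; simpl; lra).
  destruct (J_real_bound (al + 1) be R1) as [B HB].
  apply (kummer_unique al (al + be) strip (fun w => / mel hG al * J al be w)
    (fun w => - / mel hG al * J (al + 1) be w) (KummerU al (al + be)) v1
    (Cmod (- / mel hG al) * B)); auto using strip_convex, strip_real, J_Ksol.
  - apply (Ksol_sub _ _ (fun _ => True)); auto.
  - apply sector_asym_asym, J_sector; auto.
  - apply sector_asym_asym; auto.
  - intros x Hx. rewrite Cmod_mult. apply Rmult_le_compat_l; [apply Cmod_ge_0 | apply HB; auto].
Qed.

(** * The Kummer function of the Macdonald function [K_1] *)

(** [t = sg v] maps the line onto the unit interval. *)
Definition sg (v : R) : R := (exp v / (1 + exp v))%R.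

(** [sqrt (t (1 - t)) dt] at [t = sg v], as a form in [v]. *)
Definition hB (v : R) : C := RtoC (exp (3 / 2 * v - 3 * lg v)).

Lemma sg_bound v : (0 < sg v < 1)%R.
Proof.
  unfold sg. assert (P := exp_pos v). split.
  - apply Rdiv_lt_0_compat; lra.
  - apply Rmult_lt_reg_r with (1 + exp v)%R; [lra|]. unfold Rdiv. rewrite Rmult_assoc, Rinv_l; lra.
Qed.

Lemma sg_derive v : is_derive sg v (sg v * (1 - sg v))%R.
Proof.
  unfold sg. assert (P := exp_pos v). auto_derive; [lra|]. field. lra.
Qed.

Lemma lg_derive v : is_derive lg v (sg v).
Proof.
  unfold lg, sg. assert (P := exp_pos v). auto_derive; [lra|]. field. lra.
Qed.

Lemma hB_derive v : RD hB v (RtoC (3 / 2 - 3 * sg v) * hB v).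
Proof.
  unfold hB. rewrite <- RtoC_mult. apply RD_RtoC.
  apply (is_derive_comp (V := R_NormedModule) exp (fun v => 3 / 2 * v - 3 * lg v)%R).
  - apply is_derive_Reals, derivable_pt_lim_exp.
  - apply (is_derive_minus (V := R_NormedModule)).
    + auto_derive; auto. ring.
    + apply is_derive_scal, lg_derive.
Qed.

Lemma hB_bound : exists M, forall v, (Cmod (hB v) <= M / (1 + v * v))%R.
Proof.
  destruct (ln_le_lin 1 2 Rlt_0_1) as [K HK].
  exists (exp K). intros v. unfold hB. rewrite Cmod_R, Rabs_pos_eq by (left; apply exp_pos).
  apply (bdd_of_exp (fun v => 3 / 2 * v - 3 * lg v)%R). clear v. intros v.
  assert (A := abs_le_lg v). assert (B := Rabs_pos v). specialize (HK (Rabs v) B).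
  assert (E := ln_sqr_le (Rabs v) B).
  replace (Rabs v * Rabs v)%R with (v * v)%R in E
    by (rewrite <- Rabs_mult; symmetry; apply Rabs_pos_eq, Rle_0_sqr).
  lra.
Qed.

Lemma hB_dom (j : nat) (x : R) :
  exists M, ET_dom (fun v => (- sg v)%R) (fun v => RtoC (sg v ^ j) * hB v) x 1 M.
Proof.
  destruct hB_bound as [M HM]. exists (2 * exp (1 + Rabs x) * M)%R. split; [|split].
  - intros v. apply (continuous_opp (V := R_NormedModule)), (ex_derive_continuous (V := R_NormedModule)).
    eexists; apply sg_derive.
  - intros v. apply ccts_mult; [|eapply RD_ccts, hB_derive]. apply ccts_RtoC.
    apply (continuous_of_derive (fun t => t ^ j)%R sg); [auto_derive; auto|].
    apply (ex_derive_continuous (V := R_NormedModule)). eexists; apply sg_derive.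
  - intros v. assert (S := sg_bound v). rewrite Rabs_Ropp, Rabs_pos_eq by lra.
    rewrite Cmod_mult, Cmod_R.
    assert (Sj : (Rabs (sg v ^ j) <= 1)%R).
    { rewrite Rabs_pos_eq by (apply pow_le; lra).
      induction j as [|j IH]; simpl; [lra|]. assert (0 <= sg v ^ j)%R by (apply pow_le; lra). nra. }
    unfold Rdiv. rewrite (Rmult_assoc _ M). apply Rmult_le_compat; [| | |].
    + apply Rmult_le_pos; [nra | left; apply exp_pos].
    + apply Rmult_le_pos; [apply Rabs_pos | apply Cmod_ge_0].
    + apply Rmult_le_compat; [nra | left; apply exp_pos | nra |].
      apply exp_le. assert (A := Rle_abs x). assert (A2 := Rabs_pos x). nra.
    + eapply Rle_trans; [|apply (HM v)]. rewrite <- (Rmult_1_l (Cmod (hB v))) at 2.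
      apply Rmult_le_compat_r; auto using Cmod_ge_0.
Qed.

(** [Bi 0] is the entire solution of Kummer's equation with parameters [3/2] and [3], the integral
    of [e^(z t) sqrt (t (1 - t))] over the unit interval; [Bi j] is its [j]th derivative. *)
Definition Bi (j : nat) (z : C) : C := ET (fun v => (- sg v)%R) (fun v => RtoC (sg v ^ j) * hB v) z.

Lemma Bi_intg (j : nat) (z : C) : intg (fun v => Cexp (- (z * RtoC (- sg v))) * (RtoC (sg v ^ j) * hB v)).
Proof.
  destruct (hB_dom j (Re z)) as [M D].
  apply (ET_intg _ _ (Re z) 1 M z Rle_0_1 D). rewrite Rminus_diag, Rabs_R0; lra.
Qed.

Lemma Bi_CD (j : nat) (z : C) : CD (Bi j) z (Bi (S j) z).
Proof.
  destruct (hB_dom j (Re z)) as [M D].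
  eapply CD_eq; [apply (ET_CD _ _ (Re z) 1 M z Rlt_0_1 D eq_refl)|].
  unfold Bi, ET. replace (CI (fun v => Cexp (- (z * RtoC (- sg v))) * (RtoC (sg v ^ S j) * hB v))) with
    (CI (fun v => - (1) * (Cexp (- (z * RtoC (- sg v))) * (RtoC (- sg v) * (RtoC (sg v ^ j) * hB v))))).
  - rewrite CI_scal; [ring|].
    apply (ET_intg _ _ (Re z) 1 M z Rle_0_1 D). rewrite Rminus_diag, Rabs_R0; lra.
  - apply CI_ext. intros v. simpl. rewrite RtoC_mult, !RtoC_opp. ring.
Qed.

(** The left-hand side is minus the integral of the derivative of [e^(z t) (t (1 - t))^(3/2)]. *)
Lemma Bi_ODE (z : C) : z * Bi 2 z + (3 - z) * Bi 1 z - RtoC (3 / 2) * Bi 0 z = 0.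
Proof.
  set (f := fun (j : nat) (v : R) => Cexp (- (z * RtoC (- sg v))) * (RtoC (sg v ^ j) * hB v)).
  assert (I : forall j, intg (f j)) by (intros; apply Bi_intg).
  set (G := fun v => - z * f 2%nat v + ((z - 3) * f 1%nat v + RtoC (3 / 2) * f 0%nat v)).
  assert (IG : intg G) by (apply intg_plus; [apply intg_scal; auto | apply intg_plus; apply intg_scal; auto]).
  destruct (I 0%nat) as [_ [M BM]].
  assert (Z : CI G = 0).
  { apply (CI_FTC0 (f 0%nat) G M); auto. intros t. unfold f, G. eapply RD_eq.
    - apply RD_mult.
      + apply RD_exp, RD_opp, RD_scal, RD_RtoC.
        apply (is_derive_opp (V := R_NormedModule)), sg_derive.
      + apply RD_mult; [apply (RD_const (RtoC (sg t ^ 0)))|apply hB_derive].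
    - unfold f. simpl. unfold opp; simpl.
      rewrite ?RtoC_mult, ?RtoC_opp, ?RtoC_minus, ?RtoC_mult, ?RtoC_minus, ?RtoC_div by lra. ring. }
  unfold G in Z. rewrite CI_plus, CI_plus, !CI_scal in Z; auto.
  - change (- z * Bi 2 z + ((z - 3) * Bi 1 z + RtoC (3 / 2) * Bi 0 z) = 0) in Z.
    match type of Z with ?L = _ => transitivity (- L); [ring | rewrite Z; ring] end.
  - apply intg_scal; auto.
  - apply intg_scal; auto.
  - apply intg_scal; auto.
  - apply intg_plus; apply intg_scal; auto.
Qed.

Lemma Bi_Ksol S : Ksol (RtoC (3 / 2)) 3 S (fun w => Bi 0 (Cexp w)) (fun w => Bi 1 (Cexp w)).
Proof.
  intros w _. split.
  - eapply CD_eq; [apply (CD_comp (Bi 0) Cexp); [apply Bi_CD | apply CD_Cexp]|]. ring.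
  - eapply CD_eq; [apply (CD_comp (Bi 1) Cexp); [apply Bi_CD | apply CD_Cexp]|].
    assert (O := Bi_ODE (Cexp w)).
    match type of O with ?L = _ =>
      replace (Bi 2 (Cexp w) * Cexp w) with (L + RtoC (3 / 2) * Bi 0 (Cexp w) - (3 - Cexp w) * Bi 1 (Cexp w)) by ring end.
    rewrite O. ring.
Qed.

Lemma Bi_real_neq_0 (x : R) : Bi 0 x <> 0.
Proof.
  assert (E : Bi 0 x = CI (fun v => RtoC (exp (x * sg v) * exp (3 / 2 * v - 3 * lg v)))).
  { apply CI_ext. intros v. unfold hB. simpl. rewrite RtoC_mult, Cmult_1_l, <- (Cexp_RtoC (x * sg v)).
    f_equal. f_equal. rewrite RtoC_mult, RtoC_opp. ring. }
  assert (P : (0 < Re (Bi 0 x))%R).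
  { assert (I := Bi_intg 0 x). rewrite E. apply CI_pos.
    - intros v. apply (ex_derive_continuous (V := R_NormedModule)). auto_derive.
      repeat split; eexists; match goal with |- context [lg] => apply lg_derive | _ => apply sg_derive end.
    - revert I. apply intg_ext. intros v. unfold hB. simpl. rewrite RtoC_mult, Cmult_1_l, <- (Cexp_RtoC (x * sg v)).
      f_equal. f_equal. rewrite RtoC_mult, RtoC_opp. ring.
    - intros v. apply Rmult_lt_0_compat; apply exp_pos. }
  intros Z. rewrite Z in P. simpl in P. lra.
Qed.

Lemma Cexp_2PI_Z (k : Z) : Cexp (0, 2 * PI * IZR k)%R = 1.
Proof.
  assert (P : forall n : nat, cos (2 * PI * INR n) = 1%R /\ sin (2 * PI * INR n) = 0%R).
  { intros n. split.
    - rewrite <- cos_0, <- (cos_period 0 n). f_equal. ring.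
    - rewrite <- sin_0, <- (sin_period 0 n). f_equal. ring. }
  unfold Cexp; simpl. rewrite exp_0.
  destruct (Z_le_dec 0 k) as [H|H].
  - rewrite <- (Z2Nat.id k) by auto. rewrite <- INR_IZR_INZ. destruct (P (Z.to_nat k)) as [A B].
    rewrite A, B. apply C_eq; simpl; ring.
  - replace k with (- Z.of_nat (Z.to_nat (- k)))%Z by lia. rewrite opp_IZR, <- INR_IZR_INZ.
    replace (2 * PI * - INR (Z.to_nat (- k)))%R with (- (2 * PI * INR (Z.to_nat (- k))))%R by ring.
    rewrite cos_neg, sin_neg. destruct (P (Z.to_nat (- k))) as [A B]. rewrite A, B.
    apply C_eq; simpl; ring.
Qed.

(** Translation by [turn k] is [k] turns around the origin. *)
Definition turn (k : Z) : C := (0, 2 * PI * IZR k)%R.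

Lemma Cexp_turn w k : Cexp (w - turn k) = Cexp w.
Proof. rewrite Cexp_minus. unfold turn. rewrite Cexp_2PI_Z. field. Qed.

Lemma Ksol_turn a b (S : C -> Prop) u u1 k : Ksol a b S u u1 ->
  Ksol a b (fun w => S (w - turn k)) (fun w => u (w - turn k)) (fun w => u1 (w - turn k)).
Proof.
  intros U w Hw. destruct (U _ Hw) as [D1 D2]. rewrite Cexp_turn in D1, D2.
  assert (T : CD (fun w => w - turn k) w 1).
  { eapply CD_eq; [apply CD_minus; [apply CD_id | apply CD_const]|]. ring. }
  split.
  - eapply CD_eq; [apply (CD_comp u (fun w => w - turn k)); eassumption|]. ring.
  - eapply CD_eq; [apply (CD_comp u1 (fun w => w - turn k)); eassumption|]. ring.
Qed.

Lemma Im_turn w k : Im (w - turn k) = (Im w - 2 * PI * IZR k)%R.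
Proof. reflexivity. Qed.

(** Monodromy: after one turn around the origin the Laplace integral is increased by a multiple
    of the entire solution. The Wronskian with the entire solution is unchanged by the turn,
    because [b = 3] is an integer. *)
Lemma monodromy (u u1 : C -> C) : Ksol (RtoC (3 / 2)) 3 strip u u1 ->
  exists mu : C, forall w, (- (3 / 2 * PI) < Im w < - (PI / 2))%R ->
  u (w - turn (-1)) = u w + mu * Bi 0 (Cexp w) /\
  u1 (w - turn (-1)) = u1 w + mu * Bi 1 (Cexp w).
Proof.
  intros U. assert (P := PI_RGT_0).
  set (O := fun w : C => (- (3 / 2 * PI) < Im w < - (PI / 2))%R).
  assert (OC : convex O).
  { intros a b [A1 A2] [B1 B2] t Ht. unfold O.
    replace (Im (a + t * (b - a))) with ((1 - t) * Im a + t * Im b)%R by (unfold Im; simpl; ring).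
    split; [apply convex_gt | apply convex_lt]; auto. }
  assert (OS : forall w, O w -> strip w /\ strip (w - turn (-1))).
  { intros w [H1 H2]. unfold strip. rewrite Im_turn. split; apply Rabs_def1; lra. }
  set (V := fun w => Bi 0 (Cexp w)). set (V1 := fun w => Bi 1 (Cexp w)).
  assert (KU : Ksol (RtoC (3 / 2)) 3 O u u1) by (apply (Ksol_sub _ _ strip); auto; intros; apply OS; auto).
  assert (KT : Ksol (RtoC (3 / 2)) 3 O (fun w => u (w - turn (-1))) (fun w => u1 (w - turn (-1)))).
  { apply (Ksol_sub _ _ (fun w => strip (w - turn (-1)))); [intros; apply OS; auto|]. apply Ksol_turn; auto. }
  assert (KV := Bi_Ksol O). fold V V1 in KV.
  (* a point above [z = -1], where both branches are defined and the entire solution is the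
     integral of a positive function *)
  set (w0 := ((0, - PI)%R : C)).
  assert (O0 : O w0) by (unfold O, w0; simpl; lra).
  assert (E0 : Cexp w0 = RtoC (-1)).
  { unfold w0, Cexp; simpl. rewrite exp_0, cos_neg, sin_neg, cos_PI, sin_PI. apply C_eq; simpl; ring. }
  assert (N0 : V w0 <> 0) by (unfold V; rewrite E0; apply Bi_real_neq_0).
  set (mu := (u (w0 - turn (-1)) - u w0) / V w0).
  exists mu. intros w Hw.
  assert (KD := Ksol_lin _ _ _ _ _ _ _ 1 (- mu) (Ksol_lin _ _ _ _ _ _ _ 1 (- (1)) KT KU) KV).
  cbv beta in KD.
  (* both points lie on the sheet of [u], and Abel's factor [e^(3 w - e^w)] takes the same value
     there *)
  assert (WE : wronskian u u1 V V1 (w0 - turn (-1)) = wronskian u u1 V V1 w0).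
  { assert (Q := CD_zero_const strip (fun w => wronskian u u1 V V1 w * Cexp (3 * w - Cexp w)) strip_convex
      (wronskian_CD _ _ _ _ _ _ _ U (Bi_Ksol strip)) _ _ (proj2 (OS w0 O0)) (proj1 (OS w0 O0))).
    cbv beta in Q. rewrite Cexp_turn in Q.
    replace (3 * (w0 - turn (-1)) - Cexp w0) with ((3 * w0 - Cexp w0) - turn (-3)) in Q.
    - rewrite Cexp_turn in Q. assert (N := Cexp_neq_0 (3 * w0 - Cexp w0)).
      assert (R : forall x : C, x = x * Cexp (3 * w0 - Cexp w0) / Cexp (3 * w0 - Cexp w0)) by (intros; field; auto).
      rewrite (R (wronskian u u1 V V1 (w0 - turn (-1)))), Q. symmetry. apply R.
    - assert (T3 : turn (-3) = 3 * turn (-1)).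
      { unfold turn. apply C_eq; unfold Re, Im; simpl; ring. }
      rewrite T3. ring. }
  assert (Z := Ksol_zero _ _ _ _ _ OC KD w0 O0).
  cbv beta in Z. destruct Z with (w := w) as [Z0 Z1]; auto.
  - unfold mu. field. auto.
  - unfold wronskian in WE.
    assert (EV : V (w0 - turn (-1)) = V w0) by (unfold V; rewrite Cexp_turn; auto).
    assert (EV1 : V1 (w0 - turn (-1)) = V1 w0) by (unfold V1; rewrite Cexp_turn; auto).
    rewrite EV, EV1 in WE.
    unfold mu.
    set (a := u (w0 - turn (-1))) in *. set (a1 := u1 (w0 - turn (-1))) in *.
    replace (1 * (1 * a1 + - (1) * u1 w0) + - ((a - u w0) / V w0) * V1 w0) with
      (- ((a * V1 w0 - a1 * V w0) - (u w0 * V1 w0 - u1 w0 * V w0)) / V w0) by (field; auto).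
    rewrite WE. field; auto.
  - fold (V w) (V1 w). split.
    + match type of Z0 with ?L = _ => replace (u (w - turn (-1))) with (L + u w + mu * V w) by ring end.
      rewrite Z0. ring.
    + match type of Z1 with ?L = _ => replace (u1 (w - turn (-1))) with (L + u1 w + mu * V1 w) by ring end.
      rewrite Z1. ring.
Qed.

(** On the sheet number [k], take [u] turned back [k] times plus [k mu] times the entire solution;
    [monodromy] makes consecutive sheets agree where they overlap. *)
Lemma kummer_extend (u u1 : C -> C) : Ksol (RtoC (3 / 2)) 3 strip u u1 ->
  exists v v1, Ksol (RtoC (3 / 2)) 3 (fun _ => True) v v1 /\ forall w, strip w -> v w = u w.
Proof.
  intros U. assert (P := PI_RGT_0). destruct (monodromy u u1 U) as [mu M].
  set (F := fun (k : Z) (w : C) => u (w - turn k) + RtoC (IZR k) * mu * Bi 0 (Cexp w)).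
  set (F1 := fun (k : Z) (w : C) => u1 (w - turn k) + RtoC (IZR k) * mu * Bi 1 (Cexp w)).
  assert (FK : forall k, Ksol (RtoC (3 / 2)) 3 (fun w => strip (w - turn k)) (F k) (F1 k)).
  { intros k w Hw.
    assert (L := Ksol_lin _ _ _ _ _ _ _ 1 (RtoC (IZR k) * mu) (Ksol_turn _ _ _ _ _ k U) (Bi_Ksol _) w Hw).
    cbv beta in L. unfold F, F1. destruct L as [L1 L2]. split.
    - refine (CD_eq _ _ _ _ (CD_ext _ _ _ _ _ L1) _); intros; ring.
    - refine (CD_eq _ _ _ _ (CD_ext _ _ _ _ _ L2) _); intros; ring. }
  assert (Step : forall k w, strip (w - turn k) -> strip (w - turn (k + 1)) ->
     F k w = F (k + 1)%Z w /\ F1 k w = F1 (k + 1)%Z w).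
  { intros k w H1 H2. unfold strip in *. rewrite !Im_turn, ?plus_IZR in *.
    apply Rabs_def2 in H1, H2.
    destruct (M (w - turn (k + 1))) as [M0 M1].
    - rewrite Im_turn, plus_IZR. lra.
    - assert (E : w - turn (k + 1) - turn (-1) = w - turn k).
      { unfold turn. apply C_eq; unfold Re, Im; simpl; rewrite ?plus_IZR; ring. }
      rewrite E, Cexp_turn in M0, M1. unfold F, F1. rewrite M0, M1, plus_IZR, RtoC_plus. split; ring. }
  assert (Adj : forall k l w, (k - 1 <= l <= k + 1)%Z -> strip (w - turn k) -> strip (w - turn l) ->
     F k w = F l w /\ F1 k w = F1 l w).
  { intros k l w Hkl Hk Hl.
    assert (C3 : (l = k \/ l = k + 1 \/ k = l + 1)%Z) by lia. destruct C3 as [-> | [-> | ->]].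
    - split; reflexivity.
    - apply Step; assumption.
    - destruct (Step l w Hl Hk) as [A B]. split; [exact (eq_sym A) | exact (eq_sym B)]. }
  (* the strip of the sheet [K w] contains the disc of radius [PI / 2] around [w] *)
  set (K := fun w : C => Int_part ((Im w + PI) / (2 * PI))).
  assert (HK : forall w, (- PI <= Im w - 2 * PI * IZR (K w) < PI)%R).
  { intros w. destruct (base_Int_part ((Im w + PI) / (2 * PI))) as [A B]. fold (K w) in A, B.
    set (q := ((Im w + PI) / (2 * PI))%R) in *.
    assert (Q : (Im w = 2 * PI * q - PI)%R) by (unfold q; field; lra).
    rewrite Q. split; nra. }
  assert (Near : forall w k, (Rabs (Im w - 2 * PI * IZR k) < 3 / 2 * PI)%R ->
     F (K w) w = F k w /\ F1 (K w) w = F1 k w).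
  { intros w k H. assert (H' := Rabs_def2 _ _ H). specialize (HK w).
    apply Adj.
    - assert (A : (IZR (K w) < IZR k + 2)%R) by nra. assert (B : (IZR k < IZR (K w) + 2)%R) by nra.
      replace 2%R with (IZR 2) in A, B by reflexivity. rewrite <- plus_IZR in A, B.
      apply lt_IZR in A, B. lia.
    - unfold strip. rewrite Im_turn. apply Rabs_def1; lra.
    - unfold strip. rewrite Im_turn. auto. }
  exists (fun w => F (K w) w), (fun w => F1 (K w) w). split.
  - intros w _. assert (HKw := HK w).
    assert (Sw : strip (w - turn (K w))) by (unfold strip; rewrite Im_turn; apply Rabs_def1; lra).
    assert (Nb : forall x, (Cmod (x - w) < PI / 2)%R -> (Rabs (Im x - 2 * PI * IZR (K w)) < 3 / 2 * PI)%R).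
    { intros x Hx. assert (Q := im_le_Cmod (x - w)). apply Rabs_le_between in Q.
      replace (Im (x - w)) with (Im x - Im w)%R in Q by reflexivity. apply Rabs_def1; lra. }
    destruct (FK (K w) w Sw) as [D1 D2]. split.
    + apply CD_ext_loc with (F (K w)) (PI / 2)%R; auto; [lra|].
      intros x Hx. symmetry. exact (proj1 (Near _ _ (Nb x Hx))).
    + apply CD_ext_loc with (F1 (K w)) (PI / 2)%R; auto; [lra|].
      intros x Hx. symmetry. exact (proj2 (Near _ _ (Nb x Hx))).
  - intros w Hw. unfold strip in Hw. destruct (Near w 0%Z) as [A _].
    + rewrite Rmult_0_r, Rminus_0_r. auto.
    + rewrite A. unfold F, turn. replace (w - (0, (2 * PI * IZR 0))%R) with w.
      * ring.
      * apply C_eq; unfold Re, Im; simpl; ring.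
Qed.

Lemma sector_asym_ext a u v : (forall w, strip w -> v w = u w) -> sector_asym a u -> sector_asym a v.
Proof.
  intros E S d Hd eps He. destruct (S d Hd eps He) as [M H]. exists M. intros w H1 H2.
  rewrite E; auto. unfold strip. lra.
Qed.

Lemma KummerU_three_halves : is_KummerU (RtoC (3 / 2)) 3 (KummerU (RtoC (3 / 2)) 3) /\
  forall w, strip w -> KummerU (RtoC (3 / 2)) 3 w =
    / RtoC (sqrt PI / 2) * J (RtoC (3 / 2)) (RtoC (3 / 2)) w.
Proof.
  assert (Ha : (0 < Re (RtoC (3 / 2)))%R) by (simpl; lra).
  assert (E3 : RtoC (3 / 2) + RtoC (3 / 2) = 3) by (rewrite <- RtoC_plus; f_equal; field).
  rewrite <- mel_hG_three_halves, <- E3. apply (KummerU_eq_J _ _ Ha).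
  assert (K := J_Ksol (RtoC (3 / 2)) (RtoC (3 / 2)) (/ mel hG (RtoC (3 / 2))) Ha).
  rewrite E3 in *. destruct (kummer_extend _ _ K) as [v [v1 [V E]]].
  exists v. apply is_KummerU_intro with v1; auto.
  eapply sector_asym_ext; [exact E|]. apply J_sector; auto.
Qed.

(** * Parabolic cylinder functions *)

Definition hP (xi : C) (v : R) : C := Cexp (- RtoC (exp v * exp v / 2) - xi * exp v).

(** Integrals of [t^(c-1) e^(-t^2/2 - xi t)], entire in [xi]. *)
Definition MP (c xi : C) : C := mel (hP xi) c.

Lemma hP_ccts xi v : ccts (hP xi) v.
Proof.
  unfold hP. apply ccts_Cexp, ccts_minus.
  - apply ccts_opp, ccts_RtoC. apply (ex_derive_continuous (V := R_NormedModule)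
      (fun v => exp v * exp v / 2)%R). auto_derive; auto.
  - apply ccts_mult; [apply ccts_const | apply ccts_RtoC, continuous_exp].
Qed.

Lemma Cmod_hP xi v : Cmod (hP xi v) = exp (- (exp v * exp v / 2) - Re xi * exp v).
Proof. unfold hP. rewrite Cmod_Cexp. f_equal. unfold Re; simpl. ring. Qed.

Lemma hP_bound xi v : (Cmod (hP xi v) <= exp ((1 - Re xi) * (1 - Re xi) / 2) * exp (- exp v))%R.
Proof.
  rewrite Cmod_hP, <- (exp_plus _ (- exp v)). apply exp_le.
  assert (0 <= (exp v - (1 - Re xi)) * (exp v - (1 - Re xi)))%R by apply Rle_0_sqr. lra.
Qed.

Lemma MP_intg c xi : (0 < Re c)%R -> intg (fun v => Cexp (c * v) * hP xi v).
Proof. intros H. eapply mel_intg; eauto using hP_ccts, hP_bound. Qed.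

(** The same integral seen as an exponential transform in [xi]. *)
Definition h0 (c : C) (v : R) : C := Cexp (c * v) * hP 0 v.

Lemma MP_ET c xi : MP c xi = ET exp (h0 c) xi.
Proof.
  unfold MP, mel, ET. apply CI_ext. intros v. unfold h0, hP. rewrite <- !Cexp_plus. f_equal. ring.
Qed.

Lemma h0_dom c x : (0 < Re c)%R -> exists M, ET_dom exp (h0 c) x 1 M.
Proof.
  intros Hc. destruct (double_exp_bound 1 (Re c) 2 Rlt_0_1 Hc) as [M HM].
  set (K := exp ((2 - x) * (2 - x) / 2)).
  exists (K * M)%R. split; [apply continuous_exp|]. split.
  - intros v. unfold h0. apply ccts_mult; [|apply hP_ccts].
    apply ccts_Cexp, ccts_mult; [apply ccts_const | apply ccts_RtoC, continuous_id].
  - intros v. unfold h0. rewrite Cmod_mult, Cmod_hP, Cmod_Cexp.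
    rewrite (Rabs_pos_eq (exp v)) by (left; apply exp_pos).
    replace (Re (c * v)) with (Re c * v)%R by (unfold Re; simpl; ring).
    replace (Re 0) with 0%R by reflexivity.
    unfold Rdiv at 2. rewrite (Rmult_assoc K M).
    apply Rle_trans with (K * exp (- (1 * exp v) + Re c * v + 2 * lg v))%R.
    + apply Rle_trans with (exp (2 * lg v) * exp (1 * exp v - x * exp v) *
        (exp (Re c * v) * exp (- (exp v * exp v / 2) - 0 * exp v)))%R.
      * apply Rmult_le_compat_r; [left; apply Rmult_lt_0_compat; apply exp_pos|].
        apply Rmult_le_compat_r; [left; apply exp_pos|]. apply one_plus_exp_sqr.
      * unfold K. set (t := exp v). rewrite <- !exp_plus. apply exp_le.
        assert (0 <= (t - (2 - x)) * (t - (2 - x)))%R by apply Rle_0_sqr. lra.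
    + apply Rmult_le_compat_l; [left; apply exp_pos | apply HM].
Qed.

Lemma MP_CD c xi : (0 < Re c)%R -> CD (MP c) xi (- MP (c + 1) xi).
Proof.
  intros Hc. destruct (h0_dom c (Re xi) Hc) as [M D].
  apply CD_ext with (ET exp (h0 c)); [intros; symmetry; apply MP_ET|].
  eapply CD_eq; [apply (ET_CD _ _ (Re xi) 1 M xi Rlt_0_1 D eq_refl)|].
  f_equal. rewrite MP_ET. unfold ET. apply CI_ext. intros v. f_equal. unfold h0.
  rewrite <- Cexp_RtoC, Cmult_assoc, <- Cexp_plus. f_equal. f_equal. ring.
Qed.

Lemma Re_succ_pos c (x : R) : (0 < Re c)%R -> (0 <= x)%R -> (0 < Re (c + x))%R.
Proof. unfold Re; simpl; lra. Qed.

(** Integration by parts. *)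
Lemma MP_rec c xi : (0 < Re c)%R -> MP (c + 2) xi + xi * MP (c + 1) xi = c * MP c xi.
Proof.
  intros Hc.
  assert (I0 := MP_intg c xi Hc).
  assert (I1 := MP_intg (c + 1) xi (Re_succ_pos c 1 Hc ltac:(lra))).
  assert (I2 := MP_intg (c + 2) xi (Re_succ_pos c 2 Hc ltac:(lra))).
  set (f0 := fun v : R => Cexp (c * v) * hP xi v) in *.
  set (f1 := fun v : R => Cexp ((c + 1) * v) * hP xi v) in *.
  set (f2 := fun v : R => Cexp ((c + 2) * v) * hP xi v) in *.
  assert (J0 := intg_scal c _ I0). assert (J1 := intg_scal (- xi) _ I1).
  assert (J2 := intg_scal (- (1)) _ I2). assert (J12 := intg_plus _ _ J1 J2).
  assert (JJ := intg_plus _ _ J0 J12).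
  assert (I0' := I0). destruct I0' as [_ [M B]].
  assert (Z1 : CI (fun v => c * f0 v + (- xi * f1 v + - (1) * f2 v)) = 0).
  { apply (CI_FTC0 f0 _ M) with (2 := JJ) (3 := B). intros t. unfold f0, f1, f2, hP. eapply RD_eq.
    - apply RD_mult; [apply RD_exp, RD_scal, RD_RtoC, is_derive_Reals, derivable_pt_lim_id|].
      apply RD_exp, RD_minus.
      + apply RD_opp, RD_RtoC. instantiate (1 := (exp t * exp t)%R). auto_derive; auto. field.
      + apply RD_scal, RD_RtoC, is_derive_Reals, derivable_pt_lim_exp.
    - replace ((c + 1) * t) with (c * t + t) by ring. replace ((c + 2) * t) with (c * t + t + t) by ring.
      rewrite !Cexp_plus, Cexp_RtoC, RtoC_mult. ring. }
  rewrite (CI_plus _ _ J0 J12), (CI_plus _ _ J1 J2), !CI_scal in Z1 by auto.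
  change (c * MP c xi + (- xi * MP (c + 1) xi + - (1) * MP (c + 2) xi) = 0) in Z1.
  match type of Z1 with ?L = _ => transitivity (c * MP c xi - L); [ring | rewrite Z1; ring] end.
Qed.

(** By [MP_rec] this is [(c - 1) MP (c - 1) xi] when [1 < Re c]. In the present form it makes
    sense for [0 < Re c], as needed for [|Re s| < 3/4]. *)
Definition QP (c xi : C) : C := MP (c + 1) xi + xi * MP c xi.

Lemma QP_CD c xi : (0 < Re c)%R -> CD (QP c) xi ((1 - c) * MP c xi).
Proof.
  intros Hc. unfold QP. eapply CD_eq.
  - apply CD_plus; [apply MP_CD, (Re_succ_pos c 1 Hc); lra|].
    apply CD_mult; [apply CD_id | apply MP_CD; auto].
  - assert (R := MP_rec c xi Hc). replace (c + 1 + 1) with (c + 2) by ring.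
    replace ((1 - c) * MP c xi) with (MP c xi - c * MP c xi) by ring. rewrite <- R. ring.
Qed.

(** [D_nu (xi)] with [c = 1 - nu]: the classical integral representation, continued by means of
    [QP]. *)
Definition DP (c xi : C) : C := Cexp (- (xi * xi) / 4) * (/ mel hG c * QP c xi).
Definition DP1 (c xi : C) : C :=
  Cexp (- (xi * xi) / 4) * (/ mel hG c * ((1 - c) * MP c xi - xi / 2 * QP c xi)).

Lemma C4_neq_0 : RtoC 4 <> 0.
Proof. intros Z; apply RtoC_inj in Z; lra. Qed.
Lemma C2_neq_0 : RtoC 2 <> 0.
Proof. intros Z; apply RtoC_inj in Z; lra. Qed.

Lemma CD_gauss xi : CD (fun x => Cexp (- (x * x) / 4)) xi (Cexp (- (xi * xi) / 4) * (- xi / 2)).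
Proof.
  apply (CD_exp (fun x => - (x * x) / 4)). unfold Cdiv. eapply CD_eq.
  - apply CD_mult; [apply CD_opp, CD_mult; apply CD_id | apply CD_const].
  - assert (N := C4_neq_0). assert (N2 := C2_neq_0).
    replace (RtoC 4) with (RtoC 2 * RtoC 2) by (rewrite <- RtoC_mult; f_equal; ring). field; auto.
Qed.

Lemma DP_CD c xi : (0 < Re c)%R -> CD (DP c) xi (DP1 c xi).
Proof.
  intros Hc. unfold DP, DP1. eapply CD_eq.
  - apply CD_mult; [apply CD_gauss | apply CD_scal, QP_CD; auto].
  - unfold Cdiv. ring.
Qed.

(** Weber's equation. *)
Lemma DP1_CD c xi : (0 < Re c)%R ->
  CD (DP1 c) xi ((xi * xi / 4 + c - RtoC (3 / 2)) * DP c xi).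
Proof.
  intros Hc. unfold DP1. eapply CD_eq.
  - apply CD_mult; [apply CD_gauss | apply CD_scal, CD_minus].
    + apply CD_scal, MP_CD; auto.
    + unfold Cdiv. apply CD_mult; [apply CD_mult; [apply CD_id | apply CD_const] | apply QP_CD; auto].
  - assert (N := C4_neq_0). assert (N2 := C2_neq_0).
    replace (RtoC (3 / 2)) with (1 + / RtoC 2).
    2:{ rewrite <- RtoC_inv, <- RtoC_plus by lra. f_equal. field. }
    unfold DP, QP.
    replace (RtoC 4) with (RtoC 2 * RtoC 2) by (rewrite <- RtoC_mult; f_equal; ring).
    assert (NG := mel_hG_neq_0 c Hc). field; auto.
Qed.

(** [xi = sqrt (2 z)] in the coordinate of [z]. *)
Definition xiw (w : C) : C := Cexp ((w + ln 2) / 2).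
(** Normalizes [UP] to [U(a, 1/2, z)]. *)
Definition kap (a : C) : C := Cexp (a * ln 2) * / mel hG (1 + 2 * a).
Definition UP (a w : C) : C := kap a * QP (1 + 2 * a) (xiw w).
Definition UP1 (a w : C) : C := kap a * (- (2 * a) * MP (1 + 2 * a) (xiw w) / xiw w).

Lemma xiw_CD w : CD xiw w (xiw w / 2).
Proof.
  unfold xiw, Cdiv. apply (CD_exp (fun w => (w + ln 2) * / 2)). eapply CD_eq.
  - apply CD_mult; [apply CD_plus; [apply CD_id | apply CD_const] | apply CD_const].
  - cbv beta; ring.
Qed.

Lemma xiw_sqr w : xiw w * xiw w = 2 * Cexp w.
Proof.
  unfold xiw. rewrite <- Cexp_plus.
  replace ((w + ln 2) / 2 + (w + ln 2) / 2) with (ln 2 + w) by (field; apply C2_neq_0).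
  rewrite Cexp_plus, Cexp_RtoC, exp_ln by lra. reflexivity.
Qed.

Lemma xiw_neq_0 w : xiw w <> 0.
Proof. apply Cexp_neq_0. Qed.

Lemma UP_Ksol (a : C) : (- (1 / 2) < Re a)%R -> Ksol a (RtoC (1 / 2)) (fun _ => True) (UP a) (UP1 a).
Proof.
  intros Ha w _.
  assert (Hc : (0 < Re (1 + 2 * a))%R) by (unfold Re in *; simpl; lra).
  assert (N := xiw_neq_0 w). assert (S := xiw_sqr w). assert (N2 := C2_neq_0).
  assert (Ez : Cexp w = xiw w * xiw w / 2) by (rewrite S; field; auto).
  split.
  - unfold UP. eapply CD_eq.
    + apply CD_scal. apply (CD_comp (QP (1 + 2 * a)) xiw); [apply QP_CD; auto | apply xiw_CD].
    + rewrite Ez. unfold UP1. field; auto.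
  - unfold UP1, Cdiv. eapply CD_eq.
    + apply CD_scal, CD_mult.
      * apply CD_scal. apply (CD_comp (MP (1 + 2 * a)) xiw); [apply MP_CD; auto | apply xiw_CD].
      * apply (CD_comp (fun x => / x) xiw); [apply CD_inv; auto | apply xiw_CD].
    + unfold UP, UP1, QP. rewrite Ez, RtoC_div by lra. field; auto.
Qed.

(** The factor [e^(- t^2 / 2)] is [1 + O(t^2)], which gains two powers of [1 / xi]. *)
Lemma MP_real_asym (c : C) : (0 < Re c)%R -> exists K, forall x : R, (0 <= x)%R ->
  (Cmod (Cexp (c * x) * MP c (exp x) - mel hG c)%C <= K * exp (- (2 * x)))%R.
Proof.
  intros Hc. destruct (double_exp_bound 1 (Re c + 2) 0 Rlt_0_1 ltac:(lra)) as [M HM].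
  exists (PI * M)%R. intros x Hx.
  assert (I := MP_intg c (RtoC (exp x)) Hc). assert (Is := intg_shift _ (- x) I).
  assert (IG := hG_intg c Hc).
  unfold MP, mel. rewrite <- (CI_shift _ (- x) I). cbv beta.
  rewrite <- CI_scal, <- CI_minus; auto; [|apply intg_scal; auto].
  rewrite Rmult_assoc. apply CI_bound.
  - apply (intg_minus _ _ (intg_scal (Cexp (c * x)) _ Is) IG).
  - intros v.
    replace (Cexp (c * x) * (Cexp (c * (v + - x)%R) * hP (exp x) (v + - x)) - Cexp (c * v) * hG v) with
      (Cexp (c * v) * hG v * RtoC (exp (- (exp (v + - x) * exp (v + - x) / 2)) - 1)).
    2:{ rewrite Cmult_assoc, <- Cexp_plus.
        replace (c * x + c * (v + - x)%R) with (c * v) by (rewrite RtoC_plus, RtoC_opp; ring).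
        unfold hP, hG. set (q := (exp (v + - x) * exp (v + - x) / 2)%R).
        assert (X : RtoC (exp x) * RtoC (exp (v + - x)) = RtoC (exp v))
          by (rewrite <- RtoC_mult, <- exp_plus; f_equal; f_equal; ring).
        rewrite X, RtoC_minus.
        replace (- RtoC q - RtoC (exp v)) with (RtoC (- q) + RtoC (- exp v)) by (rewrite !RtoC_opp; ring).
        rewrite Cexp_plus, !Cexp_RtoC. ring. }
    rewrite !Cmod_mult, Cmod_R, Cmod_Cexp.
    set (y := (exp (v + - x) * exp (v + - x) / 2)%R).
    assert (Py : (0 <= y)%R) by (unfold y; generalize (Rle_0_sqr (exp (v + - x))); unfold Rsqr; lra).
    assert (B1 : (Rabs (exp (- y) - 1) <= exp (2 * v) * exp (- (2 * x)))%R).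
    { rewrite Rabs_left1.
      - apply Rle_trans with y; [generalize (exp_ineq1_le (- y)); lra|].
        unfold y. rewrite <- !exp_plus. replace (v + - x + (v + - x))%R with (2 * v + - (2 * x))%R by ring.
        generalize (exp_pos (2 * v + - (2 * x))); lra.
      - assert (exp (- y) <= exp 0)%R by (apply exp_le; lra). rewrite exp_0 in H. lra. }
    unfold hG. rewrite Cmod_R, (Rabs_pos_eq (exp (- exp v))) by (left; apply exp_pos).
    replace (Re (c * v)) with (Re c * v)%R by (unfold Re; simpl; ring).
    specialize (HM v).
    apply Rle_trans with (exp (Re c * v) * exp (- exp v) * (exp (2 * v) * exp (- (2 * x))))%R.
    + apply Rmult_le_compat_l; auto. left; apply Rmult_lt_0_compat; apply exp_pos.
    + apply Rle_trans with (exp (- (1 * exp v) + (Re c + 2) * v + 0 * lg v) * exp (- (2 * x)))%R.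
      * right. rewrite <- !exp_plus. f_equal. ring.
      * unfold Rdiv in *. rewrite (Rmult_assoc M), (Rmult_comm (exp (- (2 * x)))), <- Rmult_assoc.
        apply Rmult_le_compat_r; auto. left; apply exp_pos.
Qed.

Lemma UP_asym (a : C) : (- (1 / 2) < Re a)%R -> asym a (UP a).
Proof.
  intros Ha. set (c := 1 + 2 * a).
  assert (Hc : (0 < Re c)%R) by (unfold c, Re in *; simpl; lra).
  assert (Hc1 := Re_succ_pos c 1 Hc ltac:(lra)).
  destruct (MP_real_asym c Hc) as [K HK]. destruct (MP_real_asym (c + 1) Hc1) as [K1 HK1].
  assert (NG := mel_hG_neq_0 c Hc). assert (PG := proj1 (Cmod_gt_0 _) NG).
  set (G1 := Cmod (mel hG (c + 1))).
  intros eps He.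
  destruct (exp_small (Rabs K + G1 + Rabs K1) (eps * Cmod (mel hG c))) as [X [PX HX]]; [nra|].
  exists X. intros w Hw.
  set (x := ((w + ln 2) / 2)%R).
  assert (L2 : (0 < ln 2)%R) by (rewrite <- ln_1; apply ln_increasing; lra).
  assert (x0 : (0 <= x)%R) by (unfold x; lra).
  assert (Ex : xiw w = RtoC (exp x)).
  { unfold xiw, x. rewrite <- Cexp_RtoC. f_equal. rewrite RtoC_div, RtoC_plus by lra. reflexivity. }
  assert (Nw := Cexp_neq_0 (- a * w)).
  assert (E : UP a w / Cexp (- a * w) - 1 = / mel hG c *
    ((Cexp (c * x) * MP c (exp x) - mel hG c) + RtoC (exp (- (2 * x))) * (Cexp ((c + 1) * x) * MP (c + 1) (exp x)))).
  { unfold UP, kap, QP. fold c. rewrite Ex.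
    assert (E1 : Cexp (a * ln 2) = Cexp (c * x) * Cexp (- a * w) * / exp x).
    { rewrite <- (Cexp_RtoC x), <- Cexp_opp, <- !Cexp_plus. f_equal. unfold c, x.
      rewrite RtoC_div, RtoC_plus by lra. field; apply C2_neq_0. }
    assert (E2 : RtoC (exp (- (2 * x))) * Cexp ((c + 1) * x) = Cexp (c * x) * / exp x).
    { rewrite <- !Cexp_RtoC, <- Cexp_opp, <- !Cexp_plus. f_equal. rewrite RtoC_opp, RtoC_mult. ring. }
    assert (Ne : RtoC (exp x) <> 0).
    { rewrite <- Cexp_RtoC. apply Cexp_neq_0. }
    rewrite (Cmult_assoc (RtoC (exp (- (2 * x))))), E2, E1. field; auto. }
  rewrite E, Cmod_mult, Cmod_inv by auto.
  apply Rmult_lt_reg_l with (Cmod (mel hG c)); auto.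
  rewrite <- Rmult_assoc, Rinv_r, Rmult_1_l by lra.
  specialize (HK x x0). specialize (HK1 x x0).
  assert (P2 := exp_pos (- (2 * x))).
  assert (e1 : (exp (- (2 * x)) <= 1)%R) by (rewrite <- exp_0; apply exp_le; lra).
  assert (ew : (exp (- (2 * x)) <= exp (- w))%R) by (apply exp_le; unfold x; lra).
  eapply Rle_lt_trans; [apply Cmod_triangle|].
  rewrite (Cmod_mult (RtoC _)), Cmod_R, Rabs_pos_eq by lra.
  assert (T : (Cmod (Cexp ((c + 1) * x) * MP (c + 1) (exp x))%C <= Rabs K1 + G1)%R).
  { assert (T := Cmod_triangle (Cexp ((c + 1) * x) * MP (c + 1) (exp x) - mel hG (c + 1)) (mel hG (c + 1))).
    replace (Cexp ((c + 1) * x) * MP (c + 1) (exp x) - mel hG (c + 1) + mel hG (c + 1)) with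
      (Cexp ((c + 1) * x) * MP (c + 1) (exp x)) in T by ring.
    fold G1 in T. assert (K1 * exp (- (2 * x)) <= Rabs K1 * 1)%R; [|lra].
    apply Rle_trans with (Rabs K1 * exp (- (2 * x)))%R.
    - apply Rmult_le_compat_r; [lra | apply Rle_abs].
    - apply Rmult_le_compat_l; [apply Rabs_pos | auto]. }
  specialize (HX w Hw).
  assert (T1 : (K * exp (- (2 * x)) <= Rabs K * exp (- w))%R).
  { apply Rle_trans with (Rabs K * exp (- (2 * x)))%R.
    - apply Rmult_le_compat_r; [lra | apply Rle_abs].
    - apply Rmult_le_compat_l; [apply Rabs_pos | auto]. }
  assert (T2 : (exp (- (2 * x)) * Cmod (Cexp ((c + 1) * x) * MP (c + 1) (exp x))%C <= exp (- w) * (Rabs K1 + G1))%R).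
  { apply Rmult_le_compat; auto using Cmod_ge_0. lra. }
  lra.
Qed.

Lemma UP1_bound (a : C) : (- (1 / 2) < Re a)%R -> exists B, forall x : R, (0 <= x)%R -> (Cmod (UP1 a x) <= B)%R.
Proof.
  intros Ha. set (c := 1 + 2 * a).
  assert (Hc : (0 < Re c)%R) by (unfold c, Re in *; simpl; lra).
  destruct (MP_intg c 0 Hc) as [_ [M BM]].
  exists (Cmod (kap a) * (Cmod (- (2 * a)) * (PI * M)))%R. intros x Hx.
  unfold UP1. fold c. unfold Cdiv. rewrite !Cmod_mult.
  assert (L2 : (0 < ln 2)%R) by (rewrite <- ln_1; apply ln_increasing; lra).
  assert (Ex : xiw x = RtoC (exp ((x + ln 2) / 2))).
  { unfold xiw. rewrite <- Cexp_RtoC. f_equal. rewrite RtoC_div, RtoC_plus by lra. reflexivity. }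
  assert (e1 : (1 <= exp ((x + ln 2) / 2))%R) by (rewrite <- exp_0; apply exp_le; lra).
  rewrite Cmod_inv, Ex, Cmod_R, Rabs_pos_eq by (apply xiw_neq_0 || lra).
  assert (BMP : (Cmod (MP c (exp ((x + ln 2) / 2))) <= PI * M)%R).
  { apply CI_bound; [apply (MP_intg c _ Hc)|]. intros v. eapply Rle_trans; [|apply (BM v)].
    rewrite !Cmod_mult, !Cmod_hP. apply Rmult_le_compat_l; [apply Cmod_ge_0|]. apply exp_le.
    simpl. generalize (exp_pos v). nra. }
  assert (i1 : (/ exp ((x + ln 2) / 2) <= 1)%R).
  { rewrite <- Rinv_1. apply Rinv_le_contravar; lra. }
  assert (i0 : (0 < / exp ((x + ln 2) / 2))%R) by (apply Rinv_0_lt_compat; lra).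
  rewrite Rmult_assoc. apply Rmult_le_compat_l; [apply Cmod_ge_0|].
  apply Rmult_le_compat_l; [apply Cmod_ge_0|].
  rewrite <- (Rmult_1_r (PI * M)). apply Rmult_le_compat; auto using Cmod_ge_0. lra.
Qed.

(** Kummer's transformation [U(a, 1/2, z) = z^(1/2) U(a + 1/2, 3/2, z)]. *)
Lemma Ksol_transform (a : C) (S : C -> Prop) (v v1 : C -> C) :
  Ksol (a + RtoC (1 / 2)) (RtoC (3 / 2)) S v v1 ->
  Ksol a (RtoC (1 / 2)) S (fun w => Cexp (w / 2) * v w)
    (fun w => Cexp (w / 2) * (v w / (2 * Cexp w) + v1 w)).
Proof.
  intros V w Hw. destruct (V w Hw) as [D1 D2].
  assert (N := Cexp_neq_0 w). assert (N2 := C2_neq_0).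
  assert (E : CD (fun w => Cexp (w / 2)) w (Cexp (w / 2) / 2)).
  { unfold Cdiv. apply (CD_exp (fun w => w * / 2)).
    eapply CD_eq; [apply CD_mult; [apply CD_id | apply CD_const]|]. cbv beta; ring. }
  assert (h3 : RtoC (3 / 2) = 1 + / 2) by (rewrite <- RtoC_inv, <- RtoC_plus by lra; f_equal; field).
  assert (h1 : RtoC (1 / 2) = / 2) by (rewrite <- RtoC_inv by lra; f_equal; field).
  split.
  - eapply CD_eq; [apply CD_mult; eassumption|]. cbv beta; field; auto.
  - unfold Cdiv. eapply CD_eq.
    + apply CD_mult; [exact E|]. apply CD_plus; [|exact D2]. apply CD_mult; [exact D1|].
      apply (CD_comp (fun x => / x) (fun w => 2 * Cexp w)).
      * apply CD_inv. apply Cmult_neq_0; auto.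
      * apply CD_scal, CD_Cexp.
    + rewrite h1, h3. cbv beta. unfold Cdiv. field; auto.
Qed.

Lemma sector_transform (a : C) (v : C -> C) : sector_asym (a + RtoC (1 / 2)) v ->
  sector_asym a (fun w => Cexp (w / 2) * v w).
Proof.
  intros S d Hd eps He. destruct (S d Hd eps He) as [M H]. exists M. intros w H1 H2.
  replace (Cexp (w / 2) * v w / Cexp (- a * w)) with (v w / Cexp (- (a + RtoC (1 / 2)) * w)); [apply H; auto|].
  replace (- a * w) with (- (a + RtoC (1 / 2)) * w + w / 2).
  - rewrite Cexp_plus. field. split; apply Cexp_neq_0.
  - rewrite RtoC_div by lra. field; apply C2_neq_0.
Qed.

(** [UP] is a solution on the whole surface but its asymptotics are computed on the positive axis
    only; the transformed Laplace integral has the asymptotics in the full sector but lives on one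
    sheet. Uniqueness identifies the two and shows that [U(a, 1/2, .)] exists. *)
Lemma KummerU_half (a : C) : (- (1 / 2) < Re a)%R ->
  (forall w, KummerU a (RtoC (1 / 2)) w = UP a w) /\
  (forall w, strip w -> UP a w =
     Cexp (w / 2) * (/ mel hG (a + RtoC (1 / 2)) * J (a + RtoC (1 / 2)) (1 - a) w)).
Proof.
  intros Ha. set (al := a + RtoC (1 / 2)).
  assert (Hal : (0 < Re al)%R) by (unfold al, Re in *; simpl; lra).
  assert (Eb : al + (1 - a) = RtoC (3 / 2)).
  { unfold al. replace (a + RtoC (1 / 2) + (1 - a)) with (RtoC (1 / 2) + 1) by ring.
    rewrite <- RtoC_plus. f_equal. field. }
  assert (KJ := J_Ksol al (1 - a) (/ mel hG al) Hal). rewrite Eb in KJ.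
  assert (KT := Ksol_transform a strip _ _ KJ).
  assert (ST := sector_transform a _ (J_sector al (1 - a) Hal)).
  destruct (UP1_bound a Ha) as [B HB].
  assert (EJ : forall w, strip w -> UP a w = Cexp (w / 2) * (/ mel hG al * J al (1 - a) w)).
  { apply (kummer_unique a (RtoC (1 / 2)) strip (UP a) (UP1 a) _ _ B strip_convex strip_real) with (2 := KT); auto.
    - apply (Ksol_sub _ _ (fun _ => True)); auto using UP_Ksol.
    - apply UP_asym; auto.
    - apply sector_asym_asym; auto. }
  split; auto.
  assert (SU : sector_asym a (UP a)) by (eapply sector_asym_ext; [exact EJ | exact ST]).
  assert (K : is_KummerU a (RtoC (1 / 2)) (KummerU a (RtoC (1 / 2)))).
  { apply (epsilon_spec _ (is_KummerU a (RtoC (1 / 2)))). exists (UP a).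
    apply is_KummerU_intro with (UP1 a); auto using UP_Ksol. }
  destruct (is_KummerU_elim _ _ _ K) as [v1 [V S]].
  intros w. symmetry.
  apply (kummer_unique a (RtoC (1 / 2)) (fun _ => True) (UP a) (UP1 a) _ v1 B); auto using UP_Ksol.
  - intros x y _ _ t _. exact I.
  - apply UP_asym; auto.
  - apply sector_asym_asym; auto.
Qed.

Lemma ParabolicD_log_DP (nu w : C) : (Re nu < 1)%R -> ParabolicD_log nu w = DP (1 - nu) (Cexp w).
Proof.
  intros Hn. assert (N2 := C2_neq_0).
  assert (Ha : (- (1 / 2) < Re (- nu / 2))%R).
  { replace (- nu / 2) with (RtoC (- (1 / 2)) * nu).
    - unfold Re in *; simpl. lra.
    - rewrite RtoC_opp, RtoC_div by lra. field; auto. }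
  unfold ParabolicD_log. rewrite (proj1 (KummerU_half _ Ha)). unfold UP, kap, DP.
  replace (1 + 2 * (- nu / 2)) with (1 - nu) by (field; auto).
  replace (xiw (2 * w - ln 2)) with (Cexp w) by (unfold xiw; f_equal; field; auto).
  transitivity (Cexp (nu / 2 * ln 2) * Cexp (- nu / 2 * ln 2) * (Cexp (- (Cexp w * Cexp w) / 4) *
    (/ mel hG (1 - nu) * QP (1 - nu) (Cexp w)))); [ring|].
  rewrite <- Cexp_plus. replace (nu / 2 * ln 2 + - nu / 2 * ln 2) with (RtoC 0) by (field; auto).
  rewrite Cexp_0. ring.
Qed.

Lemma Proper_locally'_C (x : C) : ProperFilter' (@locally' C_UniformSpace x).
Proof.
  split.
  - intros [eps H]. apply (H (x + RtoC (eps / 2))).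
    + assert (P := cond_pos eps). split; unfold ball; simpl; unfold AbsRing_ball, abs, minus, plus, opp; simpl.
      * replace (fst x + eps / 2 + - fst x)%R with (eps / 2)%R by ring. rewrite Rabs_pos_eq; lra.
      * replace (snd x + 0 + - snd x)%R with 0%R by ring. rewrite Rabs_R0; lra.
    + intros E. assert (Z : RtoC (eps / 2) = 0) by (replace (RtoC (eps / 2)) with (x + RtoC (eps / 2) - x) by ring; rewrite E; ring).
      apply RtoC_inj in Z. generalize (cond_pos eps); lra.
  - apply within_filter, locally_filter.
Qed.

(** For nonzero [xi] this is [KummerU_half]; at the origin the limit in the definition of
    [ParabolicD] is the value of the entire function [DP]. *)
Lemma ParabolicD_DP (nu xi : C) : (Re nu < 1)%R -> ParabolicD nu xi = DP (1 - nu) xi.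
Proof.
  intros Hn. unfold ParabolicD. destruct (Ceq_dec xi 0) as [E|E].
  - subst xi.
    assert (F : filterlim (fun y : C => ParabolicD_log nu (Clog y)) (@locally' C_UniformSpace (RtoC 0))
      (@locally C_CompleteNormedModule (DP (1 - nu) 0))).
    { assert (Hc : (0 < Re (1 - nu))%R) by (unfold Re in *; simpl; lra).
      assert (Cc := CD_ccts _ _ _ (DP_CD (1 - nu) 0 Hc)). destruct Cc as [A B].
      intros P [eps HP]. unfold filtermap, locally', within.
      assert (A1 : @locally C_UniformSpace (RtoC 0) (fun u => ball (Re (DP (1 - nu) 0)) eps (Re (DP (1 - nu) u))))
        by (apply A, locally_ball).
      assert (B1 : @locally C_UniformSpace (RtoC 0) (fun u => ball (Im (DP (1 - nu) 0)) eps (Im (DP (1 - nu) u))))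
        by (apply B, locally_ball).
      generalize (filter_and _ _ A1 B1). apply filter_imp. intros u [H1 H2] Nu. apply HP.
      rewrite ParabolicD_log_DP, Cexp_Clog by auto. split; auto. }
    exact (@iota_filterlim_locally C_AbsRing C_CompleteNormedModule C (@locally' C_UniformSpace (RtoC 0))
      (Proper_locally'_C 0) _ _ F).
  - rewrite ParabolicD_log_DP by auto. rewrite Cexp_Clog; auto.
Qed.

(** * Bounds for large parameter *)

(** [Gamma(3/4 - s) D_(2s - 1/2)(xi)] at [al = 3/4 - s]; the other half of the integrand is the
    same function at [al = 3/4 + s]. *)
Definition GP (al xi : C) : C := mel hG al * DP (2 * al) xi.
Definition GP1 (al xi : C) : C := mel hG al * DP1 (2 * al) xi.

Lemma Re_double al : (0 < Re al)%R -> (0 < Re (2 * al))%R.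
Proof. unfold Re; simpl. lra. Qed.

Lemma GP_CD al xi : (0 < Re al)%R -> CD (GP al) xi (GP1 al xi).
Proof. intros H. apply CD_scal, DP_CD, Re_double, H. Qed.

Lemma GP1_CD al xi : (0 < Re al)%R ->
  CD (GP1 al) xi ((xi * xi / 4 + 2 * al - RtoC (3 / 2)) * GP al xi).
Proof.
  intros H. eapply CD_eq; [apply CD_scal, DP1_CD, Re_double, H|]. unfold GP. ring.
Qed.

Lemma CD_unique f z l l' : CD f z l -> CD f z l' -> l = l'.
Proof.
  intros A B. assert (Z : (Cmod (l - l') <= 0)%R).
  { apply le_epsilon. intros eps He. rewrite Rplus_0_l.
    destruct (A (eps / 2)%R ltac:(lra)) as [d1 [P1 H1]]. destruct (B (eps / 2)%R ltac:(lra)) as [d2 [P2 H2]].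
    set (h := (Rmin d1 d2 / 2)%R). assert (Pm : (0 < Rmin d1 d2)%R) by (apply Rmin_pos; auto).
    assert (Ph : Cmod (RtoC h) = h) by (rewrite Cmod_R; apply Rabs_pos_eq; unfold h; lra).
    assert (m1 := Rmin_l d1 d2). assert (m2 := Rmin_r d1 d2).
    specialize (H1 (RtoC h) ltac:(rewrite Ph; unfold h; lra)).
    specialize (H2 (RtoC h) ltac:(rewrite Ph; unfold h; lra)). rewrite Ph in H1, H2.
    assert (T := Cmod_triangle (- (f (z + h) - f z - h * l)) (f (z + h) - f z - h * l')).
    rewrite Cmod_opp in T.
    replace (- (f (z + h) - f z - h * l) + (f (z + h) - f z - h * l')) with (h * (l - l')) in T by ring.
    rewrite Cmod_mult, Ph in T. assert (0 < h)%R by (unfold h; lra).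
    apply Rmult_le_reg_l with h; auto. lra. }
  assert (E : l - l' = 0) by (apply Cmod_eq_0; generalize (Cmod_ge_0 (l - l')); lra).
  replace l with (l - l' + l') by ring. rewrite E. ring.
Qed.

Lemma strip_open w : strip w -> exists r, (0 < r)%R /\ forall x, (Cmod (x - w) < r)%R -> strip x.
Proof.
  intros H. unfold strip in *. exists (3 / 2 * PI - Rabs (Im w))%R. split; [lra|]. intros x Hx.
  assert (P := im_le_Cmod (x - w)). replace (Im (x - w)) with (Im x - Im w)%R in P by reflexivity.
  generalize (Rabs_triang_inv (Im x) (Im w)). lra.
Qed.

(** By [KummerU_half] the gamma factor cancels and a Laplace integral remains. *)
Lemma GP_ray (al om : C) : (0 < Re al)%R -> (Rabs (Im om) < 3 / 4 * PI)%R ->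
  let xi := Cexp om in let w := 2 * om - ln 2 in
  let g := Cexp (- (xi * xi) / 4) * Cexp ((RtoC (1 / 2) - al) * ln 2) * Cexp (w / 2) in
  let J0 := J al (RtoC (3 / 2) - al) w in let J1 := J (al + 1) (RtoC (3 / 2) - al) w in
  GP al xi = g * J0 /\ GP1 al xi = g * (xi * (J0 / (xi * xi) - J1) - xi / 2 * J0).
Proof.
  intros Ha Ho xi w g J0 J1.
  assert (NG := mel_hG_neq_0 al Ha). assert (N2 := C2_neq_0).
  set (a := al - RtoC (1 / 2)).
  assert (Haa : (- (1 / 2) < Re a)%R) by (unfold a, Re in *; simpl; lra).
  assert (Sw : strip w).
  { unfold strip, w. replace (Im (2 * om - ln 2)) with (2 * Im om)%R by (unfold Im; simpl; ring).
    rewrite Rabs_mult, Rabs_pos_eq; lra. }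
  assert (Ea : a + RtoC (1 / 2) = al) by (unfold a; ring).
  assert (Eb : 1 - a = RtoC (3 / 2) - al).
  { unfold a. replace (RtoC (3 / 2)) with (1 + RtoC (1 / 2)) by (rewrite <- RtoC_plus; f_equal; field). ring. }
  assert (Ec : 1 + 2 * a = 2 * al).
  { unfold a. rewrite RtoC_div by lra. field; auto. }
  assert (Ex : xiw w = xi) by (unfold xiw, w, xi; f_equal; field; auto).
  assert (Ez : Cexp w = xi * xi / 2) by (rewrite <- Ex, xiw_sqr; field; auto).
  assert (Nx : xi <> 0) by apply Cexp_neq_0.
  destruct (KummerU_half a Haa) as [_ K]. rewrite Ea, Eb in K.
  assert (K0 := K w Sw). fold J0 in K0.
  assert (K1 : UP1 a w = Cexp (w / 2) * (/ mel hG al * (J0 / (2 * Cexp w) - J1))).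
  { assert (KJ := J_Ksol al (RtoC (3 / 2) - al) (/ mel hG al) Ha).
    replace (al + (RtoC (3 / 2) - al)) with (RtoC (3 / 2)) in KJ by ring. rewrite <- Ea in KJ at 1.
    destruct (Ksol_transform a strip _ _ KJ w Sw) as [D1 _].
    destruct (UP_Ksol a Haa w I) as [D2 _].
    destruct (strip_open w Sw) as [r [Pr Hr]].
    assert (D3 := CD_ext_loc _ _ w _ r Pr (fun x Hx => K x (Hr x Hx)) D2).
    assert (E := CD_unique _ _ _ _ D3 D1). cbv beta in E. fold J0 J1 in E.
    assert (N := Cexp_neq_0 w).
    replace (UP1 a w) with (Cexp w * UP1 a w / Cexp w) by (field; auto). rewrite E. field; auto. }
  unfold UP in K0. unfold UP1 in K1. rewrite Ec, Ex in K0, K1. unfold kap in K0, K1. rewrite Ec in K0, K1.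
  assert (Na := Cexp_neq_0 (a * ln 2)). assert (NG2 := mel_hG_neq_0 (2 * al) (Re_double al Ha)).
  assert (Eg : Cexp ((RtoC (1 / 2) - al) * ln 2) = / Cexp (a * ln 2)).
  { rewrite <- Cexp_opp. f_equal. unfold a. ring. }
  assert (Q0 : / mel hG (2 * al) * QP (2 * al) xi = / Cexp (a * ln 2) * (Cexp (w / 2) * (/ mel hG al * J0))).
  { rewrite <- K0. field; auto. }
  assert (Q1 : / mel hG (2 * al) * ((1 - 2 * al) * MP (2 * al) xi) =
    / Cexp (a * ln 2) * (Cexp (w / 2) * (/ mel hG al * (J0 / (2 * Cexp w) - J1))) * xi).
  { rewrite <- K1. replace (- (2 * a)) with (1 - 2 * al) by (rewrite <- Ec; ring). field; auto. }
  split.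
  - unfold GP, DP. rewrite Q0. unfold g. rewrite Eg. field; auto.
  - unfold GP1, DP1.
    replace (/ mel hG (2 * al) * ((1 - 2 * al) * MP (2 * al) xi - xi / 2 * QP (2 * al) xi)) with
      (/ mel hG (2 * al) * ((1 - 2 * al) * MP (2 * al) xi) - xi / 2 * (/ mel hG (2 * al) * QP (2 * al) xi)) by ring.
    rewrite Q0, Q1, Ez. unfold g. rewrite Eg. field; auto.
Qed.

(** For [e Im al <= 0], the dependence on [Im al] of the modulus of [((1 + t) / t)^(- al)] on the
    ray [arg t = - e ph] is then a factor at most [e^(- |Im al| sin ph / (1 + |t|))]. *)
Lemma Im_lam_lower (e ph v : R) : (e = 1 \/ e = - 1)%R -> (0 < ph < PI)%R ->
  (sin ph / (1 + exp v) <= e * Im (lam (v, - (e * ph)))%R)%R.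
Proof.
  intros He Hp. set (y := ((v, - (e * ph))%R : C)).
  assert (By : (- PI < Im y < PI)%R) by (unfold y; simpl; destruct He as [-> | ->]; lra).
  assert (S := slit_lam y By). assert (E := Cexp_lam y By).
  assert (N := slit_neq_0 _ S). assert (P := proj1 (Cmod_gt_0 _) N).
  set (u := 1 + Cexp (- y)) in *.
  assert (Lb : (- PI < Im (lam y) < PI)%R) by (apply (Carg_slit u); auto).
  (* the sine of the argument of [u = (1 + t) / t], from the imaginary part of [u] *)
  assert (I1 : (Cmod u * sin (Im (lam y)) = e * (exp (- v) * sin ph))%R).
  { assert (Er : exp (Re (lam y)) = Cmod u) by (unfold lam; fold u; apply exp_ln; auto).
    rewrite <- Er. change (Im (Cexp (lam y)) = e * (exp (- v) * sin ph))%R.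
    rewrite E. unfold u, y, Cexp, Re, Im; simpl. rewrite Ropp_involutive.
    destruct He as [-> | ->].
    - rewrite !Rmult_1_l. ring.
    - replace (-1 * ph)%R with (- ph)%R by ring. rewrite sin_neg. ring. }
  assert (sp : (0 < sin ph)%R) by (apply sin_gt_0; lra).
  assert (U : (Cmod u <= 1 + exp (- v))%R).
  { unfold u. eapply Rle_trans; [apply Cmod_triangle|]. rewrite Cmod_1, Cmod_Cexp. right. reflexivity. }
  assert (ev := exp_pos (- v)).
  set (x := (e * Im (lam y))%R).
  assert (sx : (sin x = exp (- v) * sin ph / Cmod u)%R).
  { apply Rmult_eq_reg_l with (Cmod u); [|lra].
    replace (Cmod u * (exp (- v) * sin ph / Cmod u))%R with (exp (- v) * sin ph)%R by (field; lra).
    unfold x. destruct He as [-> | ->].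
    - rewrite Rmult_1_l, I1. ring.
    - replace (-1 * Im (lam y))%R with (- Im (lam y))%R by ring. rewrite sin_neg.
      replace (Cmod u * - sin (Im (lam y)))%R with (- (Cmod u * sin (Im (lam y))))%R by ring. rewrite I1. ring. }
  assert (bx : (- PI < x < PI)%R) by (unfold x; destruct He as [-> | ->]; lra).
  assert (sx0 : (0 < sin x)%R) by (rewrite sx; apply Rdiv_lt_0_compat; nra).
  assert (x0 : (0 < x)%R).
  { apply Rnot_le_lt. intros [L|L].
    - assert (sin x < 0)%R by (apply sin_lt_0_var; lra). lra.
    - rewrite L, sin_0 in sx0. lra. }
  apply Rle_trans with (sin x); [|left; apply sin_lt_x; auto].
  rewrite sx. apply Rle_trans with (exp (- v) * sin ph / (1 + exp (- v)))%R.
  - right. rewrite exp_Ropp. field. generalize (exp_pos v); lra.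
  - unfold Rdiv. apply Rmult_le_compat_l; [nra|]. apply Rinv_le_contravar; auto.
Qed.

(** The natural scale: for large [|Im s|] the functions [GP] grow or decay like exponentials of
    [TT]. *)
Definition TT (al : C) : R := sqrt (Rabs (Im al) + 1).

Lemma TT_sqr al : (TT al * TT al = Rabs (Im al) + 1)%R.
Proof. apply sqrt_sqrt. generalize (Rabs_pos (Im al)); lra. Qed.

Lemma TT_ge_1 al : (1 <= TT al)%R.
Proof.
  unfold TT. rewrite <- sqrt_1 at 1. apply sqrt_le_1_alt. generalize (Rabs_pos (Im al)); lra.
Qed.

(** Saddle point bound on a ray: by the arithmetic-geometric inequality, the two decaying
    exponents satisfy [c (1 + r) + T^2 S / (1 + r) >= rho T] with [rho^2 = 4 c S]. *)
Lemma J_ray_bound (w : C) (e ph rho d A0 : R) (j : nat) : (e = 1 \/ e = - 1)%R ->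
  (0 < ph < PI)%R -> adm w (- (e * ph)) -> strip w -> (0 < A0)%R -> (0 < d < 1)%R -> (0 <= rho)%R ->
  (rho * rho <= 4 * (exp (Re w) * cos (Im w - e * ph)) * sin ph)%R ->
  exists K, forall al : C, Re al = A0 -> (e * Im al <= 0)%R ->
  (Cmod (J (al + INR j) (RtoC (3 / 2) - al) w)%C <= K * exp (- ((1 - d) * rho * TT al)))%R.
Proof.
  intros He Hp A Sw HA Hd Hr Hrho.
  set (th := (- (e * ph))%R) in *.
  set (c0 := (exp (Re w) * cos (Im w - e * ph))%R) in *.
  assert (Pc : (0 < c0)%R).
  { assert (P := adm_pos w th A). rewrite Re_ray in P. unfold c0, th in *.
    replace (Im w - e * ph)%R with (Im w + - (e * ph))%R by ring. auto. }
  assert (sp : (0 < sin ph)%R) by (apply sin_gt_0; lra).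
  assert (sp1 : (sin ph <= 1)%R) by apply SIN_bound.
  assert (Hth : (Rabs th < PI)%R) by apply A.
  destruct (hJ_bound (RtoC A0 + INR j) (RtoC (3 / 2) - RtoC A0) (Rabs th)) as [K [PK HK]].
  { split; [apply Rabs_pos | auto]. }
  assert (Aj : (0 < A0 + INR j)%R) by (generalize (pos_INR j); lra).
  destruct (double_exp_bound (d * c0) (A0 + INR j) (3 / 2 - A0 - 1)) as [M HM]; [nra | auto |].
  exists (PI * (exp (1 + c0) * K * M))%R. intros al Hal Hi.
  assert (Ra : (0 < Re (al + INR j))%R) by (unfold Re in *; simpl; lra).
  rewrite (J_adm _ _ th w Ra A Sw). unfold Jray, ET.
  assert (I := Jray_intg (al + INR j) (RtoC (3 / 2) - al) th w Ra A).
  set (X := exp (- ((1 - d) * rho * TT al))).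
  replace (PI * (exp (1 + c0) * K * M) * X)%R with (PI * (exp (1 + c0) * K * X * M))%R by ring.
  apply CI_bound; [apply I|]. intros v. rewrite Cmod_mult, Cmod_Cexp.
  replace (Re (- (Cexp (w + (0, th)) * exp v))) with (- (c0 * exp v))%R.
  2:{ replace (Re (- (Cexp (w + (0, th)) * exp v))) with (- (Re (Cexp (w + (0, th))) * exp v))%R
        by (unfold Re; simpl; ring).
      rewrite Re_ray. unfold c0, th. replace (Im w - e * ph)%R with (Im w + - (e * ph))%R by ring. ring. }
  assert (EhJ : Cmod (hJ (al + INR j) (RtoC (3 / 2) - al) (v, th)) =
     (Cmod (hJ (RtoC A0 + INR j) (RtoC (3 / 2) - RtoC A0) (v, th)) * exp (Im al * Im (lam (v, th))))%R).
  { unfold hJ. rewrite !Cmod_Cexp, <- exp_plus. f_equal. unfold Re, Im in *; simpl. rewrite Hal. ring. }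
  rewrite EhJ.
  assert (L := Im_lam_lower e ph v He Hp). fold th in L.
  assert (ev := exp_pos v).
  assert (Sr : (0 < sin ph / (1 + exp v) <= 1)%R).
  { split; [apply Rdiv_lt_0_compat; lra|]. apply Rmult_le_reg_r with (1 + exp v)%R; [lra|].
    unfold Rdiv. rewrite Rmult_assoc, Rinv_l; lra. }
  set (S := (sin ph / (1 + exp v))%R) in *.
  assert (Tq := TT_sqr al). assert (T1 := TT_ge_1 al). set (T := TT al) in *.
  assert (E1 : (Im al * Im (lam (v, th)) <= 1 - T * T * S)%R).
  { assert (Ei : (Im al * Im (lam (v, th)) = - (Rabs (Im al) * (e * Im (lam (v, th)))))%R).
    { destruct He as [-> | ->].
      - rewrite Rabs_left1 by lra. ring.
      - rewrite Rabs_pos_eq by lra. ring. }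
    rewrite Ei, Tq. assert (Q := Rabs_pos (Im al)). nra. }
  (* arithmetic-geometric mean; below, the fraction [d] of [c0 e^v] is kept for convergence *)
  assert (AM : (rho * T <= c0 * (1 + exp v) + T * T * S)%R).
  { apply Rsqr_incr_0_var; [|nra]. unfold Rsqr.
    assert (Q : (c0 * (1 + exp v) * S = c0 * sin ph)%R) by (unfold S; field; lra).
    assert (0 <= (c0 * (1 + exp v) - T * T * S) * (c0 * (1 + exp v) - T * T * S))%R by apply Rle_0_sqr.
    assert (rho * rho * (T * T) <= 4 * c0 * sin ph * (T * T))%R by (apply Rmult_le_compat_r; nra).
    nra. }
  assert (E2 : (- (c0 * exp v) + (1 - T * T * S) <= - ((1 - d) * rho * T) + (1 + c0) - d * c0 * exp v)%R).
  { assert ((1 - d) * (rho * T) <= (1 - d) * (c0 * (1 + exp v) + T * T * S))%R by (apply Rmult_le_compat_l; lra).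
    assert (0 <= d * (T * T * S))%R by (apply Rmult_le_pos; nra). nra. }
  specialize (HK v th (Rle_refl _)).
  replace (Re (RtoC A0 + INR j)) with (A0 + INR j)%R in HK by reflexivity.
  replace (Re (RtoC (3 / 2) - RtoC A0)) with (3 / 2 - A0)%R in HK by reflexivity.
  rewrite (Rmult_comm (Cmod _)), <- Rmult_assoc, <- exp_plus.
  apply Rle_trans with (exp (- ((1 - d) * rho * T) + (1 + c0) - d * c0 * exp v) *
     (K * exp ((A0 + INR j) * v + (3 / 2 - A0 - 1) * lg v)))%R.
  - apply Rmult_le_compat; [left; apply exp_pos | apply Cmod_ge_0 | apply exp_le; lra | apply HK].
  - apply Rle_trans with (exp (1 + c0) * K * X * exp (- (d * c0 * exp v) + (A0 + INR j) * v + (3 / 2 - A0 - 1) * lg v))%R.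
    + right. unfold X.
      replace (- ((1 - d) * rho * T) + (1 + c0) - d * c0 * exp v)%R with
        (- ((1 - d) * rho * T) + (1 + c0) + - (d * c0 * exp v))%R by ring.
      rewrite (exp_plus (- (d * c0 * exp v) + (A0 + INR j) * v)), (exp_plus (- (d * c0 * exp v))),
        (exp_plus ((A0 + INR j) * v)), (exp_plus _ (- (d * c0 * exp v))), (exp_plus _ (1 + c0)). ring.
    + unfold Rdiv. rewrite (Rmult_assoc _ M). apply Rmult_le_compat_l; [|apply HM].
      apply Rmult_le_pos; [|left; apply exp_pos]. apply Rmult_le_pos; [left; apply exp_pos | lra].
Qed.

(** [Re ((1 - e i) xi)], the rate of decay of [GP] on the half of the line where [e Im al <= 0]. *)
Definition rate (e : R) (xi : C) : R := (Re xi + e * Im xi)%R.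

(** With the ray chosen below, [Im w - e ph] is the angle [chi] between [xi] and [e^(e i PI / 4)],
    and [sin ph = cos chi]; the constant of [J_ray_bound] is then exactly [rate e xi]. *)
Lemma GP_ray_bound (xi : C) (e d A0 : R) : (e = 1 \/ e = - 1)%R -> (0 < rate e xi)%R -> (0 < A0)%R ->
  (0 < d < 1)%R ->
  exists K, (0 <= K)%R /\ forall al : C, Re al = A0 -> (e * Im al <= 0)%R ->
  (Cmod (GP al xi) <= K * exp (- ((1 - d) * rate e xi * TT al)))%R /\
  (Cmod (GP1 al xi) <= K * exp (- ((1 - d) * rate e xi * TT al)))%R.
Proof.
  intros He Hr HA Hd. assert (Pp := PI_RGT_0).
  assert (N : xi <> 0) by (intros Z; rewrite Z in Hr; unfold rate, Re, Im in Hr; simpl in Hr; lra).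
  assert (Pm := proj1 (Cmod_gt_0 _) N).
  set (om := Clog xi). assert (Eo : Cexp om = xi) by (apply Cexp_Clog; auto).
  set (psi := Im om). assert (Bp := Carg_bound xi). change (Carg xi) with psi in Bp.
  assert (R1 : Re xi = (Cmod xi * cos psi)%R).
  { rewrite <- Eo at 1. unfold Cexp; simpl. unfold om, Clog. simpl. rewrite exp_ln by auto. reflexivity. }
  assert (R2 : Im xi = (Cmod xi * sin psi)%R).
  { rewrite <- Eo at 1. unfold Cexp; simpl. unfold om, Clog. simpl. rewrite exp_ln by auto. reflexivity. }
  set (chi := (psi - e * (PI / 4))%R).
  assert (S2 : (sqrt 2 * sqrt 2 = 2)%R) by (apply sqrt_sqrt; lra).
  assert (s20 : (0 < sqrt 2)%R) by (apply sqrt_lt_R0; lra).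
  assert (Ec : (cos chi = (cos psi + e * sin psi) / sqrt 2)%R).
  { unfold chi. rewrite cos_minus. destruct He as [-> | ->].
    - rewrite !Rmult_1_l, cos_PI4, sin_PI4. field. lra.
    - replace (-1 * (PI / 4))%R with (- (PI / 4))%R by ring. rewrite cos_neg, sin_neg, cos_PI4, sin_PI4. field. lra. }
  assert (Er : rate e xi = (sqrt 2 * Cmod xi * cos chi)%R).
  { unfold rate. rewrite R1, R2, Ec. field. lra. }
  assert (cc : (0 < cos chi)%R).
  { rewrite Er in Hr. apply Rmult_lt_reg_l with (sqrt 2 * Cmod xi)%R; [nra|]. lra. }
  assert (Bc : (- (PI / 2) < chi < PI / 2)%R).
  { assert (W : forall x, (PI / 2 <= x <= 3 * (PI / 2))%R -> (cos x <= 0)%R) by (intros; apply cos_le_0; lra).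
    split; apply Rnot_le_lt; intros L.
    - assert (Q := W (- chi)%R). rewrite cos_neg in Q. unfold chi in *. destruct He as [-> | ->]; lra.
    - assert (Q := W chi). unfold chi in *. destruct He as [-> | ->]; lra. }
  assert (Ho : (Rabs (Im om) < 3 / 4 * PI)%R).
  { fold psi. unfold chi in Bc. apply Rabs_def1; destruct He as [-> | ->]; lra. }
  set (w := 2 * om - ln 2). set (ph := (e * chi + PI / 2)%R).
  assert (Hph : (0 < ph < PI)%R) by (unfold ph; destruct He as [-> | ->]; lra).
  assert (Ei : Im w = (2 * psi)%R) by (unfold w, psi, Im; simpl; ring).
  assert (Ew : (Im w - e * ph = chi)%R) by (rewrite Ei; unfold ph, chi; destruct He as [-> | ->]; field).
  assert (Sw : strip w).
  { unfold strip. rewrite Ei, Rabs_mult, Rabs_pos_eq by lra. fold psi in Ho. lra. }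
  assert (Ad : adm w (- (e * ph))).
  { split.
    - rewrite Rabs_Ropp, Rabs_mult. replace (Rabs e) with 1%R.
      + rewrite Rabs_pos_eq; lra.
      + destruct He as [-> | ->]; [rewrite Rabs_R1 | rewrite Rabs_left]; lra.
    - replace (Im w + - (e * ph))%R with chi by lra. apply Rabs_def1; lra. }
  assert (Sph : sin ph = cos chi).
  { unfold ph. replace (e * chi + PI / 2)%R with (PI / 2 - - (e * chi))%R by ring. rewrite sin_shift.
    rewrite cos_neg. destruct He as [-> | ->]; [f_equal; ring|].
    replace (-1 * chi)%R with (- chi)%R by ring. apply cos_neg. }
  assert (Rw : exp (Re w) = (Cmod xi * Cmod xi / 2)%R).
  { replace (Re w) with (ln (Cmod xi) + ln (Cmod xi) - ln 2)%R by (unfold w, om, Clog, Re; simpl; ring).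
    unfold Rminus. rewrite !exp_plus, exp_Ropp, !exp_ln by lra. reflexivity. }
  assert (Hrho : (rate e xi * rate e xi <= 4 * (exp (Re w) * cos (Im w - e * ph)) * sin ph)%R).
  { rewrite Ew, Sph, Rw, Er. right.
    replace (sqrt 2 * Cmod xi * cos chi * (sqrt 2 * Cmod xi * cos chi))%R with
      ((sqrt 2 * sqrt 2) * (Cmod xi * Cmod xi) * (cos chi * cos chi))%R by ring. rewrite S2. field. }
  destruct (J_ray_bound w e ph (rate e xi) d A0 0 He Hph Ad Sw HA Hd ltac:(lra) Hrho) as [K0 H0].
  destruct (J_ray_bound w e ph (rate e xi) d A0 1 He Hph Ad Sw HA Hd ltac:(lra) Hrho) as [K1 H1].
  set (g := (Cmod (Cexp (- (xi * xi) / 4))%C * exp ((1 / 2 - A0) * ln 2) * Cmod (Cexp (w / 2))%C)%R).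
  assert (Pg : (0 <= g)%R).
  { unfold g. apply Rmult_le_pos; [apply Rmult_le_pos|]; try apply Cmod_ge_0. left; apply exp_pos. }
  set (m := Cmod xi) in *.
  set (B := (1 + (m * (/ (m * m) + 1) + m / 2))%R).
  assert (PB : (1 <= B)%R).
  { unfold B. assert (0 < / (m * m))%R by (apply Rinv_0_lt_compat; nra).
    assert (0 <= m * (/ (m * m) + 1))%R by (apply Rmult_le_pos; lra). lra. }
  exists (g * (B * (Rabs K0 + Rabs K1)))%R. assert (A0' := Rabs_pos K0). assert (A1' := Rabs_pos K1). split.
  { apply Rmult_le_pos; auto. nra. }
  intros al Hal Hi.
  assert (Ral : (0 < Re al)%R) by lra.
  destruct (GP_ray al om Ral Ho) as [G0 G1]. fold w in G0, G1. rewrite Eo in G0, G1.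
  specialize (H0 al Hal Hi). specialize (H1 al Hal Hi).
  replace (al + INR 0) with al in H0 by (simpl; ring). replace (al + INR 1) with (al + 1) in H1 by (simpl; ring).
  set (X := exp (- ((1 - d) * rate e xi * TT al))) in *.
  assert (PX : (0 < X)%R) by apply exp_pos.
  set (J0 := J al (RtoC (3 / 2) - al) w) in *. set (J1 := J (al + 1) (RtoC (3 / 2) - al) w) in *.
  assert (Q0 : (Cmod J0 <= Rabs K0 * X)%R).
  { eapply Rle_trans; [apply H0|]. apply Rmult_le_compat_r; [lra | apply Rle_abs]. }
  assert (Q1 : (Cmod J1 <= Rabs K1 * X)%R).
  { eapply Rle_trans; [apply H1|]. apply Rmult_le_compat_r; [lra | apply Rle_abs]. }
  assert (Eg : Cmod (Cexp (- (xi * xi) / 4) * Cexp ((RtoC (1 / 2) - al) * ln 2) * Cexp (w / 2)) = g).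
  { unfold g. rewrite !Cmod_mult. f_equal. f_equal. rewrite (Cmod_Cexp ((RtoC (1 / 2) - al) * ln 2)).
    f_equal. rewrite <- Hal. unfold Re; simpl. ring. }
  assert (i2 := Cmod_ge_0 J0). assert (i3 := Cmod_ge_0 J1).
  set (KX0 := (Rabs K0 * X)%R) in *. set (KX1 := (Rabs K1 * X)%R) in *.
  assert (EX : (g * (B * (Rabs K0 + Rabs K1)) * X = g * (B * (KX0 + KX1)))%R) by (unfold KX0, KX1; ring).
  rewrite EX. rewrite G0, G1. rewrite (Cmod_mult _ J0), (Cmod_mult _ (xi * _ - _)), Eg. split.
  - apply Rmult_le_compat_l; auto. nra.
  - apply Rmult_le_compat_l; auto.
    assert (im : (0 < / (m * m))%R) by (apply Rinv_0_lt_compat; nra).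
    apply Rle_trans with (m * (KX0 * / (m * m) + KX1) + m / 2 * KX0)%R.
    + unfold Cminus at 1. eapply Rle_trans; [apply Cmod_triangle|]. rewrite Cmod_opp, !Cmod_mult.
      apply Rplus_le_compat.
      * fold m. apply Rmult_le_compat_l; [lra|]. unfold Cminus. eapply Rle_trans; [apply Cmod_triangle|].
        rewrite Cmod_opp. apply Rplus_le_compat; auto.
        rewrite Cmod_div, Cmod_mult by (apply Cmult_neq_0; auto). fold m.
        unfold Rdiv. apply Rmult_le_compat_r; lra.
      * rewrite Cmod_div by apply C2_neq_0. fold m. rewrite Cmod_R, Rabs_pos_eq by lra.
        apply Rmult_le_compat_l; [lra | auto].
    + unfold B. assert (0 <= KX0)%R by lra. assert (0 <= KX1)%R by lra.
      assert (0 <= m * / (m * m) * KX1)%R by (apply Rmult_le_pos; [nra | lra]).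
      assert (0 <= m * KX0)%R by nra. assert (0 <= m * KX1)%R by nra. nra.
Qed.

Lemma rate_le (e : R) (x : C) : (e = 1 \/ e = - 1)%R -> (Rabs (rate e x) <= 2 * Cmod x)%R.
Proof.
  intros He. unfold rate. eapply Rle_trans; [apply Rabs_triang|].
  assert (A := re_le_Cmod x). assert (B := im_le_Cmod x). rewrite Rabs_mult.
  replace (Rabs e) with 1%R; [lra|]. destruct He as [-> | ->]; [rewrite Rabs_R1 | rewrite Rabs_left]; lra.
Qed.

Lemma rate_minus e x y : rate e (x - y) = (rate e x - rate e y)%R.
Proof. unfold rate, Re, Im; simpl. ring. Qed.

Lemma dot_self (a z : C) : dot a (z * a) = (Re z * sq a)%R.
Proof. unfold dot, sq, Re, Im; simpl. ring. Qed.

Lemma dot_plus (a x y : C) : dot a (x + y) = (dot a x + dot a y)%R.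
Proof. unfold dot, Re, Im; simpl. ring. Qed.

(** Energy estimate for [y'' = (l^2 + O(1)) y] with [l = T (1 - e i)]: in the characteristic
    variables [y' + l y] and [y' - l y] the growth rate is exactly [|Re (l d)|] along [d]. *)
Lemma GP_gronwall (A0 R0 : R) : (0 < A0)%R -> exists Q : R, (0 <= Q)%R /\
  forall (e : R) (al xb xi : C), (e = 1 \/ e = - 1)%R -> Re al = A0 -> (e * Im al <= 0)%R ->
  (Cmod xb <= R0)%R -> (Cmod xi <= R0)%R ->
  (Cmod (GP al xi) <= 2 * TT al * (Cmod (GP al xb) + Cmod (GP1 al xb)) *
     exp (TT al * Rabs (rate e (xi - xb)%C) + Q))%R.
Proof.
  intros HA.
  set (Cq := (R0 * R0 / 4 + Rabs (2 * A0 - 3 / 2) + 2)%R).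
  assert (PC : (0 <= Cq)%R) by (unfold Cq; generalize (Rabs_pos (2 * A0 - 3 / 2)) (Rle_0_sqr R0); unfold Rsqr; lra).
  destruct (Rlt_dec R0 0) as [Hn|Hn].
  { exists 0%R. split; [lra|]. intros e al xb xi _ _ _ Hb _. generalize (Cmod_ge_0 xb); lra. }
  exists (2 * R0 * Cq)%R. split; [apply Rmult_le_pos; lra|].
  intros e al xb xi He Hal Hi Hb Hx.
  assert (Ral : (0 < Re al)%R) by lra.
  assert (T1 := TT_ge_1 al). assert (Tq := TT_sqr al). set (T := TT al) in *.
  set (d := xi - xb).
  assert (Hd : (Cmod d <= 2 * R0)%R).
  { unfold d, Cminus. eapply Rle_trans; [apply Cmod_triangle|]. rewrite Cmod_opp. lra. }
  (* [l^2 = - 2 e T^2 i] differs from [2 al] by a bounded term, because [T^2 = |Im al| + 1] *)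
  set (l := ((T, - (e * T))%R : C)).
  assert (ee : (e * e = 1)%R) by (destruct He as [-> | ->]; ring).
  set (y := GP al). set (y1 := GP1 al).
  set (p := fun t : R => xb + t * d).
  set (cc := fun x : C => x * x / 4 + 2 * al - RtoC (3 / 2) - l * l).
  assert (Ei : (Im al = - (e * Rabs (Im al)))%R).
  { destruct He as [-> | ->]; [rewrite Rabs_left1 by lra | rewrite Rabs_pos_eq by lra]; ring. }
  assert (Bp : forall t, (0 <= t <= 1)%R -> (Cmod (p t) <= R0)%R).
  { intros t Ht. unfold p, d. replace (xb + t * (xi - xb)) with ((1 - t)%R * xb + t * xi)
      by (rewrite RtoC_minus; ring).
    eapply Rle_trans; [apply Cmod_triangle|]. rewrite !Cmod_mult, !Cmod_R, !Rabs_pos_eq by lra. nra. }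
  assert (Bcc : forall t, (0 <= t <= 1)%R -> (Cmod (cc (p t)) <= Cq)%R).
  { intros t Ht. unfold cc. assert (b := Bp t Ht). set (x := p t) in *.
    replace (x * x / 4 + 2 * al - RtoC (3 / 2) - l * l) with
      (x * x / 4 + ((2 * A0 - 3 / 2)%R, (2 * e)%R)).
    2:{ unfold Cminus. rewrite <- !Cplus_assoc. f_equal. apply C_eq.
        - unfold l, Re, Im in *; simpl. rewrite Hal.
          replace (2 * A0 - 3 / 2)%R with (2 * A0 - 3 / 2 - (1 - e * e) * (T * T))%R by (rewrite ee; ring). ring.
        - unfold l. change (Im al) with (snd al) in *. unfold Re, Im; simpl.
          rewrite Ei. replace (2 * e)%R with (2 * e * (T * T) - 2 * e * Rabs (snd al))%R by (rewrite Tq; ring). ring. }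
    eapply Rle_trans; [apply Cmod_triangle|]. unfold Cq. rewrite Rplus_assoc. apply Rplus_le_compat.
    - rewrite Cmod_div, Cmod_mult, Cmod_R, Rabs_pos_eq by (apply C4_neq_0 || lra).
      unfold Rdiv. apply Rmult_le_compat_r; [lra|]. apply Rmult_le_compat; auto using Cmod_ge_0.
    - eapply Rle_trans; [apply Cmod_le_sum|]. simpl. apply Rplus_le_compat_l.
      destruct He as [-> | ->]; [rewrite Rabs_pos_eq | rewrite Rabs_left]; lra. }
  set (a := fun t : R => y1 (p t) + l * y (p t)). set (b := fun t : R => y1 (p t) + - l * y (p t)).
  assert (Dy : forall t, RD (fun t => y (p t)) t (y1 (p t) * d)).
  { intros t. apply CD_RD_line. apply GP_CD; auto. }
  assert (Dy1 : forall t, RD (fun t => y1 (p t)) t ((p t * p t / 4 + 2 * al - RtoC (3 / 2)) * y (p t) * d)).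
  { intros t. apply CD_RD_line. apply GP1_CD; auto. }
  assert (Da : forall t, RD a t ((d * l) * a t + d * cc (p t) * y (p t))).
  { intros t. eapply RD_eq; [apply RD_plus; [apply Dy1 | apply RD_scal, Dy]|]. unfold a, cc. ring. }
  assert (Db : forall t, RD b t (- (d * l) * b t + d * cc (p t) * y (p t))).
  { intros t. eapply RD_eq; [apply RD_plus; [apply Dy1 | apply RD_scal, Dy]|]. unfold b, cc. ring. }
  assert (El : (Cmod l * Cmod l = 2 * (T * T))%R).
  { rewrite Cmod_sqr. unfold l; simpl. replace (- (e * T) * - (e * T))%R with (e * e * (T * T))%R by ring.
    rewrite ee. ring. }
  assert (Pl := Cmod_ge_0 l). assert (l1 : (1 <= Cmod l)%R) by nra.
  assert (Edl : Re (d * l) = (T * rate e d)%R).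
  { unfold l, rate, Re, Im; simpl. ring. }
  assert (Yab : forall t, (2 * Cmod (y (p t)) <= Cmod (a t) + Cmod (b t))%R).
  { intros t. assert (Q := Cmod_triangle (a t) (- b t)). rewrite Cmod_opp in Q.
    replace (a t + - b t) with (2 * l * y (p t)) in Q by (unfold a, b; ring).
    rewrite !Cmod_mult, Cmod_R, Rabs_pos_eq in Q by lra.
    assert (Py := Cmod_ge_0 (y (p t))). nra. }
  assert (G := gronwall (fun t => sq (a t) + sq (b t))%R
    (fun t => 2 * dot (a t) ((d * l) * a t + d * cc (p t) * y (p t)) +
      2 * dot (b t) (- (d * l) * b t + d * cc (p t) * y (p t)))%R
    (2 * (T * Rabs (rate e d) + 2 * R0 * Cq))%R).
  assert (L : (sq (a 1) + sq (b 1) <= (sq (a 0) + sq (b 0)) * exp (2 * (T * Rabs (rate e d) + 2 * R0 * Cq)))%R).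
  { apply G.
    - intros t _. apply (is_derive_plus (K := R_AbsRing) (V := R_NormedModule)); apply RD_sq; auto.
    - intros t Ht. rewrite !dot_plus, !dot_self.
      replace (Re (- (d * l))) with (- (T * rate e d))%R by (rewrite <- Edl; unfold Re; simpl; ring).
      rewrite Edl.
      assert (r1 := Rle_abs (rate e d)). assert (r2 := Rle_abs (- rate e d)). rewrite Rabs_Ropp in r2.
      assert (sa : (0 <= sq (a t))%R) by (unfold sq; nra). assert (sb : (0 <= sq (b t))%R) by (unfold sq; nra).
      assert (B1 : (dot (a t) (d * cc (p t) * y (p t)) + dot (b t) (d * cc (p t) * y (p t)) <=
         2 * R0 * Cq * (sq (a t) + sq (b t)))%R).
      { eapply Rle_trans; [apply Rplus_le_compat; apply dot_le|].
        rewrite !Cmod_mult, !sq_Cmod. specialize (Yab t). specialize (Bcc t Ht).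
        assert (Pc := Cmod_ge_0 (cc (p t))). assert (Pd := Cmod_ge_0 d). assert (Py := Cmod_ge_0 (y (p t))).
        assert (Pa := Cmod_ge_0 (a t)). assert (Pb := Cmod_ge_0 (b t)).
        set (ca := Cmod (a t)) in *. set (cb := Cmod (b t)) in *.
        assert (D : (Cmod d * Cmod (cc (p t)) <= 2 * R0 * Cq)%R) by (apply Rmult_le_compat; auto).
        assert (D0 : (0 <= Cmod d * Cmod (cc (p t)))%R) by (apply Rmult_le_pos; auto).
        set (D1 := (Cmod d * Cmod (cc (p t)))%R) in *.
        apply Rle_trans with (D1 * (ca * ca + cb * cb))%R; [|apply Rmult_le_compat_r; nra].
        assert (Y2 : ((ca + cb) * Cmod (y (p t)) <= ca * ca + cb * cb)%R).
        { assert (0 <= (ca - cb) * (ca - cb))%R by apply Rle_0_sqr. nra. }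
        apply Rmult_le_compat_l with (r := D1) in Y2; auto. nra. }
      assert (B2 : (T * rate e d * sq (a t) <= T * Rabs (rate e d) * sq (a t))%R) by (apply Rmult_le_compat_r; nra).
      assert (B3 : (- (T * rate e d) * sq (b t) <= T * Rabs (rate e d) * sq (b t))%R) by (apply Rmult_le_compat_r; nra).
      nra. }
  assert (p0 : p 0%R = xb) by (unfold p; ring). assert (p1 : p 1%R = xi) by (unfold p, d; ring).
  assert (E0 : (sq (a 0) + sq (b 0) <= (2 * T * (Cmod (y xb) + Cmod (y1 xb))) * (2 * T * (Cmod (y xb) + Cmod (y1 xb))))%R).
  { replace (sq (a 0) + sq (b 0))%R with (2 * sq (y1 xb) + 2 * sq (l * y xb))%R
      by (unfold a, b; rewrite p0; replace (- l * y xb) with (- (l * y xb)) by ring; generalize (y1 xb) (l * y xb); intros; unfold sq, Re, Im; simpl; ring).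
    rewrite !sq_Cmod, Cmod_mult.
    replace (Cmod l * Cmod (y xb) * (Cmod l * Cmod (y xb)))%R with (Cmod l * Cmod l * (Cmod (y xb) * Cmod (y xb)))%R by ring.
    rewrite El. assert (P0 := Cmod_ge_0 (y xb)). assert (P1 := Cmod_ge_0 (y1 xb)).
    set (u := Cmod (y xb)) in *. set (v := Cmod (y1 xb)) in *.
    assert (0 <= u * v)%R by nra. assert (1 <= T * T)%R by nra.
    assert (0 <= T * T * (u * v))%R by nra. assert (v * v <= T * T * (v * v))%R by nra.
    assert (0 <= T * T * (v * v))%R by nra. nra. }
  assert (E1 : (Cmod (y xi) * Cmod (y xi) <= sq (a 1) + sq (b 1))%R).
  { specialize (Yab 1%R). rewrite p1 in Yab. rewrite !sq_Cmod.
    assert (Pa := Cmod_ge_0 (a 1%R)). assert (Pb := Cmod_ge_0 (b 1%R)). assert (Py := Cmod_ge_0 (y xi)).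
    assert (0 <= (Cmod (a 1%R) - Cmod (b 1%R)) * (Cmod (a 1%R) - Cmod (b 1%R)))%R by apply Rle_0_sqr. nra. }
  fold d. fold y y1.
  set (Z := exp (T * Rabs (rate e d) + 2 * R0 * Cq)).
  assert (PZ : (0 < Z)%R) by apply exp_pos.
  replace (exp (2 * (T * Rabs (rate e d) + 2 * R0 * Cq))) with (Z * Z)%R in L
    by (unfold Z; rewrite <- exp_plus; f_equal; ring).
  set (W := (2 * T * (Cmod (y xb) + Cmod (y1 xb)))%R) in *.
  assert (PW : (0 <= W)%R).
  { unfold W. apply Rmult_le_pos; [lra|]. generalize (Cmod_ge_0 (y xb)) (Cmod_ge_0 (y1 xb)); lra. }
  apply Rsqr_incr_0_var; [|nra]. unfold Rsqr.
  assert ((sq (a 0) + sq (b 0)) * (Z * Z) <= W * W * (Z * Z))%R by (apply Rmult_le_compat_r; nra). nra.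
Qed.

(** From a base point where [GP_ray_bound] applies ([xi0] itself if its rate is positive, a point
    near the origin otherwise), [GP_gronwall] continues the bound at the cost of the difference of
    the rates. *)
Lemma GP_bound (xi0 : C) (e dl A0 : R) : (e = 1 \/ e = - 1)%R -> (0 < A0)%R -> (0 < dl)%R ->
  exists K r : R, (0 <= K)%R /\ (0 < r)%R /\ forall xi : C, (Cmod (xi - xi0) < r)%R ->
  forall al : C, Re al = A0 -> (e * Im al <= 0)%R ->
  (Cmod (GP al xi) <= K * exp (TT al * (- rate e xi0 + dl)))%R.
Proof.
  intros He HA Hd. set (rho := rate e xi0). set (r := (dl / 16)%R).
  assert (ee : (e * e = 1)%R) by (destruct He as [-> | ->]; ring).
  assert (Base : exists (xb : C) (d : R), (0 < rate e xb)%R /\ (0 < d < 1)%R /\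
    forall xi : C, (Cmod (xi - xi0) < r)%R ->
    (- ((1 - d) * rate e xb) + Rabs (rate e (xi - xb)%C) <= - rho + dl / 2)%R).
  { destruct (Rlt_dec 0 rho) as [Hr|Hr].
    - exists xi0, (Rmin (1 / 2) (dl / (4 * rho))).
      assert (m1 := Rmin_l (1 / 2) (dl / (4 * rho))). assert (m2 := Rmin_r (1 / 2) (dl / (4 * rho))).
      assert (Pm : (0 < dl / (4 * rho))%R) by (apply Rdiv_lt_0_compat; lra).
      fold rho. split; auto. split; [split; [apply Rmin_pos; lra | lra]|].
      intros xi Hx. assert (Q := rate_le e (xi - xi0) He).
      apply Rmult_le_compat_r with (r := rho) in m2; [|lra].
      replace (dl / (4 * rho) * rho)%R with (dl / 4)%R in m2 by (field; lra). unfold r in Hx. lra.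
    - exists ((dl / 16)%R, (e * (dl / 16))%R), (1 / 2)%R.
      assert (Rb : rate e ((dl / 16)%R, (e * (dl / 16))%R) = (dl / 8)%R).
      { unfold rate; simpl. replace (e * (e * (dl / 16)))%R with (e * e * (dl / 16))%R by ring. rewrite ee. field. }
      rewrite Rb. split; [lra|]. split; [lra|]. intros xi Hx.
      assert (Q := rate_le e (xi - xi0) He). rewrite rate_minus in Q. fold rho in Q.
      rewrite rate_minus, Rb. unfold r in Hx. apply Rabs_le_between in Q.
      assert (Rabs (rate e xi - dl / 8) <= - rho + dl / 4)%R by (apply Rabs_le; lra). lra. }
  destruct Base as [xb [d [Hb [Hd1 HB]]]].
  destruct (GP_ray_bound xb e d A0 He Hb HA Hd1) as [K [PK HK]].
  set (R0 := (Cmod xb + Cmod xi0 + r)%R).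
  destruct (GP_gronwall A0 R0 HA) as [Q [PQ HQ]].
  assert (Pr : (0 < r)%R) by (unfold r; lra).
  exists (4 * K * (2 / dl) * exp Q)%R, r. split.
  { apply Rmult_le_pos; [|left; apply exp_pos]. apply Rmult_le_pos; [lra|]. left. apply Rdiv_lt_0_compat; lra. }
  split; auto. intros xi Hx al Hal Hi.
  destruct (HK al Hal Hi) as [H0 H1].
  assert (G := HQ e al xb xi He Hal Hi).
  assert (T1 := TT_ge_1 al). set (T := TT al) in *.
  set (X := exp (- ((1 - d) * rate e xb * T))) in *.
  set (Y := exp (T * Rabs (rate e (xi - xb)%C) + Q)) in *.
  assert (PX : (0 < X)%R) by apply exp_pos. assert (PY : (0 < Y)%R) by apply exp_pos.
  assert (G' : (Cmod (GP al xi) <= 2 * T * (2 * K * X) * Y)%R).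
  { eapply Rle_trans; [apply G|].
    - unfold R0. generalize (Cmod_ge_0 xi0); lra.
    - unfold R0. assert (S := Cmod_triangle (xi - xi0) xi0). replace (xi - xi0 + xi0) with xi in S by ring.
      generalize (Cmod_ge_0 xb); lra.
    - apply Rmult_le_compat_r; [lra|]. apply Rmult_le_compat_l; lra. }
  eapply Rle_trans; [apply G'|].
  assert (Te : (T <= 2 / dl * exp (dl / 2 * T))%R).
  { apply Rmult_le_reg_l with (dl / 2)%R; [lra|].
    replace (dl / 2 * (2 / dl * exp (dl / 2 * T)))%R with (exp (dl / 2 * T)) by (field; lra).
    generalize (exp_ineq1_le (dl / 2 * T)); lra. }
  apply Rle_trans with (4 * K * (2 / dl * exp (dl / 2 * T)) * (X * Y))%R.
  - replace (2 * T * (2 * K * X) * Y)%R with (4 * K * T * (X * Y))%R by ring.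
    apply Rmult_le_compat_r; [nra|]. apply Rmult_le_compat_l; lra.
  - unfold X, Y. rewrite <- exp_plus.
    apply Rle_trans with (4 * K * (2 / dl) * exp Q * exp (dl / 2 * T + (- ((1 - d) * rate e xb * T) + T * Rabs (rate e (xi - xb)%C))))%R.
    + right. rewrite !exp_plus. ring.
    + apply Rmult_le_compat_l.
      * apply Rmult_le_pos; [|left; apply exp_pos]. apply Rmult_le_pos; [lra|]. left. apply Rdiv_lt_0_compat; lra.
      * apply exp_le. specialize (HB xi Hx). apply Rmult_le_compat_l with (r := T) in HB; [|lra]. lra.
Qed.

Lemma exp_sqrt_decay (c : R) : (0 < c)%R -> exists K, (0 <= K)%R /\ forall t : R,
  ((1 + Rabs t) * exp (- (c * sqrt (Rabs t + 1))) <= K / (1 + t * t))%R.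
Proof.
  intros Hc. destruct (ln_le_lin c 6 Hc) as [K HK]. exists (exp (K)). split; [left; apply exp_pos|]. intros t.
  assert (P := Rabs_pos t). set (T := sqrt (Rabs t + 1)).
  assert (Tq : (T * T = Rabs t + 1)%R) by (apply sqrt_sqrt; lra).
  assert (T1 : (1 <= T)%R) by (unfold T; rewrite <- sqrt_1 at 1; apply sqrt_le_1_alt; lra).
  assert (tt : (t * t = Rabs t * Rabs t)%R) by (rewrite <- Rabs_mult; symmetry; apply Rabs_pos_eq, Rle_0_sqr).
  apply Rmult_le_reg_r with (1 + t * t)%R; [apply one_plus_sqr_pos|].
  replace (exp K / (1 + t * t) * (1 + t * t))%R with (exp K) by (field; apply Rgt_not_eq, one_plus_sqr_pos).
  assert (L : ((1 + Rabs t) * (1 + t * t) <= exp (6 * ln T))%R).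
  { replace (6 * ln T)%R with (ln T + ln T + (ln T + ln T) + (ln T + ln T))%R by ring.
    rewrite !exp_plus, exp_ln by lra. rewrite tt.
    apply Rle_trans with ((T * T) * ((T * T) * (T * T)))%R; [|right; ring]. rewrite !Tq.
    apply Rmult_le_compat; nra. }
  specialize (HK (T - 1)%R ltac:(lra)). replace (1 + (T - 1))%R with T in HK by ring.
  apply Rle_trans with (exp (6 * ln T) * exp (- (c * T)))%R.
  - replace ((1 + Rabs t) * exp (- (c * T)) * (1 + t * t))%R with ((1 + Rabs t) * (1 + t * t) * exp (- (c * T)))%R by ring.
    apply Rmult_le_compat_r; auto. left; apply exp_pos.
  - rewrite <- exp_plus. apply exp_le. lra.
Qed.

Definition integrand (s xi eta : C) : C := GP (RtoC (3 / 4) - s) xi * GP (RtoC (3 / 4) + s) eta.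

(** On each half of the line one of the two hypotheses makes the sum of the rates positive, so the
    integrand decays like [e^(- c sqrt |Im s|)]. *)
Lemma integrand_bound (xi0 eta0 : C) (A : R) : (Rabs A < 3 / 4)%R ->
  (0 < rate 1 xi0 + rate (-1) eta0)%R -> (0 < rate (-1) xi0 + rate 1 eta0)%R ->
  exists K r : R, (0 <= K)%R /\ (0 < r)%R /\ forall xi eta : C,
  (Cmod (xi - xi0) < r)%R -> (Cmod (eta - eta0) < r)%R ->
  forall s : C, Re s = A -> (Cmod (integrand s xi eta) <= K / (1 + Im s * Im s))%R.
Proof.
  intros HA H1 H2. apply Rabs_def2 in HA.
  (* where [0 <= e Im s], the function of [xi] decays at the rate of sign [e], that of [eta] at
     the opposite one *)
  assert (Half : forall e, (e = 1 \/ e = - 1)%R -> (0 < rate e xi0 + rate (- e) eta0)%R ->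
    exists K r : R, (0 <= K)%R /\ (0 < r)%R /\ forall xi eta : C,
    (Cmod (xi - xi0) < r)%R -> (Cmod (eta - eta0) < r)%R ->
    forall s : C, Re s = A -> (0 <= e * Im s)%R -> (Cmod (integrand s xi eta) <= K / (1 + Im s * Im s))%R).
  { intros e He H. set (c := (rate e xi0 + rate (- e) eta0)%R) in *.
    assert (He' : (- e = 1 \/ - e = - 1)%R) by (destruct He; subst; lra).
    destruct (GP_bound xi0 e (c / 4) (3 / 4 - A) He ltac:(lra) ltac:(lra)) as [K1 [r1 [P1 [Q1 B1]]]].
    destruct (GP_bound eta0 (- e) (c / 4) (3 / 4 + A) He' ltac:(lra) ltac:(lra)) as [K2 [r2 [P2 [Q2 B2]]]].
    destruct (exp_sqrt_decay (c / 2) ltac:(lra)) as [K3 [P3 H3]].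
    exists (K1 * K2 * K3)%R, (Rmin r1 r2). split; [apply Rmult_le_pos; auto; nra|].
    split; [apply Rmin_pos; auto|]. intros xi eta Hx Hy s Hs Hi.
    assert (c1 := B1 xi (Rlt_le_trans _ _ _ Hx (Rmin_l _ _)) (RtoC (3 / 4) - s)).
    assert (c2 := B2 eta (Rlt_le_trans _ _ _ Hy (Rmin_r _ _)) (RtoC (3 / 4) + s)).
    assert (I1 : Im (RtoC (3 / 4) - s) = (- Im s)%R) by (unfold Im; simpl; ring).
    assert (I2 : Im (RtoC (3 / 4) + s) = (Im s)%R) by (unfold Im; simpl; ring).
    assert (ET1 : TT (RtoC (3 / 4) - s) = sqrt (Rabs (Im s) + 1)) by (unfold TT; rewrite I1, Rabs_Ropp; auto).
    assert (ET2 : TT (RtoC (3 / 4) + s) = sqrt (Rabs (Im s) + 1)) by (unfold TT; rewrite I2; auto).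
    rewrite ET1, I1 in c1. rewrite ET2, I2 in c2.
    specialize (c1 ltac:(unfold Re in *; simpl; lra) ltac:(lra)).
    specialize (c2 ltac:(unfold Re in *; simpl; lra) ltac:(lra)).
    set (T := sqrt (Rabs (Im s) + 1)) in *.
    unfold integrand. rewrite Cmod_mult.
    apply Rle_trans with (K1 * exp (T * (- rate e xi0 + c / 4)) * (K2 * exp (T * (- rate (- e) eta0 + c / 4))))%R.
    - apply Rmult_le_compat; auto using Cmod_ge_0.
    - apply Rle_trans with (K1 * K2 * ((1 + Rabs (Im s)) * exp (- (c / 2 * T))))%R.
      + replace (K1 * exp (T * (- rate e xi0 + c / 4)) * (K2 * exp (T * (- rate (- e) eta0 + c / 4))))%R
          with (K1 * K2 * exp (- (c / 2 * T)))%R.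
        * apply Rmult_le_compat_l; [nra|]. assert (Q := Rabs_pos (Im s)). assert (E := exp_pos (- (c / 2 * T))). nra.
        * replace (- (c / 2 * T))%R with (T * (- rate e xi0 + c / 4) + T * (- rate (- e) eta0 + c / 4))%R
            by (unfold c; field). rewrite exp_plus. ring.
      + unfold Rdiv. rewrite (Rmult_assoc _ K3). apply Rmult_le_compat_l; [nra | apply H3]. }
  destruct (Half 1%R ltac:(auto) ltac:(replace (- (1))%R with (-1)%R by ring; auto)) as [K1 [r1 [P1 [Q1 B1]]]].
  destruct (Half (-1)%R ltac:(right; lra) ltac:(replace (- (-1))%R with 1%R by ring; auto)) as [K2 [r2 [P2 [Q2 B2]]]].
  exists (K1 + K2)%R, (Rmin r1 r2). split; [lra|]. split; [apply Rmin_pos; auto|].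
  intros xi eta Hx Hy s Hs.
  assert (M : (0 < / (1 + Im s * Im s))%R) by apply Rinv_0_lt_compat, one_plus_sqr_pos.
  destruct (Rle_dec 0 (Im s)).
  - eapply Rle_trans; [apply B1; auto; try (eapply Rlt_le_trans; [eassumption | apply Rmin_l]); lra|].
    unfold Rdiv. nra.
  - eapply Rle_trans; [apply B2; auto; try (eapply Rlt_le_trans; [eassumption | apply Rmin_r]); lra|].
    unfold Rdiv. nra.
Qed.

(** * Fourier inversion *)

(** Weights [(1 + eps |t|) e^(-eps |t|)]; their Fourier transforms decay like the fourth power,
    which leaves room for a Lipschitz factor in the approximation of the identity. *)
Definition wt (eps t : R) : R := ((1 + eps * Rabs t) * exp (- (eps * Rabs t)))%R.

Lemma wt_continuous eps t : continuous (wt eps) t.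
Proof.
  assert (A : continuous (fun t => eps * Rabs t)%R t)
    by (apply (continuous_scal_r (V := R_NormedModule) eps Rabs), continuous_Rabs).
  unfold wt. apply (continuous_mult (K := R_AbsRing)).
  - apply (continuous_plus (V := R_NormedModule) (fun _ => 1%R)); auto. apply continuous_const.
  - apply ccts_exp, (continuous_opp (V := R_NormedModule)); auto.
Qed.

Lemma wt_bound eps : (0 < eps)%R -> exists M, forall t, (0 <= wt eps t <= M / (1 + t * t))%R.
Proof.
  intros He. destruct (ln_le_lin (1 / 2) 1 ltac:(lra)) as [K1 H1].
  destruct (ln_le_lin (eps / 2) 2 ltac:(lra)) as [K2 H2].
  exists (exp (K1 + K2)). intros t. assert (P := Rabs_pos t).
  assert (Q : (0 <= eps * Rabs t)%R) by nra.
  split; [unfold wt; apply Rmult_le_pos; [lra | left; apply exp_pos]|].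
  replace (wt eps t) with (exp (ln (1 + eps * Rabs t) - eps * Rabs t)).
  - apply (bdd_of_exp (fun t => ln (1 + eps * Rabs t) - eps * Rabs t)%R). clear t P Q. intros t.
    assert (P := Rabs_pos t). assert (Q : (0 <= eps * Rabs t)%R) by nra.
    specialize (H1 _ Q). specialize (H2 _ P). assert (E := ln_sqr_le _ P).
    replace (Rabs t * Rabs t)%R with (t * t)%R in E by (rewrite <- Rabs_mult; symmetry; apply Rabs_pos_eq, Rle_0_sqr).
    lra.
  - unfold wt, Rminus. rewrite exp_plus, exp_ln by lra. reflexivity.
Qed.

Lemma wt_near_1 eps t : (0 < eps)%R -> (Rabs (1 - wt eps t) <= eps * Rabs t)%R.
Proof.
  intros He. unfold wt. assert (P := Rabs_pos t). set (h := (eps * Rabs t)%R).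
  assert (Hh : (0 <= h)%R) by (unfold h; nra).
  assert (E1 := exp_ineq1_le h). assert (E2 := exp_ineq1_le (- h)).
  assert (E3 : (exp h * exp (- h) = 1)%R) by (rewrite <- exp_plus; replace (h + - h)%R with 0%R by ring; apply exp_0).
  assert (E4 := exp_pos (- h)). apply Rabs_le. split; nra.
Qed.

Definition ker (eps d : R) : R := (4 * (eps * eps * eps) / ((eps * eps + d * d) * (eps * eps + d * d)))%R.

Lemma wt_fourier (eps d : R) : (0 < eps)%R ->
  intg (fun t => RtoC (wt eps t) * Cexp (Ci * (t * d))) /\
  CI (fun t => RtoC (wt eps t) * Cexp (Ci * (t * d))) = RtoC (ker eps d).
Proof.
  intros He. destruct (wt_bound eps He) as [M HM].
  set (f := fun t : R => RtoC (wt eps t) * Cexp (Ci * (t * d))).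
  assert (U : forall t : R, Cmod (Cexp (Ci * (t * d))) = 1%R).
  { intros t. rewrite Cmod_Cexp. replace (Re (Ci * (t * d))) with 0%R by (unfold Re; simpl; ring). apply exp_0. }
  assert (Fb : forall t, (Cmod (f t) <= wt eps t)%R).
  { intros t. unfold f. rewrite Cmod_mult, U, Cmod_R, Rabs_pos_eq; [lra | apply HM]. }
  assert (I : intg f).
  { split.
    - intros t. apply ccts_mult; [apply ccts_RtoC, wt_continuous|].
      apply ccts_Cexp, ccts_mult; [apply ccts_const|]. apply ccts_mult; [apply ccts_RtoC, continuous_id | apply ccts_const].
    - exists M. intros t. eapply Rle_trans; [apply Fb | apply HM]. }
  split; auto.
  set (c := ((eps, - d)%R : C)). set (c' := ((eps, d) : C)).
  assert (Nc : c <> 0) by (intros Z; apply (f_equal Re) in Z; simpl in Z; lra).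
  assert (Nc' : c' <> 0) by (intros Z; apply (f_equal Re) in Z; simpl in Z; lra).
  set (P := fun t : R => - (((1 + eps * t) / c + eps / (c * c)) * Cexp (t * - c))).
  set (N := fun t : R => ((1 + - eps * t) / c' + eps / (c' * c')) * Cexp (t * c')).
  assert (lin : forall (q : C) (t : R), RD (fun t : R => 1 + q * t) t q).
  { intros q t. eapply RD_ext; [|apply (RD_line 1 q t)]. intros; simpl; ring. }
  assert (DP' : forall t : R, RD P t ((1 + eps * t) * Cexp (t * - c))).
  { intros t. unfold P, Cdiv. eapply RD_eq.
    - apply RD_opp, RD_mult; [|apply Cexp_line].
      apply RD_plus; [|apply RD_const]. apply RD_mult; [apply lin | apply RD_const].
    - cbv beta. field. auto. }
  assert (DN : forall t : R, RD N t ((1 + - eps * t) * Cexp (t * c'))).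
  { intros t. unfold N, Cdiv. eapply RD_eq.
    - apply RD_mult; [|apply Cexp_line].
      apply RD_plus; [|apply RD_const]. apply RD_mult; [apply lin | apply RD_const].
    - cbv beta. field. auto. }
  assert (fP : forall t : R, (0 <= t)%R -> f t = (1 + eps * t) * Cexp (t * - c)).
  { intros t Ht. unfold f, wt. rewrite Rabs_pos_eq by auto.
    rewrite RtoC_mult, RtoC_plus, RtoC_mult, <- Cexp_RtoC, <- Cmult_assoc, <- Cexp_plus.
    f_equal. f_equal. apply C_eq; unfold c, Re, Im; simpl; ring. }
  assert (fN : forall t : R, (t <= 0)%R -> f t = (1 + - eps * t) * Cexp (t * c')).
  { intros t Ht. unfold f, wt. rewrite Rabs_left1 by auto.
    replace (eps * - t)%R with (- eps * t)%R by ring.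
    rewrite RtoC_mult, RtoC_plus, RtoC_mult, <- Cexp_RtoC, <- Cmult_assoc, <- Cexp_plus, RtoC_opp.
    f_equal. f_equal. apply C_eq; unfold c', Re, Im; simpl; ring. }
  assert (Ek : RtoC (ker eps d) = N 0%R - P 0%R).
  { unfold N, P. rewrite !Cmult_0_l, !Cmult_0_r, Cexp_0, !Cplus_0_r.
    assert (Q : (0 < eps * eps + d * d)%R) by nra.
    assert (cc : c * c' = RtoC (eps * eps + d * d)) by (apply C_eq; unfold c, c', Re, Im; simpl; ring).
    assert (NQ : RtoC (eps * eps + d * d) <> 0) by (intros Z; apply RtoC_inj in Z; lra).
    transitivity ((c * c' * (c + c') + eps * (c * c + c' * c')) / ((c * c') * (c * c'))).
    - rewrite cc.
      replace (c + c') with (RtoC (2 * eps)) by (apply C_eq; unfold c, c', Re, Im; simpl; ring).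
      replace (c * c + c' * c') with (RtoC (2 * (eps * eps - d * d))) by (apply C_eq; unfold c, c', Re, Im; simpl; ring).
      rewrite <- !RtoC_mult, <- RtoC_plus, <- RtoC_div by nra. f_equal. unfold ker. field. lra.
    - field. auto. }
  apply CI_eq; auto. intros e Hee.
  set (B := (/ Cmod c + Rabs eps * / (Cmod c * Cmod c) + (/ Cmod c' + Rabs eps * / (Cmod c' * Cmod c')))%R).
  destruct (bdd_vanish (fun t => RtoC (B * wt eps t)) (Rabs B * M)) with (eps := (e / 2)%R) as [X HX].
  { intros t. rewrite Cmod_R, Rabs_mult. unfold Rdiv. rewrite Rmult_assoc.
    apply Rmult_le_compat_l; [apply Rabs_pos|]. rewrite Rabs_pos_eq by apply HM. apply HM. }
  { lra. }
  exists (Rmax X 0). intros x Hx.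
  assert (x0 : (0 <= x)%R) by (eapply Rle_trans; [apply Rmax_r | exact Hx]).
  destruct (HX x (Rle_trans _ _ _ (Rmax_l _ _) Hx)) as [HX1 _].
  replace (RtoC (B * wt eps x) - 0) with (RtoC (B * wt eps x)) in HX1 by ring. rewrite Cmod_R in HX1.
  assert (HX2 := Rle_trans _ _ _ (Rle_abs _) HX1).
  rewrite <- (CInt_Chasles f (- x) 0 x) by apply I.
  rewrite (CInt_FTC N f), (CInt_FTC P f).
  - rewrite Ek. change (Cmod (N 0%R - P 0%R - (N 0%R - N (- x)%R + (P x - P 0%R))) <= e)%R.
    replace (N 0%R - P 0%R - (N 0%R - N (- x)%R + (P x - P 0%R))) with (N (- x)%R + - P x) by ring.
    eapply Rle_trans; [apply Cmod_triangle|]. rewrite Cmod_opp.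
    assert (BP : (Cmod (P x) <= (/ Cmod c + Rabs eps * / (Cmod c * Cmod c)) * wt eps x)%R).
    { unfold P. rewrite Cmod_opp.
      replace (((1 + eps * x) / c + eps / (c * c)) * Cexp (x * - c)) with
        (/ c * ((1 + eps * x) * Cexp (x * - c)) + eps / (c * c) * Cexp (x * - c)) by (field; auto).
      rewrite <- fP by auto. eapply Rle_trans; [apply Cmod_triangle|]. rewrite Rmult_plus_distr_r.
      rewrite !Cmod_mult, Cmod_inv, Cmod_div, Cmod_R, Cmod_mult by (auto; apply Cmult_neq_0; auto).
      apply Rplus_le_compat.
      - apply Rmult_le_compat_l; [|apply Fb]. left; apply Rinv_0_lt_compat, (proj1 (Cmod_gt_0 c)); auto.
      - apply Rmult_le_compat_l.
        + apply Rmult_le_pos; [apply Rabs_pos|]. left; apply Rinv_0_lt_compat.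
          apply Rmult_lt_0_compat; apply (proj1 (Cmod_gt_0 c)); auto.
        + rewrite Cmod_Cexp. replace (Re (x * - c)) with (- (eps * x))%R by (unfold c, Re; simpl; ring).
          unfold wt. rewrite Rabs_pos_eq by auto. assert (Q := exp_pos (- (eps * x))).
          assert (0 <= eps * x)%R by nra. nra. }
    assert (BN : (Cmod (N (- x)%R) <= (/ Cmod c' + Rabs eps * / (Cmod c' * Cmod c')) * wt eps x)%R).
    { unfold N.
      replace (((1 + - eps * (- x)%R) / c' + eps / (c' * c')) * Cexp ((- x)%R * c')) with
        (/ c' * ((1 + - eps * (- x)%R) * Cexp ((- x)%R * c')) + eps / (c' * c') * Cexp ((- x)%R * c')) by (field; auto).
      rewrite <- fN by lra. eapply Rle_trans; [apply Cmod_triangle|]. rewrite Rmult_plus_distr_r.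
      assert (Ew : wt eps (- x) = wt eps x) by (unfold wt; rewrite Rabs_Ropp; auto).
      rewrite !Cmod_mult, Cmod_inv, Cmod_div, Cmod_R, Cmod_mult by (auto; apply Cmult_neq_0; auto).
      apply Rplus_le_compat.
      - apply Rmult_le_compat_l; [|rewrite <- Ew; apply Fb]. left; apply Rinv_0_lt_compat, (proj1 (Cmod_gt_0 c')); auto.
      - apply Rmult_le_compat_l.
        + apply Rmult_le_pos; [apply Rabs_pos|]. left; apply Rinv_0_lt_compat.
          apply Rmult_lt_0_compat; apply (proj1 (Cmod_gt_0 c')); auto.
        + rewrite Cmod_Cexp. replace (Re ((- x)%R * c')) with (- (eps * x))%R by (unfold c', Re; simpl; ring).
          unfold wt. rewrite Rabs_pos_eq by auto. assert (Q := exp_pos (- (eps * x))).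
          assert (0 <= eps * x)%R by nra. nra. }
    unfold B in HX2. lra.
  - rewrite Rmin_left, Rmax_right by auto. intros t Ht. rewrite fP by lra. apply DP'.
  - apply I.
  - rewrite Rmin_left, Rmax_right by lra. intros t Ht. rewrite fN by lra. apply DN.
  - apply I.
Qed.

(** [X = ln ((1 + t) / t)] at [t = e^v]: the Laplace integrals are Fourier integrals in [X]. The
    derivative of [X] in [v] is [- kx]. *)
Definition Xv (v : R) : R := (lg v - v)%R.
Definition kx (v : R) : R := (1 - sg v)%R.

Lemma Xv_derive v : is_derive Xv v (- kx v)%R.
Proof.
  unfold Xv, kx. replace (- (1 - sg v))%R with (sg v - 1)%R by ring.
  apply (is_derive_minus (V := R_NormedModule)); [apply lg_derive|].
  apply is_derive_Reals, derivable_pt_lim_id.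
Qed.

Lemma Xv_continuous v : continuous Xv v.
Proof. apply (ex_derive_continuous (V := R_NormedModule)). eexists; apply Xv_derive. Qed.

Lemma kx_pos v : (0 < kx v <= 1)%R.
Proof. unfold kx. generalize (sg_bound v). lra. Qed.

Lemma kx_continuous v : continuous kx v.
Proof.
  unfold kx. apply (continuous_minus (V := R_NormedModule)); [apply continuous_const|].
  apply (ex_derive_continuous (V := R_NormedModule)). eexists; apply sg_derive.
Qed.

Lemma Xv_pos v : (0 < Xv v)%R.
Proof.
  unfold Xv. assert (P := exp_pos v). unfold lg.
  assert (ln (exp v) < ln (1 + exp v))%R by (apply ln_increasing; lra). rewrite ln_exp in H. lra.
Qed.

Lemma Xv_ge v : (- v <= Xv v)%R.
Proof. unfold Xv. generalize (lg_pos v); lra. Qed.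

Lemma Xv_le v : (Xv v <= exp (- v))%R.
Proof.
  unfold Xv. rewrite <- lg_opp. unfold lg. assert (P := exp_pos (- v)).
  generalize (exp_ineq1_le (ln (1 + exp (- v)))). rewrite exp_ln by lra. lra.
Qed.

Lemma kx_le v : (kx v <= exp (- v))%R.
Proof.
  unfold kx, sg. rewrite exp_Ropp. assert (P := exp_pos v).
  replace (1 - exp v / (1 + exp v))%R with (/ (1 + exp v))%R by (field; lra).
  apply Rinv_le_contravar; lra.
Qed.

Lemma poisson_bound (eps x0 : R) : (0 < eps)%R -> exists M, forall v,
  (0 <= kx v * / (eps * eps + (x0 - Xv v) * (x0 - Xv v)) <= M / (1 + v * v))%R.
Proof.
  intros He. set (C := (2 + (1 + 2 * (x0 * x0)) / (eps * eps))%R).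
  assert (Pe : (0 < eps * eps)%R) by nra.
  assert (PC : (2 <= C)%R).
  { unfold C. assert (0 <= (1 + 2 * (x0 * x0)) / (eps * eps))%R; [|lra].
    apply Rmult_le_pos; [nra | left; apply Rinv_0_lt_compat; auto]. }
  exists (C + 2 / (eps * eps))%R. intros v. set (d := (x0 - Xv v)%R).
  assert (Q : (0 < eps * eps + d * d)%R) by nra.
  destruct (kx_pos v) as [k0 k1].
  assert (Pi : (0 < / (eps * eps + d * d))%R) by (apply Rinv_0_lt_compat; auto).
  assert (Pi2 : (0 < / (eps * eps))%R) by (apply Rinv_0_lt_compat; auto).
  split; [nra|].
  apply Rmult_le_reg_r with (1 + v * v)%R; [apply one_plus_sqr_pos|].
  replace ((C + 2 / (eps * eps)) / (1 + v * v) * (1 + v * v))%R with (C + 2 / (eps * eps))%R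
    by (field; split; [lra | apply Rgt_not_eq, one_plus_sqr_pos]).
  destruct (Rle_dec 0 v) as [Hv|Hv].
  - assert (E : (1 + v * v <= 2 * exp v)%R).
    { assert (L := cosh_ge v). assert (L2 : (exp (- v) <= 1)%R) by (rewrite <- exp_0; apply exp_le; lra).
      assert (L3 := exp_ineq1_le v). lra. }
    assert (K := kx_le v).
    assert (I1 : (/ (eps * eps + d * d) <= / (eps * eps))%R) by (apply Rinv_le_contravar; nra).
    assert (E3 : (exp v * exp (- v) = 1)%R) by (rewrite <- exp_plus; replace (v + - v)%R with 0%R by ring; apply exp_0).
    apply Rle_trans with (exp (- v) * / (eps * eps) * (2 * exp v))%R.
    + apply Rmult_le_compat; [nra | nra | | auto]. apply Rmult_le_compat; lra.
    + replace (exp (- v) * / (eps * eps) * (2 * exp v))%R with (2 / (eps * eps) * (exp v * exp (- v)))%R by (unfold Rdiv; ring).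
      rewrite E3. lra.
  - assert (G := Xv_ge v). assert (Gp := Xv_pos v).
    assert (V : (1 + v * v <= C * (eps * eps + d * d))%R).
    { assert (v * v <= Xv v * Xv v)%R by nra.
      assert (Xv v * Xv v <= 2 * (d * d) + 2 * (x0 * x0))%R.
      { unfold d. assert (0 <= (x0 - Xv v + x0) * (x0 - Xv v + x0))%R by apply Rle_0_sqr.
        assert (0 <= (2 * x0 - Xv v) * (2 * x0 - Xv v))%R by apply Rle_0_sqr. nra. }
      assert (E : (C * (eps * eps) = 2 * (eps * eps) + (1 + 2 * (x0 * x0)))%R) by (unfold C; field; lra).
      assert (0 <= (C - 2) * (d * d))%R by (apply Rmult_le_pos; nra). nra. }
    apply Rle_trans with (1 * / (eps * eps + d * d) * (C * (eps * eps + d * d)))%R.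
    + apply Rmult_le_compat; [nra | nra | | auto]. apply Rmult_le_compat_r; lra.
    + replace (1 * / (eps * eps + d * d) * (C * (eps * eps + d * d)))%R with C by (field; lra).
      assert (0 < 2 / (eps * eps))%R by (apply Rdiv_lt_0_compat; lra). lra.
Qed.

(** [b / kx] is the density of the form [b dv] with respect to [dX]; it is Lipschitz as a function
    of [X] at each point. *)
Definition lipX (b : R -> C) : Prop := forall v0, exists L, (0 <= L)%R /\ forall v,
  (Cmod (b v - b v0 / kx v0 * kx v) <= L * Rabs (Xv v0 - Xv v)%R * kx v)%R.

(** As [v] runs over the line, [x0 - X] increases from minus infinity to [x0]. *)
Lemma CI_subst_X (Psi psi : R -> R) (x0 l K : R) : (forall y, is_derive Psi y (psi y)) ->
  intg (fun v => RtoC (psi (x0 - Xv v)%R * kx v)) ->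
  (0 <= K)%R -> (forall y, (0 < y)%R -> (Rabs (Psi (- y) - l) <= K / y)%R) ->
  CI (fun v => RtoC (psi (x0 - Xv v)%R * kx v)) = RtoC (Psi x0 - l).
Proof.
  intros D I HK L. rewrite (CI_FTC (fun v => RtoC (Psi (x0 - Xv v)%R)) (fun v => RtoC (psi (x0 - Xv v)%R * kx v)) (RtoC l) (RtoC (Psi x0))); [| |exact I|].
  - rewrite <- RtoC_minus. reflexivity.
  - intros v. apply RD_RtoC.
    replace (psi (x0 - Xv v)%R * kx v)%R with (scal (0 - - kx v)%R (psi (x0 - Xv v)%R))
      by (unfold scal; simpl; unfold mult; simpl; ring).
    apply (is_derive_comp (V := R_NormedModule) Psi (fun v => x0 - Xv v)%R); auto.
    apply (is_derive_minus (V := R_NormedModule)); [|apply Xv_derive].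
    apply is_derive_Reals, derivable_pt_lim_const.
  - intros e Hee.
    assert (CP : continuity_pt Psi x0) by (apply derivable_continuous_pt; eexists; apply is_derive_Reals, D).
    destruct (CP e Hee) as [dl [Pdl Hdl]]. destruct (exp_small 1 dl Pdl) as [X1 [PX1 HX1]].
    exists (Rmax (X1 + 1) (x0 + (K + 1) / e + 1)). intros v Hv.
    assert (Hv1 := Rle_trans _ _ _ (Rmax_l _ _) Hv). assert (Hv2 := Rle_trans _ _ _ (Rmax_r _ _) Hv).
    split; rewrite <- RtoC_minus, Cmod_R.
    + left. destruct (Req_dec (x0 - Xv v) x0) as [Z|Z].
      * rewrite Z, Rminus_diag, Rabs_R0; auto.
      * apply Hdl. split; [split; [exact Logic.I|auto]|]. simpl. unfold Rdist.
        replace (x0 - Xv v - x0)%R with (- Xv v)%R by ring. rewrite Rabs_Ropp, Rabs_pos_eq by (left; apply Xv_pos).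
        eapply Rle_lt_trans; [apply Xv_le|]. specialize (HX1 v ltac:(lra)). lra.
    + assert (G := Xv_ge (- v)%R). set (y := (Xv (- v) - x0)%R).
      assert (Pe : (0 < (K + 1) / e)%R) by (apply Rdiv_lt_0_compat; lra).
      assert (Hy : ((K + 1) / e < y)%R) by (unfold y; lra).
      replace (x0 - Xv (- v))%R with (- y)%R by (unfold y; ring).
      eapply Rle_trans; [apply L; lra|]. apply Rmult_le_reg_r with y; [lra|].
      replace (K / y * y)%R with K by (field; lra).
      apply Rmult_lt_compat_l with (r := e) in Hy; auto. replace (e * ((K + 1) / e))%R with (K + 1)%R in Hy by (field; lra). lra.
Qed.

Section Kernel.
Variables (eps x0 : R).
Hypothesis He : (0 < eps)%R.

(** The square root of [ker], up to a constant: Poisson's kernel. *)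
Definition qX (v : R) : R := (/ (eps * eps + (x0 - Xv v) * (x0 - Xv v)))%R.

Lemma den_pos (d : R) : (0 < eps * eps + d * d)%R.
Proof using He. nra. Qed.

Lemma qX_pos v : (0 < qX v)%R.
Proof using He. apply Rinv_0_lt_compat, den_pos. Qed.

Lemma qX_le v : (eps * eps * qX v <= 1)%R.
Proof using He.
  assert (Q := den_pos (x0 - Xv v)). unfold qX. apply Rmult_le_reg_r with (1 := Q).
  rewrite Rmult_assoc, Rinv_l by lra. generalize (Rle_0_sqr (x0 - Xv v)). unfold Rsqr. lra.
Qed.

Lemma ker_qX v : ker eps (x0 - Xv v) = (4 * (eps * eps * eps) * (qX v * qX v))%R.
Proof using He. assert (Q := den_pos (x0 - Xv v)). unfold ker, qX. field. lra. Qed.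

Lemma qX_continuous v : continuous qX v.
Proof using He.
  apply (ex_derive_continuous (V := R_NormedModule)). unfold qX. auto_derive. assert (Q := den_pos (x0 - Xv v)).
  repeat split; try (eexists; apply Xv_derive). apply Rgt_not_eq. unfold Rminus in Q. lra.
Qed.

Lemma kerX_continuous v : continuous (fun v => ker eps (x0 - Xv v)) v.
Proof using He.
  apply (continuous_ext (fun v => 4 * (eps * eps * eps) * (qX v * qX v))%R); [intros; symmetry; apply ker_qX|].
  apply (continuous_scal_r (V := R_NormedModule)), (continuous_mult (K := R_AbsRing)); apply qX_continuous.
Qed.

Lemma qX_intg : intg (fun v => RtoC (qX v * kx v)).
Proof using He.
  split.
  - intros v. apply ccts_RtoC, (continuous_mult (K := R_AbsRing)); [apply qX_continuous | apply kx_continuous].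
  - destruct (poisson_bound eps x0 He) as [M H]. exists M. intros v. specialize (H v). fold (qX v) in H.
    rewrite Rmult_comm, Cmod_R, Rabs_pos_eq; apply H.
Qed.

Lemma kerX_le v : (0 <= ker eps (x0 - Xv v) <= 4 * eps * qX v)%R.
Proof using He.
  rewrite ker_qX. assert (P := qX_pos v). assert (L := qX_le v). assert (0 < eps * eps)%R by nra. split.
  - apply Rmult_le_pos; nra.
  - replace (4 * (eps * eps * eps) * (qX v * qX v))%R with (4 * eps * qX v * (eps * eps * qX v))%R by ring.
    rewrite <- (Rmult_1_r (4 * eps * qX v)) at 2. apply Rmult_le_compat_l; nra.
Qed.

Lemma kerX_intg : intg (fun v => RtoC (ker eps (x0 - Xv v) * kx v)).
Proof using He.
  destruct qX_intg as [_ [M H]]. split.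
  - intros v. apply ccts_RtoC, (continuous_mult (K := R_AbsRing)); [apply kerX_continuous | apply kx_continuous].
  - exists (4 * eps * M)%R. intros v. specialize (H v). cbv beta in H. destruct (kx_pos v). assert (P := qX_pos v).
    destruct (kerX_le v). rewrite Cmod_R, Rabs_pos_eq in H by (apply Rmult_le_pos; lra).
    rewrite Cmod_R, Rabs_pos_eq by (apply Rmult_le_pos; lra).
    unfold Rdiv. rewrite Rmult_assoc. apply Rle_trans with (4 * eps * (qX v * kx v))%R.
    + rewrite <- Rmult_assoc. apply Rmult_le_compat_r; lra.
    + apply Rmult_le_compat_l; [lra | exact H].
Qed.

Lemma kerX_mult_intg (b : R -> C) : intg b -> intg (fun v => RtoC (ker eps (x0 - Xv v)) * b v).
Proof using He.
  intros [C [M H]]. split.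
  - intros v. apply ccts_mult; [apply ccts_RtoC, kerX_continuous | apply C].
  - exists (4 * / eps * M)%R. intros v. rewrite Cmod_mult, Cmod_R. destruct (kerX_le v) as [k0 k1].
    rewrite Rabs_pos_eq by exact k0. unfold Rdiv. rewrite (Rmult_assoc _ M).
    apply Rmult_le_compat; [exact k0 | apply Cmod_ge_0 | | apply H].
    eapply Rle_trans; [exact k1|]. assert (L := qX_le v). assert (0 < / eps)%R by (apply Rinv_0_lt_compat; auto).
    replace (4 * eps * qX v)%R with (4 * / eps * (eps * eps * qX v))%R by (field; lra). nra.
Qed.

Lemma atan_defect y : (0 < y)%R -> (0 <= PI / 2 - atan (y / eps) <= eps / y)%R.
Proof using He.
  intros Hy. split; [generalize (atan_bound (y / eps)); lra|].
  rewrite <- atan_inv by (apply Rdiv_lt_0_compat; auto).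
  replace (/ (y / eps))%R with (eps / y)%R by (field; lra). apply atan_small. left; apply Rdiv_lt_0_compat; auto.
Qed.

Lemma poisson_mass : (Re (CI (fun v => RtoC (qX v * kx v))) <= PI / eps)%R.
Proof using He.
  assert (Pe : (0 < / eps)%R) by (apply Rinv_0_lt_compat; auto).
  assert (D : forall y, is_derive (fun y => / eps * atan (y / eps))%R y (/ (eps * eps + y * y))%R).
  { intros y. assert (Q := den_pos y). auto_derive; [lra|]. simpl. field. repeat split; try lra; nra. }
  unfold qX. rewrite (CI_subst_X _ _ x0 (/ eps * - (PI / 2)) 1 D qX_intg); [|lra|].
  - simpl. replace (PI / eps)%R with (/ eps * PI)%R by (unfold Rdiv; ring).
    rewrite <- Rmult_minus_distr_l. apply Rmult_le_compat_l; [lra|].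
    generalize (atan_bound (x0 / eps)). lra.
  - intros y Hy. replace (- y / eps)%R with (- (y / eps))%R by (field; lra). rewrite atan_opp.
    replace (/ eps * - atan (y / eps) - / eps * - (PI / 2))%R with (/ eps * (PI / 2 - atan (y / eps)))%R by ring.
    destruct (atan_defect y Hy). rewrite Rabs_pos_eq by (apply Rmult_le_pos; lra).
    apply Rle_trans with (/ eps * (eps / y))%R; [apply Rmult_le_compat_l; lra | right; field; lra].
Qed.

Lemma ker_mass : (0 < x0)%R ->
  exists m, CI (fun v => RtoC (ker eps (x0 - Xv v) * kx v)) = RtoC m /\ (Rabs (m - 2 * PI) <= eps * (4 * / x0))%R.
Proof using He.
  intros Px.
  set (rest := fun y => (2 * eps * y * / (eps * eps + y * y))%R).
  assert (Hr : forall y, (0 < y)%R -> (Rabs (rest y) <= 2 * eps / y)%R).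
  { intros y Hy. assert (Q := den_pos y). assert (P1 := Rinv_0_lt_compat _ Q).
    rewrite Rabs_pos_eq by (unfold rest; apply Rmult_le_pos; nra).
    apply Rmult_le_reg_r with y; auto. replace (2 * eps / y * y)%R with (2 * eps)%R by (field; lra). unfold rest.
    apply Rmult_le_reg_r with (eps * eps + y * y)%R; auto.
    replace (2 * eps * y * / (eps * eps + y * y) * y * (eps * eps + y * y))%R with (2 * eps * (y * y))%R by (field; lra).
    apply Rmult_le_compat_l; nra. }
  assert (D : forall y, is_derive (fun y => 2 * atan (y / eps) + rest y)%R y (ker eps y)).
  { intros y. assert (Q := den_pos y). unfold rest, ker. auto_derive; [lra|]. simpl. field. repeat split; try lra; nra. }
  exists (2 * atan (x0 / eps) + rest x0 - - PI)%R. split.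
  - apply (CI_subst_X _ _ x0 (- PI) (4 * eps) D kerX_intg); [lra|]. intros y Hy.
    replace (- y / eps)%R with (- (y / eps))%R by (field; lra). rewrite atan_opp.
    replace (rest (- y)%R) with (- rest y)%R by (unfold rest; replace (- y * - y)%R with (y * y)%R by ring; ring).
    replace (2 * - atan (y / eps) + - rest y - - PI)%R with (2 * (PI / 2 - atan (y / eps)) + - rest y)%R by field.
    eapply Rle_trans; [apply Rabs_triang|]. rewrite Rabs_Ropp.
    assert (A := atan_defect y Hy). assert (B := Hr y Hy). rewrite Rabs_pos_eq by lra. unfold Rdiv in *. lra.
  - replace (2 * atan (x0 / eps) + rest x0 - - PI - 2 * PI)%R with (- (2 * (PI / 2 - atan (x0 / eps))) + rest x0)%R by field.
    eapply Rle_trans; [apply Rabs_triang|]. rewrite Rabs_Ropp.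
    assert (A := atan_defect x0 Px). assert (B := Hr x0 Px). rewrite Rabs_pos_eq by lra. unfold Rdiv in *. lra.
Qed.

(** The fourth-power decay of the kernel absorbs the factor [|x0 - X|]. *)
Lemma ker_lip_le v : (ker eps (x0 - Xv v) * Rabs (x0 - Xv v) <= 2 * (eps * eps) * qX v)%R.
Proof using He.
  set (d := (x0 - Xv v)%R). assert (P := qX_pos v). assert (Q := den_pos d). assert (e2 : (0 < eps * eps)%R) by nra.
  assert (D2 : (2 * eps * Rabs d * qX v <= 1)%R).
  { unfold qX. fold d. apply Rmult_le_reg_r with (1 := Q). rewrite Rmult_assoc, Rinv_l by lra.
    assert (Rabs d * Rabs d = d * d)%R by (rewrite <- Rabs_mult; apply Rabs_pos_eq, Rle_0_sqr).
    assert (0 <= (eps - Rabs d) * (eps - Rabs d))%R by apply Rle_0_sqr. nra. }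
  unfold d at 1. rewrite ker_qX.
  replace (4 * (eps * eps * eps) * (qX v * qX v) * Rabs d)%R with
    (2 * (eps * eps) * qX v * (2 * eps * Rabs d * qX v))%R by ring.
  rewrite <- (Rmult_1_r (2 * (eps * eps) * qX v)) at 2. apply Rmult_le_compat_l; nra.
Qed.
End Kernel.

Section Inversion.
Variables (b : R -> C) (M : R) (v0 L : R).
Let x0 := Xv v0.
Let b0 := b v0 / kx v0.
Let B (t : R) : C := CI (fun v => Cexp (- (Ci * (t * Xv v))) * b v).
Let f (t : R) : C := Cexp (Ci * (t * x0)) * B t.
Hypotheses (Ib : intg b) (PL : (0 <= L)%R)
  (HL : forall v, (Cmod (b v - b0 * kx v) <= L * Rabs (x0 - Xv v)%R * kx v)%R)
  (HB : forall t, ((1 + Rabs t) * Cmod (B t) <= M / (1 + t * t))%R) (CB : forall t, ccts B t).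

Lemma Cmod_wave (t d : R) : Cmod (Cexp (Ci * (t * d))) = 1%R.
Proof using. rewrite Cmod_Cexp. replace (Re (Ci * (t * d))) with 0%R by (unfold Re; simpl; ring). apply exp_0. Qed.

Lemma wave_ccts (d t : R) : ccts (fun t : R => Cexp (Ci * (t * d))) t.
Proof using.
  apply ccts_Cexp, ccts_mult; [apply ccts_const|].
  apply ccts_mult; [apply ccts_RtoC, continuous_id | apply ccts_const].
Qed.

Lemma transform_le t : (Cmod (B t) <= M / (1 + t * t))%R /\ (Rabs t * Cmod (B t) <= M / (1 + t * t))%R.
Proof using HB. specialize (HB t). assert (P := Rabs_pos t). assert (Q := Cmod_ge_0 (B t)). split; nra. Qed.

Lemma inverse_integrand_intg : intg f.
Proof using HB CB.
  split; [intros t; apply ccts_mult; [apply wave_ccts | apply CB]|].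
  exists M. intros t. unfold f. rewrite Cmod_mult, Cmod_wave, Rmult_1_l. apply transform_le.
Qed.

Lemma weighted_integrand_intg eps : (0 < eps)%R -> intg (fun t => RtoC (wt eps t) * f t).
Proof using HB CB.
  intros He. destruct (wt_bound eps He) as [K H]. split.
  - intros t. apply ccts_mult; [apply ccts_RtoC, wt_continuous | apply inverse_integrand_intg].
  - destruct inverse_integrand_intg as [_ [N Bf]]. exists (K * N)%R. intros t. rewrite Cmod_mult, Cmod_R.
    destruct (H t) as [w0 w1]. rewrite Rabs_pos_eq by auto. assert (P := one_plus_sqr_pos t).
    unfold Rdiv. rewrite Rmult_assoc. apply Rmult_le_compat; [auto | apply Cmod_ge_0 | | apply Bf].
    eapply Rle_trans; [exact w1|]. apply Rmult_le_reg_r with (1 := P).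
    replace (K / (1 + t * t) * (1 + t * t))%R with K by (field; lra).
    assert (0 <= K / (1 + t * t))%R by lra. assert (0 <= K)%R; [|nra].
    replace K with (K / (1 + t * t) * (1 + t * t))%R by (field; lra). apply Rmult_le_pos; lra.
Qed.

(** Removing the weight costs [O(eps)], thanks to the decay of [t B]. *)
Lemma weight_error eps : (0 < eps)%R ->
  (Cmod (CI f - CI (fun t => RtoC (wt eps t) * f t))%C <= PI * (eps * M))%R.
Proof using HB CB.
  intros He. rewrite <- CI_minus by (apply inverse_integrand_intg || apply weighted_integrand_intg, He).
  apply CI_bound; [apply (intg_minus _ _ inverse_integrand_intg (weighted_integrand_intg eps He))|]. cbv beta. intros t.
  replace (f t - RtoC (wt eps t) * f t) with (RtoC (1 - wt eps t) * f t) by (rewrite RtoC_minus; ring).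
  rewrite Cmod_mult, Cmod_R. unfold f. rewrite Cmod_mult, Cmod_wave, Rmult_1_l.
  assert (W := wt_near_1 eps t He). destruct (transform_le t) as [_ b2].
  apply Rle_trans with (eps * Rabs t * Cmod (B t))%R; [apply Rmult_le_compat_r; auto using Cmod_ge_0|].
  unfold Rdiv. rewrite (Rmult_assoc eps M). rewrite Rmult_assoc. apply Rmult_le_compat_l; lra.
Qed.

Lemma weighted_inverse eps : (0 < eps)%R ->
  CI (fun t => RtoC (wt eps t) * f t) = CI (fun v => RtoC (ker eps (x0 - Xv v)) * b v).
Proof using Ib.
  intros He. destruct Ib as [Cb [Mb Bb]]. destruct (wt_bound eps He) as [Mw Hw].
  set (F := fun (t v : R) => RtoC (wt eps t) * Cexp (Ci * (t * (x0 - Xv v)%R)) * b v).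
  assert (cF : forall t v, ccts2 F t v).
  { intros t v. unfold F. apply ccts_mult; [apply ccts_mult|].
    - apply (ccts2_fst (fun t => RtoC (wt eps t))), ccts_RtoC, wt_continuous.
    - apply ccts_Cexp, ccts_mult; [apply ccts_const|]. apply ccts_mult.
      + apply (ccts2_fst (fun t => RtoC t)), ccts_RtoC, continuous_id.
      + apply (ccts2_snd (fun v => RtoC (x0 - Xv v))), ccts_RtoC.
        apply (continuous_minus (V := R_NormedModule)); [apply continuous_const | apply Xv_continuous].
    - apply (ccts2_snd b), Cb. }
  transitivity (CI (fun t => CI (fun v => F t v))).
  - apply CI_ext. intros t. unfold f, B. rewrite Cmult_assoc, <- CI_scal.
    + apply CI_ext. intros v. unfold F.
      replace (Ci * (t * (x0 - Xv v)%R)) with (Ci * (t * x0) + - (Ci * (t * Xv v))) by (rewrite RtoC_minus; ring).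
      rewrite Cexp_plus. ring.
    + split.
      * intros v. apply ccts_mult; [|apply Cb]. apply ccts_Cexp, ccts_opp, ccts_mult; [apply ccts_const|].
        apply ccts_mult; [apply ccts_const | apply ccts_RtoC, Xv_continuous].
      * exists Mb. intros v. rewrite Cmod_mult, Cmod_Cexp.
        replace (Re (- (Ci * (t * Xv v)))) with 0%R by (unfold Re; simpl; ring). rewrite exp_0, Rmult_1_l. apply Bb.
  - rewrite (CI_Fubini F (Mw * Mb) cF).
    + apply CI_ext. intros v. destruct (wt_fourier eps (x0 - Xv v) He) as [Iw Ew].
      rewrite <- Ew, Cmult_comm, <- CI_scal by exact Iw. apply CI_ext. intros t. unfold F. ring.
    + intros t v. unfold F. rewrite !Cmod_mult, Cmod_wave, Cmod_R, Rabs_pos_eq by apply Hw. rewrite Rmult_1_r.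
      apply Rle_trans with (Mw / (1 + t * t) * (Mb / (1 + v * v)))%R.
      * apply Rmult_le_compat; [apply Hw | apply Cmod_ge_0 | apply Hw | apply Bb].
      * right. field. split; apply Rgt_not_eq, one_plus_sqr_pos.
Qed.

(** The variation of [b / kx] costs [O(eps)], because it is Lipschitz in [X]. *)
Lemma lipschitz_error eps : (0 < eps)%R ->
  (Cmod (CI (fun v => RtoC (ker eps (x0 - Xv v)) * b v) - b0 * CI (fun v => RtoC (ker eps (x0 - Xv v) * kx v)))%C
    <= 2 * PI * L * eps)%R.
Proof using Ib PL HL.
  intros He. set (g := fun v => (2 * L * (eps * eps) * (qX eps x0 v * kx v))%R).
  assert (Ek := kerX_intg eps x0 He). assert (Iq := qX_intg eps x0 He). assert (Ikb := kerX_mult_intg eps x0 He b Ib).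
  assert (Eg : forall v, RtoC (2 * L * (eps * eps)) * RtoC (qX eps x0 v * kx v) = RtoC (g v))
    by (intros; unfold g; rewrite <- RtoC_mult; auto).
  assert (Ig := intg_ext _ _ Eg (intg_scal _ _ Iq)).
  rewrite <- CI_scal, <- CI_minus by (exact Ek || exact Ikb || exact (intg_scal _ _ Ek)).
  eapply Rle_trans; [apply (CI_le _ g)|].
  - apply (intg_minus _ _ Ikb (intg_scal b0 _ Ek)).
  - intros v. apply (continuous_scal_r (V := R_NormedModule) (2 * L * (eps * eps))%R (fun v => qX eps x0 v * kx v)%R),
      (continuous_mult (K := R_AbsRing)); [apply qX_continuous, He | apply kx_continuous].
  - exact Ig.
  - intros v. rewrite RtoC_mult.
    replace (RtoC (ker eps (x0 - Xv v)) * b v - b0 * (RtoC (ker eps (x0 - Xv v)) * RtoC (kx v))) with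
      (RtoC (ker eps (x0 - Xv v)) * (b v - b0 * kx v)) by ring.
    destruct (kerX_le eps x0 He v) as [k0 _]. destruct (kx_pos v) as [kp _].
    rewrite Cmod_mult, Cmod_R, Rabs_pos_eq by exact k0.
    eapply Rle_trans; [apply Rmult_le_compat_l; [exact k0 | apply HL]|].
    assert (Kl := ker_lip_le eps x0 He v).
    replace (ker eps (x0 - Xv v) * (L * Rabs (x0 - Xv v) * kx v))%R with
      (L * kx v * (ker eps (x0 - Xv v) * Rabs (x0 - Xv v)))%R by ring.
    replace (g v) with (L * kx v * (2 * (eps * eps) * qX eps x0 v))%R by (unfold g; ring).
    apply Rmult_le_compat_l; [apply Rmult_le_pos; lra | exact Kl].
  - rewrite <- (CI_ext _ _ Eg), CI_scal by exact Iq.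
    replace (Re (RtoC (2 * L * (eps * eps)) * CI (fun v => RtoC (qX eps x0 v * kx v)))) with
      (2 * L * (eps * eps) * Re (CI (fun v => RtoC (qX eps x0 v * kx v))))%R by (unfold Re; simpl; ring).
    apply Rle_trans with (2 * L * (eps * eps) * (PI / eps))%R; [|right; field; lra].
    apply Rmult_le_compat_l; [|apply poisson_mass, He]. apply Rmult_le_pos; nra.
Qed.

Lemma inversion_error eps : (0 < eps)%R ->
  (Cmod (CI f - RtoC (2 * PI) * b0)%C <= eps * (PI * M + 2 * PI * L + 4 * / x0 * Cmod b0))%R.
Proof using Ib PL HL HB CB.
  intros He. destruct (ker_mass eps x0 He (Xv_pos v0)) as [m [Em Hm]].
  assert (E1 := weight_error eps He). rewrite (weighted_inverse eps He) in E1.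
  assert (E2 := lipschitz_error eps He). rewrite Em in E2.
  assert (E3 : (Cmod (b0 * RtoC m - RtoC (2 * PI) * b0)%C <= eps * (4 * / x0) * Cmod b0)%R).
  { replace (b0 * RtoC m - RtoC (2 * PI) * b0) with (RtoC (m - 2 * PI) * b0) by (rewrite RtoC_minus; ring).
    rewrite Cmod_mult, Cmod_R. apply Rmult_le_compat_r; [apply Cmod_ge_0 | auto]. }
  set (I := CI f) in *. set (I2 := CI (fun v => RtoC (ker eps (x0 - Xv v)) * b v)) in *.
  replace (I - RtoC (2 * PI) * b0) with ((I - I2) + ((I2 - b0 * RtoC m) + (b0 * RtoC m - RtoC (2 * PI) * b0))) by ring.
  eapply Rle_trans; [apply Cmod_triangle|].
  eapply Rle_trans; [apply Rplus_le_compat_l, Cmod_triangle|]. lra.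
Qed.

Lemma fourier_inversion_lip : CI f = RtoC (2 * PI) * b0.
Proof using Ib PL HL HB CB.
  set (K := (PI * M + 2 * PI * L + 4 * / x0 * Cmod b0)%R).
  assert (PK : (0 <= K)%R).
  { assert (H := inversion_error 1 Rlt_0_1). fold K in H. rewrite Rmult_1_l in H.
    eapply Rle_trans; [apply Cmod_ge_0 | exact H]. }
  assert (Z : (Cmod (CI f - RtoC (2 * PI) * b0) <= 0)%R).
  { apply le_epsilon. intros e He. rewrite Rplus_0_l.
    eapply Rle_trans; [apply (inversion_error (e / (K + 1)))|].
    - apply Rdiv_lt_0_compat; lra.
    - fold K. apply Rmult_le_reg_r with (K + 1)%R; [lra|].
      replace (e / (K + 1) * K * (K + 1))%R with (e * K)%R by (field; lra). nra. }
  set (I := CI f) in *. replace I with (I - RtoC (2 * PI) * b0 + RtoC (2 * PI) * b0) by ring.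
  rewrite (Cmod_eq_0 (I - RtoC (2 * PI) * b0)); [ring|]. generalize (Cmod_ge_0 (I - RtoC (2 * PI) * b0)). lra.
Qed.
End Inversion.

Lemma fourier_inversion (b : R -> C) (M : R) (v0 : R) : intg b -> lipX b ->
  let B := fun t : R => CI (fun v => Cexp (- (Ci * (t * Xv v))) * b v) in
  (forall t, ((1 + Rabs t) * Cmod (B t) <= M / (1 + t * t))%R) -> (forall t, ccts B t) ->
  CI (fun t => Cexp (Ci * (t * Xv v0)) * B t) = RtoC (2 * PI) * (b v0 / kx v0).
Proof. intros Ib Lb B HB CB. destruct (Lb v0) as [L [PL HL]]. exact (fourier_inversion_lip b M v0 L Ib PL HL HB CB). Qed.

(** Insert the inversion formula for [b] under the integral against [a] and exchange the
    integrals. *)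
Lemma parseval (a b : R -> C) (M : R) : intg a -> intg b -> lipX b ->
  let A := fun t : R => CI (fun v => Cexp (Ci * (t * Xv v)) * a v) in
  let B := fun t : R => CI (fun v => Cexp (- (Ci * (t * Xv v))) * b v) in
  (forall t, ((1 + Rabs t) * Cmod (B t) <= M / (1 + t * t))%R) -> (forall t, ccts B t) ->
  CI (fun t => A t * B t) = CI (fun v => RtoC (2 * PI) * (a v * (b v / kx v))).
Proof.
  intros Ia Ib Lb A B HB CB. destruct (Ia) as [Ca [Ma Ba]].
  assert (U : forall t d : R, Cmod (Cexp (Ci * (t * d))) = 1%R).
  { intros t d. rewrite Cmod_Cexp. replace (Re (Ci * (t * d))) with 0%R by (unfold Re; simpl; ring). apply exp_0. }
  set (F := fun (t v : R) => Cexp (Ci * (t * Xv v)) * a v * B t).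
  transitivity (CI (fun t => CI (fun v => F t v))).
  - apply CI_ext. intros t. rewrite Cmult_comm. unfold A. rewrite <- CI_scal.
    + apply CI_ext. intros v. unfold F. ring.
    + split.
      * intros v. apply ccts_mult; auto. apply ccts_Cexp, ccts_mult; [apply ccts_const|].
        apply ccts_mult; [apply ccts_const | apply ccts_RtoC, Xv_continuous].
      * exists Ma. intros v. rewrite Cmod_mult, U, Rmult_1_l. apply Ba.
  - rewrite (CI_Fubini F (M * Ma)).
    + apply CI_ext. intros v.
      assert (Fi := fourier_inversion b M v Ib Lb HB CB). fold B in Fi.
      transitivity (a v * CI (fun t => Cexp (Ci * (t * Xv v)) * B t)).
      * rewrite <- CI_scal.
        -- apply CI_ext. intros t. unfold F. ring.
        -- split.
           ++ intros t. apply ccts_mult; auto. apply ccts_Cexp, ccts_mult; [apply ccts_const|].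
              apply ccts_mult; [apply ccts_RtoC, continuous_id | apply ccts_const].
           ++ exists M. intros t. rewrite Cmod_mult, U, Rmult_1_l. eapply Rle_trans; [|apply HB].
              generalize (Rabs_pos t) (Cmod_ge_0 (B t)). nra.
      * rewrite Fi. ring.
    + intros t v. unfold F. apply ccts_mult; [apply ccts_mult|].
      * apply ccts_Cexp, ccts_mult; [apply ccts_const|]. apply ccts_mult.
        -- apply (ccts2_fst (fun t => RtoC t)), ccts_RtoC, continuous_id.
        -- apply (ccts2_snd (fun v => RtoC (Xv v))), ccts_RtoC, Xv_continuous.
      * apply (ccts2_snd a), Ca.
      * exact (ccts2_fst B t v (CB t)).
    + intros t v. unfold F. rewrite !Cmod_mult, U, Rmult_1_l.
      apply Rle_trans with (Ma / (1 + v * v) * (M / (1 + t * t)))%R.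
      * apply Rmult_le_compat; auto using Cmod_ge_0. eapply Rle_trans; [|apply HB].
        generalize (Rabs_pos t) (Cmod_ge_0 (B t)). nra.
      * right. field. split; apply Rgt_not_eq, one_plus_sqr_pos.
Qed.

(** * The integral for arguments near the positive axis *)

Lemma lipX_of_derive (b be be' : R -> C) (L : R) : (0 <= L)%R -> (forall v, b v = be v * kx v) ->
  (forall v, RD be v (be' v)) -> (forall v, ccts be' v) -> (forall v, (Cmod (be' v) <= L * kx v)%R) -> lipX b.
Proof.
  intros PL E D C B.
  assert (K : forall u v, (u <= v)%R -> (Cmod (be v - be u)%C <= L * (Xv u - Xv v))%R).
  { intros u v Huv. rewrite <- (CInt_FTC be be') by auto.
    assert (I : is_RInt (fun t => L * kx t)%R u v (L * - Xv v - L * - Xv u)%R).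
    { apply (is_RInt_derive (V := R_CompleteNormedModule) (fun t => L * - Xv t)%R).
      - intros t _. apply (is_derive_scal (fun t => - Xv t)%R). replace (kx t) with (- - kx t)%R by ring.
        apply (is_derive_opp (V := R_NormedModule)), Xv_derive.
      - intros t _. apply (continuous_scal_r (V := R_NormedModule)), kx_continuous. }
    eapply Rle_trans; [apply (CInt_bound be' (fun t => L * kx t)%R); auto; eexists; exact I|].
    rewrite (is_RInt_unique (V := R_CompleteNormedModule) _ _ _ _ I). lra. }
  intros v0. exists L. split; auto. intros v. destruct (kx_pos v), (kx_pos v0).
  assert (N : RtoC (kx v0) <> 0) by (intros Z; apply RtoC_inj in Z; lra).
  rewrite !E. replace (be v * kx v - be v0 * kx v0 / kx v0 * kx v) with ((be v - be v0) * kx v) by (field; auto).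
  rewrite Cmod_mult, Cmod_R, (Rabs_pos_eq (kx v)) by lra. apply Rmult_le_compat_r; [lra|].
  destruct (Rle_dec v0 v) as [O|O].
  - eapply Rle_trans; [apply K; auto|]. apply Rmult_le_compat_l; auto. apply Rle_abs.
  - rewrite Cmod_sub_rev. eapply Rle_trans; [apply K; lra|]. apply Rmult_le_compat_l; auto.
    rewrite Rabs_minus_sym. apply Rle_abs.
Qed.

Lemma lam_real v : lam (v, 0%R) = RtoC (Xv v).
Proof.
  unfold lam, Xv. rewrite <- lg_opp. unfold lg.
  replace (1 + Cexp (- (v, 0%R))) with (Cexp (RtoC (ln (1 + exp (- v))))).
  - rewrite Clog_Cexp; auto. simpl. generalize PI_RGT_0; lra.
  - rewrite Cexp_RtoC, exp_ln by (generalize (exp_pos (- v)); lra).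
    replace (- (v, 0%R)) with (RtoC (- v)) by (apply C_eq; simpl; ring).
    rewrite Cexp_RtoC, RtoC_plus. auto.
Qed.

Lemma hJ_real (al be : C) v : hJ al be (v, 0%R) = Cexp ((al + be - 1) * v + (be - 1) * Xv v).
Proof. unfold hJ. rewrite lam_real. auto. Qed.

(** The points of the surface above the right half-plane, where the rays may be taken along the
    positive axis. *)
Definition right_half (w : C) : Prop := (Rabs (Im w) < PI / 2)%R.

Lemma right_half_adm w : right_half w -> adm w 0.
Proof. intros Q. split; [rewrite Rabs_R0; apply PI_RGT_0 | rewrite Rplus_0_r; auto]. Qed.

Lemma right_half_strip w : right_half w -> strip w.
Proof. unfold right_half, strip. generalize PI_RGT_0. lra. Qed.

Lemma J_real (al be w : C) : (0 < Re al)%R -> right_half w ->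
  J al be w = CI (fun v : R => Cexp (- (Cexp w * exp v)) * hJ al be (v, 0%R)).
Proof.
  intros Ha Q. rewrite (J_adm al be 0 w Ha (right_half_adm w Q) (right_half_strip w Q)). unfold Jray, ET.
  replace (w + (0, 0)%R) with w by (apply C_eq; unfold Re, Im; simpl; ring). reflexivity.
Qed.

Lemma J_real_intg (al be w : C) : (0 < Re al)%R -> right_half w ->
  intg (fun v : R => Cexp (- (Cexp w * exp v)) * hJ al be (v, 0%R)).
Proof.
  intros Ha Q. assert (I := Jray_intg al be 0 w Ha (right_half_adm w Q)).
  replace (w + (0, 0)%R) with w in I by (apply C_eq; unfold Re, Im; simpl; ring). exact I.
Qed.

Section Nice.
Variables (A : R) (w : C).
Hypotheses (HA : (- (3 / 4) < A < 3 / 4)%R) (Q : right_half w).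

(** With [s = A + i t], the integrand of the Laplace integral is this form multiplied by the wave
    [e^(- i t X)]. *)
Definition laplace_form (v : R) : C := Cexp (- (Cexp w * exp v)) * hJ (3 / 4 + A)%R (3 / 4 - A)%R (v, 0%R).

(** The derivative in [v] of [b / kx] is [O(kx)], because the factor [e^(- z e^v)] absorbs all
    powers of [e^v]. *)
Lemma laplace_form_lipX : lipX laplace_form.
Proof using HA Q.
 assert (Px := adm_pos w 0 (right_half_adm w Q)).
  replace (w + (0, 0)%R) with w in Px by (apply C_eq; unfold Re, Im; simpl; ring).
  set (x := Re (Cexp w)) in *. set (z := Cexp w) in *.
  (* [laplace_form = e^E kx] *)
  set (E := fun v : R => RtoC (3 / 2 * v + (3 / 4 - A) * Xv v) + - z * exp v).
  set (E' := fun v : R => RtoC (3 / 2 + (3 / 4 - A) * - kx v) + - z * exp v).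
  destruct (double_exp_bound x (3 / 4 + A) (3 / 4 - A + 2) Px ltac:(lra)) as [M HM].
  set (c := (Cmod z + 3)%R). assert (Pc : (3 <= c)%R) by (unfold c; generalize (Cmod_ge_0 z); lra).
  assert (PM : (0 <= M)%R).
  { specialize (HM 0%R). replace (M / (1 + 0 * 0))%R with M in HM by field. eapply Rle_trans; [left; apply exp_pos | exact HM]. }
  assert (cX : forall v, continuous (fun v => (3 / 4 - A) * Xv v)%R v)
    by (intros; apply (continuous_scal_r (V := R_NormedModule)), Xv_continuous).
  apply lipX_of_derive with (be := fun v => Cexp (E v)) (be' := fun v => Cexp (E v) * E' v) (L := (c * M)%R).
  - apply Rmult_le_pos; lra.
  - intros v. unfold laplace_form. rewrite hJ_real.
    replace (RtoC (kx v)) with (Cexp (RtoC (- (v + Xv v)))).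
    + rewrite <- !Cexp_plus. f_equal. unfold E. fold z.
      clearbody z. apply C_eq; unfold Re, Im; simpl; field.
    + rewrite Cexp_RtoC. f_equal. unfold Xv. replace (- (v + (lg v - v)))%R with (- lg v)%R by ring.
      rewrite exp_Ropp, exp_lg. unfold kx, sg. assert (P := exp_pos v). field. lra.
  - intros v. apply RD_exp. unfold E, E'. apply RD_plus.
    + apply RD_RtoC. apply (is_derive_plus (V := R_NormedModule)).
      * replace (3 / 2)%R with (3 / 2 * 1)%R at 2 by ring. apply (is_derive_scal (fun t : R => t)). apply is_derive_Reals, derivable_pt_lim_id.
      * apply (is_derive_scal Xv). apply Xv_derive.
    + apply RD_scal, RD_RtoC, is_derive_Reals, derivable_pt_lim_exp.
  - intros v. apply ccts_mult.
    + apply ccts_Cexp. unfold E. apply ccts_plus.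
      * apply ccts_RtoC. apply (continuous_plus (V := R_NormedModule) (fun v => 3 / 2 * v)%R); auto.
        apply (continuous_scal_r (V := R_NormedModule)), continuous_id.
      * apply ccts_mult; [apply ccts_const | apply ccts_RtoC, continuous_exp].
    + unfold E'. apply ccts_plus; [|apply ccts_mult; [apply ccts_const | apply ccts_RtoC, continuous_exp]].
      apply ccts_RtoC. apply (continuous_plus (V := R_NormedModule) (fun _ => 3 / 2)%R); [apply continuous_const|].
      apply (continuous_scal_r (V := R_NormedModule) _ (fun v => - kx v)%R), (continuous_opp (V := R_NormedModule)), kx_continuous.
  - intros v. destruct (kx_pos v) as [k0 k1]. assert (Pe := exp_pos v).
    assert (Ek : (kx v * exp (lg v) = 1)%R) by (rewrite exp_lg; unfold kx, sg; field; lra).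
    assert (B' : (Cmod (E' v) <= c * exp (lg v))%R).
    { unfold E'. eapply Rle_trans; [apply Cmod_triangle|]. rewrite Cmod_mult, Cmod_opp, !Cmod_R, (Rabs_pos_eq (exp v)) by lra.
      rewrite exp_lg. assert (Rabs (3 / 2 + (3 / 4 - A) * - kx v) <= 3)%R by (apply Rabs_le; split; nra).
      unfold c. generalize (Cmod_ge_0 z). nra. }
    assert (B0 : (Cmod (Cexp (E v)) * exp (lg v) * exp (lg v) <= M)%R).
    { rewrite Cmod_Cexp, <- !exp_plus. eapply Rle_trans; [|eapply Rle_trans; [apply (HM v)|]].
      - right. f_equal. unfold E, Re, x; fold z. simpl. unfold Xv, Re. field.
      - unfold Rdiv. rewrite <- (Rmult_1_r M) at 2. apply Rmult_le_compat_l; auto.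
        rewrite <- Rinv_1. apply Rinv_le_contravar; nra. }
    rewrite Cmod_mult. apply Rle_trans with (Cmod (Cexp (E v)) * (c * exp (lg v)))%R.
    { apply Rmult_le_compat_l; [apply Cmod_ge_0 | auto]. }
    apply Rle_trans with (c * kx v * (Cmod (Cexp (E v)) * exp (lg v) * exp (lg v)))%R.
    { right. transitivity (c * (Cmod (Cexp (E v)) * exp (lg v)) * (kx v * exp (lg v)))%R; [rewrite Ek|]; ring. }
    replace (c * M * kx v)%R with (c * kx v * M)%R by ring. apply Rmult_le_compat_l; auto. nra.
Qed.

Definition laplace_line (t : R) : C := J (RtoC (3 / 4) + (A, t)) (RtoC (3 / 4) - (A, t)) w.

Lemma laplace_line_fourier t : laplace_line t = CI (fun v => Cexp (- (Ci * (t * Xv v))) * laplace_form v).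
Proof using HA Q.
 unfold laplace_line. rewrite J_real by (auto; simpl; lra).
  apply CI_ext. intros v. unfold laplace_form. rewrite !hJ_real.
  replace (Cexp (- (Ci * (t * Xv v))) * (Cexp (- (Cexp w * exp v)) * Cexp ((RtoC (3 / 4 + A) + RtoC (3 / 4 - A) - 1) * v + (RtoC (3 / 4 - A) - 1) * Xv v)))
    with (Cexp (- (Cexp w * exp v)) * (Cexp (- (Ci * (t * Xv v))) * Cexp ((RtoC (3 / 4 + A) + RtoC (3 / 4 - A) - 1) * v + (RtoC (3 / 4 - A) - 1) * Xv v))) by ring.
  f_equal. rewrite <- Cexp_plus. f_equal. apply C_eq; unfold Re, Im; simpl; field.
Qed.

Lemma laplace_line_ccts t : ccts laplace_line t.
Proof using HA Q.
 apply ccts_ext with (1 := fun t => eq_sym (laplace_line_fourier t)).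
  destruct (J_real_intg (3 / 4 + A)%R (3 / 4 - A)%R w ltac:(simpl; lra) Q) as [C [M HM]].
  apply (ccts_CI_param _ M t 1); [lra | |].
  - intros u v. apply ccts_mult; [|apply (ccts2_snd laplace_form), C].
    apply ccts_Cexp, ccts_opp, ccts_mult; [apply ccts_const|]. apply ccts_mult.
    + apply (ccts2_fst (fun t => RtoC t)), ccts_RtoC, continuous_id.
    + apply (ccts2_snd (fun v => RtoC (Xv v))), ccts_RtoC, Xv_continuous.
  - intros u _ v. rewrite Cmod_mult, Cmod_Cexp. replace (Re (- (Ci * (u * Xv v)))) with 0%R by (unfold Re; simpl; ring).
    rewrite exp_0, Rmult_1_l. exact (HM v).
Qed.

Lemma laplace_line_decay : exists M, forall t, ((1 + Rabs t) * Cmod (laplace_line t) <= M / (1 + t * t))%R.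
Proof using HA Q.
 assert (Pp := PI_RGT_0).
  (* rays on either side, close enough to the positive axis to be admissible *)
  set (ph := ((PI / 2 - Rabs (Im w)) / 2)%R). assert (Q' := Q). unfold right_half in Q'. assert (P0 := Rabs_pos (Im w)).
  assert (Hb : forall e, (e = 1 \/ e = -1)%R -> exists K c, (0 < c)%R /\ forall t, (e * t <= 0)%R ->
    (Cmod (laplace_line t) <= K * exp (- (c * sqrt (Rabs t + 1))))%R).
  { intros e He.
    assert (Ha : (Rabs (Im w - e * ph) < PI / 2)%R).
    { assert (Rabs (e * ph) = ph)%R.
      { destruct He; subst e; unfold ph; [rewrite Rmult_1_l, Rabs_pos_eq; lra|].
        rewrite Rabs_left; unfold ph; lra. }
      apply Rle_lt_trans with (Rabs (Im w) + Rabs (e * ph))%R.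
      - unfold Rminus. rewrite <- (Rabs_Ropp (e * ph)). apply Rabs_triang.
      - rewrite H. unfold ph. lra. }
    assert (Pr : (0 < 4 * (exp (Re w) * cos (Im w - e * ph)) * sin ph)%R).
    { apply Rmult_lt_0_compat; [|apply sin_gt_0; unfold ph; lra].
      apply Rmult_lt_0_compat; [lra|]. apply Rmult_lt_0_compat; [apply exp_pos|].
      apply Rabs_def2 in Ha. apply cos_gt_0; lra. }
    set (rho := sqrt (4 * (exp (Re w) * cos (Im w - e * ph)) * sin ph)).
    assert (Pro : (0 < rho)%R) by (apply sqrt_lt_R0; auto).
    destruct (J_ray_bound w e ph rho (1 / 2) (3 / 4 + A) 0 He) as [K HK]; try lra.
    - unfold ph; lra.
    - split.
      + rewrite Rabs_Ropp. destruct He; subst e; unfold ph; [rewrite Rmult_1_l, Rabs_pos_eq; lra|].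
        rewrite Rabs_left; unfold ph; lra.
      + replace (Im w + - (e * ph))%R with (Im w - e * ph)%R by ring. auto.
    - apply right_half_strip, Q.
    - right. apply sqrt_sqrt. lra.
    - exists K, (1 / 2 * rho)%R. split; [lra|]. intros t Ht.
      assert (H := HK (RtoC (3 / 4) + (A, t))). unfold TT in H.
      replace (Im (RtoC (3 / 4) + (A, t))) with t in H by (simpl; ring).
      replace (RtoC (3 / 4) + (A, t) + INR 0) with (RtoC (3 / 4) + (A, t)) in H by (apply C_eq; simpl; ring).
      replace (RtoC (3 / 2) - (RtoC (3 / 4) + (A, t))) with (RtoC (3 / 4) - (A, t)) in H by (apply C_eq; simpl; field).
      replace ((1 - 1 / 2) * rho)%R with (1 / 2 * rho)%R in H by field. apply H; [simpl; lra | auto]. }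
  assert (Hd : forall e, (e = 1 \/ e = -1)%R -> exists M, forall t, (e * t <= 0)%R ->
    ((1 + Rabs t) * Cmod (laplace_line t) <= M / (1 + t * t))%R).
  { intros e He. destruct (Hb e He) as [K [c [Pc H]]]. destruct (exp_sqrt_decay c Pc) as [K2 [_ H2]].
    exists (Rabs K * K2)%R. intros t Ht. specialize (H t Ht). specialize (H2 t). assert (P := Rabs_pos t).
    set (E := exp (- (c * sqrt (Rabs t + 1)))) in *. assert (PE : (0 < E)%R) by apply exp_pos.
    apply Rle_trans with ((1 + Rabs t) * (Rabs K * E))%R.
    - apply Rmult_le_compat_l; [lra|]. eapply Rle_trans; [exact H|]. apply Rmult_le_compat_r; [lra | apply Rle_abs].
    - unfold Rdiv. rewrite Rmult_assoc. replace ((1 + Rabs t) * (Rabs K * E))%R with (Rabs K * ((1 + Rabs t) * E))%R by ring.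
      apply Rmult_le_compat_l; [apply Rabs_pos | exact H2]. }
  destruct (Hd 1%R ltac:(lra)) as [M1 H1]. destruct (Hd (-1)%R ltac:(lra)) as [M2 H2].
  exists (Rmax M1 M2). intros t. assert (P := one_plus_sqr_pos t).
  destruct (Rle_dec 0 t) as [O|O].
  - eapply Rle_trans; [apply H2; lra|]. apply Rmult_le_compat_r; [left; apply Rinv_0_lt_compat; auto | apply Rmax_r].
  - eapply Rle_trans; [apply H1; lra|]. apply Rmult_le_compat_r; [left; apply Rinv_0_lt_compat; auto | apply Rmax_l].
Qed.

End Nice.

Lemma right_half_sum w1 w2 : right_half w1 -> right_half w2 ->
  let Z := Cexp w1 + Cexp w2 in (0 < Re Z)%R /\ right_half (Clog Z) /\ Cexp (Clog Z) = Z.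
Proof.
  intros Q1 Q2 Z. unfold right_half in *. apply Rabs_def2 in Q1, Q2.
  assert (P : (0 < Re Z)%R).
  { unfold Z, Cexp, Re; simpl.
    assert (0 < cos (Im w1))%R by (apply cos_gt_0; lra). assert (0 < cos (Im w2))%R by (apply cos_gt_0; lra).
    generalize (exp_pos (fst w1)) (exp_pos (fst w2)). intros. apply Rplus_lt_0_compat; apply Rmult_lt_0_compat; auto. }
  assert (S : slit Z) by (left; auto). assert (Pz := slit_pos Z S).
  split; auto. split; [|apply Cexp_Clog, slit_neq_0, S].
  change (Im (Clog Z)) with (Carg Z). rewrite Carg_atan by auto.
  assert (I := im_le_Cmod Z).
  assert (N : (Cmod Z * Cmod Z = Re Z * Re Z + Im Z * Im Z)%R) by apply Cmod_sqr.
  assert (H : (Rabs (Im Z / (Cmod Z + Re Z)) < 1)%R).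
  { unfold Rdiv. rewrite Rabs_mult, (Rabs_pos_eq (/ _)) by (left; apply Rinv_0_lt_compat; auto).
    apply Rmult_lt_reg_r with (Cmod Z + Re Z)%R; auto. rewrite Rmult_assoc, Rinv_l, Rmult_1_r by lra. lra. }
  apply Rabs_def2 in H. destruct H as [H1 H2]. apply atan_increasing in H1, H2.
  rewrite atan_opp, atan_1 in H2. rewrite atan_1 in H1. apply Rabs_def1; lra.
Qed.

(** Both factors of the integrand are Fourier transforms in [X], so Parseval's relation turns the
    integral into a single Laplace integral: the exponents [xi^2 / 2] and [eta^2 / 2] add up, and
    the powers combine to those of [J (3/2) (3/2)]. *)
Lemma integral_sector (A : R) (om1 om2 : C) : (- (3 / 4) < A < 3 / 4)%R ->
  (Rabs (Im om1) < PI / 4)%R -> (Rabs (Im om2) < PI / 4)%R ->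
  let xi := Cexp om1 in let eta := Cexp om2 in let W := Clog ((xi * xi + eta * eta) / 2) in
  CI (fun t : R => integrand (A, t) xi eta) =
  RtoC (2 * PI) * (Cexp (- (xi * xi + eta * eta) / 4) * (xi * eta) * RtoC (exp (- (3 / 2 * ln 2))) *
    J (RtoC (3 / 2)) (RtoC (3 / 2)) W) /\
  right_half W /\ Cexp W = (xi * xi + eta * eta) / 2 /\ (0 < Re ((xi * xi + eta * eta) / 2))%R.
Proof.
  intros HA H1 H2 xi eta W. set (w1 := 2 * om1 - ln 2). set (w2 := 2 * om2 - ln 2). assert (Pp := PI_RGT_0).
  assert (Q : forall om : C, (Rabs (Im om) < PI / 4)%R -> right_half (2 * om - ln 2)).
  { intros om H. unfold right_half. apply Rabs_def2 in H.
    replace (Im (2 * om - ln 2)) with (2 * Im om)%R by (unfold Im; simpl; ring). apply Rabs_def1; lra. }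
  assert (Q1 := Q om1 H1). assert (Q2 := Q om2 H2). fold w1 in Q1. fold w2 in Q2.
  assert (Ew : forall om : C, Cexp (2 * om - ln 2) = Cexp om * Cexp om / 2).
  { intros om. replace (2 * om - ln 2) with (om + om - ln 2) by ring.
    rewrite Cexp_minus, Cexp_plus. replace (Cexp (ln 2)) with (RtoC 2); auto.
    rewrite Cexp_RtoC, exp_ln by lra. auto. }
  assert (EZ : (xi * xi + eta * eta) / 2 = Cexp w1 + Cexp w2).
  { unfold w1, w2. rewrite !Ew. fold xi eta. field. }
  destruct (right_half_sum w1 w2 Q1 Q2) as [PZ [QW EW]]. rewrite <- EZ in PZ, QW, EW. fold W in QW, EW.
  split; [|auto].
  set (G := Cexp (- (xi * xi + eta * eta) / 4) * (xi * eta) * RtoC (exp (- (3 / 2 * ln 2)))).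
  assert (E : forall t, integrand (A, t) xi eta = G * (laplace_line (- A) w1 (- t) * laplace_line A w2 t)).
  { intros t. unfold integrand.
    destruct (GP_ray (RtoC (3 / 4) - (A, t)) om1 ltac:(simpl; lra) ltac:(lra)) as [E1 _].
    destruct (GP_ray (RtoC (3 / 4) + (A, t)) om2 ltac:(simpl; lra) ltac:(lra)) as [E2 _].
    fold xi in E1. fold eta in E2. fold w1 in E1. fold w2 in E2. rewrite E1, E2. clear E1 E2.
    unfold laplace_line.
    replace (RtoC (3 / 4) + (- A, - t)%R) with (RtoC (3 / 4) - (A, t)) by (apply C_eq; simpl; ring).
    replace (RtoC (3 / 4) - (- A, - t)%R) with (RtoC (3 / 4) + (A, t)) by (apply C_eq; simpl; ring).
    replace (RtoC (3 / 2) - (RtoC (3 / 4) - (A, t))) with (RtoC (3 / 4) + (A, t)) by (apply C_eq; simpl; field).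
    replace (RtoC (3 / 2) - (RtoC (3 / 4) + (A, t))) with (RtoC (3 / 4) - (A, t)) by (apply C_eq; simpl; field).
    set (j1 := J _ _ w1). set (j2 := J _ _ w2).
    assert (EG : G = Cexp (- (xi * xi) / 4) * Cexp ((RtoC (1 / 2) - (RtoC (3 / 4) - (A, t))) * ln 2) * Cexp (w1 / 2) *
      (Cexp (- (eta * eta) / 4) * Cexp ((RtoC (1 / 2) - (RtoC (3 / 4) + (A, t))) * ln 2) * Cexp (w2 / 2))).
    { unfold G. rewrite <- Cexp_RtoC. unfold xi at 3, eta at 3. rewrite <- !Cexp_plus.
      f_equal. unfold w1, w2. generalize (ln 2). intros l.
      generalize (xi * xi) (eta * eta). intros x y. apply C_eq; unfold Re, Im; simpl; field. }
    rewrite EG. ring. }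
  rewrite (CI_ext _ _ E).
  destruct (laplace_line_decay A w2 HA Q2) as [M HM].
  assert (HA' : (- (3 / 4) < - A < 3 / 4)%R) by lra.
  assert (I1 : intg (laplace_form (- A) w1)) by (apply J_real_intg; auto; simpl; lra).
  assert (I2 : intg (laplace_form A w2)) by (apply J_real_intg; auto; simpl; lra).
  assert (Par := parseval (laplace_form (- A) w1) (laplace_form A w2) M I1 I2 (laplace_form_lipX A w2 HA Q2)).
  cbv beta zeta in Par.
  assert (EB : forall t : R, CI (fun v => Cexp (- (Ci * (t * Xv v))) * laplace_form A w2 v) = laplace_line A w2 t)
    by (intros; symmetry; apply laplace_line_fourier; auto).
  assert (EA : forall t : R, CI (fun v => Cexp (Ci * (t * Xv v)) * laplace_form (- A) w1 v) = laplace_line (- A) w1 (- t)).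
  { intros t. rewrite laplace_line_fourier by auto. apply CI_ext. intros v. f_equal. f_equal. rewrite RtoC_opp. ring. }
  assert (Par2 : CI (fun t => laplace_line (- A) w1 (- t) * laplace_line A w2 t) =
    CI (fun v => RtoC (2 * PI) * (laplace_form (- A) w1 v * (laplace_form A w2 v / kx v)))).
  { rewrite <- Par.
    - apply CI_ext. intros t. rewrite EA, EB. auto.
    - intros t. rewrite EB. apply HM.
    - intros t. apply ccts_ext with (1 := fun t => eq_sym (EB t)). apply laplace_line_ccts; auto. }
  assert (EJ : forall v : R, Cexp (- (Cexp W * exp v)) * hJ (RtoC (3 / 2)) (RtoC (3 / 2)) (v, 0%R) =
    laplace_form (- A) w1 v * (laplace_form A w2 v / kx v)).
  { intros v. symmetry. unfold laplace_form. rewrite !hJ_real, EW, EZ.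
    unfold Cdiv. rewrite <- RtoC_inv by (generalize (kx_pos v); lra).
    replace (RtoC (/ kx v)) with (Cexp (RtoC (v + Xv v))).
    + rewrite <- !Cexp_plus. f_equal. generalize (Cexp w1) (Cexp w2) (exp v) (Xv v). intros x y e X.
      apply C_eq; unfold Re, Im; simpl; field.
    + rewrite Cexp_RtoC. f_equal. unfold Xv. replace (v + (lg v - v))%R with (lg v) by ring.
      rewrite exp_lg. unfold kx, sg. assert (P := exp_pos v). field. lra. }
  assert (IJ := intg_ext _ _ EJ (J_real_intg (RtoC (3 / 2)) (RtoC (3 / 2)) W ltac:(simpl; lra) QW)).
  destruct (laplace_line_decay (- A) w1 HA' Q1) as [M1 HM1].
  rewrite CI_scal.
  - rewrite Par2, CI_scal by exact IJ. rewrite J_real by (auto; simpl; lra).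
    rewrite (CI_ext _ _ EJ). ring.
  - split.
    + intros t. apply ccts_mult; [|apply laplace_line_ccts; auto].
      destruct (laplace_line_ccts (- A) w1 HA' Q1 (- t)%R) as [C1 C2].
      split; [apply (continuous_comp (fun t : R => (- t)%R) (fun t => Re (laplace_line (- A) w1 t)))
             |apply (continuous_comp (fun t : R => (- t)%R) (fun t => Im (laplace_line (- A) w1 t)))]; auto;
      apply (continuous_opp (V := R_NormedModule)), continuous_id.
    + exists (M1 * M)%R. intros t. rewrite Cmod_mult.
      specialize (HM t). specialize (HM1 (- t)%R). replace (- t * - t)%R with (t * t)%R in HM1 by ring. rewrite Rabs_Ropp in HM1.
      set (y1 := Cmod (laplace_line (- A) w1 (- t))) in *. set (y2 := Cmod (laplace_line A w2 t)) in *.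
      assert (P1 : (0 <= y1)%R) by apply Cmod_ge_0. assert (P2 : (0 <= y2)%R) by apply Cmod_ge_0.
      assert (P := Rabs_pos t). assert (Pq := one_plus_sqr_pos t).
      assert (L1 : (y1 <= M1)%R).
      { apply Rle_trans with ((1 + Rabs t) * y1)%R; [nra|]. eapply Rle_trans; [exact HM1|].
        assert (P3 : (0 <= M1 / (1 + t * t))%R) by (eapply Rle_trans; [|exact HM1]; nra).
        apply Rle_trans with (M1 / (1 + t * t) * (1 + t * t))%R; [nra | right; field; lra]. }
      unfold Rdiv. rewrite Rmult_assoc. apply Rmult_le_compat; auto. eapply Rle_trans; [|exact HM]. nra.
Qed.

(** * Power series and the identity theorem *)

Definition circ (t : R) : C := Cexp (t * Ci).
Definition circ' (t : R) : C := Cexp (- (t * Ci)).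

Lemma circ_RD t : RD circ t (Ci * circ t).
Proof. apply Cexp_line. Qed.

Lemma circ_inv t : circ t * circ' t = 1.
Proof. unfold circ, circ'. rewrite <- Cexp_plus. replace (t * Ci + - (t * Ci)) with (RtoC 0) by ring. apply Cexp_0. Qed.

Lemma circ'_RD t : RD circ' t (- Ci * circ' t).
Proof.
  unfold circ'. eapply RD_ext; [|eapply RD_eq; [apply (Cexp_line (- Ci))|]]; [intros; simpl; f_equal; ring|].
  simpl. f_equal. f_equal. ring.
Qed.

Lemma Cmod_circ t : Cmod (circ t) = 1%R.
Proof. unfold circ. rewrite Cmod_Cexp. replace (Re (t * Ci)) with 0%R by (unfold Re; simpl; ring). apply exp_0. Qed.

Lemma Cmod_circ' t : Cmod (circ' t) = 1%R.
Proof. unfold circ'. rewrite Cmod_Cexp. replace (Re (- (t * Ci))) with 0%R by (unfold Re; simpl; ring). apply exp_0. Qed.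

Lemma circ_period : circ (2 * PI) = circ 0 /\ circ' (2 * PI) = circ' 0.
Proof.
  split; unfold circ, circ', Cexp, Re, Im; simpl; f_equal;
  rewrite ?Rmult_0_l, ?Rmult_0_r, ?Rmult_1_r, ?Rplus_0_l, ?Rminus_0_r, ?Rplus_0_r, ?Ropp_0, ?cos_neg, ?sin_neg, ?cos_2PI, ?sin_2PI, ?cos_0, ?sin_0; ring.
Qed.

Lemma circ_ccts t : ccts circ t. Proof. eapply RD_ccts, circ_RD. Qed.
Lemma circ'_ccts t : ccts circ' t. Proof. eapply RD_ccts, circ'_RD. Qed.

Definition cker (x : C) (t : R) : C := / (1 - x * circ' t).

Lemma cker_lower (x : C) t : (Cmod x <= 1 / 2)%R -> (1 / 2 <= Re (1 - x * circ' t))%R.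
Proof.
  intros Hx. assert (A := re_le_Cmod (x * circ' t)). rewrite Cmod_mult, Cmod_circ', Rmult_1_r in A.
  apply Rabs_le_between in A. replace (Re (1 - x * circ' t)) with (1 - Re (x * circ' t))%R by (unfold Re; simpl; ring). lra.
Qed.

Lemma cker_neq_0 (x : C) t : (Cmod x <= 1 / 2)%R -> 1 - x * circ' t <> 0.
Proof. intros Hx Z. assert (A := cker_lower x t Hx). rewrite Z in A. simpl in A. lra. Qed.

Lemma Cmod_cker (x : C) t : (Cmod x <= 1 / 2)%R -> (Cmod (cker x t) <= 2)%R.
Proof.
  intros Hx. unfold cker. rewrite Cmod_inv by (apply cker_neq_0; auto).
  rewrite <- (Rinv_inv 2). apply Rinv_le_contravar; [lra|].
  assert (A := cker_lower x t Hx). assert (B := re_le_Cmod (1 - x * circ' t)).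
  apply Rabs_le_between in B. lra.
Qed.

Lemma cker_ccts (x : C) t : (Cmod x <= 1 / 2)%R -> ccts (cker x) t.
Proof.
  intros Hx. unfold cker. eapply (ccts_comp (fun z => / z)); [apply CD_inv, cker_neq_0; auto|].
  apply ccts_minus; [apply ccts_const | apply ccts_mult; [apply ccts_const | apply circ'_ccts]].
Qed.

(** The kernel minus one has the primitive [-i log (1 - x e^(-it))], single valued because the
    logarithm stays in the right half plane. *)
Lemma cker_mass (x : C) : (Cmod x <= 1 / 2)%R -> CInt (cker x) 0 (2 * PI) = RtoC (2 * PI).
Proof.
  intros Hx. rewrite (CInt_FTC (fun t => RtoC t + - Ci * Clog (1 - x * circ' t))).
  - rewrite (proj2 circ_period). Cring.
  - intros t _. eapply RD_eq.
    + apply RD_plus; [apply RD_RtoC, is_derive_Reals, derivable_pt_lim_id|].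
      apply RD_scal. eapply RD_comp; [apply CD_Clog|].
      * left. generalize (cker_lower x t Hx). lra.
      * apply RD_minus; [apply RD_const | apply RD_scal, circ'_RD].
    + unfold cker. assert (N := cker_neq_0 x t Hx).
      replace (RtoC 1) with (/ (1 - x * circ' t) * (1 - x * circ' t)) at 1 by (field; auto).
      replace (- Ci * (/ (1 - x * circ' t) * (0 - x * (- Ci * circ' t)))) with (/ (1 - x * circ' t) * (- (Ci * Ci) * (x * circ' t))) by ring.
      replace (- (Ci * Ci)) with (RtoC 1) by (apply C_eq; simpl; ring). ring.
  - intros t. apply cker_ccts; auto.
Qed.

Section Cauchy.
Variables (f f' : C -> C) (z0 : C) (R0 rho : R).
Hypotheses (Hrho : (0 < rho < R0)%R)
  (D : forall z, (Cmod (z - z0) < R0)%R -> CD f z (f' z))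
  (D' : forall z, (Cmod (z - z0) < R0)%R -> @ccts C_UniformSpace f' z).

(** Contracting the circle to the point [h]: the derivative of the contracted integral is the
    integral of a total derivative around the circle. *)
Lemma cauchy_formula (h : C) : (Cmod h <= rho / 2)%R ->
  CInt (fun t => f (z0 + rho * circ t) * cker (h / rho) t) 0 (2 * PI) = f (z0 + h) * RtoC (2 * PI).
Proof using Hrho D D'.
  intros Hh. assert (Nr : RtoC rho <> 0) by (intros Z; apply RtoC_inj in Z; lra).
  assert (Hx : (Cmod (h / rho) <= 1 / 2)%R).
  { rewrite Cmod_div, Cmod_R, Rabs_pos_eq by (auto; lra).
    apply Rmult_le_reg_r with rho; [lra|]. replace (Cmod h / rho * rho)%R with (Cmod h) by (field; lra). lra. }
  (* [p s] contracts the circle ([s = 1]) to the point [z0 + h] ([s = 0]); [cl] keeps it in the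
     disc for all real [s] *)
  set (p := fun (s t : R) => z0 + (h + s * (rho * circ t - h))).
  set (cl := clamp 0 1). assert (Hcl : forall s, (0 <= cl s <= 1)%R) by (intros; apply clamp_in; lra).
  assert (Hp : forall s t, (0 <= s <= 1)%R -> (Cmod (p s t - z0) < R0)%R).
  { intros s t Hs. replace (p s t - z0) with (RtoC (1 - s) * h + RtoC s * (rho * circ t)) by (unfold p; rewrite RtoC_minus; ring).
    eapply Rle_lt_trans; [apply Cmod_triangle|]. rewrite !Cmod_mult, Cmod_circ, !Cmod_R, !Rabs_pos_eq by lra. nra. }
  assert (cp : forall s t, ccts2 (fun s t => p (cl s) t) s t).
  { intros s t. unfold p. apply ccts_plus; [apply ccts_const|]. apply ccts_plus; [apply ccts_const|].
    apply ccts_mult; [apply (ccts2_fst (fun s => RtoC (cl s))), ccts_RtoC, continuous_clamp|].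
    apply ccts_minus; [|apply ccts_const]. apply (ccts2_snd (fun t => rho * circ t)).
    apply ccts_mult; [apply ccts_const | apply circ_ccts]. }
  assert (cf : forall s t, ccts2 (fun s t => f' (p (cl s) t)) s t).
  { intros s t. apply (ccts_comp_C f' (fun q : R * R => p (cl (fst q)) (snd q))); [apply D', Hp, Hcl | apply cp]. }
  assert (cE : forall t, ccts (fun t => rho * circ t) t) by (intros; apply ccts_mult; [apply ccts_const | apply circ_ccts]).
  set (G := fun s t : R => f' (p (cl s) t) * (rho * circ t)).
  assert (cG : forall s t, ccts2 G s t) by (intros; apply ccts_mult; [apply cf | apply (ccts2_snd _ _ _ (cE t))]).
  assert (cG' : forall t s, ccts2 (fun t s => G s t) t s).
  { intros t s. apply ccts_mult; [|apply (ccts2_fst (fun t => rho * circ t)), cE].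
    apply (ccts_comp_C f' (fun q : R * R => p (cl (snd q)) (fst q))); [apply D', Hp, Hcl|].
    unfold p. apply ccts_plus; [apply ccts_const|]. apply ccts_plus; [apply ccts_const|].
    apply ccts_mult; [apply (ccts2_snd (fun s => RtoC (cl s))), ccts_RtoC, continuous_clamp|].
    apply ccts_minus; [|apply ccts_const]. apply (ccts2_fst (fun t => rho * circ t)), cE. }
  assert (S1 : forall t, f (z0 + rho * circ t) - f (z0 + h) = CInt (fun s => f' (p (cl s) t) * (rho * circ t - h)) 0 1).
  { intros t. rewrite (CInt_FTC (fun s => f (p s t))).
    - f_equal; [|f_equal]; f_equal; unfold p; ring.
    - intros s Hs. rewrite Rmin_left, Rmax_right in Hs by lra. unfold cl. rewrite clamp_id by lra.
      eapply RD_ext; [|apply (CD_RD_line f (z0 + h) (rho * circ t - h) s)].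
      + intros; simpl. f_equal. unfold p. ring.
      + replace (z0 + h + s * (rho * circ t - h)) with (p s t) by (unfold p; ring). apply D, Hp; lra.
    - intros s. apply ccts_mult; [apply (ccts2_slice' (fun s t => f' (p (cl s) t))), cf | apply ccts_const]. }
  assert (S2 : forall s, CInt (fun t => G s t) 0 (2 * PI) = RtoC 0).
  { intros s. unfold G. specialize (Hcl s). set (S := cl s) in *.
    assert (Ni : Ci <> 0) by (intros Z; apply (f_equal Im) in Z; simpl in Z; lra).
    destruct (Req_dec S 0) as [Z|Z].
    - assert (E : forall t, p S t = z0 + h) by (intros; unfold p; rewrite Z; ring).
      rewrite (CInt_FTC (fun t => f' (z0 + h) * (rho / Ci) * circ t)).
      + rewrite (proj1 circ_period). Cring.
      + intros t _. eapply RD_eq; [apply RD_scal, circ_RD|]. cbv beta. rewrite E. field. auto.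
      + intros t. apply (ccts2_slice G). apply cG.
    - assert (NS : RtoC S <> 0) by (intros Y; apply RtoC_inj in Y; lra).
      rewrite (CInt_FTC (fun t => / (S * Ci) * f (p S t))).
      + unfold p. rewrite (proj1 circ_period). Cring.
      + intros t _. eapply RD_eq.
        * apply RD_scal. eapply (RD_comp f (p S)); [apply D, Hp; lra|].
          unfold p. apply RD_plus; [apply RD_const|]. apply RD_plus; [apply RD_const|].
          apply RD_scal, RD_minus; [apply RD_scal, circ_RD | apply RD_const].
        * cbv beta. field. auto.
      + intros t. apply (ccts2_slice G). apply cG. }
  assert (ck : forall t, ccts (cker (h / rho)) t) by (intros; apply cker_ccts; auto).
  assert (cff : forall t, ccts (fun t => f (z0 + rho * circ t)) t).
  { intros t. eapply (ccts_comp f (fun t => z0 + rho * circ t)).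
    - apply D. replace (z0 + rho * circ t - z0) with (rho * circ t) by ring.
      rewrite Cmod_mult, Cmod_circ, Cmod_R, Rabs_pos_eq; lra.
    - apply ccts_plus; [apply ccts_const | apply cE]. }
  rewrite <- (cker_mass (h / rho) Hx), <- CInt_scal by auto.
  rewrite (CInt_ext _ (fun t => f (z0 + h) * cker (h / rho) t + CInt (fun s => G s t) 0 1)).
  - rewrite CInt_plus.
    + rewrite (CInt_Fubini (fun t s => G s t)).
      * rewrite (CInt_ext _ (fun _ => 0) 0 1) by exact S2.
        replace (CInt (fun _ => RtoC 0) 0 1) with (RtoC 0); [Cring|].
        symmetry. rewrite (CInt_FTC (fun _ => 0)); [Cring | intros; apply RD_const | intros; apply ccts_const].
      * exact cG'.
    + intros t. apply ccts_mult; [apply ccts_const | auto].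
    + intros t. apply (ccts_CInt_param (fun t s => G s t)), cG'.
  - intros t. unfold G.
    replace (f (z0 + rho * circ t)) with (f (z0 + rho * circ t) - f (z0 + h) + f (z0 + h)) by ring.
    rewrite S1, Cmult_plus_distr_r, Cplus_comm. f_equal. rewrite Cmult_comm, <- CInt_scal.
    + apply CInt_ext. intros s. unfold cker.
      replace (rho * circ t - h) with (rho * circ t * (1 - h / rho * circ' t)).
      * generalize (cker_neq_0 (h / rho) t Hx). generalize (1 - h / rho * circ' t). intros y Hy. field. auto.
      * replace (rho * circ t * (1 - h / rho * circ' t)) with (rho * circ t - h * (circ t * circ' t)) by (field; auto).
        rewrite circ_inv. ring.
    + intros s. apply ccts_mult; [apply (ccts2_slice' (fun s t => f' (p (cl s) t))), cf | apply ccts_const].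
Qed.
End Cauchy.

Fixpoint psum (c : nat -> C) (h : C) (N : nat) : C :=
  match N with O => 0 | S n => psum c h n + c n * h ^ n end.

Lemma psum_zero (c : nat -> C) (h : C) (N : nat) : (forall m, (m < N)%nat -> c m = 0) -> psum c h N = 0.
Proof.
  induction N as [|N IH]; intros H; simpl; auto.
  rewrite IH, H by (intros; auto with arith). ring.
Qed.

(** Power expansion with a geometric remainder at distance up to [rho / 2]. This form passes to
    integrals over a parameter, coefficient by coefficient. *)
Definition taylor (f : C -> C) (z0 : C) (c : nat -> C) (K rho : R) : Prop :=
  forall (N : nat) (h : C), (Cmod h <= rho / 2)%R ->
    (Cmod (f (z0 + h) - psum c h N)%C <= K * (Cmod h / rho) ^ N)%R.

(** Cauchy's formula and the geometric expansion of the kernel. *)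
Lemma taylor_of_CD (f f' : C -> C) (z0 : C) (R0 rho M : R) : (0 < rho < R0)%R ->
  (forall z, (Cmod (z - z0) < R0)%R -> CD f z (f' z)) ->
  (forall z, (Cmod (z - z0) < R0)%R -> @ccts C_UniformSpace f' z) ->
  (forall z, (Cmod (z - z0) < R0)%R -> (Cmod (f z) <= M)%R) ->
  exists c, taylor f z0 c (2 * M) rho.
Proof.
  intros Hrho D D' B. assert (Pp := PI_RGT_0).
  assert (Nr : RtoC rho <> 0) by (intros Z; apply RtoC_inj in Z; lra).
  assert (Np : RtoC (2 * PI) <> 0) by (intros Z; apply RtoC_inj in Z; lra).
  assert (hd : forall t, (Cmod (z0 + rho * circ t - z0) < R0)%R).
  { intros t. replace (z0 + rho * circ t - z0) with (rho * circ t) by ring.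
    rewrite Cmod_mult, Cmod_circ, Cmod_R, Rabs_pos_eq; lra. }
  set (F := fun t => f (z0 + rho * circ t)).
  assert (cF : forall t, ccts F t).
  { intros t. eapply (ccts_comp f (fun t => z0 + rho * circ t)); [apply D, hd|].
    apply ccts_plus; [apply ccts_const | apply ccts_mult; [apply ccts_const | apply circ_ccts]]. }
  assert (cc : forall (x : C) n t, ccts (fun t => (x * circ' t) ^ n) t).
  { intros x n t. induction n as [|n IH]; [apply ccts_const|].
    apply ccts_mult; [|exact IH]. apply ccts_mult; [apply ccts_const | apply circ'_ccts]. }
  exists (fun n => / RtoC (2 * PI) * CInt (fun t => F t * (/ rho * circ' t) ^ n) 0 (2 * PI)).
  intros N h Hh. set (c := fun n : nat => _).
  assert (Hx : (Cmod (h / rho) <= 1 / 2)%R).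
  { rewrite Cmod_div, Cmod_R, Rabs_pos_eq by (auto; lra).
    apply Rmult_le_reg_r with rho; [lra|]. replace (Cmod h / rho * rho)%R with (Cmod h) by (field; lra). lra. }
  set (x := h / rho) in *.
  assert (ck : forall n t, ccts (fun t => F t * ((x * circ' t) ^ n * cker x t)) t).
  { intros n t. apply ccts_mult; [apply cF|]. apply ccts_mult; [apply cc | apply cker_ccts; auto]. }
  assert (E : RtoC (2 * PI) * (f (z0 + h) - psum c h N) = CInt (fun t => F t * ((x * circ' t) ^ N * cker x t)) 0 (2 * PI)).
  { induction N as [|N IH].
    - rewrite (CInt_ext _ (fun t => f (z0 + rho * circ t) * cker x t)) by (intros; unfold F; simpl; ring).
      unfold x. rewrite (cauchy_formula f f' z0 R0 rho Hrho D D' h Hh). simpl. ring.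
    - simpl psum. replace (RtoC (2 * PI) * (f (z0 + h) - (psum c h N + c N * h ^ N))) with
        (RtoC (2 * PI) * (f (z0 + h) - psum c h N) + - (RtoC (2 * PI) * c N) * h ^ N) by ring.
      rewrite IH. unfold c. rewrite Cmult_assoc, Cinv_r, Cmult_1_l by auto.
      rewrite (CInt_ext _ (fun t => h ^ N * (F t * (/ rho * circ' t) ^ N) + F t * ((x * circ' t) ^ S N * cker x t))).
      + rewrite CInt_plus, CInt_scal; [Cring | | | apply ck].
        * intros t. apply ccts_mult; [apply cF | apply cc].
        * intros t. apply ccts_mult; [apply ccts_const|]. apply ccts_mult; [apply cF | apply cc].
      + intros t. replace (h ^ N * (F t * (/ rho * circ' t) ^ N)) with (F t * (x * circ' t) ^ N).
        * rewrite Cpow_S. unfold cker. generalize (cker_neq_0 x t Hx).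
          set (y := x * circ' t). intros Ny. field. auto.
        * unfold x, Cdiv. rewrite !Cpow_mult_l. ring. }
  apply Rmult_le_reg_l with (Cmod (RtoC (2 * PI))); [apply (proj1 (Cmod_gt_0 _)); auto|].
  rewrite <- Cmod_mult, E, Cmod_R, Rabs_pos_eq by lra.
  assert (PM : (0 <= M)%R) by (eapply Rle_trans; [apply Cmod_ge_0 | apply (B z0)]; replace (z0 - z0) with (RtoC 0) by ring; rewrite Cmod_0; lra).
  replace (2 * PI * (2 * M * (Cmod h / rho) ^ N))%R with ((2 * PI - 0) * (M * (((Cmod h / rho)) ^ N * 2)))%R by ring.
  apply CInt_bound_const; [lra | apply ck|]. intros t _.
  rewrite !Cmod_mult. apply Rmult_le_compat; [apply Cmod_ge_0 | | apply B, hd|].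
  { apply Rmult_le_pos; apply Cmod_ge_0. }
  apply Rmult_le_compat; [apply Cmod_ge_0 | apply Cmod_ge_0 | | apply Cmod_cker; auto].
  right. rewrite Cmod_pow, Cmod_mult, Cmod_circ'. unfold x. rewrite Cmod_div, Cmod_R, Rabs_pos_eq by (auto; lra).
  f_equal. ring.
Qed.

Lemma taylor_minus f g z0 c d K L r1 r2 : (0 < r1)%R -> (0 < r2)%R -> (0 <= K)%R -> (0 <= L)%R ->
  taylor f z0 c K r1 -> taylor g z0 d L r2 ->
  taylor (fun z => f z - g z) z0 (fun n => c n - d n) (K + L) (Rmin r1 r2).
Proof.
  intros P1 P2 PK PL T1 T2 N h Hh.
  assert (P : (0 < Rmin r1 r2)%R) by (apply Rmin_glb_lt; auto).
  assert (E : psum (fun n => c n - d n) h N = psum c h N - psum d h N).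
  { clear. induction N as [|N IH]; simpl; [ring | rewrite IH; ring]. }
  rewrite E. replace (f (z0 + h) - g (z0 + h) - (psum c h N - psum d h N)) with
    ((f (z0 + h) - psum c h N) + - (g (z0 + h) - psum d h N)) by ring.
  eapply Rle_trans; [apply Cmod_triangle|]. rewrite Cmod_opp, Rmult_plus_distr_r.
  assert (Pw : forall r, (Rmin r1 r2 <= r)%R -> (0 <= Cmod h / r <= Cmod h / Rmin r1 r2)%R).
  { intros r Hr. assert (Q := Cmod_ge_0 h). assert (0 < / r)%R by (apply Rinv_0_lt_compat; lra). split.
    - apply Rmult_le_pos; lra.
    - apply Rmult_le_compat_l; auto. apply Rinv_le_contravar; auto. }
  apply Rplus_le_compat.
  - eapply Rle_trans; [apply T1; eapply Rle_trans; [exact Hh | apply Rmult_le_compat_r; [lra | apply Rmin_l]]|].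
    apply Rmult_le_compat_l; auto. apply pow_incr, Pw, Rmin_l.
  - eapply Rle_trans; [apply T2; eapply Rle_trans; [exact Hh | apply Rmult_le_compat_r; [lra | apply Rmin_r]]|].
    apply Rmult_le_compat_l; auto. apply pow_incr, Pw, Rmin_r.
Qed.

(** The [n]th coefficient is recovered from the values near the centre and the earlier ones. *)
Lemma taylor_step f z0 c K rho n h : (0 < rho)%R -> taylor f z0 c K rho -> (0 < Cmod h <= rho / 2)%R ->
  (Cmod (c n - (f (z0 + h) - psum c h n) / h ^ n)%C <= K / rho ^ S n * Cmod h)%R.
Proof.
  intros Hr T [Ph Hh]. assert (Nh : h <> 0) by (apply Cmod_gt_0; auto).
  assert (Nn : h ^ n <> 0) by (apply Cpow_nz; auto).
  replace (c n - (f (z0 + h) - psum c h n) / h ^ n) with (- (f (z0 + h) - psum c h (S n)) / h ^ n) by (simpl; field; auto).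
  rewrite Cmod_div, Cmod_opp, Cmod_pow by auto.
  assert (P : (0 < Cmod h ^ n)%R) by (apply pow_lt; auto).
  apply Rmult_le_reg_r with (Cmod h ^ n)%R; auto. unfold Rdiv at 1. rewrite Rmult_assoc, Rinv_l, Rmult_1_r by lra.
  eapply Rle_trans; [apply (T (S n) h Hh)|]. right. unfold Rdiv. rewrite Rpow_mult_distr, pow_inv. simpl. ring.
Qed.

Lemma le_zero_of_linear (a b rho : R) : (0 < rho)%R -> (0 <= b)%R ->
  (forall x, (0 < x < rho)%R -> (a <= b * x)%R) -> (a <= 0)%R.
Proof.
  intros Hr Hb H. apply le_epsilon. intros e He.
  assert (P : (0 < e / (b + 1))%R) by (apply Rdiv_lt_0_compat; lra).
  set (x := Rmin (rho / 2) (e / (b + 1))). assert (x0 : (0 < x)%R) by (apply Rmin_glb_lt; lra).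
  assert (X1 : (x <= rho / 2)%R) by apply Rmin_l. assert (X2 : (x <= e / (b + 1))%R) by apply Rmin_r.
  specialize (H x ltac:(lra)). apply Rmult_le_compat_l with (r := (b + 1)%R) in X2; [|lra].
  replace ((b + 1) * (e / (b + 1)))%R with e in X2 by (field; lra). nra.
Qed.

(** Zeros accumulating at the centre kill all the coefficients one after the other, by
    [taylor_step]. *)
Lemma taylor_zero f z0 c K rho dl (sg : R) : (0 < rho)%R -> (0 <= K)%R -> (0 < dl)%R -> (sg = 1 \/ sg = -1)%R ->
  taylor f z0 c K rho -> (forall y : R, (0 < y < dl)%R -> f (z0 + RtoC (sg * y)) = 0) ->
  forall h, (Cmod h < rho / 2)%R -> f (z0 + h) = 0.
Proof.
  intros Hr HK Hd Hs T Z.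
  assert (C0 : forall n m, (m < n)%nat -> c m = 0).
  { induction n as [|n IH]; intros m Hm; [lia|].
    destruct (Nat.eq_dec m n) as [->|Hne]; [|apply IH; lia].
    assert (P0 : forall h, psum c h n = 0).
    { intros h. apply psum_zero, IH. }
    apply Cmod_eq_0. apply Rle_antisym; [|apply Cmod_ge_0].
    apply (le_zero_of_linear _ (K / rho ^ S n) (Rmin dl (rho / 2))); [apply Rmin_glb_lt; lra | |].
    { apply Rmult_le_pos; auto. left; apply Rinv_0_lt_compat, pow_lt; auto. }
    intros y [y0 y1]. assert (y2 := Rlt_le_trans _ _ _ y1 (Rmin_l _ _)). assert (y3 := Rlt_le_trans _ _ _ y1 (Rmin_r _ _)).
    assert (Ey : Cmod (RtoC (sg * y)) = y).
    { rewrite Cmod_R. destruct Hs; subst sg; [rewrite Rabs_pos_eq; lra|]. rewrite Rabs_left; lra. }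
    assert (S := taylor_step f z0 c K rho n (RtoC (sg * y)) Hr T). rewrite Ey in S. specialize (S ltac:(lra)).
    rewrite P0, (Z y ltac:(lra)) in S. replace (c n - (0 - 0) / (sg * y)%R ^ n) with (c n) in S; auto.
    unfold Cdiv. ring. }
  intros h Hh. apply Cmod_eq_0. apply Rle_antisym; [|apply Cmod_ge_0].
  assert (P0 : forall N, psum c h N = 0).
  { intros N. apply psum_zero. intros m _. apply (C0 (S m)). lia. }
  assert (B : forall N, (Cmod (f (z0 + h)%C) <= K * (1 / 2) ^ N)%R).
  { intros N. assert (S := T N h ltac:(lra)). rewrite P0 in S. replace (f (z0 + h) - 0) with (f (z0 + h)) in S by ring.
    eapply Rle_trans; [exact S|]. apply Rmult_le_compat_l; auto. apply pow_incr. split.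
    - apply Rmult_le_pos; [apply Cmod_ge_0 | left; apply Rinv_0_lt_compat; auto].
    - apply Rmult_le_reg_r with rho; auto. replace (Cmod h / rho * rho)%R with (Cmod h) by (field; lra). lra. }
  apply le_epsilon. intros e He. rewrite Rplus_0_l.
  destruct (pow_lt_1_zero (1 / 2) ltac:(rewrite Rabs_pos_eq; lra) (e / (K + 1)) ltac:(apply Rdiv_lt_0_compat; lra)) as [N HN].
  specialize (HN N (le_n N)). apply Rabs_def2 in HN. destruct HN as [HN _].
  eapply Rle_trans; [apply (B N)|]. apply Rmult_lt_compat_l with (r := (K + 1)%R) in HN; [|lra].
  replace ((K + 1) * (e / (K + 1)))%R with e in HN by (field; lra).
  assert (0 <= (1 / 2) ^ N)%R by (apply pow_le; lra). nra.
Qed.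

(** The supremum of the [x] such that [f] vanishes on [[0, x]] is again a centre of expansion, so
    it cannot be less than [1]. *)
Lemma identity_unit_interval (f : C -> C) (dl : R) : (0 < dl)%R ->
  (forall x : R, (0 <= x <= 1)%R -> exists c K rho, (0 < rho)%R /\ (0 <= K)%R /\ taylor f x c K rho) ->
  (forall y : R, (0 <= y < dl)%R -> f y = 0) -> f 1 = 0.
Proof.
  intros Hd T Z. set (E := fun x => (0 <= x <= 1)%R /\ forall y : R, (0 <= y <= x)%R -> f y = 0).
  destruct (completeness E) as [s [Us Ls]].
  { exists 1%R. intros x [Hx _]. lra. }
  { exists 0%R. split; [lra|]. intros y Hy. apply Z. lra. }
  assert (s1 : (s <= 1)%R) by (apply Ls; intros x [Hx _]; lra).
  set (d0 := Rmin (dl / 2) 1).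
  assert (Hd0 : (0 < d0 <= dl / 2)%R /\ (d0 <= 1)%R) by (split; [split; [apply Rmin_glb_lt; lra | apply Rmin_l] | apply Rmin_r]).
  assert (sd : (d0 <= s)%R) by (apply Us; split; [lra | intros y Hy; apply Z; lra]).
  assert (Zs : forall y : R, (0 <= y < s)%R -> f y = 0).
  { intros y Hy. destruct (Classical_Prop.classic (exists x, E x /\ (y < x)%R)) as [[x [[_ Hx] H]]|H]; [apply Hx; lra|].
    exfalso. assert (s <= y)%R; [|lra]. apply Ls. intros x Hx. apply Rnot_lt_le. intros G. apply H. exists x; auto. }
  destruct (T s ltac:(lra)) as [c [K [rho [Pr [PK Tc]]]]].
  assert (F := taylor_zero f s c K rho s (-1) Pr PK ltac:(lra) (or_intror eq_refl) Tc).
  assert (F' : forall h : C, (Cmod h < rho / 2)%R -> f (s + h) = 0).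
  { apply F. intros y Hy. rewrite <- RtoC_plus. apply Zs. lra. }
  assert (G : forall y : R, (0 <= y < s + rho / 2)%R -> f y = 0).
  { intros y Hy. destruct (Rlt_dec y s) as [L|L]; [apply Zs; lra|].
    replace (RtoC y) with (s + RtoC (y - s)) by (rewrite RtoC_minus; ring). apply F'. rewrite Cmod_R, Rabs_pos_eq; lra. }
  destruct (Rlt_dec s 1) as [L|L]; [|apply G; lra].
  exfalso. set (x := Rmin 1 (s + rho / 4)). assert (X1 : (x <= 1)%R) by apply Rmin_l. assert (X2 : (x <= s + rho / 4)%R) by apply Rmin_r.
  assert (X3 : (s < x)%R) by (apply Rmin_glb_lt; lra).
  assert (x <= s)%R; [|lra]. apply Us. split; [lra|]. intros y Hy. apply G. lra.
Qed.

Section Param.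
Variables (F : R -> C -> C) (z0 : C) (c : R -> nat -> C) (K rho : R).
Hypotheses (Hr : (0 < rho)%R) (HK : (0 <= K)%R)
  (T : forall t, taylor (F t) z0 (c t) (K / (1 + t * t)) rho)
  (CF : forall h, (Cmod h <= rho / 2)%R -> forall t, ccts (fun t => F t (z0 + h)) t).

Lemma ccts_psum h n : (forall m, (m < n)%nat -> forall t, ccts (fun t => c t m) t) ->
  forall t, ccts (fun t => psum (c t) h n) t.
Proof using.
  induction n as [|n IH]; intros H t; simpl; [apply ccts_const|].
  apply ccts_plus; [apply IH; intros; apply H; lia|].
  apply ccts_mult; [apply (H n); lia | apply ccts_const].
Qed.

Lemma taylor_coef_err n h t : (0 < Cmod h <= rho / 2)%R ->
  (Cmod (c t n - (F t (z0 + h) - psum (c t) h n) / h ^ n)%C <= K / rho ^ S n * Cmod h / (1 + t * t))%R.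
Proof using Hr T.
  intros Hh. eapply Rle_trans; [apply (taylor_step (F t) z0 (c t) _ rho n h Hr (T t) Hh)|].
  right. unfold Rdiv. ring.
Qed.

Lemma div_one_plus_sqr_le t (k : R) : (0 <= k)%R -> (k / (1 + t * t) <= k)%R.
Proof using.
  intros H. apply Rmult_le_reg_r with (1 + t * t)%R; [apply one_plus_sqr_pos|].
  replace (k / (1 + t * t) * (1 + t * t))%R with k by (field; apply Rgt_not_eq, one_plus_sqr_pos). nra.
Qed.

(** Strong induction: by [taylor_coef_err] the coefficient is a uniform limit of functions
    continuous in the parameter. *)
Lemma taylor_coef_ccts n : forall t, ccts (fun t => c t n) t.
Proof using Hr HK T CF.
  induction n as [n IH] using (well_founded_induction Wf_nat.lt_wf). intros t0.
  set (k := (K / rho ^ S n)%R). assert (Hk : (0 <= k)%R) by (apply Rmult_le_pos; auto; left; apply Rinv_0_lt_compat, pow_lt; auto).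
  apply ccts_eps. intros e He.
  assert (P : (0 < e / (4 * (k + 1)))%R) by (apply Rdiv_lt_0_compat; lra).
  set (h := Rmin (rho / 2) (e / (4 * (k + 1)))). assert (h0 : (0 < h)%R) by (apply Rmin_glb_lt; lra).
  assert (h1 : (h <= rho / 2)%R) by apply Rmin_l. assert (h2 : (h <= e / (4 * (k + 1)))%R) by apply Rmin_r.
  assert (Ch : Cmod h = h) by (rewrite Cmod_R, Rabs_pos_eq; lra).
  set (q := fun t => (F t (z0 + h) - psum (c t) h n) / h ^ n).
  assert (kh : (k * h <= e / 4)%R).
  { apply Rmult_le_compat_l with (r := (k + 1)%R) in h2; [|lra].
    replace ((k + 1) * (e / (4 * (k + 1))))%R with (e / 4)%R in h2 by (field; lra). nra. }
  assert (Hq : forall t, (Cmod (c t n - q t)%C <= e / 4)%R).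
  { intros t. assert (E := taylor_coef_err n h t ltac:(lra)). rewrite Ch in E. fold k in E.
    eapply Rle_trans; [exact E|]. eapply Rle_trans; [apply div_one_plus_sqr_le; nra | auto]. }
  assert (cq : ccts q t0).
  { unfold q, Cdiv. apply ccts_mult; [|apply ccts_const]. apply ccts_minus; [apply CF; lra|].
    apply ccts_psum. intros m Hm. apply IH; auto. }
  apply ccts_eps with (eps := (e / 4)%R) in cq; [|lra].
  apply filter_imp with (2 := cq). intros t Ht.
  replace (c t n - c t0 n) with ((c t n - q t) + ((q t - q t0) + - (c t0 n - q t0))) by ring.
  eapply Rle_lt_trans; [apply Cmod_triangle|].
  eapply Rle_lt_trans; [apply Rplus_le_compat_l, Cmod_triangle|]. rewrite Cmod_opp.
  generalize (Hq t) (Hq t0). lra.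
Qed.

Lemma taylor_coef_intg n : intg (fun t => c t n).
Proof using Hr HK T CF.
  split; [apply taylor_coef_ccts|].
  set (h := (rho / 2)%R). assert (Ch : Cmod h = h) by (unfold h; rewrite Cmod_R, Rabs_pos_eq; lra).
  assert (Nn : RtoC h ^ n <> 0) by (apply Cpow_nz; intros Z; apply RtoC_inj in Z; unfold h in Z; lra).
  exists (K / rho ^ S n * h + (h / rho) ^ n / h ^ n * K)%R. intros t.
  assert (E := taylor_coef_err n h t ltac:(unfold h in *; lra)). rewrite Ch in E.
  assert (E2 := T t n h ltac:(unfold h in *; lra)). rewrite Ch in E2.
  set (q := (F t (z0 + h) - psum (c t) h n) / h ^ n) in *.
  replace (c t n) with ((c t n - q) + q) by ring. eapply Rle_trans; [apply Cmod_triangle|].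
  unfold Rdiv at 1. rewrite Rmult_plus_distr_r. apply Rplus_le_compat; [exact E|].
  unfold q. rewrite Cmod_div, Cmod_pow, Ch by auto. unfold Rdiv at 1.
  apply Rle_trans with (K / (1 + t * t) * (h / rho) ^ n * / h ^ n)%R.
  - apply Rmult_le_compat_r; [|exact E2]. left. apply Rinv_0_lt_compat, pow_lt. unfold h; lra.
  - right. unfold Rdiv. ring.
Qed.

Lemma psum_CI h N : intg (fun t => psum (c t) h N) /\
  CI (fun t => psum (c t) h N) = psum (fun n => CI (fun t => c t n)) h N.
Proof using Hr HK T CF.
  induction N as [|N [I E]]; simpl.
  - assert (I0 : intg (fun _ => RtoC 0)).
    { split; [intros; apply ccts_const|]. exists 0%R. intros t. rewrite Cmod_0. unfold Rdiv. lra. }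
    split; auto. rewrite (CI_FTC0 (fun _ => 0) (fun _ => 0) 0); auto; [intros; apply RD_const|].
    intros t. rewrite Cmod_0. unfold Rdiv. lra.
  - assert (J : intg (fun t => h ^ N * c t N)) by (apply intg_scal, taylor_coef_intg).
    assert (Ex : forall t, psum (c t) h N + h ^ N * c t N = psum (c t) h N + c t N * h ^ N) by (intros; ring).
    split.
    + apply (intg_ext _ _ Ex). apply intg_plus; auto.
    + rewrite <- (CI_ext _ _ Ex), CI_plus, CI_scal, E; auto using taylor_coef_intg. ring.
Qed.

Lemma taylor_CI : taylor (fun z => CI (fun t => F t z)) z0 (fun n => CI (fun t => c t n)) (PI * K) rho.
Proof using Hr HK T CF.
  intros N h Hh. destruct (psum_CI h N) as [I E]. rewrite <- E.
  assert (IF : intg (fun t => F t (z0 + h))).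
  { split; [apply CF; auto|]. exists K. intros t. assert (S := T t 0%nat h Hh). simpl in S.
    replace (F t (z0 + h) - 0) with (F t (z0 + h)) in S by ring. rewrite Rmult_1_r in S. exact S. }
  rewrite <- CI_minus by auto. rewrite Rmult_assoc. apply CI_bound.
  - intros t. apply ccts_minus; [apply CF; auto | apply I].
  - intros t. eapply Rle_trans; [apply (T t N h Hh)|]. right. unfold Rdiv. ring.
Qed.
End Param.

(** * Continuation to all admissible arguments *)

Lemma ccts_mel (h : R -> C) (K : R) (g : R -> C) (t : R) : (forall v, ccts h v) ->
  (forall v, (Cmod (h v) <= K * exp (- exp v))%R) -> ccts g t -> (0 < Re (g t))%R -> ccts (fun t => mel h (g t)) t.
Proof.
  intros Ch Bh Cg P. destruct (mel_CD h K (g t) P Ch Bh) as [l D]. apply (ccts_comp _ _ _ l); auto.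
Qed.

Lemma GP_ccts (g : R -> C) (xi : C) (t : R) : ccts g t -> (0 < Re (g t))%R -> ccts (fun t => GP (g t) xi) t.
Proof.
  intros Cg P.
  assert (C2 : ccts (fun t => 2 * g t) t) by (apply ccts_mult; auto using ccts_const).
  assert (P2 := Re_double _ P).
  assert (CG : forall f : R -> C, ccts f t -> (0 < Re (f t))%R -> ccts (fun t => mel hG (f t)) t).
  { intros f Cf Pf. apply (ccts_mel hG 1); auto using hG_ccts. apply hG_bound. }
  assert (CM : forall f : R -> C, ccts f t -> (0 < Re (f t))%R -> ccts (fun t => MP (f t) xi) t).
  { intros f Cf Pf. apply (ccts_mel (hP xi) _ f t (hP_ccts xi) (hP_bound xi) Cf Pf). }
  unfold GP, DP, QP. apply ccts_mult; [apply CG; auto|].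
  apply ccts_mult; [apply ccts_const|]. apply ccts_mult.
  - eapply (ccts_comp (fun z => / z)); [apply CD_inv, mel_hG_neq_0; auto | apply CG; auto].
  - apply ccts_plus; [|apply ccts_mult; [apply ccts_const | apply CM; auto]].
    apply CM; [apply ccts_plus; auto using ccts_const|]. simpl. simpl in P2. lra.
Qed.

Lemma line_ccts (A t : R) : ccts (fun t : R => ((A, t) : C)) t.
Proof. split; simpl; [apply continuous_const | apply continuous_id]. Qed.

Lemma integrand_ccts (A : R) (xi eta : C) (t : R) : (- (3 / 4) < A < 3 / 4)%R -> ccts (fun t : R => integrand (A, t) xi eta) t.
Proof.
  intros HA. unfold integrand. apply ccts_mult.
  - apply (GP_ccts (fun t : R => RtoC (3 / 4) - (A, t))); [|simpl; lra].
    apply ccts_minus; [apply ccts_const | apply line_ccts].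
  - apply (GP_ccts (fun t : R => RtoC (3 / 4) + (A, t))); [|simpl; lra].
    apply ccts_plus; [apply ccts_const | apply line_ccts].
Qed.

(** [xi^2 + eta^2] is half the product of the two numbers of the hypotheses, which lie in the
    right half-plane; such a product is never a negative real. *)
Lemma slit_half_sum (x y : C) : (0 < rate 1 x + rate (-1) y)%R -> (0 < rate (-1) x + rate 1 y)%R ->
  slit ((x * x + y * y) / 2).
Proof.
  unfold rate. intros H1 H2. set (p := (1 - Ci) * x + (1 + Ci) * y). set (q := (1 + Ci) * x + (1 - Ci) * y).
  assert (P1 : (0 < Re p)%R) by (unfold p, Re, Im in *; simpl in *; lra).
  assert (P2 : (0 < Re q)%R) by (unfold q, Re, Im in *; simpl in *; lra).
  replace ((x * x + y * y) / 2) with (p * q / 4).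
  2:{ unfold p, q. apply C_eq; unfold Re, Im; simpl; field. }
  clearbody p q. unfold slit.
  replace (Re (p * q / 4)) with ((Re p * Re q - Im p * Im q) / 4)%R by (unfold Re, Im; simpl; field).
  replace (Im (p * q / 4)) with ((Re p * Im q + Im p * Re q) / 4)%R by (unfold Re, Im; simpl; field).
  destruct (Req_dec (Re p * Im q + Im p * Re q) 0) as [Z|Z]; [left|right; lra].
  set (a := Re p) in *. set (b := Im p) in *. set (c := Re q) in *. set (d := Im q) in *.
  assert (E : (a * (a * c - b * d) = c * (a * a + b * b))%R).
  { replace (a * (a * c - b * d))%R with (c * (a * a) - b * (a * d))%R by ring.
    replace (a * d)%R with (- (b * c))%R by lra. ring. }
  assert (0 < c * (a * a + b * b))%R by (apply Rmult_lt_0_compat; nra).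
  assert (0 < a * c - b * d)%R by (apply Rmult_lt_reg_l with a; auto; lra). lra.
Qed.

Notation uK := (KummerU (RtoC (3 / 2)) 3).

(** The integral, up to the constant [closed_const]. *)
Definition closed_form (x y : C) : C := x * y * (Cexp (- (x * x + y * y) / 4) * uK (Clog ((x * x + y * y) / 2))).

Definition closed_const : R := (2 * PI * exp (- (3 / 2 * ln 2)) * (sqrt PI / 2))%R.

Lemma integral_near_one (A : R) (x y : C) : (- (3 / 4) < A < 3 / 4)%R -> (Cmod (x - 1) < 1 / 4)%R -> (Cmod (y - 1) < 1 / 4)%R ->
  CI (fun t : R => integrand (A, t) x y) = RtoC closed_const * closed_form x y.
Proof.
  intros HA Hx Hy.
  assert (L : forall z : C, (Cmod (z - 1) < 1 / 4)%R -> Cexp (Clog z) = z /\ (Rabs (Im (Clog z)) < PI / 4)%R).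
  { intros z Hz. assert (B1 := re_le_Cmod (z - 1)). assert (B2 := im_le_Cmod (z - 1)).
    replace (Re (z - 1)) with (Re z - 1)%R in B1 by (unfold Re; simpl; ring).
    replace (Im (z - 1)) with (Im z) in B2 by (unfold Im; simpl; ring).
    apply Rabs_le_between in B1.
    assert (S : slit z) by (left; lra). split; [apply Cexp_Clog, slit_neq_0; auto|].
    change (Im (Clog z)) with (Carg z). rewrite Carg_atan by auto.
    assert (P2 := PI2_3_2). assert (B3 := re_le_Cmod z). apply Rabs_le_between in B3.
    set (q := (Cmod z + Re z)%R) in *. assert (Pq : (3 / 2 <= q)%R) by (unfold q; lra).
    assert (B : (Rabs (Im z / q) <= 1 / 6)%R).
    { unfold Rdiv. rewrite Rabs_mult, (Rabs_pos_eq (/ q)) by (left; apply Rinv_0_lt_compat; lra).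
      apply Rmult_le_reg_r with q; [lra|]. rewrite Rmult_assoc, Rinv_l by lra. lra. }
    apply Rabs_le_between in B. assert (T := atan_small (1 / 6) ltac:(lra)).
    assert (T1 := atan_le _ _ (proj2 B)). assert (T2 := atan_le _ _ (proj1 B)). rewrite atan_opp in T2.
    apply Rabs_def1; lra. }
  destruct (L x Hx) as [Ex Ix]. destruct (L y Hy) as [Ey Iy].
  destruct (integral_sector A (Clog x) (Clog y) HA Ix Iy) as [E [Q _]]. rewrite Ex, Ey in E, Q. rewrite E. clear E.
  unfold closed_form. rewrite (proj2 KummerU_three_halves) by (apply right_half_strip; auto).
  assert (Np : RtoC (sqrt PI / 2) <> 0) by (intros Z; apply RtoC_inj in Z; generalize (sqrt_lt_R0 PI PI_RGT_0); lra).
  unfold closed_const. rewrite (RtoC_mult (2 * PI * _)), (RtoC_mult (2 * PI)). field. auto.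
Qed.

(** The segment from [1] to [x], with a complex parameter. *)
Definition seg (x k : C) : C := 1 + k * (x - 1).

Lemma seg_CD x k : CD (seg x) k (x - 1).
Proof. unfold seg. eapply CD_eq; [apply CD_plus; [apply CD_const | apply CD_mult; [apply CD_id | apply CD_const]]|]. simpl. ring. Qed.

Lemma seg_near (x k k' : C) (r : R) : (0 < r)%R -> (Cmod (k' - k) < r / (Cmod (x - 1) + 1))%R ->
  (Cmod (seg x k' - seg x k) < r)%R.
Proof.
  intros Pr H. replace (seg x k' - seg x k) with ((k' - k) * (x - 1)) by (unfold seg; ring).
  rewrite Cmod_mult. assert (P := Cmod_ge_0 (x - 1)). assert (P' := Cmod_ge_0 (k' - k)).
  apply Rmult_lt_compat_r with (r := (Cmod (x - 1) + 1)%R) in H; [|lra].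
  replace (r / (Cmod (x - 1) + 1) * (Cmod (x - 1) + 1))%R with r in H by (field; lra). nra.
Qed.

Section Segment.
Variables (A : R) (xi eta : C).
Hypotheses (HA : (- (3 / 4) < A < 3 / 4)%R)
  (H1 : (0 < rate 1 xi + rate (-1) eta)%R) (H2 : (0 < rate (-1) xi + rate 1 eta)%R).

(** The hypotheses are convex and hold at [(1, 1)]. *)
Lemma seg_rates (k : R) : (0 <= k <= 1)%R ->
  (0 < rate 1 (seg xi k) + rate (-1) (seg eta k))%R /\ (0 < rate (-1) (seg xi k) + rate 1 (seg eta k))%R.
Proof using H1 H2.
  intros Hk. unfold rate, seg in *. unfold Re, Im in *. simpl. split.
  - replace (_ + _)%R with ((1 - k) * 2 + k * (fst xi + 1 * snd xi + (fst eta + -1 * snd eta)))%R by ring. apply convex_gt; lra.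
  - replace (_ + _)%R with ((1 - k) * 2 + k * (fst xi + -1 * snd xi + (fst eta + 1 * snd eta)))%R by ring. apply convex_gt; lra.
Qed.

Lemma taylor_integral (k : R) : (0 <= k <= 1)%R -> exists c K rho, (0 < rho)%R /\ (0 <= K)%R /\
  taylor (fun z => CI (fun t : R => integrand (A, t) (seg xi z) (seg eta z))) k c K rho.
Proof using HA H1 H2.
  intros Hk. destruct (seg_rates k Hk) as [R1 R2].
  destruct (integrand_bound (seg xi k) (seg eta k) A ltac:(apply Rabs_def1; lra) R1 R2) as [K [r [PK [Pr B]]]].
  set (R0 := Rmin (r / (Cmod (xi - 1) + 1)) (r / (Cmod (eta - 1) + 1))).
  assert (P0 : (0 < R0)%R).
  { apply Rmin_glb_lt; apply Rdiv_lt_0_compat; auto; [generalize (Cmod_ge_0 (xi - 1)) | generalize (Cmod_ge_0 (eta - 1))]; lra. }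
  assert (BF : forall t z, (Cmod (z - k) < R0)%R -> (Cmod (integrand (A, t) (seg xi z) (seg eta z)) <= K / (1 + t * t))%R).
  { intros t z Hz. apply (B (seg xi z) (seg eta z)); auto; apply seg_near; auto;
    eapply Rlt_le_trans; eauto; [apply Rmin_l | apply Rmin_r]. }
  assert (T : forall t, exists c, taylor (fun z => integrand (A, t) (seg xi z) (seg eta z)) k c (2 * K / (1 + t * t)) (R0 / 2)).
  { intros t. replace (2 * K / (1 + t * t))%R with (2 * (K / (1 + t * t)))%R by (unfold Rdiv; ring).
    set (a1 := RtoC (3 / 4) - (A, t)). set (a2 := RtoC (3 / 4) + (A, t)).
    assert (p1 : (0 < Re a1)%R) by (simpl; lra). assert (p2 : (0 < Re a2)%R) by (simpl; lra).
    apply (taylor_of_CD _ (fun z => GP1 a1 (seg xi z) * (xi - 1) * GP a2 (seg eta z) + GP a1 (seg xi z) * (GP1 a2 (seg eta z) * (eta - 1))) k R0); [lra | | |apply BF].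
    - intros z _. unfold integrand. fold a1 a2. eapply CD_eq.
      + apply (CD_mult (fun z => GP a1 (seg xi z)) (fun z => GP a2 (seg eta z)));
        [apply (CD_comp (GP a1) (seg xi)) | apply (CD_comp (GP a2) (seg eta))]; auto using GP_CD, seg_CD.
      + cbv beta. ring.
    - intros z _.
      assert (c1 : forall x, @ccts C_UniformSpace (seg x) z) by (intros; eapply CD_ccts, seg_CD).
      assert (c2 : forall a x, (0 < Re a)%R -> @ccts C_UniformSpace (fun z => GP a (seg x z)) z)
        by (intros; eapply ccts_comp; [apply GP_CD; auto | auto]).
      assert (c3 : forall a x, (0 < Re a)%R -> @ccts C_UniformSpace (fun z => GP1 a (seg x z)) z)
        by (intros; eapply ccts_comp; [apply GP1_CD; auto | auto]).
      apply ccts_plus; apply ccts_mult; auto; apply ccts_mult; auto using ccts_const. }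
  (* the expansions for all [t] have a common radius; choose their coefficients *)
  set (c := fun t => proj1_sig (constructive_indefinite_description _ (T t))).
  exists (fun n => CI (fun t => c t n)), (PI * (2 * K))%R, (R0 / 2)%R.
  assert (Pp := PI_RGT_0). split; [lra|]. split; [nra|].
  apply (taylor_CI (fun t z => integrand (A, t) (seg xi z) (seg eta z))); [lra | lra | |].
  - intros t. unfold c. apply (proj2_sig (constructive_indefinite_description _ (T t))).
  - intros h _ t. apply integrand_ccts, HA.
Qed.

Lemma taylor_closed_form (k : R) : (0 <= k <= 1)%R -> exists c K rho, (0 < rho)%R /\ (0 <= K)%R /\
  taylor (fun z => RtoC closed_const * closed_form (seg xi z) (seg eta z)) k c K rho.
Proof using H1 H2.
  intros Hk. destruct (seg_rates k Hk) as [R1 R2].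
  destruct (is_KummerU_elim _ _ _ (proj1 KummerU_three_halves)) as [u1 [U _]].
  set (X := seg xi). set (Y := seg eta). set (Q := fun z => X z * X z + Y z * Y z).
  set (Q1 := fun z => 2 * (X z * (xi - 1) + Y z * (eta - 1))).
  assert (DX : forall z, CD X z (xi - 1)) by (intros; apply seg_CD).
  assert (DY : forall z, CD Y z (eta - 1)) by (intros; apply seg_CD).
  assert (DQ : forall z, CD Q z (Q1 z)).
  { intros z. unfold Q, Q1. eapply CD_eq; [apply CD_plus; apply CD_mult; auto|]. ring. }
  set (S := fun z => slit (Q z / 2)).
  set (f := fun z => RtoC closed_const * closed_form (X z) (Y z)).
  set (E := fun z => Cexp (- Q z / 4)). set (w := fun z => Clog (Q z / 2)).
  set (f' := fun z => RtoC closed_const * (((xi - 1) * Y z + X z * (eta - 1)) * (E z * uK (w z)) +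
     X z * Y z * (E z * (- Q1 z / 4) * uK (w z) + E z * (u1 (w z) * (Q1 z / 2))))).
  assert (Dw : forall z, S z -> CD w z (/ (Q z / 2) * (Q1 z / 2))).
  { intros z Hz. apply (CD_comp Clog (fun z => Q z / 2)); [apply CD_Clog, Hz|].
    eapply CD_eq; [apply CD_mult; [apply DQ | apply CD_const]|]. simpl. unfold Cdiv. ring. }
  assert (DE : forall z, CD E z (E z * (- Q1 z / 4))).
  { intros z. apply (CD_exp (fun z => - Q z / 4)). eapply CD_eq; [apply CD_mult; [apply CD_opp, DQ | apply CD_const]|].
    simpl. unfold Cdiv. ring. }
  assert (D : forall z, S z -> CD f z (f' z)).
  { intros z Hz. assert (Nq := slit_neq_0 _ Hz). unfold f, closed_form, f'. eapply CD_eq.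
    - apply CD_scal. apply (CD_mult (fun z => X z * Y z) (fun z => E z * uK (w z))).
      + apply CD_mult; auto.
      + apply (CD_mult E (fun z => uK (w z))); [apply DE|].
        apply (CD_comp uK w); [apply (proj1 (U (w z) I)) | apply Dw, Hz].
    - cbv beta. unfold w at 3. rewrite (Cexp_Clog _ Nq). fold (w z).
      replace (Q z / 2 * u1 (w z) * (/ (Q z / 2) * (Q1 z / 2))) with (u1 (w z) * (Q1 z / 2) * (Q z / 2 * / (Q z / 2))) by ring.
      rewrite Cinv_r by auto. ring. }
  assert (C' : forall z, S z -> @ccts C_UniformSpace f' z).
  { intros z Hz.
    assert (cX : @ccts C_UniformSpace X z) by (eapply CD_ccts; auto).
    assert (cY : @ccts C_UniformSpace Y z) by (eapply CD_ccts; auto).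
    assert (cw : @ccts C_UniformSpace w z) by (eapply CD_ccts, Dw, Hz).
    assert (cE : @ccts C_UniformSpace E z) by (eapply CD_ccts, DE).
    assert (cu : @ccts C_UniformSpace (fun z => uK (w z)) z) by (eapply ccts_comp; [apply (proj1 (U (w z) I)) | auto]).
    assert (cu1 : @ccts C_UniformSpace (fun z => u1 (w z)) z) by (eapply ccts_comp; [apply (proj2 (U (w z) I)) | auto]).
    assert (cQ1 : @ccts C_UniformSpace Q1 z).
    { unfold Q1. apply ccts_mult; [apply ccts_const|]. apply ccts_plus; apply ccts_mult; auto using ccts_const. }
    assert (cc : forall c, @ccts C_UniformSpace (fun _ => c) z) by (intros; apply ccts_const).
    assert (cQ4 : @ccts C_UniformSpace (fun z => - Q1 z / 4) z) by exact (ccts_mult _ _ _ (ccts_opp _ _ cQ1) (cc (/ 4))).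
    assert (cQ2 : @ccts C_UniformSpace (fun z => Q1 z / 2) z) by exact (ccts_mult _ _ _ cQ1 (cc (/ 2))).
    exact (ccts_mult _ _ _ (cc _) (ccts_plus _ _ _
      (ccts_mult _ _ _ (ccts_plus _ _ _ (ccts_mult _ _ _ (cc _) cY) (ccts_mult _ _ _ cX (cc _))) (ccts_mult _ _ _ cE cu))
      (ccts_mult _ _ _ (ccts_mult _ _ _ cX cY) (ccts_plus _ _ _ (ccts_mult _ _ _ (ccts_mult _ _ _ cE cQ4) cu)
        (ccts_mult _ _ _ cE (ccts_mult _ _ _ cu1 cQ2)))))). }
  assert (Sk : S k) by (apply slit_half_sum; auto).
  assert (O : @locally C_UniformSpace (RtoC k) S).
  { assert (cQ : @ccts C_UniformSpace (fun z => Q z / 2) (RtoC k)).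
    { unfold Cdiv. apply ccts_mult; [eapply CD_ccts, DQ | apply ccts_const]. }
    destruct (locally_C_disc _ _ (slit_open _ Sk)) as [r [Pr Hr]].
    apply filter_imp with (2 := proj1 (ccts_eps _ _) cQ r Pr). intros z Hz. apply Hr, Hz. }
  assert (O2 := proj1 (ccts_eps f (RtoC k)) (CD_ccts _ _ _ (D _ Sk)) 1%R Rlt_0_1).
  destruct (locally_C_disc _ _ (filter_and _ _ O O2)) as [R0 [P0 H0]].
  destruct (taylor_of_CD f f' k R0 (R0 / 2) (Cmod (f k) + 1)) as [c T].
  - lra.
  - intros z Hz. apply D, H0, Hz.
  - intros z Hz. apply C', H0, Hz.
  - intros z Hz. destruct (H0 z Hz) as [_ Hf]. replace (f z) with ((f z - f k) + f k) by ring.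
    eapply Rle_trans; [apply Cmod_triangle|]. lra.
  - exists c, (2 * (Cmod (f k) + 1))%R, (R0 / 2)%R. split; [lra|]. split; [generalize (Cmod_ge_0 (f k)); lra | exact T].
Qed.

(** Both sides are analytic along the segment from [(1, 1)] to [(xi, eta)] and agree near its
    origin. *)
Lemma integral_value : CI (fun t : R => integrand (A, t) xi eta) = RtoC closed_const * closed_form xi eta.
Proof using HA H1 H2.
  set (f := fun z : C => CI (fun t : R => integrand (A, t) (seg xi z) (seg eta z)) - RtoC closed_const * closed_form (seg xi z) (seg eta z)).
  set (dl := Rmin (1 / 4 / (Cmod (xi - 1) + 1)) (1 / 4 / (Cmod (eta - 1) + 1))).
  assert (E : f 1 = 0).
  { apply (identity_unit_interval f dl).
    - apply Rmin_glb_lt; apply Rdiv_lt_0_compat; try lra; [generalize (Cmod_ge_0 (xi - 1)) | generalize (Cmod_ge_0 (eta - 1))]; lra.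
    - intros k Hk. destruct (taylor_integral k Hk) as [c [K [r [Pr [PK T]]]]].
      destruct (taylor_closed_form k Hk) as [c' [K' [r' [Pr' [PK' T']]]]].
      exists (fun n => c n - c' n), (K + K')%R, (Rmin r r'). split; [apply Rmin_glb_lt; auto|]. split; [lra|].
      apply taylor_minus; auto.
    - intros y Hy. unfold f.
      assert (S0 : forall x, seg x 0 = 1) by (intros; unfold seg; ring).
      rewrite integral_near_one; auto; [ring | rewrite <- (S0 xi) | rewrite <- (S0 eta)];
      apply seg_near; try lra; replace (RtoC y - 0) with (RtoC y) by ring; rewrite Cmod_R, Rabs_pos_eq by lra;
      (eapply Rlt_le_trans; [apply Hy|]); [apply Rmin_l | apply Rmin_r]. }
  unfold f in E. assert (S1 : forall x, seg x 1 = x) by (intros; unfold seg; ring). rewrite !S1 in E.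
  replace (CI (fun t : R => integrand (A, t) xi eta)) with (CI (fun t : R => integrand (A, t) xi eta) - RtoC closed_const * closed_form xi eta + RtoC closed_const * closed_form xi eta) by ring.
  rewrite E. ring.
Qed.
End Segment.

(** The definition of [K_1] involves the same function [U(3/2, 3, .)], at the point [Clog z + ln
    2] of the principal sheet. *)
Lemma BesselK_one (x y : C) : slit ((x * x + y * y) / 2) ->
  x * y * BesselK 1 (RtoC (1 / 4) * (x * x + y * y)) = RtoC (sqrt PI / 2) * (x * x + y * y) * closed_form x y.
Proof.
  set (P := x * x + y * y). intros S. set (z := RtoC (1 / 4) * P).
  assert (Sz : slit z).
  { unfold slit, z in *. replace (Re (RtoC (1 / 4) * P)) with (Re (P / 2) / 2)%R by (unfold Re; simpl; field).
    replace (Im (RtoC (1 / 4) * P)) with (Im (P / 2) / 2)%R by (unfold Im; simpl; field). lra. }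
  assert (E2 : Cexp (ln 2) = 2) by (rewrite Cexp_RtoC, exp_ln by lra; auto).
  assert (Ez : Cexp (Clog z) = z) by (apply Cexp_Clog, slit_neq_0, Sz).
  assert (Ew : Cexp (Clog z + ln 2) = P / 2).
  { rewrite Cexp_plus, E2, Ez. unfold z. apply C_eq; unfold Re, Im; simpl; field. }
  assert (El : Clog z + ln 2 = Clog (P / 2)).
  { rewrite <- Ew, Clog_Cexp; auto. replace (Im (Clog z + ln 2)) with (Carg z) by (unfold Clog, Im; simpl; ring).
    apply Carg_slit, Sz. }
  unfold BesselK, BesselK_log. rewrite Ez, Cmult_1_l, Ew, El.
  replace (RtoC (1 / 2) + 1) with (RtoC (3 / 2)) by (apply C_eq; simpl; field).
  replace (1 + 2 * 1) with (RtoC 3) by (apply C_eq; simpl; ring).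
  unfold closed_form. fold P. replace (- P / 4) with (- z) by (unfold z; apply C_eq; unfold Re, Im; simpl; field).
  rewrite (RtoC_div (sqrt PI)) by lra. field.
Qed.

Theorem corollary12 (xi eta sigma : C)
  (h1 : (0 < Re ((1 - Ci) * xi + (1 + Ci) * eta))%R)
  (h2 : (0 < Re ((1 + Ci) * xi + (1 - Ci) * eta))%R)
  (hsigma : (Rabs (Re sigma) < 3 / 4)%R) :
  exists I : C,
    is_vertical_integral
      (fun s : C =>
         Gamma (RtoC (3 / 4) - s) * Gamma (RtoC (3 / 4) + s)
         * ParabolicD (2 * s - RtoC (1 / 2)) xi
         * ParabolicD (- 2 * s - RtoC (1 / 2)) eta)
      sigma I /\
    xi * eta * BesselK 1 (RtoC (1 / 4) * (xi * xi + eta * eta))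
    = sqrt 2 * (xi * xi + eta * eta) / (PI * Ci) * I.
Proof.
  assert (H1 : (0 < rate 1 xi + rate (-1) eta)%R) by (unfold rate, Re, Im in *; simpl in *; lra).
  assert (H2 : (0 < rate (-1) xi + rate 1 eta)%R) by (unfold rate, Re, Im in *; simpl in *; lra).
  apply Rabs_def2 in hsigma. set (A := Re sigma) in *.
  assert (HA : (- (3 / 4) < A < 3 / 4)%R) by lra.
  set (F := fun t : R => integrand (A, t) xi eta).
  assert (IF : intg F).
  { split; [exact (fun t => integrand_ccts A xi eta t HA)|].
    destruct (integrand_bound xi eta A ltac:(apply Rabs_def1; lra) H1 H2) as [K [r [_ [Pr B]]]].
    exists K. intros t. assert (Z : forall z : C, (Cmod (z - z) < r)%R) by (intros; replace (z - z) with (RtoC 0) by ring; rewrite Cmod_0; exact Pr).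
    exact (B xi eta (Z xi) (Z eta) (A, t) eq_refl). }
  (* the line through [sigma] is the line through its real part, reparametrized *)
  set (G := fun t : R => Ci * F (t + Im sigma)%R).
  assert (IG : intg G) by (apply intg_scal, intg_shift, IF).
  assert (EG : CI G = Ci * CI F).
  { unfold G. rewrite CI_scal by (apply intg_shift, IF). rewrite CI_shift by exact IF. reflexivity. }
  exists (CI G). split.
  - unfold is_vertical_integral. replace (fun t : R => _) with G; [apply (CI_spec G IG)|].
    apply FunctionalExtensionality.functional_extensionality. intros t. unfold G, F, integrand, GP.
    replace (sigma + Ci * t) with ((A, (t + Im sigma)%R) : C) by (unfold A; apply C_eq; unfold Re, Im; simpl; ring).
    set (s := ((A, (t + Im sigma)%R) : C)). assert (Rs : Re s = A) by reflexivity.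
    rewrite !Gamma_mel by (unfold Re in *; simpl in *; lra).
    rewrite !ParabolicD_DP by (unfold Re in *; simpl in *; lra).
    replace (1 - (2 * s - RtoC (1 / 2))) with (2 * (RtoC (3 / 4) - s)) by (apply C_eq; unfold Re, Im; simpl; field).
    replace (1 - (- 2 * s - RtoC (1 / 2))) with (2 * (RtoC (3 / 4) + s)) by (apply C_eq; unfold Re, Im; simpl; field).
    ring.
  - rewrite EG. unfold F. rewrite (integral_value A xi eta HA H1 H2).
    rewrite (BesselK_one xi eta (slit_half_sum xi eta H1 H2)).
    assert (Ni : Ci <> 0) by (intros Z; apply (f_equal Im) in Z; simpl in Z; lra).
    assert (Np : RtoC PI <> 0) by (intros Z; apply RtoC_inj in Z; generalize PI_RGT_0; lra).
    replace (RtoC (sqrt PI / 2)) with (RtoC (sqrt 2) / PI * RtoC closed_const).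
    + field. auto.
    + rewrite <- RtoC_div, <- RtoC_mult by (generalize PI_RGT_0; lra). f_equal. unfold closed_const.
      assert (E2 : (sqrt 2 * exp (- (3 / 2 * ln 2)) = 1 / 2)%R).
      { rewrite <- Rpower_sqrt by lra. unfold Rpower. rewrite <- exp_plus.
        replace (/ 2 * ln 2 + - (3 / 2 * ln 2))%R with (- ln 2)%R by field. rewrite exp_Ropp, exp_ln by lra. field. }
      replace (sqrt 2 / PI * (2 * PI * exp (- (3 / 2 * ln 2)) * (sqrt PI / 2)))%R with
        (sqrt 2 * exp (- (3 / 2 * ln 2)) * sqrt PI)%R by (field; generalize PI_RGT_0; lra).
      rewrite E2. field.
Qed.
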